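(* Let $u$ be the solution of $$u_{tt}+\kappa(-\Delta)^{\alpha/2}u+\gamma_1(-\Delta)^{\alpha/2}u_t+\gamma_2u_t+F'(u)=0\ \text{ in }\Omega\times(0,T],\qquad u(\cdot,0)=\phi_0,\ u_t(\cdot,0)=\varphi_0,$$ with periodic boundary conditions, set $v=u_t$ and $r(t)=\sqrt{E(u(\cdot,t))}$, and let $(u_N^n,v_N^n,R^n)_{n=0}^K$ be the solution of the fully discrete SAV Fourier spectral scheme described in the context. Assume that $u$ satisfies the regularity assumption $$\|\phi_0\|_{H^m}+\|u\|_{H^m}+\|u_t\|_{H^m}+|r|_{L^\infty(0,T)}+|r_t|_{L^\infty(0,T)}+|r_{tt}|_{L^\infty(0,T)}+|r_{ttt}|_{L^\infty(0,T)}+\|u\|_\alpha+\|u_t\|_\alpha+\|u_{tt}\|_\alpha+\|u_{ttt}\|_{\alpha/2}\le L,$$ where $L>0$ is a constant independent of $N$ and $\tau$. Then there is a constant $C>0$, independent of $N$ and $\tau$, such that for $0\le n\le K$, writing $u^n=u(\cdot,t_n)$, $v^n=v(\cdot,t_n)$, $r^n=r(t_n)$, $$\|u^n-u_N^n\|^2+\|v^n-v_N^n\|^2+|r^n-R^n|^2\le C(\tau^4+N^{-2m}),\qquad \kappa\,|u^n-u_N^n|_{\alpha/2}^2\le C(\tau^4+N^{\alpha-2m}).$$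
   Context: Setting: $\Omega=(a,b)\times(c,d)\subset\mathbb{R}^2$ is a periodic cell with side lengths $2\pi$; all functions are real-valued and $2\pi$-periodic in each variable. $(f,g)=\int_\Omega fg\,d\mathbf{x}$, $\|f\|^2=(f,f)$. Parameters: $\kappa>0$, $1<\alpha\le2$, $\gamma_1,\gamma_2\ge0$. For $u=\sum_{s,l\in\mathbb{Z}}\hat u_{sl}e^{isx_1+ilx_2}$, $(-\Delta)^\beta u=\sum_{s,l}(s^2+l^2)^\beta\hat u_{sl}e^{isx_1+ilx_2}$. For $\rho\ge0$, $|u|_\rho^2=\sum_{s,l}|\hat u_{sl}|^2(s^2+l^2)^\rho$ and $\|u\|_\rho^2=\|u\|_{H^\rho}^2=\sum_{s,l}|\hat u_{sl}|^2(1+s^2+l^2)^\rho$ are the seminorm and norm of the periodic Sobolev space $H^\rho_{per}(\Omega)$. In the regularity assumption, $m\ge0$ is a fixed real number (the spatial regularity index) and spatial norms of time-dependent functions are understood as bounded uniformly for $t\in[0,T]$. $F:\mathbb{R}\to\mathbb{R}$ is nonnegative, $F\in C^3(\mathbb{R})$, $F'$ is locally Lipschitz (no global Lipschitz condition); $E(w)=\int_\Omega F(w)d\mathbf{x}+C_0$ with the constant $C_0$ chosen such that $E(w)>0$ for all bounded $w$. For a positive integer $N$, $X_N$ is the space of real-valued functions in $\mathrm{span}\{e^{isx_1+ilx_2}: s,l\in\mathbb{Z},\,-N/2\le s,l\le N/2-1\}$, and $P_N$ is the $L^2$-orthogonal projection onto $X_N$. $\tau=T/K$ is the time step ($K$ a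 positive integer), $t_n=n\tau$. For a sequence $w^n$: $\delta_tw^{n+1/2}=(w^{n+1}-w^n)/\tau$, $\bar w^{n+1/2}=(w^{n+1}+w^n)/2$, and for $n\ge1$, $\tilde w^{n+1/2}=(3w^n-w^{n-1})/2$. Scheme: $u_N^0=P_N\phi_0$, $v_N^0=P_N\varphi_0$, $R^0=r(0)$; for $n=0,1,\dots,K-1$ find $(u_N^{n+1},v_N^{n+1})\in X_N\times X_N$ and $R^{n+1}\in\mathbb{R}$ such that for all $(\psi,\varphi)\in X_N\times X_N$ $$(\delta_tu_N^{n+1/2},\psi)=(\bar v_N^{n+1/2},\psi),$$ $$(\delta_tv_N^{n+1/2},\varphi)+\kappa((-\Delta)^{\alpha/2}\bar u_N^{n+1/2},\varphi)+\gamma_1((-\Delta)^{\alpha/2}\bar v_N^{n+1/2},\varphi)+\gamma_2(\bar v_N^{n+1/2},\varphi)+\bar R^{n+1/2}\Big(\tfrac{F'(\tilde u_N^{n+1/2})}{\sqrt{E(\tilde u_N^{n+1/2})}},\varphi\Big)=0,$$ $$\delta_tR^{n+1/2}=\frac{1}{2\sqrt{E(\tilde u_N^{n+1/2})}}\big(F'(\tilde u_N^{n+1/2}),\delta_tu_N^{n+1/2}\big).$$ For $n=0$, $\tilde u_N^{1/2}\in X_N$ (together with $\tilde v_N^{1/2}\in X_N$, $\tilde R^{1/2}\in\mathbb{R}$) is defined by the first-step scheme: for all $(\psi,\varphi)\in X_N\times X_N$ $$\Big(\tfrac{\tilde u_N^{1/2}-u_N^0}{\tau/2},\psi\Big)=(\tilde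 v_N^{1/2},\psi),$$ $$\Big(\tfrac{\tilde v_N^{1/2}-v_N^0}{\tau/2},\varphi\Big)+\kappa((-\Delta)^{\alpha/2}\tilde u_N^{1/2},\varphi)+\gamma_1((-\Delta)^{\alpha/2}\tilde v_N^{1/2},\varphi)+\gamma_2(\tilde v_N^{1/2},\varphi)+\tilde R^{1/2}\Big(\tfrac{F'(u_N^0)}{\sqrt{E(u_N^0)}},\varphi\Big)=0,$$ $$\frac{\tilde R^{1/2}-R^0}{\tau/2}=\frac{1}{2\sqrt{E(u_N^0)}}\Big(F'(u_N^0),\tfrac{\tilde u_N^{1/2}-u_N^0}{\tau/2}\Big).$$ *)

(* Defs.v *)
From HB Require Import structures.
From mathcomp Require Import all_boot all_order all_algebra.
From mathcomp Require Import all_classical all_reals all_analysis.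
From mathcomp Require Import complex.

Set Implicit Arguments.
Unset Strict Implicit.
Unset Printing Implicit Defensive.

Import Order.TTheory GRing.Theory Num.Theory.
Import numFieldNormedType.Exports.

Local Open Scope classical_set_scope.
Local Open Scope ring_scope.

(* [measurableTypeR R] is [R] with its Borel sigma-algebra, so that the product
   carries the canonical product structure used by the product measure. *)
Notation plane R := (measurableTypeR R * measurableTypeR R)%type.

(* Functions on the plane are plain functions [plane R -> R] and classes of
   functions modulo null sets are not formed: [Om] is the periodic cell, every
   integral is taken over it, and identities between L^2 functions are required
   almost everywhere on it. *)
Section PeriodicFunctions.
Context {R : realType}.
Variable Om : set (plane R).
Implicit Types (f g w : plane R -> R) (k : int * int).

Definition leb2 : {measure set (plane R) -> \bar R} :=
  (lebesgue_measure \x lebesgue_measure)%E.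

Definition periodic2pi f : Prop :=
  forall x y : R, f (x + 2 * pi, y) = f (x, y) /\ f (x, y + 2 * pi) = f (x, y).

Definition L2per f : Prop :=
  [/\ periodic2pi f, measurable_fun Om f &
      leb2.-integrable Om (EFin \o (fun x => f x ^+ 2))].

Definition bounded_per f : Prop :=
  [/\ periodic2pi f, measurable_fun Om f & exists M : R, forall x, `|f x| <= M].

Definition ip f g : R := \int[leb2]_(x in Om) (f x * g x).

Definition L2norm2 f : R := ip f f.

Definition cexpi (th : R) : R[i] := (cos th +i* sin th)%C.

Definition phase k (x : plane R) : R := k.1%:~R * x.1 + k.2%:~R * x.2.

(* [cexpi (- phase k x)] has real part [cos (phase k x)] and imaginary part
   [- sin (phase k x)]; the complex integral is taken componentwise. *)
Definition fcoef f k : R[i] :=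
  (((2 * pi) ^- 2 * \int[leb2]_(x in Om) (f x * cos (phase k x)))
   -i* ((2 * pi) ^- 2 * \int[leb2]_(x in Om) (f x * sin (phase k x))))%C.

Definition freq2 k : R := (k.1 ^+ 2 + k.2 ^+ 2)%:~R.

Definition hseminorm2 (rho : R) f : \bar R :=
  \esum_(k in [set: int * int])
    (Normc.normc (fcoef f k) ^+ 2 * (freq2 k) `^ rho)%:E.

Definition hnorm2 (rho : R) f : \bar R :=
  \esum_(k in [set: int * int])
    (Normc.normc (fcoef f k) ^+ 2 * (1 + freq2 k) `^ rho)%:E.

Definition hnorm (rho : R) f : \bar R := (hnorm2 rho f `^ 2^-1)%E.

(* [is_fracLap beta w g]: the L^2 function [g] is [(-Delta)^beta w], that is,
   it has the Fourier expansion of [w] multiplied by [(s^2 + l^2)^beta]. *)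
Definition is_fracLap (beta : R) w g : Prop :=
  L2per g /\
  forall k, fcoef g k = ((freq2 k `^ beta)%:C)%C * fcoef w k.

Definition energy (F : R -> R) (C0 : R) w : R :=
  \int[leb2]_(x in Om) (F (w x)) + C0.

Definition modes (N : nat) : set (int * int) :=
  [set k | - (N%:R / 2) <= (k.1%:~R : R) <= N%:R / 2 - 1 /\
           - (N%:R / 2) <= (k.2%:~R : R) <= N%:R / 2 - 1].

Definition XN (N : nat) : set (plane R -> R) :=
  [set w | exists c : int * int -> R[i], forall x : plane R,
     ((w x)%:C)%C = \sum_(k \in modes N) c k * cexpi (phase k x)].

Definition is_PN (N : nat) f p : Prop :=
  XN N p /\ forall psi, XN N psi -> ip (f \- p) psi = 0.

(* [w' t] is the time derivative of [w] at [t], as an L^2-valued map on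
   [0, T] (one-sided at the end points). *)
Definition L2_derivative (T : R) (w w' : R -> plane R -> R) : Prop :=
  forall t : R, 0 <= t <= T ->
    L2norm2 (fun x => (w s x - w t x) / (s - t) - w' t x)
      @[s --> within `[0, T] (dnbhs t)] --> (0 : R).

Definition sup_time (T : R) (nrm : (plane R -> R) -> \bar R)
    (w : R -> plane R -> R) : \bar R :=
  ereal_sup [set nrm (w t) | t in `[0, T]].

Definition Linfty_norm (T : R) (h : R -> R) : \bar R :=
  Lnorm lebesgue_measure +oo%E (EFin \o (h \_ `]0, T[)).

End PeriodicFunctions.

Section Problem.
Context {R : realType}.
Variable Om : set (plane R).
Variables (kappa alpha gamma1 gamma2 : R).
Variables (F : R -> R) (C0 : R).
Variables (phi0 phi1 : plane R -> R) (T : R).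

(* [u] solves the Cauchy problem, with [v = u_t] and [w = u_tt]. *)
Definition is_solution (u v w : R -> plane R -> R) : Prop :=
  [/\ forall t : R, 0 <= t <= T ->
        [/\ L2per Om (u t), L2per Om (v t) & L2per Om (w t)],
      L2_derivative Om T u v /\ L2_derivative Om T v w,
      u 0 = phi0 %[ae leb2 in Om] /\ v 0 = phi1 %[ae leb2 in Om] &
      forall t : R, 0 < t <= T -> exists Au Av : plane R -> R,
        [/\ is_fracLap Om (alpha / 2) (u t) Au,
            is_fracLap Om (alpha / 2) (v t) Av &
            {ae leb2, forall x, Om x ->
               w t x + kappa * Au x + gamma1 * Av x + gamma2 * v t x
                 + derive1 F (u t x) = 0}]].

(* The SAV Galerkin equations with the nonlinear term frozen at [q]:
   [(um, vm, rm)] are the values the linear terms are evaluated at and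
   [(du, dv, dr)] the difference quotients in time. *)
Definition SAV_equations (N : nat) (q : plane R -> R)
    (um vm : plane R -> R) (rm : R) (du dv : plane R -> R) (dr : R) : Prop :=
  [/\ forall psi, XN N psi -> ip Om du psi = ip Om vm psi,
      exists Au Av : plane R -> R,
        [/\ is_fracLap Om (alpha / 2) um Au,
            is_fracLap Om (alpha / 2) vm Av &
            forall phi, XN N phi ->
              ip Om dv phi + kappa * ip Om Au phi + gamma1 * ip Om Av phi
              + gamma2 * ip Om vm phi
              + rm * ip Om (fun x => derive1 F (q x) /
                                     Num.sqrt (energy Om F C0 q)) phi = 0] &
      dr = (2 * Num.sqrt (energy Om F C0 q))^-1
           * ip Om (fun x => derive1 F (q x)) du].

(* [tilde u^{n+1/2}]; [uh] is the value produced by the first-step scheme. *)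
Definition extrapolate (uh : plane R -> R) (uN : nat -> plane R -> R) (n : nat) :
    plane R -> R :=
  if n is k.+1 then fun x => (3 * uN n x - uN k x) / 2 else uh.

(* [(uh, vh, Rh)] are the auxiliary values at time [tau / 2]; the first-step
   scheme is implicit Euler with step [tau / 2], so its unknowns appear in
   place of the midpoint averages. *)
Definition SAV_scheme (N K : nat) (uh vh : plane R -> R) (Rh : R)
    (uN vN : nat -> plane R -> R) (RN : nat -> R) : Prop :=
  let tau := T / K%:R in
  [/\ [/\ is_PN Om N phi0 (uN 0%N), is_PN Om N phi1 (vN 0%N) &
          RN 0%N = Num.sqrt (energy Om F C0 phi0)],
      forall n, (n <= K)%N -> XN N (uN n) /\ XN N (vN n),
      [/\ XN N uh, XN N vh &
          SAV_equations N (uN 0%N) uh vh Rh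
            (fun x => (uh x - uN 0%N x) / (tau / 2))
            (fun x => (vh x - vN 0%N x) / (tau / 2))
            ((Rh - RN 0%N) / (tau / 2))] &
      forall n, (n < K)%N ->
        SAV_equations N (extrapolate uh uN n)
          (fun x => (uN n.+1 x + uN n x) / 2)
          (fun x => (vN n.+1 x + vN n x) / 2)
          ((RN n.+1 + RN n) / 2)
          (fun x => (uN n.+1 x - uN n x) / tau)
          (fun x => (vN n.+1 x - vN n x) / tau)
          ((RN n.+1 - RN n) / tau)].

(* Here [v = u_t], [w = u_tt] and [z = u_ttt]. *)
Definition regularity (m L : R) (u v w z : R -> plane R -> R) : Prop :=
  let r := fun t => Num.sqrt (energy Om F C0 (u t)) in
  [/\ forall t : R, 0 <= t <= T -> L2per Om (z t),
      L2_derivative Om T w z,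
      forall (k : nat) (t : R), (k < 3)%N -> 0 < t < T -> derivable (derive1n k r) t 1 &
      (hnorm Om m phi0 + sup_time T (hnorm Om m) u + sup_time T (hnorm Om m) v
       + Linfty_norm T r + Linfty_norm T (derive1n 1 r)
       + Linfty_norm T (derive1n 2 r) + Linfty_norm T (derive1n 3 r)
       + sup_time T (hnorm Om alpha) u + sup_time T (hnorm Om alpha) v
       + sup_time T (hnorm Om alpha) w
       + sup_time T (hnorm Om (alpha / 2)) z <= L%:E)%E].

End Problem.

(* Main.v *)
(* The errors of the Fourier coefficients satisfy a Crank-Nicolson system, and testing its
   second equation with the mean velocity gives the energy
   |e_v|^2 + kappa |e_u|_(alpha/2)^2 + |e_u|^2 + e_R^2, to which a discrete Gronwall
   inequality applies as long as the numerical solution stays bounded. Since alpha > 1, the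
   H^alpha norm controls the l^1 norm of the coefficients in two dimensions, so the exact
   solution is bounded; for the numerical solution an induction on the time step shows that
   the l^1 norm of the error stays below 1, with no condition linking tau and N.

   Consistency is measured at the midpoints of the steps. Time derivatives only exist in L^2,
   so midpoint and second differences are estimated coefficientwise by the mean value
   theorem applied to scalar products with a fixed vector. The defect of the velocity equation
   would need a fourth time derivative of u: the equation expresses u_tt by u and u_t, which
   bounds the defect in a dual norm, and the factor (-Delta)^(alpha/2) in front of u_t is
   absorbed by the damping. The differences of r are computed from those of r^2 = E(u).

   All this holds for tau below and N above some thresholds; otherwise the right-hand side is
   bounded below and unconditional stability suffices. The index m is replaced by
   max(m, alpha), which is harmless since the H^alpha norms are bounded too. *)
Require Import Defs.
From HB Require Import structures.
From mathcomp Require Import all_boot all_order all_algebra finmap.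
From mathcomp Require Import all_classical all_reals all_analysis.
From mathcomp Require Import measurable_realfun zify ring lra complex.

Set Implicit Arguments.
Unset Strict Implicit.
Unset Printing Implicit Defensive.

Import Order.TTheory GRing.Theory Num.Theory.
Import numFieldNormedType.Exports HBSimple HBNNSimple.

Local Open Scope classical_set_scope.
Local Open Scope ring_scope.

(** * Square-integrable functions *)

(** The obstacle is the sup norm. The energy controls the error only in H^(alpha/2), and alpha / 2
    <= 1 does not bound a maximum in two dimensions, while [F'] is only locally Lipschitz. The
    missing smoothness is paid for with one order in time: each residual is estimated twice, at
    second order in the weak norms of the energy and at first order in stronger ones. When tau^2
    dominates N^-m, the first-order bounds keep the H^alpha norm of the error bounded, though not
    small, and this suffices for the high frequencies.

    The local constants of [F] must be known before the induction on the steps. They are fixed on a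
    range found in this order: sup bound of the exact solution, then of the first-step predictor,
    which only depends on the initial data, then of all extrapolated arguments.

    Estimates are carried out on finite families of real coefficients, uniformly in N. Completeness
    of the trigonometric system enters when such bounds are turned back into L^2 norms or
    almost-everywhere bounds; it is derived from the approximation of indicators of arcs. *)

Section SquareIntegrable.
Context d (T : measurableType d) (R : realType).
Variables (mu : {measure set T -> \bar R}) (D : set T).
Hypotheses (mD : measurable D) (fD : (mu D < +oo)%E).
Implicit Types (f g h : T -> R) (M : R).

Definition L2 f : Prop :=
  measurable_fun D f /\ mu.-integrable D (EFin \o (fun x => f x ^+ 2)).

Definition L2dot f g : R := \int[mu]_(x in D) (f x * g x).

Definition L2nrm f : R := Num.sqrt (L2dot f f).

Lemma ae_le_Rintegral f g :
  mu.-integrable D (EFin \o f) -> mu.-integrable D (EFin \o g) ->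
  {ae mu, forall x, D x -> f x <= g x} ->
  \int[mu]_(x in D) f x <= \int[mu]_(x in D) g x.
Proof.
move=> fi gi fg; rewrite -subr_ge0 -RintegralB//.
have mf : measurable_fun D f by apply/measurable_EFinP; case/integrableP: fi.
have mg : measurable_fun D g by apply/measurable_EFinP; case/integrableP: gi.
(* Nonnegativity of [g - f] is known almost everywhere only; its absolute value is nonnegative
   everywhere and has the same integral. *)
have -> : \int[mu]_(x in D) (g x - f x) = \int[mu]_(x in D) `|g x - f x|.
  congr fine; apply: ae_eq_integral => //.
  - by apply/measurable_EFinP; apply: measurable_funB.
  - apply/measurable_EFinP; apply: measurableT_comp => //.
    exact: measurable_funB.
  - apply: filterS fg => x fgx Dx; rewrite ger0_norm// subr_ge0; exact: fgx.
by apply: Rintegral_ge0 => x _.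
Qed.

Lemma eq_ae_Rintegral f g :
  mu.-integrable D (EFin \o f) -> mu.-integrable D (EFin \o g) ->
  {ae mu, forall x, D x -> f x = g x} ->
  \int[mu]_(x in D) f x = \int[mu]_(x in D) g x.
Proof.
move=> fi gi fg; apply/eqP; rewrite eq_le; apply/andP; split;
  apply: ae_le_Rintegral => //.
  by apply: filterS fg => x fgx Dx; rewrite fgx.
by apply: filterS fg => x fgx Dx; rewrite fgx.
Qed.

Lemma ae_integrable_dom f g :
  measurable_fun D f -> mu.-integrable D (EFin \o g) ->
  {ae mu, forall x, D x -> `|f x| <= g x} -> mu.-integrable D (EFin \o f).
Proof.
move=> mf gi fg; apply/integrableP; split; first exact/measurable_EFinP.
have /integrableP[mg goo] := gi.
apply: le_lt_trans goo.
apply: ae_ge0_le_integral => //.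
- by apply: measurableT_comp => //; apply/measurable_EFinP.
- exact: measurableT_comp.
- apply: filterS fg => x fgx Dx; rewrite lee_fin.
  by apply: (le_trans (fgx Dx)); exact: ler_norm.
Qed.

Lemma L2_ae_dom f g : measurable_fun D f -> L2 g ->
  {ae mu, forall x, D x -> `|f x| <= `|g x|} -> L2 f.
Proof.
move=> mf [mg gi] fg; split => //.
apply: ae_integrable_dom gi _; first exact: measurable_funX.
apply: filterS fg => x fgx Dx; rewrite normrX -[leRHS]real_normK ?num_real//.
by rewrite lerXn2r ?nnegrE//; exact: fgx.
Qed.

Lemma L2_cst M : L2 (fun=> M).
Proof.
split; first exact: measurable_cst.
apply/integrableP; split; first exact/measurable_EFinP/measurable_cst.
rewrite (eq_integral (fun=> `|(M ^+ 2)%:E|%E)) //.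
by rewrite integral_cst//= lte_mul_pinfty.
Qed.

Lemma L2_ae_bounded f M : measurable_fun D f ->
  {ae mu, forall x, D x -> `|f x| <= M} -> L2 f.
Proof.
move=> mf fM; apply: (L2_ae_dom mf (L2_cst M)).
by apply: filterS fM => x fM Dx; apply: (le_trans (fM Dx)); exact: ler_norm.
Qed.

Lemma L2_bounded f M : measurable_fun D f ->
  (forall x, D x -> `|f x| <= M) -> L2 f.
Proof. by move=> mf fM; apply: (L2_ae_bounded (M := M) mf); apply: aeW. Qed.

Lemma L2_mul_integrable f g : L2 f -> L2 g ->
  mu.-integrable D (EFin \o (fun x => f x * g x)).
Proof.
move=> [mf fi] [mg gi].
have fgi : mu.-integrable D (EFin \o (fun x => f x ^+ 2 + g x ^+ 2)).
  exact (integrableD mD fi gi).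
apply: (ae_integrable_dom _ fgi); first exact: measurable_funM.
apply: aeW => x _; rewrite ler_norml; apply/andP; split; nra.
Qed.

Lemma L2_integrable f : L2 f -> mu.-integrable D (EFin \o f).
Proof.
move=> f2; have := L2_mul_integrable f2 (L2_cst 1).
by under [EFin \o _]funext do rewrite /= mulr1.
Qed.

Lemma L2Z r f : L2 f -> L2 (fun x => r * f x).
Proof.
move=> [mf fi]; split; first exact: measurable_funM.
have := integrableZl mD (r ^+ 2) fi.
by under [X in integrable _ _ X -> _]funext do rewrite /= -EFinM -exprMn.
Qed.

Lemma L2D f g : L2 f -> L2 g -> L2 (fun x => f x + g x).
Proof.
move=> f2 g2; have [mf fi] := f2; have [mg gi] := g2.
split; first exact: measurable_funD.
have fgi := L2_mul_integrable f2 g2.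
have := integrableD mD (integrableD mD fi gi) (integrableZl mD 2 fgi).
by under [X in integrable _ _ X -> _]funext do
  rewrite /= -EFinM -!EFinD addrAC mulr_natl -sqrrD.
Qed.

Lemma L2B f g : L2 f -> L2 g -> L2 (fun x => f x - g x).
Proof.
move=> f2 g2; have := L2D f2 (L2Z (-1) g2).
by under [X in L2 X -> _]funext do rewrite mulN1r.
Qed.

Lemma L2_sum (I : Type) (s : seq I) (F : I -> T -> R) :
  (forall i, L2 (F i)) -> L2 (fun x => \sum_(i <- s) F i x).
Proof.
move=> F2; elim: s => [|i s IH].
  by under [X in L2 X]funext do rewrite big_nil; exact: L2_cst.
by under [X in L2 X]funext do rewrite big_cons; exact: L2D.
Qed.

Lemma dotC f g : L2dot f g = L2dot g f.
Proof. by rewrite /L2dot; apply: eq_Rintegral => x _; rewrite mulrC. Qed.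

Lemma dotDl f g h : L2 f -> L2 g -> L2 h ->
  L2dot (fun x => f x + g x) h = L2dot f h + L2dot g h.
Proof.
move=> f2 g2 h2; rewrite /L2dot -RintegralD//; [|exact: L2_mul_integrable..].
by apply: eq_Rintegral => x _; rewrite mulrDl.
Qed.

Lemma dotBl f g h : L2 f -> L2 g -> L2 h ->
  L2dot (fun x => f x - g x) h = L2dot f h - L2dot g h.
Proof.
move=> f2 g2 h2; rewrite /L2dot -RintegralB//; [|exact: L2_mul_integrable..].
by apply: eq_Rintegral => x _; rewrite mulrBl.
Qed.

Lemma dotZl r f h : L2 f -> L2 h -> L2dot (fun x => r * f x) h = r * L2dot f h.
Proof.
move=> f2 h2; rewrite /L2dot -RintegralZl//; last exact: L2_mul_integrable.
by apply: eq_Rintegral => x _; rewrite mulrA.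
Qed.

Lemma dotDr f g h : L2 f -> L2 g -> L2 h ->
  L2dot h (fun x => f x + g x) = L2dot h f + L2dot h g.
Proof. by move=> *; rewrite dotC dotDl// dotC (dotC g). Qed.

Lemma dotBr f g h : L2 f -> L2 g -> L2 h ->
  L2dot h (fun x => f x - g x) = L2dot h f - L2dot h g.
Proof. by move=> *; rewrite dotC dotBl// dotC (dotC g). Qed.

Lemma dotZr r f h : L2 f -> L2 h -> L2dot h (fun x => r * f x) = r * L2dot h f.
Proof. by move=> *; rewrite dotC dotZl// dotC. Qed.

Lemma dot_suml (I : Type) (s : seq I) (F : I -> T -> R) h :
  (forall i, L2 (F i)) -> L2 h ->
  L2dot (fun x => \sum_(i <- s) F i x) h = \sum_(i <- s) L2dot (F i) h.
Proof.
move=> F2 h2; elim: s => [|i s IH].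
  rewrite big_nil /L2dot; under eq_Rintegral do rewrite big_nil mul0r.
  by rewrite Rintegral_cst// mul0r.
rewrite big_cons -IH -dotDl//; last exact: L2_sum.
by congr L2dot; apply/funext => x; rewrite big_cons.
Qed.

Lemma dot_ge0 f : 0 <= L2dot f f.
Proof. by apply: Rintegral_ge0 => x _; rewrite -expr2 sqr_ge0. Qed.

Lemma nrm_ge0 f : 0 <= L2nrm f.
Proof. exact: sqrtr_ge0. Qed.

Lemma sqr_nrm f : L2nrm f ^+ 2 = L2dot f f.
Proof. by rewrite sqr_sqrtr// dot_ge0. Qed.

Lemma nrm_le f r : 0 <= r -> L2dot f f <= r ^+ 2 -> L2nrm f <= r.
Proof.
by move=> r0 fr; rewrite -(ger0_norm r0) -sqrtr_sqr ler_wsqrtr.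
Qed.

Lemma dot_le_nrm f g : L2 f -> L2 g -> `|L2dot f g| <= L2nrm f * L2nrm g.
Proof.
move=> f2 g2.
have quad t : 0 <= L2dot f f - 2 * t * L2dot f g + t ^+ 2 * L2dot g g.
  have := dot_ge0 (fun x => f x - t * g x).
  have tg2 := L2Z t g2.
  by rewrite dotBl ?dotBr ?dotZl ?dotZr//; [rewrite (dotC g f); lra|exact: L2B].
rewrite -sqrtrM ?dot_ge0// -sqrtr_sqr ler_wsqrtr//.
have [g0|g0] := eqVneq (L2dot g g) 0.
  rewrite g0 mulr0; have [->|fg0] := eqVneq (L2dot f g) 0; first by rewrite expr0n.
  (* When [L2dot g g = 0] the quadratic is affine in [t], and at this point it takes the value
     -1. *)
  have := quad ((L2dot f f + 1) / (2 * L2dot f g)).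
  rewrite g0 mulr0 addr0.
  have -> : 2 * ((L2dot f f + 1) / (2 * L2dot f g)) * L2dot f g = L2dot f f + 1 by field.
  by move=> ?; exfalso; lra.
have gg : 0 < L2dot g g by rewrite lt_neqAle eq_sym g0 dot_ge0.
have := quad (L2dot f g / L2dot g g).
have -> : L2dot f f - 2 * (L2dot f g / L2dot g g) * L2dot f g +
   (L2dot f g / L2dot g g) ^+ 2 * L2dot g g = (L2dot f f * L2dot g g - L2dot f g ^+ 2) / L2dot g g.
  by field.
by rewrite pmulr_lge0 ?invr_gt0// subr_ge0.
Qed.

Lemma nrmD f g : L2 f -> L2 g -> L2nrm (fun x => f x + g x) <= L2nrm f + L2nrm g.
Proof.
move=> f2 g2; apply: nrm_le; first by rewrite addr_ge0// nrm_ge0.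
have f_g := L2D f2 g2.
rewrite dotDl ?dotDr// (dotC g f) sqrrD !sqr_nrm.
have := dot_le_nrm f2 g2; have := ler_norm (L2dot f g); lra.
Qed.

Lemma nrmZ r f : L2 f -> L2nrm (fun x => r * f x) = `|r| * L2nrm f.
Proof.
move=> f2; rewrite /L2nrm dotZl ?dotZr//; last exact: L2Z.
by rewrite mulrA -expr2 sqrtrM ?sqr_ge0// sqrtr_sqr.
Qed.

Lemma nrm_ae_le f g : L2 f -> L2 g ->
  {ae mu, forall x, D x -> `|f x| <= `|g x|} -> L2nrm f <= L2nrm g.
Proof.
move=> f2 g2 fg; rewrite ler_wsqrtr//; apply: ae_le_Rintegral.
- exact: L2_mul_integrable.
- exact: L2_mul_integrable.
- apply: filterS fg => x fgx Dx.
  by rewrite -!expr2 -[leLHS]real_normK ?num_real// -[leRHS]real_normK ?num_real//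
    lerXn2r ?nnegrE//; exact: fgx.
Qed.

Lemma nrm_ae_eq f g : L2 f -> L2 g ->
  {ae mu, forall x, D x -> f x = g x} -> L2nrm f = L2nrm g.
Proof.
move=> f2 g2 fg; apply/eqP; rewrite eq_le; apply/andP; split;
  apply: nrm_ae_le => //; by apply: filterS fg => x fgx Dx; rewrite fgx.
Qed.

Lemma dot_ae_eq f g h : L2 f -> L2 g -> L2 h ->
  {ae mu, forall x, D x -> f x = g x} -> L2dot f h = L2dot g h.
Proof.
move=> f2 g2 h2 fg; apply: eq_ae_Rintegral; try exact: L2_mul_integrable.
by apply: filterS fg => x fgx Dx; rewrite fgx.
Qed.

Lemma Rintegral_dot1 f : \int[mu]_(x in D) f x = L2dot f (fun=> 1).
Proof. by apply: eq_Rintegral => x _; rewrite mulr1. Qed.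

End SquareIntegrable.

(** * Density of trigonometric polynomials *)

Section Density.
Context d (T : measurableType d) (R : realType).
Variables (mu : {measure set T -> \bar R}) (D : set T).
Hypotheses (mD : measurable D) (fD : (mu D < +oo)%E).
Variable A : (T -> R) -> Prop.
Hypothesis A2 : forall f, A f -> L2 mu D f.
Hypothesis AD : forall f g, A f -> A g -> A (fun x => f x + g x).
Hypothesis AZ : forall r f, A f -> A (fun x => r * f x).
Hypothesis A1 : A (fun=> 1).
Implicit Types (f g h : T -> R).

Definition L2clo f : Prop :=
  L2 mu D f /\
  forall e, 0 < e -> exists g, A g /\ L2nrm mu D (fun x => f x - g x) < e.

Lemma L2cloA f : A f -> L2clo f.
Proof.
move=> Af; split; first exact: A2.
move=> e e0; exists f; split => //; rewrite /L2nrm /L2dot.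
under eq_Rintegral do rewrite subrr mul0r.
by rewrite Rintegral_cst// mul0r sqrtr0.
Qed.

Lemma L2clo_lim f : L2 mu D f ->
  (forall e, 0 < e -> exists g, L2clo g /\ L2nrm mu D (fun x => f x - g x) < e) ->
  L2clo f.
Proof.
move=> f2 fe; split => // e e0; have e20 : 0 < e / 2 by rewrite divr_gt0.
have [g [[g2 gA] fg]] := fe _ e20; have [h [Ah gh]] := gA _ e20.
exists h; split => //; rewrite (splitr e).
apply: le_lt_trans (ltrD fg gh).
have h2 := A2 Ah; have := nrmD mD (L2B mD f2 g2) (L2B mD g2 h2).
by under [X in L2nrm _ _ X]funext do rewrite subrKA.
Qed.

Lemma L2cloD f g : L2clo f -> L2clo g -> L2clo (fun x => f x + g x).
Proof.
move=> [f2 fA] [g2 gA]; split; first exact: L2D.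
move=> e e0; have e20 : 0 < e / 2 by rewrite divr_gt0.
have [f' [Af' ff']] := fA _ e20; have [g' [Ag' gg']] := gA _ e20.
exists (fun x => f' x + g' x); split; first exact: AD.
rewrite (splitr e); apply: le_lt_trans (ltrD ff' gg').
have := nrmD mD (L2B mD f2 (A2 Af')) (L2B mD g2 (A2 Ag')).
by under [X in L2nrm _ _ X]funext do rewrite addrACA -opprD.
Qed.

Lemma L2cloZ r f : L2clo f -> L2clo (fun x => r * f x).
Proof.
move=> [f2 fA]; split; first exact: L2Z.
move=> e e0; have e20 : 0 < e / (`|r| + 1) by rewrite divr_gt0// ltr_wpDl.
have [g [Ag fg]] := fA _ e20; exists (fun x => r * g x); split; first exact: AZ.
under [X in L2nrm _ _ X]funext do rewrite -mulrBr.
rewrite nrmZ//; last exact: (L2B mD f2 (A2 Ag)).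
move: fg; rewrite ltr_pdivlMr ?ltr_wpDl// mulrC; apply: le_lt_trans.
by rewrite ler_wpM2r ?nrm_ge0// lerDl.
Qed.

Lemma L2clo_sum (I : Type) (s : seq I) (F : I -> T -> R) :
  (forall i, L2clo (F i)) -> L2clo (fun x => \sum_(i <- s) F i x).
Proof.
move=> FA; elim: s => [|i s IH].
  under [X in L2clo X]funext do rewrite big_nil.
  by have := L2cloZ 0 (L2cloA A1); under [X in L2clo X -> _]funext do rewrite mul0r.
by under [X in L2clo X]funext do rewrite big_cons; exact: L2cloD.
Qed.

(** Dominated convergence of the squares [(f - f_ n)^2], with bound [h^2], makes some [f_ n] close
    to [f] in norm; the closure is closed under such limits. *)
Lemma L2clo_dominated f (f_ : nat -> T -> R) h :
  L2 mu D f -> L2 mu D h -> (forall n, L2clo (f_ n)) ->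
  (forall n x, D x -> `|f x - f_ n x| <= `|h x|) ->
  {ae mu, forall x, D x -> f_ ^~ x @ \oo --> f x} ->
  L2clo f.
Proof.
move=> f2 h2 fA fh cf; apply: L2clo_lim => // e e0.
pose F n x := (f x - f_ n x) * (f x - f_ n x).
have mF n : measurable_fun D (F n).
  have [mfn _] := (fA n).1; have [mf _] := f2.
  by apply: measurable_funM; exact: measurable_funB.
have [] := @dominated_convergence _ _ _ mu D mD (fun n => EFin \o F n) (cst 0%E)
  (EFin \o (fun x => h x ^+ 2)).
- by move=> n; exact/measurable_EFinP.
- exact: measurable_cst.
- apply: filterS cf => x cfx Dx; rewrite /comp/=.
  apply: cvg_EFin; first exact: nearW.
  rewrite /comp/= -[X in _ --> X](mulr0 (f x - f x)) -[X in _ * X](subrr (f x)).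
  by apply: cvgM; apply: cvgB; [exact: cvg_cst|exact: cfx|exact: cvg_cst|exact: cfx].
- exact: h2.2.
- apply: aeW => x n Dx; rewrite /= lee_fin ger0_norm /F -expr2 ?sqr_ge0//.
  rewrite -[leLHS]real_normK ?num_real// -[leRHS]real_normK ?num_real//.
  by rewrite lerXn2r ?nnegrE// fh.
move=> _ _; rewrite integral0 => /fine_cvg/cvgrPdist_lt/(_ (e ^+ 2)).
rewrite exprn_gt0// => /(_ isT)[n _ /(_ n (leqnn n))] /=.
rewrite sub0r normrN ger0_norm; last by rewrite fine_ge0// integral_ge0// => x _;
  rewrite lee_fin /F -expr2 sqr_ge0.
move=> ne; exists (f_ n); split => //.
rewrite /L2nrm -(ger0_norm (ltW e0)) -sqrtr_sqr ltr_sqrt ?exprn_gt0//.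
Qed.

Lemma measurable_indic_L2 (S : set T) : measurable S -> L2 mu D (\1_S : T -> R).
Proof.
move=> mS; apply: (L2_bounded mD fD (M := 1)).
  by apply: measurable_funTS; exact: measurable_indic.
by move=> x _; rewrite indicE; case: (_ \in _); rewrite ?normr1 ?normr0.
Qed.

Lemma L2clo_eq f g : L2 mu D g -> (forall x, D x -> f x = g x) ->
  L2clo f -> L2clo g.
Proof.
move=> g2 fg fA; apply: (@L2clo_dominated g (fun=> f) (fun=> 0)) => //.
- exact: L2_cst.
- by move=> n x Dx; rewrite fg// subrr.
- by apply: aeW => x Dx; rewrite fg//; exact: cvg_cst.
Qed.

(** A Dynkin class argument: differences are handled by linearity, disjoint unions by dominated
    convergence. The fixed factor [B] allows one coordinate to vary while the other stays in a given
    set. *)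
Lemma L2clo_preimage d' (T' : measurableType d') (phi : T -> T') (B : set T)
    (G : set (set T')) :
  measurable_fun setT phi -> measurable B ->
  @measurable _ T' = <<s G >> -> setI_closed G ->
  L2clo (\1_B : T -> R) ->
  (forall S, G S -> L2clo (\1_(phi @^-1` S `&` B) : T -> R)) ->
  forall S, measurable S -> L2clo (\1_(phi @^-1` S `&` B) : T -> R).
Proof.
move=> mphi mB GE GI BA GA S; rewrite GE.
have mI S' : measurable S' -> measurable (phi @^-1` S' `&` B).
  by move=> mS'; apply: measurableI => //; rewrite -[X in measurable X]setTI; exact: mphi.
apply: (@dynkin_induction _ _ G
  (fun S => L2clo (\1_(phi @^-1` S `&` B) : T -> R))) => //.
- by rewrite preimage_setT setTI.
- move=> S' mS' S'A; have := L2cloD BA (L2cloZ (-1) S'A).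
  congr L2clo; apply/funext => x; rewrite !indicE !in_setI preimage_setC in_setC.
  by case: (x \in B); case: (x \in _); rewrite ?mulN1r ?subrr ?oppr0 ?addr0.
- move=> F mF tF FA.
  have mU : measurable (phi @^-1` (\bigcup_k F k) `&` B).
    by apply: mI; exact: bigcup_measurable.
  pose f_ n (x : T) : R := \sum_(k <- iota 0 n) \1_(phi @^-1` F k `&` B) x.
  (* Disjointness turns the partial sums into indicators of finite unions, which are eventually
     constant at each point. *)
  have f_E n x : f_ n x = \1_((\bigcup_(k < n) (phi @^-1` F k `&` B))) x.
    rewrite /f_ -[in iota 0 n](subn0 n) -/(index_iota 0 n) big_mkord.
    rewrite indicE.
    have [/set_mem[k/= kn [Fkx Bx]]|] := boolP (x \in _).
      rewrite (bigD1 (Ordinal kn))//= indicE mem_set// big1 ?addr0// => j jk.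
      rewrite indicE; apply/eqP; rewrite pnatr_eq0 eqb0; apply/negP => /set_mem[Fjx _].
      move/trivIsetP : tF => /(_ j k I I).
      have -> : (j : nat) != k by apply: contra jk => /eqP jk; apply/eqP/val_inj.
      by move=> /(_ isT)/seteqP[+ _] => /(_ (phi x)); apply.
    move=> /negP xF; rewrite big1//= => j _; rewrite indicE.
    apply/eqP; rewrite pnatr_eq0 eqb0; apply/negP => /set_mem Fjx; apply: xF.
    by apply/mem_set; exists (j : nat) => /=.
  apply: (@L2clo_dominated _ f_ (fun=> 1)).
  + exact: measurable_indic_L2.
  + exact: L2_cst.
  + by move=> n; exact: L2clo_sum.
  + move=> n x _; rewrite f_E !indicE normr1.
    case: (_ \in _); case: (_ \in _); rewrite ?subrr ?subr0 ?sub0r ?normrN ?normr0 ?normr1//.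
  + apply: aeW => x _; under eq_fun do rewrite f_E.
    rewrite indicE; have [/set_mem[[k _ Fkx] Bx]|] := boolP (x \in _).
      apply: cvg_near_cst; exists k.+1 => // n /= kn.
      by rewrite indicE mem_set//; exists k.
    move=> /negP xF; apply: cvg_near_cst; apply: nearW => n.
    rewrite indicE memNset// => -[k _ [Fkx Bx]]; apply: xF; apply/mem_set.
    by split => //; exists k.
Qed.

(** A nonnegative function is the increasing limit of simple functions and dominates the error; the
    general case splits into positive and negative parts. *)
Lemma L2clo_total : (forall S, measurable S -> L2clo (\1_S : T -> R)) ->
  forall f, L2 mu D f -> L2clo f.
Proof.
move=> SA.
have pos f : L2 mu D f -> (forall x, 0 <= f x) -> L2clo f.
  move=> f2 f0; have [mf _] := f2.
  have mEf : measurable_fun D (EFin \o f) by exact/measurable_EFinP.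
  have Ef0 x : D x -> (0 <= (EFin \o f) x)%E by rewrite lee_fin.
  pose g_ n := nnsfun_approx mD mEf n.
  have g_le n x : D x -> g_ n x <= f x.
    by move=> Dx; rewrite -lee_fin /g_ nnsfun_approxE; exact: (le_approx n Ef0 Dx).
  apply: (@L2clo_dominated _ g_ f) => //.
  - move=> n; under [X in L2clo X]funext do rewrite fimfunE fsbig_finite//=.
    by apply: L2clo_sum => i; apply: L2cloZ; apply: SA.
  - move=> n x Dx; rewrite !ger0_norm ?subr_ge0 ?g_le ?f0//.
    by rewrite lerBlDr lerDl.
  - apply: aeW => x Dx; have := cvg_nnsfun_approx mD mEf Ef0 Dx.
    by move=> /fine_cvg.
move=> f f2; have [mf _] := f2.
have fp : L2clo (fun x => Num.max (f x) 0).
  apply: pos; last by move=> x; rewrite le_max lexx orbT.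
  apply: (L2_ae_dom mD _ f2); first exact: measurable_maxr.
  apply: aeW => x _; rewrite ger0_norm ?le_max ?lexx ?orbT// ge_max normr_ge0 andbT.
  exact: ler_norm.
have fn : L2clo (fun x => Num.max (- f x) 0).
  apply: pos; last by move=> x; rewrite le_max lexx orbT.
  apply: (L2_ae_dom mD _ f2).
    by apply: measurable_maxr => //; exact: measurableT_comp.
  apply: aeW => x _; rewrite ger0_norm ?le_max ?lexx ?orbT// ge_max normr_ge0 andbT.
  by rewrite -normrN; exact: ler_norm.
have := L2cloD fp (L2cloZ (-1) fn); congr L2clo; apply/funext => x.
by rewrite mulN1r; have [?|?] := leP (f x) 0;
  [rewrite max_l ?oppr_ge0// sub0r opprK|rewrite max_r ?subr0// oppr_le0 ltW].
Qed.

End Density.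

(** * Polynomial approximation of indicators of arcs *)

Section Arcs.
Context {R : realType}.
Implicit Types (x y t p h : R) (n m : nat).

Lemma bernoulli_ge x n : -1 <= x -> 1 + n%:R * x <= (1 + x) ^+ n.
Proof.
move=> x1; elim: n => [|n IH]; first by rewrite mul0r addr0 expr0.
rewrite exprS; have x10 : 0 <= 1 + x by lra.
apply: le_trans (ler_wpM2l x10 IH).
rewrite -natr1; have : 0 <= n%:R * x ^+ 2 by rewrite mulr_ge0 ?sqr_ge0.
by rewrite expr2; lra.
Qed.

(* The Brosowski-Deutsch polynomials: on [0, 1] they converge to the indicator
   of [0, 1/2[ away from 1/2. *)
Definition bdpoly n t : R := (1 - t ^+ n) ^+ (2 ^ n).

Lemma bdpoly_itv n t : 0 <= t <= 1 -> 0 <= bdpoly n t <= 1.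
Proof.
move=> /andP[t0 t1]; have tn0 : 0 <= t ^+ n by rewrite exprn_ge0.
have tn1 : t ^+ n <= 1 by rewrite exprn_ile1.
by rewrite exprn_ge0 ?subr_ge0//= exprn_ile1 ?subr_ge0// lerBlDr lerDl.
Qed.

(** Bernoulli's inequality with exponent 2^n gives [1 - (2 * t) ^+ n <= bdpoly n t]. *)
Lemma bdpoly_cvg1 t : 0 <= t < 1 / 2 -> (fun n => bdpoly n t) @ \oo --> (1 : R).
Proof.
move=> /andP[t0 t2].
have t01 : 0 <= t <= 1 by lra.
apply: (@squeeze_cvgr _ _ _ _ (fun n => 1 - (2 * t) ^+ n) (fun=> 1)).
- apply: nearW => n; have /andP[_ ->] := bdpoly_itv n t01; rewrite andbT.
  rewrite /bdpoly; have := @bernoulli_ge (- t ^+ n) (2 ^ n).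
  rewrite natrX exprMn mulrN; apply.
  by rewrite lerN2 exprn_ile1//; lra.
- rewrite -[X in _ --> X]subr0; apply: cvgB; first exact: cvg_cst.
  by apply: cvg_expr; rewrite ger0_norm; lra.
- exact: cvg_cst.
Qed.

(** With x = t^n, the product of (1 - x)^(2^n) and (1 + x)^(2^n) is at most 1, and by Bernoulli the
    second factor is at least (2t)^n. *)
Lemma bdpoly_cvg0 t : 1 / 2 < t <= 1 -> (fun n => bdpoly n t) @ \oo --> (0 : R).
Proof.
move=> /andP[t2 t1].
have t01 : 0 <= t <= 1 by lra.
apply: (@squeeze_cvgr _ _ _ _ (fun=> 0) (fun n => (2 * t)^-1 ^+ n)).
- apply: nearW => n; have /andP[-> _] := bdpoly_itv n t01 => /=.
  have tn0 : 0 <= t ^+ n by rewrite exprn_ge0//; lra.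
  have tn1 : t ^+ n <= 1 by rewrite exprn_ile1//; lra.
  have t2n : 0 < (2 * t) ^+ n by rewrite exprn_gt0//; lra.
  rewrite exprVn -[leRHS]mul1r ler_pdivlMr//.
  have b1 : (2 * t) ^+ n <= (1 + t ^+ n) ^+ (2 ^ n).
    have tn1' : -1 <= t ^+ n by lra.
    have := @bernoulli_ge (t ^+ n) (2 ^ n) tn1'; rewrite natrX exprMn; lra.
  apply: (@le_trans _ _ (bdpoly n t * (1 + t ^+ n) ^+ (2 ^ n))).
    by rewrite ler_wpM2l// exprn_ge0// subr_ge0.
  rewrite /bdpoly -exprMn exprn_ile1//; nra.
- exact: cvg_cst.
- apply: cvg_expr; rewrite ger0_norm; last by rewrite invr_ge0; lra.
  by rewrite invf_lt1; lra.
Qed.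

(** With p = (x + h) / 2 and q = (x - h) / 2, the difference cos h - cos x is 2 sin p sin q. *)
Lemma cos_lt_arc x h : 0 < (x + h) / 2 < pi -> 0 < (x - h) / 2 < pi ->
  cos x < cos h.
Proof.
move=> s1 s2; have p1 := sin_gt0_pi s1; have p2 := sin_gt0_pi s2.
have -> : x = (x + h) / 2 + (x - h) / 2 by lra.
have {3}-> : h = (x + h) / 2 - (x - h) / 2 by lra.
by rewrite cosD cosB; nra.
Qed.

(* The arc of centre (p + b) / 2 and half-length (b - p) / 2 cuts out ]p, b[ in
   a period ]a, b[. *)
Lemma ray_approx (a b p : R) : b = a + 2 * pi -> a < p < b ->
  exists m h : R,
  let g n x := bdpoly n (1 / 2 - (cos (x - m) - h) / 4) in
  (forall n x, 0 <= g n x <= 1) /\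
  (forall x, a < x < b -> x != p -> (fun n => g n x) @ \oo --> ((p < x)%R%:R : R)).
Proof.
move=> ab /andP[ap pb]; exists ((p + b) / 2), (cos ((b - p) / 2)) => g.
have t01 x : 0 <= 1 / 2 - (cos (x - (p + b) / 2) - cos ((b - p) / 2)) / 4 <= 1.
  have := cos_le1 (x - (p + b) / 2); have := cos_geN1 (x - (p + b) / 2).
  by have := cos_le1 ((b - p) / 2); have := cos_geN1 ((b - p) / 2); lra.
have pi0 := pi_gt0 R.
split; first by move=> n x; exact: bdpoly_itv.
move=> x /andP[ax xb] xp; case: ltgtP xp => // [px|xp] _.
  apply: bdpoly_cvg1; have /andP[-> _] /= := t01 x.
  suff : cos ((b - p) / 2) < cos (x - (p + b) / 2) by lra.
  have [xm|xm] := leP ((p + b) / 2) x.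
    by apply: cos_lt_arc; lra.
  by rewrite -(cosN (x - _)); apply: cos_lt_arc; lra.
apply: bdpoly_cvg0; have /andP[_ ->] /= := t01 x; rewrite andbT.
suff : cos (x - (p + b) / 2) < cos ((b - p) / 2) by lra.
by rewrite -(cosN (x - _)); apply: cos_lt_arc; lra.
Qed.

End Arcs.

(** * The algebra of real trigonometric polynomials *)

Section Trigonometric.
Context {R : realType}.
Implicit Types (k l : int * int) (j : (int * int) * bool) (f g : plane R -> R).

Definition tj j (x : plane R) : R :=
  if j.2 then sin (phase j.1 x) else cos (phase j.1 x).

Inductive trig : (plane R -> R) -> Prop :=
| trig_tj j : trig (tj j)
| trigD f g : trig f -> trig g -> trig (fun x => f x + g x)
| trigZ r f : trig f -> trig (fun x => r * f x).

Lemma phaseD k l (x : plane R) :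
  phase (k.1 + l.1, k.2 + l.2) x = phase k x + phase l x.
Proof. by rewrite /phase/= !intrD; ring. Qed.

Lemma phaseB k l (x : plane R) :
  phase (k.1 - l.1, k.2 - l.2) x = phase k x - phase l x.
Proof. by rewrite /phase/= !intrB; ring. Qed.

Lemma phaseN k (x : plane R) : phase (- k.1, - k.2) x = - phase k x.
Proof. by rewrite /phase/= !intrN; ring. Qed.

Lemma trig_eq f g : trig f -> f =1 g -> trig g.
Proof. by move=> tf fg; rewrite -(funext fg). Qed.

(** The product-to-sum formulas make the linear span of the waves an algebra; this is what allows a
    polynomial such as [bdpoly] to be applied to a wave. *)
Lemma trigM f g : trig f -> trig g -> trig (fun x => f x * g x).
Proof.
move=> tf tg; elim: tf => {f}[[k b]|f f' _ IH _ IH'|r f _ IH].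
- elim: tg => {g}[[l c]|g g' _ IH _ IH'|r g _ IH].
  + have D c' := trig_tj ((k.1 + l.1, k.2 + l.2), c').
    have B c' := trig_tj ((k.1 - l.1, k.2 - l.2), c').
    case: b c => -[].
    * apply: (trig_eq (trigD (trigZ (1/2) (B false)) (trigZ (- (1/2)) (D false)))) => x.
      by rewrite /tj/= phaseB phaseD cosB cosD; field.
    * apply: (trig_eq (trigD (trigZ (1/2) (D true)) (trigZ (1/2) (B true)))) => x.
      by rewrite /tj/= phaseB phaseD sinB sinD; field.
    * apply: (trig_eq (trigD (trigZ (1/2) (D true)) (trigZ (- (1/2)) (B true)))) => x.
      by rewrite /tj/= phaseB phaseD sinB sinD; field.
    * apply: (trig_eq (trigD (trigZ (1/2) (B false)) (trigZ (1/2) (D false)))) => x.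
      by rewrite /tj/= phaseB phaseD cosB cosD; field.
  + by apply: (trig_eq (trigD IH IH')) => x; rewrite mulrDr.
  + by apply: (trig_eq (trigZ r IH)) => x; ring.
- by apply: (trig_eq (trigD IH IH')) => x; rewrite mulrDl.
- by apply: (trig_eq (trigZ r IH)) => x; ring.
Qed.

Lemma trig_cst r : trig (fun=> r).
Proof.
apply: (trig_eq (trigZ r (trig_tj ((0, 0), false)))) => x.
by rewrite /tj/phase/= !mul0r addr0 cos0 mulr1.
Qed.

Lemma trigX f n : trig f -> trig (fun x => f x ^+ n).
Proof.
move=> tf; elim: n => [|n IH]; first exact: (trig_cst 1).
by apply: (trig_eq (trigM tf IH)) => x; rewrite exprS.
Qed.

Lemma trig_bdpoly f n : trig f -> trig (fun x => bdpoly n (f x)).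
Proof.
move=> tf; apply: trigX.
by apply: (trig_eq (trigD (trig_cst 1) (trigZ (-1) (trigX n tf)))) => x; rewrite mulN1r.
Qed.

Lemma trig_cos1 m : trig (fun x => cos (x.1 - m)).
Proof.
apply: (trig_eq (trigD (trigZ (cos m) (trig_tj ((1, 0), false)))
  (trigZ (sin m) (trig_tj ((1, 0), true))))) => x.
by rewrite /tj/phase/= mul1r mul0r addr0 cosB; ring.
Qed.

Lemma trig_cos2 m : trig (fun x => cos (x.2 - m)).
Proof.
apply: (trig_eq (trigD (trigZ (cos m) (trig_tj ((0, 1), false)))
  (trigZ (sin m) (trig_tj ((0, 1), true))))) => x.
by rewrite /tj/phase/= mul1r mul0r add0r cosB; ring.
Qed.

Lemma measurable_phase k : measurable_fun setT (@phase R k).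
Proof.
by rewrite /phase; apply: measurable_funD; apply: measurable_funM.
Qed.

Lemma measurable_tj j : measurable_fun setT (tj j).
Proof.
have ms : measurable_fun setT (@sin R).
  by apply: continuous_measurable_fun => x; exact: continuous_sin.
have mc : measurable_fun setT (@cos R).
  by apply: continuous_measurable_fun => x; exact: continuous_cos.
by case: j => k []; [exact: (measurableT_comp ms (measurable_phase k))
  |exact: (measurableT_comp mc (measurable_phase k))].
Qed.

Lemma tj_le1 j x : `|tj j x| <= 1.
Proof. by case: j => k []; rewrite /tj/= ?sin_max ?cos_max. Qed.

End Trigonometric.

(** * Density of trigonometric polynomials on the periodic cell *)

Section Cell.
Context {R : realType}.
Variables (a b c d : R).
Hypotheses (hab : b = a + 2 * pi) (hcd : d = c + 2 * pi).
Let Om : set (plane R) := `]a, b[ `*` `]c, d[.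
Implicit Types (f g : plane R -> R).

Lemma measurable_cell : measurable Om.
Proof. by apply: measurableX; exact: measurable_itv. Qed.

Lemma cell_measure : leb2 Om = ((2 * pi) ^+ 2)%:E.
Proof.
have pi0 := pi_gt0 R.
have -> : leb2 Om = (lebesgue_measure `]a, b[%classic * lebesgue_measure `]c, d[%classic)%E.
  by apply: product_measure1E; exact: measurable_itv.
rewrite !lebesgue_measure_itv/= !lte_fin.
rewrite hab hcd !ltrDl mulr_gt0// -!EFinD -EFinM expr2.
by congr ((_ * _)%:E); ring.
Qed.

Lemma cell_measure_lty : (leb2 Om < +oo)%E.
Proof. by rewrite cell_measure ltry. Qed.

Let mD := measurable_cell.
Let fD := cell_measure_lty.

Lemma L2_trig f : trig f -> L2 leb2 Om f.
Proof.
elim=> {f}[j|f g _ f2 _ g2|r f _ f2]; [|exact: L2D|exact: L2Z].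
apply: (L2_bounded mD fD (M := 1)); last by move=> x _; exact: tj_le1.
by apply: measurable_funTS; exact: measurable_tj.
Qed.

Let clo := L2clo leb2 Om (@trig R).

(** If [p] lies outside the open period, the indicator of the ray is constant on it and a constant
    sequence will do; otherwise [ray_approx] applies. *)
Let ray_or p q x0 : q = x0 + 2 * pi -> exists g : nat -> R -> R,
  [/\ forall (pr : plane R -> R), (forall m, trig (fun x => cos (pr x - m))) ->
        forall n, trig (fun x => g n (pr x)),
      (forall n x, 0 <= g n x <= 1) &
      (forall x, x0 < x < q -> x != p -> (fun n => g n x) @ \oo --> ((p < x)%R%:R : R))].
Proof.
move=> qx0; have [px|xp] := leP p x0.
  exists (fun _ _ => 1); split => //; first by move=> *; exact: trig_cst.
    by move=> *; rewrite ler01 lexx.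
  by move=> x /andP[xx _] _; rewrite (le_lt_trans px xx); exact: cvg_cst.
have [qp|pq] := leP q p.
  exists (fun _ _ => 0); split => //; first by move=> *; exact: trig_cst.
    by move=> *; rewrite ler01 lexx.
  by move=> x /andP[_ xx] _; rewrite ltNge (le_trans (ltW xx) qp); exact: cvg_cst.
have [|m [h [g01 gp]]] := ray_approx (p := p) qx0; first by rewrite xp.
eexists; split; [|exact: g01|exact: gp] => pr prt n.
apply: trig_bdpoly; have := trigD (trig_cst (1 / 2 + h / 4)) (trigZ (- (1 / 4)) (prt m)).
by move=> /trig_eq; apply => x; lra.
Qed.

Let rays : set (set R) := [set A | exists x, A = `]x, +oo[%classic].

Let rays_gen : @measurable _ (measurableTypeR R) = <<s rays >>.
Proof. exact: RGenOInfty.measurableE. Qed.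

Let rays_setI : setI_closed rays.
Proof.
move=> _ _ [x ->] [y ->]; exists (Num.max x y); apply/seteqP; split => z /=;
  rewrite !in_itv/= !andbT gt_max.
  by move=> [-> ->].
by move=> /andP[].
Qed.

Let clo_quadrant p q : clo (\1_(fst @^-1` `]p, +oo[ `&` snd @^-1` `]q, +oo[)).
Proof.
have [g [gt g01 gp]] := ray_or p hab; have [h [ht h01 hq]] := ray_or q hcd.
have gT n := gt fst trig_cos1 n; have hT n := ht snd trig_cos2 n.
apply: (@L2clo_dominated _ _ _ leb2 Om mD (@trig R) L2_trig
  _ (fun n x => g n x.1 * h n x.2) (fun=> 1)).
- apply: measurable_indic_L2 => //; apply: measurableI; rewrite -[X in measurable X]setTI.
    exact: measurable_fst.
  exact: measurable_snd.
- exact: L2_cst.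
- by move=> n; apply: L2cloA => //; [exact: L2_trig|exact: trigM].
- move=> n x _; rewrite normr1 indicE.
  have /andP[? ?] := g01 n x.1; have /andP[? ?] := h01 n x.2.
  have ? : 0 <= g n x.1 * h n x.2 <= 1 by rewrite mulr_ge0//=; nra.
  by rewrite ler_norml; case: (_ \in _) => /=; rewrite ?mulr1n ?mulr0n; lra.
(* Convergence can fail only on the two lines through the corner of the quadrant, a null set. *)
- exists ([set p] `*` setT `|` setT `*` [set q]); split.
  + by apply: measurableU; apply: measurableX.
  + apply: null_set_setU; [by apply: measurableX..| |].
      by rewrite [LHS]product_measure1E//= lebesgue_measure_set1 mul0e.
    by rewrite [LHS]product_measure1E//= lebesgue_measure_set1 mule0.
  + move=> x /= nP; apply: contrapT => /not_orP[/= xp xq].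
    apply: nP => -[/=]; rewrite !in_itv/= => xab xcd.
    have xp' : x.1 != p by apply/eqP => ?; apply: xp.
    have xq' : x.2 != q by apply/eqP => ?; apply: xq.
    have -> : \1_(fst @^-1` `]p, +oo[ `&` snd @^-1` `]q, +oo[) x =
      ((p < x.1)%R%:R * (q < x.2)%R%:R : R).
      rewrite indicE -natrM mulnb; congr (nat_of_bool _)%:R.
      apply/idP/andP => [/set_mem[/=]|[px qx]]; first by rewrite !in_itv/= !andbT.
      by apply/mem_set; split => /=; rewrite in_itv/= andbT.
    by apply: cvgM; [exact: gp|exact: hq].
Qed.

(** Starting from quadrants, Dynkin's argument is used three times: in the first coordinate with the
    second in a ray, in the second coordinate with the first in a Borel set, and finally from
    rectangles to the product sigma-algebra. *)
Lemma trig_dense f : L2 leb2 Om f -> clo f.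
Proof.
have tA := @L2_trig.
have tD : forall f g, trig f -> trig g -> trig (fun x => f x + g x) by exact: trigD.
have tZ : forall r f, trig f -> trig (fun x => r * f x) by exact: trigZ.
have t1 : trig (fun=> 1 : R) by exact: trig_cst.
have m1 (A : set (measurableTypeR R)) : measurable A -> measurable (fst @^-1` A : set (plane R)).
  by move=> mA; rewrite -[X in measurable X]setTI; exact: measurable_fst.
have m2 (A : set (measurableTypeR R)) : measurable A -> measurable (snd @^-1` A : set (plane R)).
  by move=> mA; rewrite -[X in measurable X]setTI; exact: measurable_snd.
have mI (S : set (plane R)) : measurable S -> L2 leb2 Om (\1_S : _ -> R).
  exact: measurable_indic_L2.
have s1 q A : measurable A -> clo (\1_(fst @^-1` A `&` snd @^-1` `]q, +oo[)).
  move=> mA; apply: (L2clo_preimage mD fD tA tD tZ t1 _ _ rays_gen rays_setI _ _ mA).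
  - exact: measurable_fst.
  - by apply: m2; exact: measurable_itv.
  (* On the cell the condition on the first coordinate is void for the ray starting at [a], so this
     quadrant provides the set [B] of the Dynkin argument. *)
  - apply: (L2clo_eq mD fD tA _ _ (clo_quadrant a q)); first by apply: mI; apply: m2; exact: measurable_itv.
    move=> x [/= xab xcd]; rewrite !indicE in_setI [X in X && _]mem_set//=.
    by move: xab; rewrite !in_itv/= andbT => /andP[].
  - by move=> _ [p ->]; exact: clo_quadrant.
have s2 A B : measurable A -> measurable B -> clo (\1_(snd @^-1` B `&` fst @^-1` A)).
  move=> mA mB; apply: (L2clo_preimage mD fD tA tD tZ t1 _ _ rays_gen rays_setI _ _ mB).
  - exact: measurable_snd.
  - exact: m1.
  - apply: (L2clo_eq mD fD tA _ _ (s1 c _ mA)); first by apply: mI; exact: m1.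
    move=> x [/= xab xcd]; rewrite !indicE in_setI [X in _ && X]mem_set//= ?andbT//.
    by move: xcd; rewrite !in_itv/= andbT => /andP[].
  - by move=> _ [p ->]; rewrite setIC; exact: s1.
move=> f2; apply: (L2clo_total mD tA tD tZ t1 _ f2) => S mS.
rewrite -[S]setIT.
apply: (L2clo_preimage mD fD tA tD tZ t1 (phi := id) (B := setT)
  _ _ (@measurable_prod_measurableType _ _ _ _) _ _ _ mS) => //.
- move=> _ _ [A mA [B mB <-]] [A' mA' [B' mB' <-]].
  exists (A `&` A'); first exact: measurableI.
  by exists (B `&` B'); [exact: measurableI|rewrite setXI].
- by rewrite indicT; exact: L2cloA.
- move=> _ [A mA [B mB <-]]; rewrite setIT.
  have := s2 _ _ mA mB; congr (clo (\1_ _)).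
  by apply/seteqP; split => x [].
Qed.

End Cell.

(** * Fourier coefficients and the projection on X_N *)

Section Waves.
Context {R : realType}.
Implicit Types (s th x y : R).

Lemma is_derive_wave s th x : s != 0 ->
  is_derive x 1 (fun x : R => - s^-1 * cos (s * x + th)) (sin (s * x + th)).
Proof.
move=> s0.
have d1 : is_derive x 1 (fun x : R => s * x + th) s.
  by apply: is_derive_eq; rewrite addr0 scaler1 /GRing.scale/=.
have d2 := is_derive1_comp (is_derive_cos _) d1.
apply: (is_derive_eq (is_deriveZ (- s^-1) d2)).
by rewrite /GRing.scale/=; field.
Qed.

Lemma cosD_period y (n : int) : cos (y + n%:~R * (2 * pi)) = cos y :> R.
Proof.
have P (k : nat) (x : R) : cos (x + k%:R * (2 * pi)) = cos x.
  by rewrite !mulr_natl; exact: periodicn (@cosD2pi R) k x.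
case: n => n; first exact: P.
have := P n.+1 (y - n.+1%:R * (2 * pi)); rewrite subrK => ->.
by rewrite NegzE intrN mulNr.
Qed.

Lemma integral_wave (a s : R) th (n : int) : s = n%:~R -> n != 0 ->
  (\int[lebesgue_measure]_(x in `]a, (a + 2 * pi)%R[) (sin (s * x + th))%:E = 0)%E.
Proof.
move=> sn n0; have s0 : s != 0 by rewrite sn intr_eq0.
have csin : continuous (fun x : R => sin (s * x + th)).
  move=> x; apply: (@continuous_comp _ _ _ (fun x => s * x + th) sin).
    by apply: cvgD; [apply: cvgM; [exact: cvg_cst|exact: cvg_id]|exact: cvg_cst].
  exact: continuous_sin.
have dW x := @is_derive_wave s th x s0.
have cW : continuous (fun x : R => - s^-1 * cos (s * x + th)).
  by move=> x; apply: differentiable_continuous; apply/derivable1_diffP/ex_derive.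
rewrite -(@integral_itv_bndoo _ _ _ _ true false); last first.
  apply/measurable_EFinP/measurable_funTS.
  exact: continuous_measurable_fun.
rewrite (@continuous_FTC2 _ _ (fun x : R => - s^-1 * cos (s * x + th))).
- rewrite mulrDr addrAC [in X in cos (_ + X)]sn cosD_period.
  by rewrite -EFinB subrr.
- by rewrite ltrDl mulr_gt0 ?pi_gt0.
- exact: continuous_subspaceT.
- split.
  + by move=> x _; exact: ex_derive.
  + exact/cvg_at_right_filter/cW.
  + exact/cvg_at_left_filter/cW.
- by move=> x _; rewrite derive1E; have [_ ->] := dW x.
Qed.

End Waves.

(** * Scalar products of the waves *)

Section Orthogonality.
Context {R : realType}.
Variables (a b c d : R).
Hypotheses (hab : b = a + 2 * pi) (hcd : d = c + 2 * pi).
Let Om : set (plane R) := `]a, b[ `*` `]c, d[.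
Let mD : measurable Om := measurable_cell a b c d.
Let fD : (leb2 Om < +oo)%E := cell_measure_lty hab hcd.

Lemma tj_shift k (e : bool) (x : plane R) :
  tj (k, e) x = sin (phase k x + (if e then 0 else pi / 2)).
Proof. by rewrite /tj/=; case: e; rewrite ?addr0// sinDpihalf. Qed.

(** The inner integral of Fubini is taken in a coordinate with non-zero frequency. The other
    coordinate is then a mere phase shift, and a cosine is a sine shifted by [pi / 2], so that
    [integral_wave] covers every case. *)
Lemma integral_tj0 k e : k != (0, 0) -> \int[leb2]_(x in Om) tj (k, e) x = 0.
Proof.
move=> k0; rewrite /Rintegral.
have iT : leb2.-integrable Om (EFin \o tj (k, e)).
  exact/(L2_integrable mD fD)/(L2_trig hab hcd)/trig_tj.
have iR : leb2.-integrable setT ((EFin \o tj (k, e)) \_ Om).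
  by have /(integrable_mkcond _ mD).1 := iT.
rewrite integral_mkcond.
have [k1|k1] := eqVneq k.1 0; last first.
  rewrite -[X in fine X]integral21_prod_meas1//.
  rewrite integral0_eq//= => y _; rewrite /fubini_G.
  have [yin|yout] := boolP (y \in `]c, d[%classic); last first.
    rewrite integral0_eq// => x _; rewrite patchE memNset// => -[/= _ ycd].
    by move: yout; rewrite mem_set.
  transitivity (\int[lebesgue_measure]_(x in `]a, b[) (sin (k.1%:~R * x +
      (k.2%:~R * y + (if e then 0 else pi / 2))))%:E)%E; last first.
    by rewrite hab (integral_wave _ _ erefl).
  rewrite [RHS]integral_mkcond; apply: eq_integral => x _; rewrite !patchE.
  have -> : ((x, y) \in Om) = (x \in `]a, b[%classic).
    apply/idP/idP => [/set_mem[/= xab _]|/set_mem xab]; first exact/mem_set.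
    by apply/mem_set; split => //; exact/set_mem.
  by case: ifP => // _; rewrite /= tj_shift /phase/= addrA.
have k2 : k.2 != 0.
  by apply: contraNneq k0 => k2; rewrite [k]surjective_pairing k1 k2.
rewrite -[X in fine X]integral12_prod_meas1//.
rewrite integral0_eq//= => x _; rewrite /fubini_F.
have [xin|xout] := boolP (x \in `]a, b[%classic); last first.
  rewrite integral0_eq// => y _; rewrite patchE memNset// => -[/= xab _].
  by move: xout; rewrite mem_set.
transitivity (\int[lebesgue_measure]_(y in `]c, d[) (sin (k.2%:~R * y +
    (k.1%:~R * x + (if e then 0 else pi / 2))))%:E)%E; last first.
  by rewrite hcd (integral_wave _ _ erefl).
rewrite [RHS]integral_mkcond; apply: eq_integral => y _; rewrite !patchE.
have -> : ((x, y) \in Om) = (y \in `]c, d[%classic).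
  apply/idP/idP => [/set_mem[/= _ ycd]|/set_mem ycd]; first exact/mem_set.
  by apply/mem_set; split => //; exact/set_mem.
by case: ifP => // _; rewrite /= tj_shift /phase/= addrA [X in sin (X + _)]addrC.
Qed.

Lemma integral_tj k e :
  \int[leb2]_(x in Om) tj (k, e) x = (2 * pi) ^+ 2 * ((k == (0, 0)) && ~~ e)%:R.
Proof.
have [->|k0] := eqVneq k (0, 0); last by rewrite integral_tj0// mulr0.
rewrite (@eq_Rintegral _ _ _ _ _ (fun=> (~~ e)%:R)); last first.
  by move=> x _; rewrite /tj/phase/= !mul0r addr0; case: e; rewrite ?sin0 ?cos0.
by rewrite Rintegral_cst// (cell_measure hab hcd)/= mulrC.
Qed.

Local Notation kD k l := (k.1 + l.1, k.2 + l.2).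
Local Notation kB k l := (k.1 - l.1, k.2 - l.2).

(** k and -k give the same wave up to the sign of the sine, hence the second Kronecker symbol; at
    frequency zero it doubles the cosine and cancels the sine. *)
Lemma dot_tj k e l e' : L2dot leb2 Om (tj (k, e)) (tj (l, e')) =
  2 * pi ^+ 2 * ((e == e')%:R *
    ((k == l)%:R + (if e then -1 else 1) * (k == (- l.1, - l.2))%:R)).
Proof.
have iT k' e'' : leb2.-integrable Om (EFin \o tj (k', e'')).
  exact/(L2_integrable mD fD)/(L2_trig hab hcd)/trig_tj.
have iZ r k' e'' : leb2.-integrable Om (EFin \o (fun x => r * tj (k', e'') x)).
  exact/(L2_integrable mD fD)/L2Z/(L2_trig hab hcd)/trig_tj.
have kBE : (kB k l == (0, 0)) = (k == l).
  by rewrite -!pair_eqE /pair_eq/= !subr_eq0.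
have kDE : (kD k l == (0, 0)) = (k == (- l.1, - l.2)).
  by rewrite -!pair_eqE /pair_eq/= !addr_eq0.
have E r r' e1 e2 : (forall x, tj (k, e) x * tj (l, e') x =
   r * tj (kB k l, e1) x + r' * tj (kD k l, e2) x) ->
   L2dot leb2 Om (tj (k, e)) (tj (l, e')) =
   (2 * pi) ^+ 2 * (r * ((k == l) && ~~ e1)%:R + r' * ((k == (- l.1, - l.2)) && ~~ e2)%:R).
  move=> eqt; rewrite /L2dot; under eq_Rintegral do rewrite eqt.
  by rewrite RintegralD// !RintegralZl// !integral_tj kBE kDE; ring.
case: e e' E => -[] E.
- rewrite (E (1/2) (- (1/2)) false false) ?andbT/= => [|x]; first by field.
  by rewrite /tj/= phaseB phaseD cosB cosD; field.
- rewrite (E (1/2) (1/2) true true) ?andbF/= => [|x]; first by rewrite !mul0r !mulr0 addr0 mulr0.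
  by rewrite /tj/= phaseB phaseD sinB sinD; field.
- rewrite (E (- (1/2)) (1/2) true true) ?andbF/= => [|x]; first by rewrite !mul0r !mulr0 addr0 mulr0.
  by rewrite /tj/= phaseB phaseD sinB sinD; field.
- rewrite (E (1/2) (1/2) false false) ?andbT/= => [|x]; first by field.
  by rewrite /tj/= phaseB phaseD cosB cosD; field.
Qed.

End Orthogonality.

Notation index := ((int * int) * bool)%type.
Notation opk k := (- k.1, - k.2).

(** * The box of frequencies *)

Section Modes.
Context {R : realType}.
Implicit Types (k l : int * int) (N : nat).

Lemma opkK k : opk (opk k) = k.
Proof. by rewrite /= !opprK -surjective_pairing. Qed.

Lemma finite_modes N : finite_set (@modes R N).
Proof.
pose s := [seq (p, q) | p <- [seq (i%:Z - N%:Z)%R | i <- iota 0 (N + N).+1],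
                        q <- [seq (i%:Z - N%:Z)%R | i <- iota 0 (N + N).+1]].
apply: (@sub_finite_set _ _ [set k | k \in s]); last exact: finite_seq.
have H (p : int) : - (N%:R / 2) <= (p%:~R : R) <= N%:R / 2 - 1 ->
    p \in [seq (i%:Z - N%:Z)%R | i <- iota 0 (N + N).+1].
  move=> /andP[p1 p2]; have N0 : 0 <= N%:R :> R by [].
  have p1' : - N%:Z <= p by rewrite -(ler_int R) intrN; lra.
  have p2' : p <= N%:Z by rewrite -(ler_int R); lra.
  apply/mapP; exists `|(p + N%:Z)%R|%N; last by lia.
  by rewrite mem_iota /= add0n; lia.
move=> [p q] [/= /H pm /H qm]; apply/allpairsP; exists (p, q); split => //.
Qed.

Definition mseq N : seq (int * int) := fset_set (@modes R N).

(* The box of modes is not symmetric (for even N it contains -N/2 but not N/2): a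
   real function of X_N only involves the modes whose opposite is also a mode. *)
Definition sseq N : seq (int * int) := [seq k <- mseq N | opk k \in mseq N].

Definition J N : seq index := [seq (k, e) | k <- sseq N, e <- [:: false; true]].

Lemma mem_mseq N k : (k \in mseq N) = (k \in @modes R N).
Proof. by rewrite /mseq in_fset_set//; exact: finite_modes. Qed.

Lemma uniq_mseq N : uniq (mseq N). Proof. exact: fset_uniq. Qed.

Lemma uniq_sseq N : uniq (sseq N).
Proof. by rewrite filter_uniq// uniq_mseq. Qed.

Lemma mem_sseq N k : (k \in sseq N) = (opk k \in mseq N) && (k \in mseq N).
Proof. by rewrite mem_filter. Qed.

Lemma sseq_opk N k : (opk k \in sseq N) = (k \in sseq N).
Proof. by rewrite !mem_sseq opkK andbC. Qed.

Lemma mem_J N j : (j \in J N) = (j.1 \in sseq N).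
Proof.
apply/allpairsP/idP => [[[k e] [/= kN _ ->]]//|jN].
by exists (j.1, j.2); split => //=; [case: j.2|rewrite -surjective_pairing].
Qed.

Lemma uniq_J N : uniq (J N).
Proof.
by apply: allpairs_uniq => [|//|[? ?] [? ?] _ _ [-> ->]//]; exact: uniq_sseq.
Qed.

Lemma big_J (V : nmodType) N (F : index -> V) :
  \sum_(j <- J N) F j = \sum_(k <- sseq N) (F (k, false) + F (k, true)).
Proof.
rewrite big_allpairs_dep/=; apply: eq_bigr => k _.
by rewrite big_cons big_seq1.
Qed.

Lemma sseqP N k : (k \in sseq N) = (`|k.1%:~R| <= N%:R / 2 - 1 :> R) &&
  (`|k.2%:~R| <= N%:R / 2 - 1 :> R).
Proof.
rewrite mem_sseq !mem_mseq; apply/andP/andP => [[]|[]].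
  move=> /set_mem[/=]; rewrite !intrN => h1 h2 /set_mem[h3 h4].
  by rewrite !ler_norml; lra.
rewrite !ler_norml => h1 h2; split; apply/mem_set; split; rewrite /= ?intrN; lra.
Qed.

Lemma sseq_sub N N' k : (N <= N')%N -> k \in sseq N -> k \in sseq N'.
Proof.
rewrite !sseqP -(ler_nat R) => NN' /andP[h1 h2].
by apply/andP; split; lra.
Qed.

Lemma sseq_ex k : exists N0, forall N, (N0 <= N)%N -> k \in sseq N.
Proof.
exists (2 * (`|k.1| + `|k.2| + 1))%N => N; rewrite -(ler_nat R) sseqP natrM !natrD.
rewrite -!intr_norm -!abszE !pmulrn -!pmulrn.
have : 0 <= `|k.1|%N%:R :> R by []. have : 0 <= `|k.2|%N%:R :> R by [].
by move=> *; apply/andP; split; lra.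
Qed.

Lemma sumr_delta (s : seq (int * int)) l (F : int * int -> R) : uniq s ->
  \sum_(k <- s) F k * (k == l)%:R = (l \in s)%:R * F l.
Proof.
move=> us; have [ls|ls] := boolP (l \in s).
  rewrite (bigD1_seq l)//= eqxx mulr1 big1 ?addr0 ?mul1r// => k kl.
  by rewrite (negbTE kl) mulr0.
rewrite mul0r big_seq big1// => k ks; have [kl|] := eqVneq k l; last by rewrite mulr0.
by move: ls; rewrite -kl ks.
Qed.

(** Off the box one component exceeds N / 2 - 1, and 1 + (N / 2 - 1)^2 - N^2 / 8 = (N - 4)^2 / 8 +
    N^2 / 8 - (N^2 / 8) >= 0. The case N = 1 is apart because N / 2 - 1 is negative there. *)
Lemma modes_off_box N k : (0 < N)%N -> k \notin sseq N ->
  N%:R ^+ 2 / 8 <= 1 + freq2 k :> R.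
Proof.
move=> N0; rewrite sseqP negb_and -!ltNge.
have -> : freq2 k = `|k.1%:~R| ^+ 2 + `|k.2%:~R| ^+ 2 :> R.
  by rewrite /freq2 intrD !rmorphXn/= !real_normK ?num_real.
have [->|N1] := eqVneq N 1%N.
  move=> _; have := sqr_ge0 `|k.1%:~R : R|; have := sqr_ge0 `|k.2%:~R : R|; lra.
have N2 : 2 <= N%:R :> R by rewrite (ler_nat R 2); case: N N0 N1 => [|[]].
have := sqr_ge0 (N%:R - 4 : R); have n1 := normr_ge0 (k.1%:~R : R).
have n2 := normr_ge0 (k.2%:~R : R).
by rewrite !expr2 => ? /orP[] ?; nra.
Qed.

End Modes.

Arguments J : clear implicits.
Arguments sseq : clear implicits.
Arguments mseq : clear implicits.

Section Hat.
Context {R : realType}.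
Variable Om : set (plane R).

(* Each wave occurs twice in [J N], for k and for -k; with this redundancy the
   factor [(2 * pi)^-1] turns the family into a Parseval frame of X_N. *)
Definition fhat (f : plane R -> R) (j : index) : R :=
  (2 * pi)^-1 * L2dot leb2 Om f (tj j).

Definition projN N (f : plane R -> R) (x : plane R) : R :=
  (2 * pi)^-1 * \sum_(j <- J R N) fhat f j * tj j x.

End Hat.

(** * Parseval frame, Bessel and Parseval relations *)

Section Projection.
Context {R : realType}.
Variables (a b c d : R).
Hypotheses (hab : b = a + 2 * pi) (hcd : d = c + 2 * pi).
Let Om : set (plane R) := `]a, b[ `*` `]c, d[.
Let mD : measurable Om := measurable_cell a b c d.
Let fD : (leb2 Om < +oo)%E := cell_measure_lty hab hcd.
Implicit Types (f g : plane R -> R) (N : nat).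
Local Notation L2 := (L2 leb2 Om).
Local Notation dot := (L2dot leb2 Om).
Local Notation nrm := (L2nrm leb2 Om).
Local Notation hat := (fhat Om).
Local Notation PN := (projN Om).
Local Notation J := (J R).

Let pi0 : 0 < 2 * pi :> R. Proof. by rewrite mulr_gt0 ?pi_gt0. Qed.
Let pine : pi != 0 :> R. Proof. by rewrite gt_eqF ?pi_gt0. Qed.
Let pin0 : 2 * pi != 0 :> R. Proof. by rewrite gt_eqF. Qed.

Lemma L2_tj j : L2 (tj j).
Proof. exact/(L2_trig hab hcd)/trig_tj. Qed.

Lemma dot_tjE f j : dot f (tj j) = 2 * pi * hat f j.
Proof. by rewrite /hat mulrA divff ?mul1r. Qed.

Lemma hatD f g j : L2 f -> L2 g -> hat (fun x => f x + g x) j = hat f j + hat g j.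
Proof. by move=> f2 g2; rewrite /hat dotDl ?mulrDr//; exact: L2_tj. Qed.

Lemma hatB f g j : L2 f -> L2 g -> hat (fun x => f x - g x) j = hat f j - hat g j.
Proof. by move=> f2 g2; rewrite /hat dotBl ?mulrBr//; exact: L2_tj. Qed.

Lemma hatZ r f j : L2 f -> hat (fun x => r * f x) j = r * hat f j.
Proof. by move=> f2; rewrite /hat dotZl//; [ring|exact: L2_tj]. Qed.

Lemma hat_ae_eq f g j : L2 f -> L2 g ->
  {ae leb2, forall x, Om x -> f x = g x} -> hat f j = hat g j.
Proof.
by move=> f2 g2 fg; rewrite /hat (dot_ae_eq mD f2 g2 (L2_tj j) fg).
Qed.

Lemma tj_opk k e (x : plane R) : tj (opk k, e) x = (if e then -1 else 1) * tj (k, e) x.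
Proof. by rewrite /tj/= phaseN; case: e; rewrite ?sinN ?cosN ?mulN1r ?mul1r. Qed.

Lemma hat_opk f k e : L2 f -> hat f (opk k, e) = (if e then -1 else 1) * hat f (k, e).
Proof.
move=> f2; rewrite /hat (funext (tj_opk k e)) dotZr//; first by rewrite mulrCA.
exact: L2_tj.
Qed.

Lemma L2_PN N f : L2 (PN N f).
Proof.
have F2 j : L2 (fun x => hat f j * tj j x) by apply: L2Z => //; exact: L2_tj.
by apply: L2Z => //; exact: (L2_sum mD fD (J N) F2).
Qed.

Lemma dot_PNl N f g : L2 g -> dot (PN N f) g = \sum_(j <- J N) hat f j * hat g j.
Proof.
move=> g2; have Z2 j : L2 (fun x => hat f j * tj j x) by apply: L2Z => //; exact: L2_tj.
rewrite dotZl//; last exact: L2_sum.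
rewrite (dot_suml mD fD (J N) Z2 g2) mulr_sumr; apply: eq_bigr => j _.
by rewrite dotZl//; [rewrite (dotC _ _ (tj j)) dot_tjE mulrCA mulKf|exact: L2_tj].
Qed.

Lemma hat_tj l e j : hat (tj (l, e)) j = pi * ((j.2 == e)%:R *
    ((j.1 == l)%:R + (if e then -1 else 1) * (j.1 == opk l)%:R)).
Proof.
case: j => k e'; rewrite /hat dotC (dot_tj hab hcd) /=.
have [<-|ee] := eqVneq e' e; [|by rewrite !mul0r !mulr0].
by move: pine; generalize (pi : R) => p p0; field.
Qed.

(** The two Kronecker terms of [hat_tj] contribute equally, because the coefficients of [f] have the
    parity of the waves, and their common factor cancels the normalisation. *)
Lemma hat_PN N f j : L2 f -> hat (PN N f) j = (j.1 \in sseq R N)%:R * hat f j.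
Proof.
move=> f2; case: j => l e; rewrite {1}/hat dot_PNl; last exact: L2_tj.
rewrite big_J; have -> : \sum_(k <- sseq R N) (hat f (k, false) * hat (tj (l, e)) (k, false) +
    hat f (k, true) * hat (tj (l, e)) (k, true)) =
    pi * (\sum_(k <- sseq R N) hat f (k, e) * (k == l)%:R +
    (if e then -1 else 1) * \sum_(k <- sseq R N) hat f (k, e) * (k == opk l)%:R).
  rewrite mulr_sumr -big_split mulr_sumr; apply: eq_bigr => k _.
  by rewrite !hat_tj/=; case: e => /=; ring.
rewrite !sumr_delta ?uniq_sseq// sseq_opk hat_opk//=.
by move: pine; generalize (pi : R) => p p0; case: e; field.
Qed.

Lemma dot_PN N f : L2 f -> dot (PN N f) (PN N f) = \sum_(j <- J N) hat f j ^+ 2.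
Proof.
move=> f2; rewrite dot_PNl; last exact: L2_PN.
rewrite big_seq [RHS]big_seq; apply: eq_bigr => j jN.
by rewrite hat_PN//; move: jN; rewrite mem_J => ->; rewrite mul1r expr2.
Qed.

Lemma sqr_nrm_subPN N f : L2 f ->
  nrm (fun x => f x - PN N f x) ^+ 2 = nrm f ^+ 2 - \sum_(j <- J N) hat f j ^+ 2.
Proof.
move=> f2; have p2 := L2_PN N f; rewrite !sqr_nrm dotBl ?dotBr//; [|exact: L2B..].
rewrite dot_PN// [dot f (PN _ _)]dotC dot_PNl//.
by under eq_bigr do rewrite -expr2; ring.
Qed.

Lemma bessel N f : L2 f -> \sum_(j <- J N) hat f j ^+ 2 <= nrm f ^+ 2.
Proof. by move=> f2; rewrite -subr_ge0 -sqr_nrm_subPN// sqr_ge0. Qed.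

Lemma nrm_subPN_le N f : L2 f -> nrm (fun x => f x - PN N f x) <= nrm f.
Proof.
move=> f2; rewrite -(ler_pXn2r (n := 2)) ?nnegrE ?nrm_ge0//.
by rewrite sqr_nrm_subPN// gerBl sumr_ge0// => j _; exact: sqr_ge0.
Qed.

Lemma PN_tj N k e x : k \in sseq R N -> PN N (tj (k, e)) x = tj (k, e) x.
Proof.
move=> kN; rewrite /projN big_J.
have -> : \sum_(l <- sseq R N) (hat (tj (k, e)) (l, false) * tj (l, false) x +
    hat (tj (k, e)) (l, true) * tj (l, true) x) =
    pi * (\sum_(l <- sseq R N) tj (l, e) x * (l == k)%:R +
    (if e then -1 else 1) * \sum_(l <- sseq R N) tj (l, e) x * (l == opk k)%:R).
  rewrite mulr_sumr -big_split mulr_sumr; apply: eq_bigr => l _.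
  by rewrite !hat_tj/=; case: e => /=; ring.
rewrite !(sumr_delta _ (fun l => tj (l, e) x)) ?uniq_sseq// sseq_opk kN tj_opk /=.
by move: pine; generalize (pi : R) => p p0; case: e; field.
Qed.

Lemma PN_trig f : trig f -> exists N0, forall N, (N0 <= N)%N -> PN N f = f.
Proof.
elim=> {f}[[k e]|f g f2 [Nf Pf] g2 [Ng Pg]|r f f2 [N0 Pf]].
- have [N0 N0k] := @sseq_ex R k.
  by exists N0 => N NN; apply/funext => x; exact/PN_tj/N0k.
- exists (maxn Nf Ng) => N; rewrite geq_max => /andP[/Pf PfN /Pg PgN].
  apply/funext => x; transitivity (PN N f x + PN N g x); last by rewrite PfN PgN.
  rewrite /projN -mulrDr -big_split/=; congr (_ * _).
  apply: eq_bigr => j _; rewrite hatD ?mulrDl//; exact: (L2_trig hab hcd).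
- exists N0 => N /Pf PfN; apply/funext => x.
  transitivity (r * PN N f x); last by rewrite PfN.
  rewrite /projN [RHS]mulrCA [in RHS]mulr_sumr; congr (_ * _); apply: eq_bigr => j _; rewrite hatZ ?mulrA//; exact: (L2_trig hab hcd).
Qed.

(** For a trigonometric polynomial [g] close to [f] and reproduced by the projection, [f - PN N f]
    equals [(f - g) - PN N (f - g)], whose norm is at most that of [f - g]. *)
Lemma PN_cvg f e : L2 f -> 0 < e ->
  exists N0, forall N, (N0 <= N)%N -> nrm (fun x => f x - PN N f x) < e.
Proof.
move=> f2 e0; have [_ /(_ e e0)[g [tg fg]]] := trig_dense hab hcd f2.
have g2 := L2_trig hab hcd tg.
have [N0 Pg] := PN_trig tg; exists N0 => N /Pg PgN.
apply: le_lt_trans fg; apply: le_trans (nrm_subPN_le N (L2B mD f2 g2)).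
rewrite le_eqVlt; apply/orP; left; apply/eqP; congr L2nrm; apply/funext => x.
have -> : PN N (fun x => f x - g x) x = PN N f x - g x; last by ring.
transitivity (PN N f x - PN N g x); last by rewrite PgN.
rewrite /projN -mulrBr -sumrB; congr (_ * _); apply: eq_bigr => j _.
by rewrite hatB// mulrBl.
Qed.

(** The half of Parseval's identity that needs completeness: bounds on finite families of
    coefficients pass to the norm. *)
Lemma nrm_sqr_le f r : L2 f -> (forall N, \sum_(j <- J N) hat f j ^+ 2 <= r) ->
  nrm f ^+ 2 <= r.
Proof.
move=> f2 fr; apply/ler_addgt0Pr => e e0.
have se0 : 0 < Num.sqrt e by rewrite sqrtr_gt0.
have [N /(_ N (leqnn N))fN] := PN_cvg f2 se0.
have := fr N; have := sqr_nrm_subPN N f2.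
have : nrm (fun x => f x - PN N f x) ^+ 2 < e.
  rewrite -[ltRHS](sqr_sqrtr (ltW e0)).
  by rewrite ltr_pXn2r ?nnegrE ?nrm_ge0// sqrtr_ge0.
lra.
Qed.

End Projection.

(** * Functions of X_N and their real coefficients *)

Section TrigSpace.
Context {R : realType}.
Variables (a b c d : R).
Hypotheses (hab : b = a + 2 * pi) (hcd : d = c + 2 * pi).
Let Om : set (plane R) := `]a, b[ `*` `]c, d[.
Let mD : measurable Om := measurable_cell a b c d.
Let fD : (leb2 Om < +oo)%E := cell_measure_lty hab hcd.
Implicit Types (f g : plane R -> R) (N : nat).
Local Notation L2 := (L2 leb2 Om).
Local Notation dot := (L2dot leb2 Om).
Local Notation nrm := (L2nrm leb2 Om).
Local Notation hat := (fhat Om).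
Local Notation PN := (projN Om).
Local Notation J := (J R).

Let pine : pi != 0 :> R. Proof. by rewrite gt_eqF ?pi_gt0. Qed.
Let pi0 : 0 < 2 * pi :> R. Proof. by rewrite mulr_gt0 ?pi_gt0. Qed.
Let pin0 : 2 * pi != 0 :> R. Proof. by rewrite gt_eqF. Qed.

Lemma XN_D N f g : XN N f -> XN N g -> XN N (fun x => f x + g x).
Proof.
move=> [cf Ef] [cg Eg]; exists (fun k => cf k + cg k) => x.
rewrite rmorphD/= Ef Eg !(fsbig_finite _ _ (finite_modes N)) -big_split.
by apply: eq_bigr => k _; rewrite mulrDl.
Qed.

Lemma XN_Z N r f : XN N f -> XN N (fun x => r * f x).
Proof.
move=> [cf Ef]; exists (fun k => (r%:C)%C * cf k) => x.
rewrite rmorphM/= Ef !(fsbig_finite _ _ (finite_modes N)) mulr_sumr.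
by apply: eq_bigr => k _; rewrite mulrA.
Qed.

Let Re_sum (I : Type) (s : seq I) (F : I -> R[i]) :
  complex.Re (\sum_(i <- s) F i) = \sum_(i <- s) complex.Re (F i).
Proof. by apply: (big_morph (@complex.Re R)) => // -[x1 y1] [x2 y2]. Qed.

Let Im_sum (I : Type) (s : seq I) (F : I -> R[i]) :
  complex.Im (\sum_(i <- s) F i) = \sum_(i <- s) complex.Im (F i).
Proof. by apply: (big_morph (@complex.Im R)) => // -[x1 y1] [x2 y2]. Qed.

Lemma XN_tj N j : j \in J N -> @XN R N (tj j).
Proof.
case: j => k e; rewrite mem_J/= => kN.
have kM : k \in mseq R N by move: kN; rewrite mem_sseq => /andP[].
have kM' : opk k \in mseq R N by move: kN; rewrite mem_sseq => /andP[].
(* Euler's formulas: [u] and [v] are the coefficients of the wave on exp(i theta) and exp(-i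
   theta). *)
pose u : R[i] := if e then (0 -i* (1/2))%C else ((1/2) +i* 0)%C.
pose v : R[i] := if e then (0 +i* (1/2))%C else ((1/2) +i* 0)%C.
exists (fun l => u * (l == k)%:R + v * (l == opk k)%:R) => x.
rewrite (fsbig_finite _ _ (finite_modes N)) -/(mseq R N).
have -> : \sum_(l <- mseq R N) (u * (l == k)%:R + v * (l == opk k)%:R) *
    cexpi (phase l x) = u * (\sum_(l <- mseq R N) cexpi (phase l x) * (l == k)%:R) +
    v * (\sum_(l <- mseq R N) cexpi (phase l x) * (l == opk k)%:R).
  by rewrite 2!mulr_sumr -big_split/=; apply: eq_bigr => l _; ring.
have delta (G : int * int -> R[i]) l : l \in mseq R N ->
    \sum_(i <- mseq R N) G i * (i == l)%:R = G l.
  move=> ls; rewrite (bigD1_seq l)//= ?uniq_mseq// eqxx mulr1 big1 ?addr0// => i il.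
  by rewrite (negbTE il) mulr0.
rewrite !delta// phaseN /cexpi cosN sinN /u /v /tj/= {u v}.
by case: e; apply/eqP; rewrite eq_complex/=; apply/andP; split; apply/eqP;
  rewrite ?mul0r ?mulr0 ?sub0r ?add0r ?subr0 ?addr0; field.
Qed.

(* A real function in the span of the modes has Hermitian coefficients, so only
   the modes k with both k and -k allowed occur. *)
Lemma XN_projN N g : XN N g -> PN N g = g.
Proof.
move=> [cg Eg]; pose p k : R := (k \in mseq R N)%:R * complex.Re (cg k).
pose q k : R := (k \in mseq R N)%:R * complex.Im (cg k).
have gRe x : g x = \sum_(k <- mseq R N) (p k * tj (k, false) x - q k * tj (k, true) x).
  have := congr1 (@complex.Re R) (Eg x); rewrite (fsbig_finite _ _ (finite_modes N)).
  rewrite -/(mseq R N) Re_sum -[complex.Re (g x)%:C%C]/(g x) big_seq => ->; rewrite [RHS]big_seq; apply: eq_bigr => k kM.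
  by rewrite /p /q /tj kM !mul1r; case: (cg k).
(* The imaginary part of the expansion is a second real expansion, of the zero function. Reading off
   its coefficients yields the Hermitian symmetry [pE], [qE]. *)
have gIm x : 0 = \sum_(k <- mseq R N) (q k * tj (k, false) x + p k * tj (k, true) x).
  have := congr1 (@complex.Im R) (Eg x); rewrite (fsbig_finite _ _ (finite_modes N)).
  rewrite -/(mseq R N) Im_sum -[complex.Im (g x)%:C%C]/0 => H0; rewrite [LHS]H0 big_seq [RHS]big_seq; apply: eq_bigr => k kM.
  by rewrite /p /q /tj kM !mul1r; case: (cg k) => /= *; rewrite addrC.
have H (r s : int * int -> R) h :
    (forall k, r k = (k \in mseq R N)%:R * r k) -> (forall k, s k = (k \in mseq R N)%:R * s k) ->
    (forall x, h x = \sum_(k <- mseq R N) (r k * tj (k, false) x + s k * tj (k, true) x)) ->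
    forall l, hat h (l, false) = pi * (r l + r (opk l)) /\
              hat h (l, true) = pi * (s l - s (opk l)).
  move=> rM sM hE l.
  have -> : h = fun x => \sum_(k <- mseq R N) (r k * tj (k, false) x + s k * tj (k, true) x).
    exact/funext.
  have t2 j : L2 (tj j) by exact: L2_tj.
  have F2 k : L2 (fun x => r k * tj (k, false) x + s k * tj (k, true) x).
    by apply: (L2D mD); exact: L2Z.
  have E e : hat (fun x => \sum_(k <- mseq R N) (r k * tj (k, false) x + s k * tj (k, true) x))
      (l, e) = \sum_(k <- mseq R N) (r k * hat (tj (k, false)) (l, e) +
        s k * hat (tj (k, true)) (l, e)).
    rewrite /fhat (dot_suml mD fD (mseq R N) F2 (t2 _)) mulr_sumr.
    apply: eq_bigr => k _; rewrite dotDl ?dotZl//; [|exact: L2Z..]; ring.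
  have D (w : int * int -> R) : (forall k, w k = (k \in mseq R N)%:R * w k) ->
      forall k', \sum_(k <- mseq R N) w k * (k' == k)%:R = w k'.
    move=> wM k'; under eq_bigr do rewrite eq_sym.
    by rewrite sumr_delta ?uniq_mseq// -wM.
  rewrite !E; split.
    transitivity (pi * (\sum_(k <- mseq R N) r k * (l == k)%:R +
        \sum_(k <- mseq R N) r k * (opk l == k)%:R)); last by rewrite !D.
    rewrite -big_split mulr_sumr; apply: eq_bigr => k _; rewrite !hat_tj//=.
    have -> : (l == opk k) = (opk l == k) by apply/eqP/eqP => [->|<-]; rewrite opkK.
    ring.
  transitivity (pi * (\sum_(k <- mseq R N) s k * (l == k)%:R -
      \sum_(k <- mseq R N) s k * (opk l == k)%:R)); last by rewrite !D.
  rewrite -sumrB mulr_sumr; apply: eq_bigr => k _; rewrite !hat_tj//=.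
  have -> : (l == opk k) = (opk l == k) by apply/eqP/eqP => [->|<-]; rewrite opkK.
  ring.
have idem k (z : R) : (k \in mseq R N)%:R * z = (k \in mseq R N)%:R * ((k \in mseq R N)%:R * z).
  by case: (_ \in _); rewrite ?mul1r ?mul0r.
have hg l : hat g (l, false) = pi * (p l + p (opk l)) /\
            hat g (l, true) = pi * (- q l - - q (opk l)).
  apply: (H p (fun k => - q k)); first by move=> k; rewrite /p -idem.
    by move=> k; rewrite mulrN /q -idem.
  by move=> x; rewrite gRe; apply: eq_bigr => k _; rewrite mulNr.
have h0 l : 0 = pi * (q l + q (opk l)) /\ 0 = pi * (p l - p (opk l)).
  have Z j : hat (fun=> 0) j = 0.
    rewrite /fhat dotC /L2dot; under eq_Rintegral do rewrite mulr0.
    by rewrite Rintegral_cst// mul0r mulr0.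
  rewrite -[in X in X /\ _](Z (l, false)) -[in X in _ /\ X](Z (l, true)).
  apply: (H q p); first by move=> k; rewrite /q -idem.
    by move=> k; rewrite /p -idem.
  exact: gIm.
have pE l : p (opk l) = p l.
  by have [_ /esym/eqP] := h0 l; rewrite mulf_eq0 (negbTE pine) subr_eq0 => /eqP.
have qE l : q (opk l) = - q l.
  have [/esym/eqP + _] := h0 l; rewrite mulf_eq0 (negbTE pine) addrC addr_eq0 => /eqP //.
have hgF l : hat g (l, false) = 2 * pi * p l by rewrite (hg l).1 pE; ring.
have hgT l : hat g (l, true) = - (2 * pi * q l) by rewrite (hg l).2 qE; ring.
apply/funext => x; rewrite gRe /projN big_J mulr_sumr big_filter.
rewrite [RHS](bigID (fun k => opk k \in mseq R N))/= [X in _ = _ + X]big1 ?addr0.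
  apply: eq_bigr => k _; rewrite hgF hgT.
  by move: pine; generalize (pi : R) => r r0; field.
(* A mode whose opposite is outside the box: by symmetry its coefficient equals, up to conjugation,
   one that is zero by definition. *)
move=> k kM; have p0 : p k = 0 by rewrite -pE /p (negbTE kM) mul0r.
have q0 : q k = 0 by apply/eqP; rewrite -oppr_eq0 -qE /q (negbTE kM) mul0r.
by rewrite p0 q0 !mul0r subr0.
Qed.

Lemma XN_L2 N g : XN N g -> L2 g.
Proof. by move=> /XN_projN <-; exact: L2_PN. Qed.

Lemma dot_XN N f g : L2 f -> XN N g -> dot f g = \sum_(j <- J N) hat f j * hat g j.
Proof.
move=> f2 gN; rewrite -{1}(XN_projN gN) dotC dot_PNl//.
by apply: eq_bigr => j _; rewrite mulrC.
Qed.

Lemma hat_XN_out N g j : XN N g -> j \notin J N -> hat g j = 0.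
Proof.
move=> gN jN; rewrite -(XN_projN gN) hat_PN//; last exact: XN_L2 gN.
by move: jN; rewrite mem_J => /negbTE ->; rewrite mul0r.
Qed.

Lemma projN_le N f (x : plane R) : `|PN N f x| <= \sum_(j <- J N) `|hat f j|.
Proof.
rewrite /projN normrM gtr0_norm ?invr_gt0//.
have pi1 : (2 * pi)^-1 <= 1 :> R by rewrite invf_le1//; have := pi_ge2 R; lra.
apply: (@le_trans _ _ (1 * \sum_(j <- J N) `|hat f j|)); last by rewrite mul1r.
apply: ler_pM => //; first by rewrite invr_ge0 ltW.
apply: le_trans (ler_norm_sum _ _ _) _; apply: ler_sum => j _.
by rewrite normrM ler_piMr// tj_le1.
Qed.

Lemma XN_le N g (x : plane R) : XN N g -> `|g x| <= \sum_(j <- J N) `|hat g j|.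
Proof. by move=> gN; rewrite -{1}(XN_projN gN); exact: projN_le. Qed.

Lemma XN_measurable N g : XN N g -> measurable_fun Om g.
Proof. by move=> /XN_L2[]. Qed.

End TrigSpace.

Lemma sumr_subseq (T : eqType) (V : zmodType) (s s' : seq T) (F : T -> V) :
  uniq s -> uniq s' -> {subset s <= s'} ->
  \sum_(i <- s') F i = \sum_(i <- s) F i + \sum_(i <- s' | i \notin s) F i.
Proof.
move=> us us' ss'; rewrite (bigID (fun i => i \in s))/=; congr (_ + _).
rewrite -big_filter; apply: perm_big; apply: uniq_perm => //; first exact: filter_uniq.
by move=> i; rewrite mem_filter andb_idr// => /ss'.
Qed.

(** * Sobolev weights *)

Section Summability.
Context {R : realType}.
Implicit Types (p q al : R).

Lemma freq2_ge0 k : 0 <= freq2 k :> R.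
Proof. by rewrite /freq2 ler0z addr_ge0// sqr_ge0. Qed.

(** Plays the role of a comparison with the integral of x^(-q-1). It follows from [1 + x <= exp x]
    and [ln (1 + x) <= x]. *)
Lemma powR_telescope q (n : nat) : 0 < q -> (0 < n)%N ->
  q * n.+1%:R `^ (- q - 1) <= n%:R `^ (- q) - n.+1%:R `^ (- q).
Proof.
move=> q0 n0; have n0' : 0 < n%:R :> R by rewrite ltr0n.
have n1 : n.+1%:R != 0 :> R by rewrite pnatr_eq0.
have -> : n.+1%:R `^ (- q - 1) = n.+1%:R `^ (- q) * n.+1%:R^-1.
  by rewrite powRD ?n1 ?implybT// powR_inv1.
have -> : n%:R `^ (- q) = n.+1%:R `^ (- q) * (n%:R / n.+1%:R) `^ (- q).
  by rewrite -powRM ?divr_ge0 ?ler0n// mulrC divfK.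
set w := n.+1%:R `^ (- q); have w0 : 0 <= w by exact: powR_ge0.
suff : 1 + q / n.+1%:R <= (n%:R / n.+1%:R) `^ (- q).
  move=> /(ler_wpM2l w0); set v := n.+1%:R^-1; set y := _ `^ _.
  by rewrite mulrDr mulr1 mulrCA (mulrC w y); lra.
have x0 : 0 < n%:R / n.+1%:R :> R by rewrite divr_gt0.
have lnx : ln (n%:R / n.+1%:R) <= - n.+1%:R^-1 :> R.
  have E : 1 + - n.+1%:R^-1 = n%:R / n.+1%:R :> R.
    by rewrite -[in LHS](divff n1) -natr1; field; rewrite natr1.
  rewrite -E; apply: le_ln1Dx; rewrite ltrN2 invf_lt1 ?ltr0n// ltr1n ltnS//.
rewrite /powR gt_eqF//; apply: le_trans (expR_ge1Dx _); rewrite lerD2l.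
by rewrite mulNr -mulrN ler_wpM2l ?(ltW q0)// lerNr.
Qed.

Definition wsum (p : R) (n : nat) : R := \sum_(0 <= i < n.+1) (1 + i%:R ^+ 2) `^ (- p).

Lemma powR_ge1 (x p : R) : 1 <= x -> 0 <= p -> 1 <= x `^ p.
Proof. by move=> x1 p0; rewrite -(powRr0 x) ler_powR. Qed.

(** The terms of index 0 and 1 are at most 1 each, and the remaining ones telescope to at most 1 /
    q. *)
Lemma wsum_le q (n : nat) : 0 < q ->
  wsum ((q + 1) / 2) n <= 2 + q^-1.
Proof.
move=> q0; set p := (q + 1) / 2; have p0 : 0 < p by rewrite /p; lra.
have le1 (x : R) : 1 <= x -> x `^ (- p) <= 1.
  by move=> x1; rewrite powRN invf_le1 ?powR_ge1 ?powR_gt0 ?(ltW p0)//; lra.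
have H m : wsum p m.+1 <= 2 + q^-1 * (1 - m.+1%:R `^ (- q)).
  elim: m => [|m IH].
    rewrite /wsum !big_nat_recr//= big_nil add0r powR1.
    have := @le1 (1 + 0%:R ^+ 2); have := @le1 (1 + 1 ^+ 2); rewrite subrr mulr0 addr0.
    by rewrite !expr2 mulr1 mulr0; lra.
  rewrite /wsum big_nat_recr//= -/(wsum p m.+1).
  apply: le_trans (lerD IH (lexx _)) _.
  suff : (1 + m.+2%:R ^+ 2) `^ (- p) <= q^-1 * (m.+1%:R `^ (- q) - m.+2%:R `^ (- q)).
    by lra.
  rewrite mulrC ler_pdivlMr// mulrC; apply: le_trans (powR_telescope q0 _) => //.
  rewrite ler_wpM2l ?(ltW q0)//.
  have -> : - q - 1 = 2 * - p by rewrite /p; lra.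
  have m1 : 0 < m.+2%:R ^+ 2 :> R by rewrite exprn_gt0// ltr0n.
  have m2 : m.+2%:R ^+ 2 <= 1 + m.+2%:R ^+ 2 :> R by rewrite lerDr.
  have m3 := lt_le_trans m1 m2.
  rewrite powRrM powR_mulrn// !powRN lef_pV2 ?posrE ?powR_gt0//.
  by apply: ge0_ler_powR => //; rewrite ?nnegrE; apply/ltW.
have qV : 0 < q^-1 by rewrite invr_gt0.
case: n => [|n].
  rewrite /wsum big_nat1; have := @le1 (1 + 0%:R ^+ 2); rewrite expr2 mulr0; lra.
apply: le_trans (H n) _; rewrite lerD2l; have := powR_ge0 n.+1%:R (- q); nra.
Qed.

Definition intrange (M : nat) : seq int :=
  [seq n%:Z | n <- iota 0 M.+1] ++ [seq - n.+1%:Z | n <- iota 0 M].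

Lemma uniq_intrange M : uniq (intrange M).
Proof.
rewrite cat_uniq !map_inj_uniq ?iota_uniq ?andbT/=; [|by move=> x y; lia..].
apply/hasPn => _ /mapP[n _ ->]; apply/negP => /mapP[m _]; lia.
Qed.

Lemma mem_intrange M (k : int) : `|k%:~R : R| <= M%:R -> k \in intrange M.
Proof.
rewrite -intr_norm -[M%:R]/(M%:Z%:~R) ler_int mem_cat => kM.
apply/orP; case: k kM => n kM; [left|right].
  by apply/mapP; exists n => //; rewrite mem_iota; lia.
by apply/mapP; exists n; [rewrite mem_iota; lia|rewrite NegzE].
Qed.

Lemma sum_intrange_le q M : 0 < q ->
  \sum_(k <- intrange M) (1 + k%:~R ^+ 2) `^ (- ((q + 1) / 2)) <= 2 * (2 + q^-1) :> R.
Proof.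
move=> q0; rewrite big_cat !big_map/=.
have H := wsum_le M q0; rewrite mulr_natl mulr2n; apply: lerD.
  by apply: le_trans H; rewrite /wsum /index_iota subn0.
apply: le_trans H; rewrite /wsum big_nat_recl//=.
apply: (@le_trans _ _ (0 + \sum_(0 <= i < M) (1 + i.+1%:R ^+ 2) `^ (- ((q + 1) / 2)))).
  rewrite add0r /index_iota subn0; apply: ler_sum => i _.
  by rewrite intrN sqrrN.
by rewrite lerD2r powR_ge0.
Qed.

Definition wt (r : R) (k : int * int) : R := (1 + freq2 k) `^ r.

Lemma wt_gt0 r k : 0 < wt r k.
Proof. by rewrite powR_gt0// ltr_wpDr// freq2_ge0. Qed.

(** Since (1 + |k|^2)^2 >= (1 + k1^2)(1 + k2^2), the weight is at most a product of one-dimensional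
    weights with exponent -al / 2, which are summable exactly because al > 1. *)
Lemma sum_wt_bounded al : 1 < al -> exists2 S : R, 0 < S &
  forall N, \sum_(k <- sseq R N) wt (- al) k <= S.
Proof.
move=> al1; pose q := al - 1; have q0 : 0 < q by rewrite subr_gt0.
pose C := 2 * (2 + q^-1); have C0 : 0 < C by rewrite mulr_gt0// addr_gt0// invr_gt0.
exists (C * C); first by rewrite mulr_gt0.
move=> N; pose g (k : int) : R := (1 + k%:~R ^+ 2) `^ (- ((q + 1) / 2)).
have wg k : wt (- al) k <= g k.1 * g k.2.
  have p0 (x : R) : 0 < 1 + x ^+ 2 by rewrite ltr_pwDl// sqr_ge0.
  rewrite /g -powRM ?(ltW (p0 _))// /wt !powRN lef_pV2 ?posrE ?powR_gt0 ?mulr_gt0//; last first.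
    by rewrite ltr_pwDl// freq2_ge0.
  have -> : al = 2 * ((q + 1) / 2) by rewrite /q; lra.
  rewrite [(1 + freq2 k) `^ _]powRrM powR_mulrn ?addr_ge0 ?freq2_ge0//.
  have q2 : 0 <= (q + 1) / 2 by rewrite /q; lra.
  apply: (ge0_ler_powR q2); rewrite ?nnegrE ?sqr_ge0//.
    by rewrite mulr_ge0 ?(ltW (p0 _)).
  rewrite /freq2 intrD !rmorphXn/= !expr2.
  have := sqr_ge0 (k.1%:~R : R); have := sqr_ge0 (k.2%:~R : R); rewrite !expr2.
  by set x := _ * _; set y := _ * _; nra.
have le_box : \sum_(k <- sseq R N) wt (- al) k <=
    \sum_(k <- [seq (i, j) | i <- intrange N, j <- intrange N]) g k.1 * g k.2.
  apply: le_trans (ler_sum _ _) _; first by move=> k _; exact: wg.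
  have us := @uniq_sseq R N.
  have us' : uniq [seq (i, j) | i <- intrange N, j <- intrange N].
    by apply: allpairs_uniq; rewrite ?uniq_intrange// => -[? ?] [? ?] _ _ [-> ->].
  rewrite (sumr_subseq _ us us').
    by rewrite lerDl sumr_ge0// => k _; rewrite mulr_ge0 ?powR_ge0.
  move=> k; rewrite sseqP => /andP[k1 k2]; apply/allpairsP; exists k; split.
  - by apply: mem_intrange; have : 0 <= N%:R :> R by []; lra.
  - by apply: mem_intrange; have : 0 <= N%:R :> R by []; lra.
  - exact: surjective_pairing.
apply: (le_trans le_box); rewrite big_allpairs_dep/=.
under eq_bigr do rewrite -mulr_sumr; rewrite -mulr_suml.
have g0 : 0 <= \sum_(k <- intrange N) g k by apply: sumr_ge0 => k _; exact: powR_ge0.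
by apply: ler_pM => //; exact: sum_intrange_le.
Qed.

(** The partial sums increase and are bounded, so a box whose sum is within [e] of their supremum
    leaves a tail of at most [e]. *)
Lemma sum_wt_tail al e : 1 < al -> 0 < e -> exists N0, forall N, (N0 <= N)%N ->
  \sum_(k <- sseq R N | k \notin sseq R N0) wt (- al) k <= e.
Proof.
move=> al1 e0; have [S S0 HS] := sum_wt_bounded al1.
pose G N := \sum_(k <- sseq R N) wt (- al) k.
have hs : has_sup (range G).
  by split; [exists (G 0%N), 0%N|exists S => _ [N _ <-]; exact: HS].
have [_ [N0 _ <-] GN0] := sup_adherent e0 hs.
exists N0 => N NN; have : G N <= sup (range G).
  by apply: sup_upper_bound => //; exists N.
move: GN0; rewrite /G => h1.
rewrite [X in X <= sup _](sumr_subseq _ (@uniq_sseq R N0) (@uniq_sseq R N)); last first.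
  by move=> k; exact: sseq_sub.
lra.
Qed.

End Summability.

(** * Sobolev norms, approximation by projection and sup bounds *)

Section Spectral.
Context {R : realType}.
Variables (a b c d : R).
Hypotheses (hab : b = a + 2 * pi) (hcd : d = c + 2 * pi).
Let Om : set (plane R) := `]a, b[ `*` `]c, d[.
Let mD : measurable Om := measurable_cell a b c d.
Let fD : (leb2 Om < +oo)%E := cell_measure_lty hab hcd.
Implicit Types (f g : plane R -> R) (N : nat) (B M L : R).
Local Notation L2 := (L2 leb2 Om).
Local Notation dot := (L2dot leb2 Om).
Local Notation nrm := (L2nrm leb2 Om).
Local Notation hat := (fhat Om).
Local Notation PN := (projN Om).
Local Notation J := (J R).

Let pi0 : 0 < 2 * pi :> R. Proof. by rewrite mulr_gt0 ?pi_gt0. Qed.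
Let pin0 : 2 * pi != 0 :> R. Proof. by rewrite gt_eqF. Qed.
Let pi1 : 1 <= 2 * pi :> R. Proof. by have := pi_ge2 R; lra. Qed.

(* The H^rho norm, which [fcoef] normalises differently, is at most [B / (2 * pi)]. *)
Definition hb (rho : R) f B : Prop :=
  forall N, \sum_(j <- J N) wt rho j.1 * hat f j ^+ 2 <= B ^+ 2.

Lemma fcoefE f k : fcoef Om f k =
  (((2 * pi)^-1 * hat f (k, false)) -i* ((2 * pi)^-1 * hat f (k, true)))%C.
Proof.
by rewrite /fcoef /fhat /L2dot -!exprVn expr2 -!mulrA.
Qed.

Lemma normc_fcoef f k : Normc.normc (fcoef Om f k) ^+ 2 =
  (2 * pi) ^- 2 * (hat f (k, false) ^+ 2 + hat f (k, true) ^+ 2).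
Proof.
rewrite fcoefE /Normc.normc sqr_sqrtr ?addr_ge0 ?sqr_ge0//.
rewrite sqrrN -exprVn; move: (hat f (k, false)) (hat f (k, true)) (2 * pi) => x y p.
by rewrite !exprMn mulrDr.
Qed.

Let sum_le_esum (F : int * int -> R) (x : R) : (forall k, 0 <= F k) ->
  (\esum_(k in [set: int * int]) (F k)%:E <= x%:E)%E ->
  forall N, \sum_(k <- sseq R N) F k <= x.
Proof.
move=> F0 Fx N; rewrite -lee_fin; apply: le_trans Fx; apply: esum_ge.
exists [set k | k \in sseq R N]; first by split => //; exact: finite_seq.
rewrite fsbig_finite; last exact: finite_seq.
rewrite -sumEFin le_eqVlt; apply/orP; left; apply/eqP; apply: perm_big.
apply: uniq_perm; [exact: uniq_sseq|exact: fset_uniq|] => k.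
rewrite in_fset_set; last exact: finite_seq.
by apply/idP/idP => [?|/set_mem//]; exact/mem_set.
Qed.

Lemma hnorm_hb rho f L : 0 <= L -> (hnorm Om rho f <= L%:E)%E -> hb rho f (2 * pi * L).
Proof.
move=> L0 fL N; rewrite big_J.
have h2 : (hnorm2 Om rho f <= (L ^+ 2)%:E)%E.
  have h0 : (0 <= hnorm2 Om rho f)%E.
    by apply: esum_ge0 => k _; rewrite lee_fin mulr_ge0 ?powR_ge0// sqr_ge0.
  have -> : hnorm2 Om rho f = (hnorm Om rho f `^ 2)%E.
    by rewrite /hnorm -poweRrM mulVf ?poweRe1.
  have -> : ((L ^+ 2)%:E = L%:E `^ 2)%E by rewrite poweR_EFin powR_mulrn.
  apply: gt0_ler_poweR => //; rewrite in_itv/= ?lee_fin ?leey ?andbT//.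
  exact: poweR_ge0.
have := sum_le_esum _ h2 N; move=> /(_ (fun k => mulr_ge0 (sqr_ge0 _) (powR_ge0 _ _))) h3.
have -> : \sum_(k <- sseq R N) (wt rho k * hat f (k, false) ^+ 2 +
    wt rho k * hat f (k, true) ^+ 2) = (2 * pi) ^+ 2 * \sum_(k <- sseq R N)
      (Normc.normc (fcoef Om f k) ^+ 2 * wt rho k).
  rewrite mulr_sumr; apply: eq_bigr => k _; rewrite normc_fcoef.
  move: (hat f (k, false)) (hat f (k, true)) (2 * pi) pin0 => x y p p0.
  by field.
by rewrite [leRHS]exprMn ler_wpM2l ?sqr_ge0.
Qed.

(** The sum over all frequencies is a supremum over finite sets, each contained in some [sseq R N];
    the normalising factor (2 pi)^-2 <= 1 is dropped. *)
Lemma hseminorm2_le rho f B :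
  (forall N, \sum_(j <- J N) freq2 j.1 `^ rho * hat f j ^+ 2 <= B) ->
  (hseminorm2 Om rho f <= B%:E)%E.
Proof.
move=> fB; apply: ub_ereal_sup => _ [A [fA _] <-].
rewrite fsbig_finite// sumEFin lee_fin.
have [N AN] : exists N, {subset (fset_set A : seq _) <= sseq R N}.
  elim: (fset_set A : seq _) => [|k s [N IH]]; first by exists 0%N.
  have [N0 kN] := @sseq_ex R k; exists (maxn N N0) => l.
  rewrite inE => /predU1P[->|/IH]; first by apply: kN; exact: leq_maxr.
  by apply: sseq_sub; exact: leq_maxl.
apply: le_trans (fB N); rewrite big_J.
rewrite (sumr_subseq _ (fset_uniq _) (@uniq_sseq R N) AN).
have T0 k : 0 <= freq2 k `^ rho * hat f (k, false) ^+ 2 + freq2 k `^ rho * hat f (k, true) ^+ 2.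
  by rewrite -mulrDr mulr_ge0 ?powR_ge0// addr_ge0// sqr_ge0.
apply: ler_wpDr; first by apply: sumr_ge0 => k _; exact: T0.
apply: ler_sum => k _; rewrite normc_fcoef -mulrDr mulrC mulrCA.
rewrite mulrC -mulrA ler_wpM2l ?powR_ge0//.
rewrite ler_piMr ?addr_ge0 ?sqr_ge0// invf_le1 ?exprn_gt0//.
exact: exprn_ege1.
Qed.

Lemma fracLap_hat beta w g : is_fracLap Om beta w g ->
  forall j, hat g j = freq2 j.1 `^ beta * hat w j.
Proof.
move=> [_ gw] [k e]; have := gw k; rewrite !fcoefE => /eqP; rewrite eq_complex/=.
rewrite !mul0r ?subr0 ?addr0 => /andP[/eqP h1 /eqP h2].
have pV : (2 * pi)^-1 != 0 :> R by rewrite invr_eq0.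
case: e => /=; apply: (mulfI pV).
  by apply/eqP; rewrite -eqr_opp h2; apply/eqP; ring.
by rewrite h1; ring.
Qed.

Lemma hb_max rho rho' f B : hb rho f B -> hb rho' f B -> hb (Num.max rho rho') f B.
Proof. by move=> h h'; have [_|_] := leP rho rho'. Qed.

Lemma sum_J_sub N N' (F : index -> R) : (N <= N')%N ->
  \sum_(j <- J N') F j = \sum_(j <- J N) F j + \sum_(j <- J N' | j \notin J N) F j.
Proof.
move=> NN; apply: sumr_subseq; [exact: uniq_J|exact: uniq_J|] => j.
by rewrite !mem_J; exact: sseq_sub.
Qed.

(** The remainder is compared with that of a larger box, which is arbitrarily small by [PN_cvg]. On
    the frequencies in between, the weight is at least (N^2 / 8)^m by [modes_off_box], which
    explains the constant 8^(m/2). *)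
Lemma hb_proj m : 0 <= m -> exists2 C : R, 0 < C & forall f B N,
  L2 f -> 0 <= B -> (0 < N)%N -> hb m f B ->
  nrm (fun x => f x - PN N f x) <= C * N%:R `^ (- m) * B.
Proof.
move=> m0; exists (8 `^ (m / 2)); first by rewrite powR_gt0.
move=> f B N f2 B0 N0 fB.
have N1 : 0 < N%:R :> R by rewrite ltr0n.
have C0 : 0 <= 8 `^ (m / 2) * N%:R `^ (- m) * B by rewrite !mulr_ge0// powR_ge0.
rewrite -(ler_pXn2r (n := 2)) ?nnegrE ?nrm_ge0//.
apply/ler_addgt0Pr => e e0.
have se0 : 0 < Num.sqrt e by rewrite sqrtr_gt0.
have [N' fN'] := PN_cvg hab hcd f2 se0.
pose N2 := maxn N N'; have /fN' fN2 : (N' <= N2)%N by exact: leq_maxr.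
have fN2' : nrm (fun x => f x - PN N2 f x) ^+ 2 <= e.
  rewrite -[leRHS](sqr_sqrtr (ltW e0)).
  by rewrite lerXn2r ?nnegrE ?nrm_ge0 ?sqrtr_ge0// ltW.
rewrite (sqr_nrm_subPN hab hcd)//; rewrite (sqr_nrm_subPN hab hcd)// in fN2'.
have NN2 : (N <= N2)%N by exact: leq_maxl.
rewrite (sum_J_sub _ NN2) in fN2'.
suff : \sum_(j <- J N2 | j \notin J N) hat f j ^+ 2 <= (8 `^ (m / 2) * N%:R `^ (- m) * B) ^+ 2.
  by lra.
have E : (8 `^ (m / 2) * N%:R `^ (- m)) ^+ 2 = (N%:R ^+ 2 / 8) `^ (- m).
  have sq (x p : R) : 0 <= x -> (x `^ p) ^+ 2 = x `^ (2 * p).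
    by move=> x0; rewrite -powR_mulrn ?powR_ge0// -powRrM mulrC.
  have E8 : (8^-1 : R) `^ (- m) = 8 `^ m.
    by rewrite -[8^-1]powR_inv1// -powRrM; congr (_ `^ _); ring.
  rewrite powRM ?sqr_ge0 ?invr_ge0// E8 exprMn !sq// mulrC -[N%:R ^+ 2]powR_mulrn// -powRrM.
  by congr (_ * _ `^ _); field.
rewrite exprMn E.
have N8 : 0 < N%:R ^+ 2 / 8 :> R by rewrite divr_gt0// exprn_gt0.
apply: (@le_trans _ _ ((N%:R ^+ 2 / 8) `^ (- m) *
    \sum_(j <- J N2 | j \notin J N) wt m j.1 * hat f j ^+ 2)).
  rewrite mulr_sumr; apply: ler_sum => j; rewrite mem_J => jN.
  rewrite mulrA -[leLHS]mul1r ler_wpM2r ?sqr_ge0// powRN mulrC ler_pdivlMr ?powR_gt0//.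
  rewrite mul1r /wt; apply: (ge0_ler_powR m0); rewrite ?nnegrE ?(ltW N8)//.
    by rewrite addr_ge0 ?freq2_ge0.
  exact: modes_off_box.
rewrite ler_wpM2l ?powR_ge0//; apply: le_trans (fB N2).
rewrite (sum_J_sub _ NN2) lerDr sumr_ge0// => j _.
by rewrite mulr_ge0 ?sqr_ge0// ltW ?wt_gt0.
Qed.

(** The partial sums are bounded by [M] everywhere, so the excess of |f| over [M] is dominated by
    [|f - PN N f|] for every N, and its norm vanishes. *)
Lemma ae_bounded_of_hat f M : L2 f -> (forall N, \sum_(j <- J N) `|hat f j| <= M) ->
  {ae leb2, forall x, Om x -> `|f x| <= M}.
Proof.
move=> f2 fM; have [mf _] := f2.
pose h x := Num.max (`|f x| - M) 0.
have h0 x : 0 <= h x by rewrite le_max lexx orbT.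
have mh : measurable_fun Om h.
  apply: measurable_maxr => //; apply: measurable_funB => //; exact: measurableT_comp.
have hN N x : h x <= `|f x - PN N f x|.
  rewrite ge_max normr_ge0 andbT lerBlDr.
  have := projN_le a b c d N f x; have := fM N; have := ler_normD (f x - PN N f x) (PN N f x).
  by rewrite subrK; lra.
have h2 : L2 h.
  apply: (L2_ae_dom mD mh (L2B mD f2 (L2_PN hab hcd 0 f))).
  by apply: aeW => x _; rewrite ger0_norm.
have nh : nrm h = 0.
  apply/eqP; rewrite eq_le nrm_ge0 andbT; apply/ler_addgt0Pr => e e0; rewrite add0r.
  have [N /(_ N (leqnn N)) fN] := PN_cvg hab hcd f2 e0.
  apply: le_trans (ltW fN); apply: nrm_ae_le => //.
    exact: (L2B mD f2 (L2_PN hab hcd N f)).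
  by apply: aeW => x _; rewrite ger0_norm.
have dh : (\int[leb2]_(x in Om) `|(h x * h x)%:E| = 0)%E.
  have hi := L2_mul_integrable mD h2 h2.
  have -> : (\int[leb2]_(x in Om) `|(h x * h x)%:E| = \int[leb2]_(x in Om) (h x * h x)%:E)%E.
    by apply: eq_integral => x _; rewrite gee0_abs// lee_fin mulr_ge0.
  rewrite -(fineK (integrable_fin_num mD hi)); congr (_%:E).
  by have := sqr_nrm leb2 Om h; rewrite nh expr0n/= => /esym.
have mhh : measurable_fun Om (fun x => (h x * h x)%:E).
  by apply/measurable_EFinP; exact: measurable_funM.
have := (ae_eq_integral_abs leb2 mD mhh).1 dh.
apply: filterS => x hx Dx; have /= [/eqP] := hx Dx.
rewrite mulf_eq0 orbb => /eqP hx0; have : `|f x| - M <= h x by rewrite le_max lexx.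
by rewrite hx0 subr_le0.
Qed.

End Spectral.

(** * Weighted scalar products on finite families *)

Section WeightedVectors.
Context {R : realType} (I : eqType).
Variables (s : seq I) (om : I -> R).
Hypothesis om0 : forall i, 0 <= om i.
Implicit Types (x y z : I -> R) (r : R).

Definition vd x y : R := \sum_(i <- s) om i * (x i * y i).
Definition vn x : R := Num.sqrt (vd x x).

Lemma vd_eq x x' y y' : {in s, x =1 x'} -> {in s, y =1 y'} -> vd x y = vd x' y'.
Proof.
move=> xx yy; rewrite /vd big_seq [RHS]big_seq; apply: eq_bigr => i si.
by rewrite xx// yy.
Qed.

Lemma vn_eq x y : {in s, x =1 y} -> vn x = vn y.
Proof. by move=> xy; rewrite /vn (vd_eq xy xy). Qed.

Lemma vdC x y : vd x y = vd y x.
Proof. by apply: eq_bigr => i _; rewrite (mulrC (x i)). Qed.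

Lemma vdDl x y z : vd (fun i => x i + y i) z = vd x z + vd y z.
Proof. by rewrite -big_split; apply: eq_bigr => i _ /=; ring. Qed.

Lemma vdBl x y z : vd (fun i => x i - y i) z = vd x z - vd y z.
Proof. by rewrite -sumrB; apply: eq_bigr => i _ /=; ring. Qed.

Lemma vdZl r x z : vd (fun i => r * x i) z = r * vd x z.
Proof. by rewrite mulr_sumr; apply: eq_bigr => i _ /=; ring. Qed.

Lemma vdDr x y z : vd z (fun i => x i + y i) = vd z x + vd z y.
Proof. by rewrite vdC vdDl !(vdC z). Qed.

Lemma vdBr x y z : vd z (fun i => x i - y i) = vd z x - vd z y.
Proof. by rewrite vdC vdBl !(vdC z). Qed.

Lemma vdZr r x z : vd z (fun i => r * x i) = r * vd z x.
Proof. by rewrite vdC vdZl (vdC z). Qed.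

Lemma vd_ge0 x : 0 <= vd x x.
Proof. by apply: sumr_ge0 => i _; rewrite mulr_ge0// -expr2 sqr_ge0. Qed.

Lemma vn_ge0 x : 0 <= vn x. Proof. exact: sqrtr_ge0. Qed.

Lemma sqr_vn x : vn x ^+ 2 = vd x x.
Proof. by rewrite sqr_sqrtr ?vd_ge0. Qed.

Lemma vn_le x r : 0 <= r -> vd x x <= r ^+ 2 -> vn x <= r.
Proof. by move=> r0 xr; rewrite -(ger0_norm r0) -sqrtr_sqr ler_wsqrtr. Qed.

Lemma vd_le_vn x y : `|vd x y| <= vn x * vn y.
Proof.
have quad t : 0 <= vd x x - 2 * t * vd x y + t ^+ 2 * vd y y.
  by have := vd_ge0 (fun i => x i - t * y i); rewrite vdBl !vdBr !vdZl !vdZr (vdC y x); lra.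
rewrite -sqrtrM ?vd_ge0// -sqrtr_sqr ler_wsqrtr//.
have [g0|g0] := eqVneq (vd y y) 0.
  rewrite g0 mulr0; have [->|fg0] := eqVneq (vd x y) 0; first by rewrite expr0n.
  have := quad ((vd x x + 1) / (2 * vd x y)).
  rewrite g0 mulr0 addr0.
  have -> : 2 * ((vd x x + 1) / (2 * vd x y)) * vd x y = vd x x + 1 by field.
  by move=> ?; exfalso; lra.
have gg : 0 < vd y y by rewrite lt_neqAle eq_sym g0 vd_ge0.
have := quad (vd x y / vd y y).
have -> : vd x x - 2 * (vd x y / vd y y) * vd x y +
   (vd x y / vd y y) ^+ 2 * vd y y = (vd x x * vd y y - vd x y ^+ 2) / vd y y.
  by field.
by rewrite pmulr_lge0 ?invr_gt0// subr_ge0.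
Qed.

Lemma vnD x y : vn (fun i => x i + y i) <= vn x + vn y.
Proof.
apply: vn_le; first by rewrite addr_ge0// vn_ge0.
rewrite vdDl !vdDr (vdC y x) sqrrD !sqr_vn.
by have := vd_le_vn x y; have := ler_norm (vd x y); lra.
Qed.

Lemma vnZ r x : vn (fun i => r * x i) = `|r| * vn x.
Proof.
by rewrite /vn vdZl vdZr mulrA -expr2 sqrtrM ?sqr_ge0// sqrtr_sqr.
Qed.

Lemma vnB x y : vn (fun i => x i - y i) <= vn x + vn y.
Proof.
have := vnD x (fun i => -1 * y i); rewrite vnZ normrN1 mul1r.
by congr (_ <= _); apply: vn_eq => i _; rewrite mulN1r.
Qed.

Lemma vn_dual x r : 0 <= r -> vd x x <= r * vn x -> vn x <= r.
Proof.
move=> r0; rewrite -sqr_vn expr2; have := vn_ge0 x; rewrite le_eqVlt => /predU1P[<-//|x0].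
by rewrite ler_pM2r.
Qed.

End WeightedVectors.

Lemma vn_wle (R : realType) (I : eqType) (s : seq I) (om om' x y : I -> R) :
  {in s, forall i, om i * x i ^+ 2 <= om' i * y i ^+ 2} -> vn s om x <= vn s om' y.
Proof.
move=> le; rewrite ler_wsqrtr// /vd big_seq [leRHS]big_seq.
by apply: ler_sum => i si; rewrite -!expr2 le.
Qed.

(* [Y k.-1] accounts for the extrapolation from the two previous steps. *)
Lemma discrete_gronwall (R : realType) (C tau eps : R) (K : nat) (Y : nat -> R) :
  0 <= C -> 0 <= tau -> C * tau <= 1 / 2 -> Y 0%N = 0 -> (forall n, 0 <= Y n) ->
  forall n, (n <= K)%N ->
  (forall k, (k < n)%N -> Y k.+1 - Y k <=
     tau * (C * (Y k.+1 + Y k + Y k.-1 + eps ^+ 2))) ->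
  Y n <= expR (6 * C * (n%:R * tau)) * eps ^+ 2.
Proof.
move=> C0 t0; set x := C * tau => Ct Y0 Yge; have x0 : 0 <= x by exact: mulr_ge0.
have e0 := sqr_ge0 eps.
(* Geometric form of the bound. The implicit term requires (1 + c x)(1 - x) >= 1 + 2 x for all x in
   [0, 1/2], and c = 6 is the least such constant. *)
have H n : (forall k, (k < n)%N -> Y k.+1 - Y k <=
     tau * (C * (Y k.+1 + Y k + Y k.-1 + eps ^+ 2))) ->
     Y n <= ((1 + 6 * x) ^+ n - 1) * eps ^+ 2.
  have b1 : 1 <= 1 + 6 * x by lra.
  elim/ltn_ind: n => -[|n] IH Hn; first by rewrite Y0 expr0 subrr mul0r.
  have IHn : Y n <= ((1 + 6 * x) ^+ n - 1) * eps ^+ 2.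
    by apply: IH => // k kn; apply: Hn; exact: ltnW.
  have IHp : Y n.-1 <= ((1 + 6 * x) ^+ n - 1) * eps ^+ 2.
    case: n IH Hn IHn => [//|n] IH Hn IHn /=.
    apply: (@le_trans _ _ (((1 + 6 * x) ^+ n - 1) * eps ^+ 2)).
      by apply: IH => // k kn; apply: Hn; rewrite (ltn_trans kn)// ltnW.
    by rewrite ler_wpM2r// lerB// ler_weXn2l.
  have := Hn n (ltnSn n); rewrite mulrA (mulrC tau) -/x [_ ^+ n.+1]exprS.
  have Z1 : 1 <= (1 + 6 * x) ^+ n by rewrite exprn_ege1.
  move: IHn IHp; set Z := (1 + 6 * x) ^+ n in Z1 *; set e2 := eps ^+ 2 in e0 * => IHn IHp h.
  set y := Y n.+1 in h *; set A := (Z - 1) * e2 in IHn IHp *.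
  have A0 : 0 <= A by rewrite mulr_ge0// subr_ge0.
  have h1 : y * (1 - x) <= A * (1 + 2 * x) + x * e2.
    by have := ler_wpM2l x0 IHn; have := ler_wpM2l x0 IHp; lra.
  have h2 : (A * (1 + 2 * x) + x * e2) <= ((1 + 6 * x) * A + 2 * x * e2) * (1 - x).
    have x2 : 0 <= 1 - 2 * x by lra.
    have := mulr_ge0 (mulr_ge0 A0 x0) x2; have := mulr_ge0 (mulr_ge0 x0 e0) x2.
    lra.
  have h3 : y <= (1 + 6 * x) * A + 2 * x * e2.
    by rewrite -(ler_pM2r (x := 1 - x)); [exact: le_trans h2|lra].
  apply: le_trans h3 _; rewrite /A; have : 0 <= x * e2 by rewrite mulr_ge0.
  lra.
move=> n nK /H Hn; apply: le_trans Hn _; rewrite ler_wpM2r//.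
apply: (@le_trans _ _ ((1 + 6 * x) ^+ n)); first lra.
have -> : 6 * C * (n%:R * tau) = n%:R * (6 * x) by rewrite /x; ring.
rewrite expRM_natl lerXn2r ?nnegrE ?expR_ge0//; first lra.
exact: expR_ge1Dx.
Qed.

(** * The discrete error equations *)

Section EnergyStep.
Context {R : realType} (I : eqType).
Variables (s : seq I) (lam : I -> R).
Hypothesis lam0 : forall i, 0 <= lam i.
Variables (kappa gamma1 gamma2 B tau eps X : R).
Hypotheses (kappa0 : 0 < kappa) (g10 : 0 <= gamma1) (g20 : 0 <= gamma2)
  (B0 : 0 <= B) (tau0 : 0 < tau) (eps0 : 0 <= eps) (X0 : 0 <= X).
Implicit Types (x y : I -> R).

Local Notation one := (fun=> 1 : R).
Local Notation n0 := (vn s one).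
Local Notation n1 := (vn s lam).

(** The symbol of the fractional Laplacian vanishes at frequency zero, so the L^2 norm of [eu] needs
    a summand of its own. *)
Definition energy_err (eu ev : I -> R) (er : R) : R :=
  n0 ev ^+ 2 + kappa * n1 eu ^+ 2 + n0 eu ^+ 2 + er ^+ 2.

(* [rho1] and [rho2] are the consistency residuals; [rho2] is only controlled by duality. *)
Definition scheme_residuals (eu eu' ev ev' : I -> R) (er er' : R)
    (rho1 rho2 G : I -> R) : Prop :=
  [/\ {in s, forall i, eu' i - eu i = tau * ((ev' i + ev i) / 2 + rho1 i)},
      {in s, forall i, (ev' i - ev i) + tau * (kappa * (lam i * ((eu' i + eu i) / 2))
         + gamma1 * (lam i * ((ev' i + ev i) / 2)) + gamma2 * ((ev' i + ev i) / 2)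
         + G i) = tau * rho2 i},
      [/\ n0 rho1 <= B * eps, n1 rho1 <= B * eps &
          forall phi, `|vd s one rho2 phi| <= B * eps * (n0 phi + gamma1 * n1 phi)],
      n0 G <= B * (eps + `|er| + `|er'| + X) &
      `|er' - er| <= tau * (B * (eps + n0 ev + n0 ev' + X))].

Definition energy_const : R := B * (kappa + 1) + 20 * B + gamma1 * B ^+ 2 + 2.

Let one0 : forall i : I, 0 <= one i :> R. Proof. by move=> i; exact: ler01. Qed.

(** The second equation is multiplied by [ev' + ev], twice the mean velocity; the first one,
    multiplied by [kappa * lam * (eu' + eu)], turns the stiffness term into a difference of
    squares. *)
Lemma energy_identity eu eu' ev ev' rho1 rho2 G :
  {in s, forall i, eu' i - eu i = tau * ((ev' i + ev i) / 2 + rho1 i)} ->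
  {in s, forall i, (ev' i - ev i) + tau * (kappa * (lam i * ((eu' i + eu i) / 2))
       + gamma1 * (lam i * ((ev' i + ev i) / 2)) + gamma2 * ((ev' i + ev i) / 2)
       + G i) = tau * rho2 i} ->
  let sv i := ev' i + ev i in let su i := eu' i + eu i in
  n0 ev' ^+ 2 - n0 ev ^+ 2 + kappa * (n1 eu' ^+ 2 - n1 eu ^+ 2)
    + tau * (gamma1 / 2 * n1 sv ^+ 2 + gamma2 / 2 * n0 sv ^+ 2) =
  tau * (kappa * vd s lam su rho1 - vd s one G sv + vd s one rho2 sv).
Proof.
move=> H1 H2 sv su; rewrite !sqr_vn// /vd.
have sD (F H : I -> R) : \sum_(i <- s) F i + \sum_(i <- s) H i = \sum_(i <- s) (F i + H i).
  by rewrite big_split.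
rewrite !(sD, mulr_sumr, =^~ sumrB) [LHS]big_seq [RHS]big_seq; apply: eq_bigr => i si.
have h1 := H1 i si; have h2 := H2 i si; rewrite /sv /su.
set x := eu' i in h1 h2 *; set x' := eu i in h1 h2 *; set y := ev' i in h1 h2 *.
set y' := ev i in h1 h2 *; set l := lam i in h2 *; set r1 := rho1 i in h1 *.
set r2 := rho2 i in h2 *; set g := G i in h2 *.
have e1 : (x - x' - tau * ((y + y') / 2 + r1)) * (kappa * l * (x + x')) = 0.
  by rewrite h1 subrr mul0r.
have e2 : ((y - y') + tau * (kappa * (l * ((x + x') / 2)) + gamma1 * (l * ((y + y') / 2))
    + gamma2 * ((y + y') / 2) + g) - tau * r2) * (y + y') = 0.
  by rewrite h2 subrr mul0r.
lra.
Qed.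

End EnergyStep.

(** The [gamma1] dissipation pays for the duality bound on [rho2]. Terms at the new time level stay
    on the right, so [tau] need not be small here; that is left to Gronwall's lemma. *)
Lemma energy_step (R : realType) (I : eqType) (s : seq I) (lam : I -> R)
    (kappa gamma1 gamma2 B tau eps X : R) :
  (forall i, 0 <= lam i) -> 0 < kappa -> 0 <= gamma1 -> 0 <= gamma2 -> 0 <= B -> 0 < tau ->
  0 <= eps -> forall eu eu' ev ev' er er' rho1 rho2 G,
  scheme_residuals s lam kappa gamma1 gamma2 B tau eps X eu eu' ev ev' er er' rho1 rho2 G ->
  energy_err s lam kappa eu' ev' er' - energy_err s lam kappa eu ev er <=
  tau * (energy_const kappa gamma1 B * (energy_err s lam kappa eu' ev' er'
    + energy_err s lam kappa eu ev er + X ^+ 2 + eps ^+ 2)).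
Proof.
move=> lam0 kappa0 g10 g20 B0 tau0 eps0 eu eu' ev ev' er er' rho1 rho2 G.
pose one (_ : I) : R := 1; have one0 i : 0 <= one i by exact: ler01.
move=> [H1 H2 [r1n0 r1n1 r2d] Gn dr].
have /= EI := energy_identity lam0 H1 H2.
set sv := (fun i => ev' i + ev i) in EI; set su := (fun i => eu' i + eu i) in EI.
(* Growth of the L^2 part of the energy, from the first equation tested with [eu' + eu]. *)
have EU : vn s (fun=> 1) eu' ^+ 2 - vn s (fun=> 1) eu ^+ 2 = tau * (vd s (fun=> 1) sv su / 2 + vd s (fun=> 1) rho1 su).
  rewrite !sqr_vn// /vd -sumrB mulr_suml -big_split mulr_sumr.
  rewrite [LHS]big_seq [RHS]big_seq; apply: eq_bigr => i si /=; rewrite /sv /su.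
  have : (eu' i - eu i - tau * ((ev' i + ev i) / 2 + rho1 i)) * (eu' i + eu i) = 0.
    by rewrite H1// subrr mul0r.
  lra.
have b1 := le_trans (ler_norm _) (vd_le_vn s lam0 su rho1).
have b2 := le_trans (ler_norm _) (vd_le_vn s one0 G (fun i => -1 * sv i)).
have b3 := le_trans (ler_norm _) (r2d sv).
have b4 := le_trans (ler_norm _) (vd_le_vn s one0 sv su).
have b5 := le_trans (ler_norm _) (vd_le_vn s one0 rho1 su).
rewrite vdZr mulN1r vnZ// normrN1 mul1r in b2.
have nsv : vn s (fun=> 1) sv <= vn s (fun=> 1) ev' + vn s (fun=> 1) ev by exact: vnD.
have nsu : vn s (fun=> 1) su <= vn s (fun=> 1) eu' + vn s (fun=> 1) eu by exact: vnD.
have nsu1 : vn s lam su <= vn s lam eu' + vn s lam eu by exact: vnD.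
rewrite /energy_err.
set a := vn s (fun=> 1) ev in EI Gn dr nsv *; set a' := vn s (fun=> 1) ev' in EI Gn dr nsv *.
set u := vn s (fun=> 1) eu in EU nsu *; set u' := vn s (fun=> 1) eu' in EU nsu *.
set p := vn s lam eu in EI nsu1 *; set p' := vn s lam eu' in EI nsu1 *.
have a0 : 0 <= a by exact: vn_ge0. have a'0 : 0 <= a' by exact: vn_ge0.
have u0 : 0 <= u by exact: vn_ge0. have u'0 : 0 <= u' by exact: vn_ge0.
have p0 : 0 <= p by exact: vn_ge0. have p'0 : 0 <= p' by exact: vn_ge0.
have sv0 : 0 <= vn s (fun=> 1) sv by exact: vn_ge0. have su0 : 0 <= vn s (fun=> 1) su by exact: vn_ge0.
have q0 : 0 <= vn s lam sv by exact: vn_ge0. have su10 : 0 <= vn s lam su by exact: vn_ge0.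
have r10 : 0 <= vn s (fun=> 1) rho1 by exact: vn_ge0. have r11 : 0 <= vn s lam rho1 by exact: vn_ge0.
have Gn0 : 0 <= vn s (fun=> 1) G by exact: vn_ge0.
(* [Q] dominates the square of every quantity involved except the unweighted [p] and [p'], so that
   products are bounded by [Q] through [prodQ]. *)
set Q := a' ^+ 2 + kappa * p' ^+ 2 + u' ^+ 2 + er' ^+ 2 +
  (a ^+ 2 + kappa * p ^+ 2 + u ^+ 2 + er ^+ 2) + X ^+ 2 + eps ^+ 2.
have kp2 : 0 <= kappa * p ^+ 2 by rewrite mulr_ge0 ?sqr_ge0// ltW.
have kp'2 : 0 <= kappa * p' ^+ 2 by rewrite mulr_ge0 ?sqr_ge0// ltW.
have [qa qa' qu qu'] : [/\ a ^+ 2 <= Q, a' ^+ 2 <= Q, u ^+ 2 <= Q & u' ^+ 2 <= Q].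
  move: (sqr_ge0 a) (sqr_ge0 a') (sqr_ge0 u) (sqr_ge0 u') (sqr_ge0 er) (sqr_ge0 er')
    (sqr_ge0 X) (sqr_ge0 eps); clear - kp2 kp'2; rewrite /Q => *; split; lra.
have [qr qr' qX qe] : [/\ `|er| ^+ 2 <= Q, `|er'| ^+ 2 <= Q, X ^+ 2 <= Q & eps ^+ 2 <= Q].
  rewrite !real_normK ?num_real//.
  move: (sqr_ge0 a) (sqr_ge0 a') (sqr_ge0 u) (sqr_ge0 u') (sqr_ge0 er) (sqr_ge0 er')
    (sqr_ge0 X) (sqr_ge0 eps); clear - kp2 kp'2; rewrite /Q => *; split; lra.
have prodQ (x y : R) : x ^+ 2 <= Q -> y ^+ 2 <= Q -> x * y <= Q.
  by move=> xQ yQ; have := sqr_ge0 (x - y); rewrite sqrrB; clearbody Q; clear - xQ yQ; lra.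
have Q0 : 0 <= Q by apply: le_trans qe; exact: sqr_ge0.
have nr : 0 <= `|er| by []. have nr' : 0 <= `|er'| by [].
have t1 : kappa * vd s lam su rho1 <= B * (kappa + 1) * Q.
  have h : vd s lam su rho1 <= (p' + p) * (B * eps) by apply: le_trans b1 _; exact: ler_pM.
  have h2 : kappa * (p' * eps) + kappa * (p * eps) <= (kappa + 1) * Q.
    have e1 := ler_wpM2l (ltW kappa0) (sqr_ge0 (p' - eps)).
    have e2 := ler_wpM2l (ltW kappa0) (sqr_ge0 (p - eps)).
    rewrite mulr0 !sqrrB in e1 e2.
    have e3 := ler_wpM2l (ltW kappa0) qe.
    have e4 : kappa * p' ^+ 2 + kappa * p ^+ 2 <= Q.
      move: (sqr_ge0 a) (sqr_ge0 a') (sqr_ge0 u) (sqr_ge0 u') (sqr_ge0 er) (sqr_ge0 er')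
        (sqr_ge0 X) (sqr_ge0 eps); clear - kp2 kp'2; rewrite /Q => *; lra.
    by clearbody Q; clear - e1 e2 e3 e4 Q0; lra.
  by have := ler_wpM2l (ltW kappa0) h; have := ler_wpM2l B0 h2; clearbody Q; clear; lra.
have t2 : - vd s (fun=> 1) G sv <= 8 * B * Q.
  have h : - vd s (fun=> 1) G sv <= B * (eps + `|er| + `|er'| + X) * (a' + a).
    by apply: le_trans b2 _; exact: ler_pM.
  have h2 : (eps + `|er| + `|er'| + X) * (a' + a) <= 8 * Q.
    have := prodQ _ _ qe qa; have := prodQ _ _ qe qa'.
    have := prodQ _ _ qr qa; have := prodQ _ _ qr qa'.
    have := prodQ _ _ qr' qa; have := prodQ _ _ qr' qa'.
    by have := prodQ _ _ qX qa; have := prodQ _ _ qX qa'; clearbody Q; clear; lra.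
  by have := ler_wpM2l B0 h2; clearbody Q; clear - h; lra.
(* Young's inequality: the part of the duality bound in the [lam] norm is absorbed by half of the
   [gamma1] dissipation, at the cost of [gamma1 * B ^+ 2 * Q]. *)
have t3 : vd s (fun=> 1) rho2 sv - gamma1 / 2 * vn s lam sv ^+ 2 <= 2 * B * Q + gamma1 * B ^+ 2 * Q.
  have e1 := ler_wpM2l g10 (sqr_ge0 (B * eps - vn s lam sv)).
  have e2 := ler_wpM2l (mulr_ge0 g10 (sqr_ge0 B)) qe.
  have Be : 0 <= B * eps by exact: mulr_ge0.
  have e3 := ler_wpM2l Be nsv.
  have e4 : B * (eps * (a' + a)) <= B * (2 * Q).
    rewrite ler_wpM2l//; by have := prodQ _ _ qe qa; have := prodQ _ _ qe qa'; clearbody Q; clear; lra.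
  have e5 := mulr_ge0 (mulr_ge0 g10 (sqr_ge0 B)) (sqr_ge0 eps).
  by rewrite mulr0 sqrrB exprMn in e1; clearbody Q; clear - b3 e1 e2 e3 e4 e5; lra.
have t4 : vd s (fun=> 1) sv su <= 4 * Q.
  have h : vd s (fun=> 1) sv su <= (a' + a) * (u' + u) by apply: le_trans b4 _; exact: ler_pM.
  have := prodQ _ _ qa qu; have := prodQ _ _ qa qu'.
  by have := prodQ _ _ qa' qu; have := prodQ _ _ qa' qu'; clearbody Q; clear - h; lra.
have t5 : vd s (fun=> 1) rho1 su <= 2 * B * Q.
  have h : vd s (fun=> 1) rho1 su <= B * eps * (u' + u) by apply: le_trans b5 _; exact: ler_pM.
  have e4 : B * (eps * (u' + u)) <= B * (2 * Q).
    rewrite ler_wpM2l//; by have := prodQ _ _ qe qu; have := prodQ _ _ qe qu'; clearbody Q; clear; lra.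
  by clearbody Q; clear - h e4; lra.
have t6 : er' ^+ 2 - er ^+ 2 <= tau * (8 * B * Q).
  have -> : er' ^+ 2 - er ^+ 2 = (er' - er) * (er' + er) by ring.
  apply: le_trans (ler_norm _) _; rewrite normrM.
  have h : `|er' + er| <= `|er'| + `|er| by exact: ler_normD.
  apply: le_trans (ler_pM _ _ dr h) _ => //.
  have h3 : (eps + a + a' + X) * (`|er'| + `|er|) <= 8 * Q.
    have := prodQ _ _ qe qr; have := prodQ _ _ qe qr'.
    have := prodQ _ _ qr qa; have := prodQ _ _ qr qa'.
    have := prodQ _ _ qr' qa; have := prodQ _ _ qr' qa'.
    by have := prodQ _ _ qX qr; have := prodQ _ _ qX qr'; clearbody Q; clear; lra.
  by have := ler_wpM2l (mulr_ge0 (ltW tau0) B0) h3; clearbody Q; clear; lra.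
have g2 : 0 <= gamma2 / 2 * vn s (fun=> 1) sv ^+ 2 by rewrite mulr_ge0 ?sqr_ge0// divr_ge0.
(* The multiples 8, 2, 2 and 8 of [B] from [t2], [t3], [t5] and [t6] make the 20 in [energy_const];
   half of [t4] makes the 2. *)
have T : kappa * vd s lam su rho1 - vd s (fun=> 1) G sv + vd s (fun=> 1) rho2 sv
    - (gamma1 / 2 * vn s lam sv ^+ 2 + gamma2 / 2 * vn s (fun=> 1) sv ^+ 2)
    + (vd s (fun=> 1) sv su / 2 + vd s (fun=> 1) rho1 su) + 8 * B * Q <= energy_const kappa gamma1 B * Q.
  by rewrite /energy_const; clearbody Q; clear - t1 t2 t3 t4 t5 g2; lra.
have Tt := ler_wpM2l (ltW tau0) T.
clear -Tt t6 EI EU; clearbody Q; lra.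
Qed.

(** * Discrete Sobolev embedding and inverse inequality *)

Section SupNorm.
Context {R : realType}.
Implicit Types (x : index -> R) (p W V : R) (N : nat).
Local Notation J := (J R).
Local Notation one := (fun=> 1 : R).

(** Cauchy-Schwarz in the weight [wt p] for the vectors [wt p ^-1] and [|x|]. *)
Lemma l1_le_wt (s : seq index) p x W V : 0 <= W -> 0 <= V ->
  \sum_(j <- s) wt p j.1 * x j ^+ 2 <= W ^+ 2 ->
  \sum_(j <- s) wt (- p) j.1 <= V ^+ 2 -> \sum_(j <- s) `|x j| <= V * W.
Proof.
move=> W0 V0 xW sV; have w0 (j : index) : 0 <= wt p j.1 :> R by rewrite ltW// wt_gt0.
have wE (j : index) : wt (- p) j.1 = (wt p j.1)^-1 :> R by rewrite /wt powRN.
have := vd_le_vn s w0 (fun j => (wt p j.1)^-1) (fun j => `|x j|).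
have -> : vd s (fun j => wt p j.1) (fun j => (wt p j.1)^-1) (fun j => `|x j|) =
    \sum_(j <- s) `|x j|.
  by apply: eq_bigr => j _; rewrite mulrA divff ?mul1r// gt_eqF ?wt_gt0.
rewrite ger0_norm ?sumr_ge0// => h; apply: le_trans h _.
apply: ler_pM; rewrite ?vn_ge0//; apply: vn_le => //.
  apply: le_trans sV; apply: ler_sum => j _.
  by rewrite wE mulrA divff ?mul1r// gt_eqF ?wt_gt0.
by apply: le_trans xW; apply: ler_sum => j _; rewrite -expr2 real_normK ?num_real.
Qed.

(** The embedding of H^p, p > 1, into the functions with summable coefficients. The factor 2 counts
    the sine and the cosine of each frequency. *)
Lemma l1_wt p : 1 < p -> exists2 S : R, 0 < S & forall N x W, 0 <= W ->
  \sum_(j <- J N) wt p j.1 * x j ^+ 2 <= W ^+ 2 -> \sum_(j <- J N) `|x j| <= S * W.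
Proof.
move=> p1; have [S S0 HS] := @sum_wt_bounded R _ p1.
have S2 : 0 < 2 * S by rewrite mulr_gt0.
exists (Num.sqrt (2 * S)); first by rewrite sqrtr_gt0.
move=> N x W W0 xW; apply: l1_le_wt xW _; rewrite ?sqrtr_ge0//.
rewrite sqr_sqrtr ?(ltW S2)// big_J/=.
by under eq_bigr do rewrite -mulr2n -mulr_natl; rewrite -mulr_sumr ler_wpM2l.
Qed.

(** A mere bound in H^p already makes the high frequencies small, uniformly in N. *)
Lemma l1_wt_tail p e : 1 < p -> 0 < e -> exists N1, forall N x W, (N1 <= N)%N -> 0 <= W ->
  \sum_(j <- J N) wt p j.1 * x j ^+ 2 <= W ^+ 2 ->
  \sum_(j <- J N | j \notin J N1) `|x j| <= e * W.
Proof.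
move=> p1 e0; have e2 : 0 < e ^+ 2 / 2 by rewrite divr_gt0// exprn_gt0.
have [N1 HN] := @sum_wt_tail R _ _ p1 e2; exists N1 => N x W NN W0 xW.
rewrite -big_filter; apply: (@l1_le_wt _ p); rewrite ?(ltW e0)//.
  rewrite big_filter; apply: le_trans xW; rewrite [leRHS](sum_J_sub _ NN) lerDr.
  by apply: sumr_ge0 => j _; rewrite mulr_ge0 ?sqr_ge0// ltW// wt_gt0.
rewrite big_filter big_mkcond big_J/=.
have := HN N NN; rewrite big_mkcond/= => h.
have -> : e ^+ 2 = 2 * (e ^+ 2 / 2) by field.
apply: le_trans (ler_wpM2l _ h) => //; rewrite mulr_sumr; apply: ler_sum => k _.
by rewrite !mem_J/=; case: ifP; rewrite ?mulr0 ?addr0// mulr2n mulrDl mul1r.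
Qed.

(** Inverse inequality: on the box, 1 + |k|^2 <= 1 + 2 (N / 2 - 1)^2 <= N^2. *)
Lemma wt_le_box p N k : 0 <= p -> (0 < N)%N -> k \in sseq R N ->
  wt p k <= N%:R `^ (2 * p) :> R.
Proof.
move=> p0 N0; rewrite sseqP => /andP[k1 k2].
have n1 := normr_ge0 (k.1%:~R : R); have n2 := normr_ge0 (k.2%:~R : R).
rewrite /wt powRrM powR_mulrn//; apply: (ge0_ler_powR p0); rewrite ?nnegrE ?sqr_ge0//.
  by rewrite addr_ge0 ?freq2_ge0.
have -> : freq2 k = `|k.1%:~R| ^+ 2 + `|k.2%:~R| ^+ 2 :> R.
  by rewrite /freq2 intrD !rmorphXn/= !real_normK ?num_real.
set y := `|k.1%:~R| in k1 n1 *; set y' := `|k.2%:~R| in k2 n2 *.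
have h1 : y ^+ 2 <= (N%:R / 2 - 1) ^+ 2 by rewrite lerXn2r ?nnegrE//; lra.
have h2 : y' ^+ 2 <= (N%:R / 2 - 1) ^+ 2 by rewrite lerXn2r ?nnegrE//; lra.
have N2 : 2 <= N%:R :> R by lra.
move: h1 h2; rewrite !expr2; nra.
Qed.

Lemma wt_le_freq p k : 0 <= p -> wt p k <= 2 `^ p * (1 + (freq2 k `^ (p / 2)) ^+ 2) :> R.
Proof.
move=> p0; have f0 := @freq2_ge0 R k.
have -> : (freq2 k `^ (p / 2)) ^+ 2 = freq2 k `^ p :> R.
  by rewrite -powR_mulrn ?powR_ge0// -powRrM; congr (_ `^ _); field.
rewrite mulrDr mulr1 /wt; have [f1|f1] := leP (freq2 k : R) 1.
  apply: ler_wpDr; first by rewrite mulr_ge0 ?powR_ge0.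
  by apply: (ge0_ler_powR p0); rewrite ?nnegrE; lra.
apply: ler_wpDl; first by rewrite powR_ge0.
by rewrite -powRM//; apply: (ge0_ler_powR p0); rewrite ?nnegrE; lra.
Qed.

End SupNorm.

(** * Induction keeping the error bounded in the sup norm *)

Section Bootstrap.
Context {R : realType}.
Variables (kappa gamma1 gamma2 T B alpha : R).
Hypotheses (kappa0 : 0 < kappa) (g10 : 0 <= gamma1) (g20 : 0 <= gamma2)
  (T0 : 0 < T) (B0 : 0 <= B) (alpha1 : 1 < alpha).
Local Notation J := (J R).
Local Notation one := (fun=> 1 : R).

Definition lam (j : index) : R := freq2 j.1 `^ (alpha / 2).

Lemma lam_ge0 j : 0 <= lam j. Proof. exact: powR_ge0. Qed.

Let one0 : forall i : index, 0 <= one i :> R. Proof. by move=> i; exact: ler01. Qed.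

(* Solves the second error equation for [lam eu'], the difference quotient of [eu]
   replacing the mean of [ev]: the coefficient of [lam eu] never exceeds that of [lam eu'],
   so the norm of [lam eu] only grows by the forcing, which is O(tau) when eps = O(tau^2). *)
Lemma lam_step N tau (eu eu' ev ev' rho1 rho2 G : index -> R) : 0 < tau ->
  {in J N, forall i, eu' i - eu i = tau * ((ev' i + ev i) / 2 + rho1 i)} ->
  {in J N, forall i, (ev' i - ev i) + tau * (kappa * (lam i * ((eu' i + eu i) / 2))
         + gamma1 * (lam i * ((ev' i + ev i) / 2)) + gamma2 * ((ev' i + ev i) / 2)
         + G i) = tau * rho2 i} ->
  let n0 := vn (J N) one in
  (n0 (fun j => lam j * eu' j) <= n0 (fun j => lam j * eu j) + 2 / kappa *
    (n0 rho2 + gamma1 * n0 (fun j => lam j * rho1 j) + n0 G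
      + gamma2 / 2 * (n0 ev' + n0 ev) + (n0 ev' + n0 ev) / tau))%R : Prop.
Proof.
move=> t0 H1 H2 n0; have tn0 : tau != 0 by rewrite gt_eqF.
pose D := kappa / 2 + gamma1 / tau; pose D' := gamma1 / tau - kappa / 2.
have gt0 : 0 <= gamma1 / tau by rewrite divr_ge0// ltW.
have D0 : kappa / 2 <= D by rewrite lerDl.
have Dpos : 0 < D by apply: lt_le_trans D0; rewrite divr_gt0.
have D'D : `|D'| <= D.
  by have k0 := kappa0; move: gt0; rewrite ler_norml /D' /D; set w := gamma1 / tau => w0; apply/andP; split; lra.
pose g j := rho2 j + gamma1 * (lam j * rho1 j) - G j - (gamma2 / 2) * (ev' j + ev j)
  - tau^-1 * (ev' j - ev j).
have E : n0 (fun j => D * (lam j * eu' j)) = n0 (fun j => D' * (lam j * eu j) + g j).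
  apply: vn_eq => j jN; have h1 := H1 j jN; have h2 := H2 j jN.
  rewrite /g; have -> : rho2 j = ((ev' j - ev j) + tau * (kappa * (lam j * ((eu' j + eu j) / 2))
         + gamma1 * (lam j * ((ev' j + ev j) / 2)) + gamma2 * ((ev' j + ev j) / 2)
         + G j)) / tau by rewrite h2 mulrAC divff ?mul1r.
  have -> : ev' j = 2 * ((eu' j - eu j) / tau - rho1 j) - ev j by rewrite h1; field.
  by rewrite /D /D'; field.
have gn : n0 g <= n0 rho2 + gamma1 * n0 (fun j => lam j * rho1 j) + n0 G
      + gamma2 / 2 * (n0 ev' + n0 ev) + (n0 ev' + n0 ev) / tau.
  have a1 := vnB (J N) one0 (fun j => rho2 j + gamma1 * (lam j * rho1 j) - G j -
    (gamma2 / 2) * (ev' j + ev j)) (fun j => tau^-1 * (ev' j - ev j)).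
  have a2 := vnB (J N) one0 (fun j => rho2 j + gamma1 * (lam j * rho1 j) - G j)
    (fun j => (gamma2 / 2) * (ev' j + ev j)).
  have a3 := vnB (J N) one0 (fun j => rho2 j + gamma1 * (lam j * rho1 j)) G.
  have a4 := vnD (J N) one0 rho2 (fun j => gamma1 * (lam j * rho1 j)).
  have g2 : 0 <= gamma2 / 2 by rewrite divr_ge0.
  rewrite vnZ// ger0_norm ?invr_ge0 ?(ltW t0)// in a1; rewrite vnZ// ger0_norm// in a2.
  rewrite vnZ// ger0_norm// in a4.
  have a5 := ler_wpM2l g2 (vnD (J N) one0 ev' ev).
  have tV : 0 <= tau^-1 by rewrite invr_ge0 ltW.
  have a6 := ler_wpM2l tV (vnB (J N) one0 ev' ev).
  rewrite -/n0 in a1 a2 a3 a4 a5 a6 *; rewrite /g [X in _ <= _ + X]mulrC.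
  apply: le_trans a1 _; apply: le_trans (lerD a2 a6) _.
  apply: le_trans (lerD (lerD a3 a5) (lexx _)) _.
  by rewrite !lerD2r.
have h := vnD (J N) one0 (fun j => D' * (lam j * eu j)) g.
have E1 : n0 (fun j => D * (lam j * eu' j)) = D * n0 (fun j => lam j * eu' j).
  by rewrite /n0 vnZ// gtr0_norm.
have E2 : n0 (fun j => D' * (lam j * eu j)) = `|D'| * n0 (fun j => lam j * eu j).
  by rewrite /n0 vnZ.
rewrite -/n0 -E E1 E2 in h.
set Gb := (X in _ + _ * X); rewrite -/Gb in gn.
set x := n0 _ in h *; set y := n0 (fun j => lam j * eu j) in h *.
have y0 : 0 <= y by exact: vn_ge0.
have Gb0 : 0 <= Gb by apply: le_trans gn; exact: vn_ge0.
have h2 : D * x <= D * y + Gb.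
  by apply: le_trans h _; apply: lerD => //; exact: ler_wpM2r.
have h3 : x <= y + D^-1 * Gb.
  by rewrite -(ler_pM2l Dpos) mulrDr mulrA divff ?mul1r// gt_eqF.
apply: le_trans h3 _; rewrite lerD2l ler_wpM2r//.
by rewrite -invf_div lef_pV2 ?posrE ?divr_gt0.
Qed.

Local Notation Cen := (energy_const kappa gamma1 B).

Lemma energy_const_ge0 : 0 <= Cen.
Proof.
by rewrite /energy_const !addr_ge0 ?mulr_ge0 ?sqr_ge0 ?addr_ge0 ?(ltW kappa0).
Qed.

Lemma energy_err_le (s : seq index) (eu ev : index -> R) er r : 0 <= r ->
  energy_err s lam kappa eu ev er <= r ^+ 2 ->
  [/\ vn s one ev <= r, vn s one eu <= r & `|er| <= r].
Proof.
move=> r0; rewrite /energy_err => h.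
have h1 := sqr_ge0 (vn s one ev); have h2 := sqr_ge0 (vn s one eu); have h3 := sqr_ge0 er.
have h4 : 0 <= kappa * vn s lam eu ^+ 2 by rewrite mulr_ge0 ?sqr_ge0// ltW.
by split; rewrite -(ler_pXn2r (n := 2)) ?nnegrE ?vn_ge0// ?real_normK ?num_real//; lra.
Qed.

End Bootstrap.

(* The sup norm of the error stays below 1 without any coupling of [tau] and [N]: if
   [N^-m <= tau^2] the bound on [lam eu] makes the high frequencies small and the energy
   estimate the low ones; otherwise [eps <= 2 N^-m] and the inverse inequality suffices. *)
Lemma bootstrap (R : realType) (kappa gamma1 gamma2 T B alpha : R) :
  0 < kappa -> 0 <= gamma1 -> 0 <= gamma2 -> 0 < T -> 0 <= B -> 1 < alpha ->
  exists C tau0 : R, exists N0 : nat, [/\ 0 < C, 0 < tau0 &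
  forall (N K : nat) (m : R) (eu ev : nat -> index -> R) (er : nat -> R),
  (N0 <= N)%N -> (0 < N)%N -> (0 < K)%N -> alpha <= m ->
  let tau := T / K%:R in let eps := tau ^+ 2 + N%:R `^ (- m) in
  let n0 := vn (J R N) (fun=> 1) in
  tau <= tau0 ->
  {in J R N, eu 0%N =1 fun=> 0} -> {in J R N, ev 0%N =1 fun=> 0} -> er 0%N = 0 ->
  (forall n, (n < K)%N -> (forall k, (k <= n)%N -> \sum_(j <- J R N) `|eu k j| <= 1) ->
    exists rho1 rho2 G : index -> R,
    [/\ scheme_residuals (J R N) (lam alpha) kappa gamma1 gamma2 B tau eps
          (n0 (eu n) + n0 (eu n.-1)) (eu n) (eu n.+1) (ev n) (ev n.+1) (er n) (er n.+1)
          rho1 rho2 G,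
        n0 (fun j => lam alpha j * rho1 j) <= B * tau & n0 rho2 <= B * tau]) ->
  forall n, (n <= K)%N -> energy_err (J R N) (lam alpha) kappa (eu n) (ev n) (er n) <= C * eps ^+ 2].
Proof.
move=> kappa0 g10 g20 T0 B0 alpha1.
pose Cen := energy_const kappa gamma1 B.
have C0 : 0 <= Cen := energy_const_ge0 kappa0 g10 B0; have T0' := ltW T0.
(* The extrapolation term [X] is a sum of two norms, so X^2 is at most twice the sum of the last two
   energies; added to the energy already present this makes 3. *)
pose Cg := 3 * Cen; have Cg0 : 0 <= Cg by rewrite mulr_ge0.
have CgE : Cg = 3 * Cen by []; clearbody Cg.
pose E := expR (6 * Cg * T); have E0 : 0 < E by exact: expR_gt0.
have EE : E = expR (6 * Cg * T) by []; clearbody E.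
pose sE := Num.sqrt E; have sE0 : 0 <= sE by exact: sqrtr_ge0.
have sEE : sE ^+ 2 = E by rewrite sqr_sqrtr ?(ltW E0).
clearbody sE.
(* Bounds the forcing of [lam_step] divided by tau, given tau <= 1 and eps <= 2 tau^2, with all
   errors at most [sE * eps]. *)
pose C4 := B + gamma1 * B + B * (2 + 8 * sE) + 2 * gamma2 * sE + 4 * sE.
have C40 : 0 <= C4 by rewrite /C4 !addr_ge0 ?mulr_ge0 ?addr_ge0 ?mulr_ge0.
pose C5 := 2 / kappa * C4.
have k2 : 0 <= 2 / kappa by rewrite divr_ge0// ltW.
have C50 : 0 <= C5 by rewrite mulr_ge0.
have C4E : C4 = B + gamma1 * B + B * (2 + 8 * sE) + 2 * gamma2 * sE + 4 * sE by [].
have C5E : C5 = 2 / kappa * C4 by []; clearbody C5 C4.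
(* H^alpha bound of the error: L^2 norm at most [2 * sE], and at most K increments of size
   [C5 * tau] for [lam eu]. It is fixed before [N1], which makes the tail of such vectors at most
   1/2. *)
pose W := Num.sqrt (2 `^ alpha * (4 * E + (C5 * T) ^+ 2)); have W0 : 0 <= W by exact: sqrtr_ge0.
have WW : W ^+ 2 = 2 `^ alpha * (4 * E + (C5 * T) ^+ 2).
  by rewrite sqr_sqrtr// mulr_ge0 ?powR_ge0// addr_ge0 ?sqr_ge0// mulr_ge0// ltW.
clearbody W.
have W1 : 0 < 2 * (W + 1) by rewrite mulr_gt0// ltr_wpDl.
have [|N1 tailN1] := @l1_wt_tail R alpha (2 * (W + 1))^-1 alpha1; first by rewrite invr_gt0.
(* Any exponent strictly between 1 and alpha: above 1 for the embedding, below alpha so that the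
   inverse inequality leaves a negative power N^-q. *)
pose al' := (1 + alpha) / 2; have al'1 : 1 < al' by rewrite /al'; lra.
have al'E : al' = (1 + alpha) / 2 by []; clearbody al'.
have al'0 : 0 <= al' by lra.
have [S S0 HS] := @l1_wt R _ al'1.
pose M1 := N1%:R `^ al'; have M10 : 0 <= M1 by exact: powR_ge0.
have M1E : M1 = N1%:R `^ al' by []; clearbody M1.
pose q := (alpha - 1) / 2; have q0 : 0 < q by rewrite /q; lra.
have qE : q = (alpha - 1) / 2 by []; clearbody q.
have [k hk] : exists k : nat, (4 * S * sE) `^ (q^-1) <= k%:R.
  by exists (Num.truncn ((4 * S * sE) `^ (q^-1))).+1; rewrite ltW// truncnS_gt.
(* Its inverse bounds the step, and the three summands provide tau <= 1, the smallness required by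
   Gronwall, and that of the low frequencies. *)
pose tden := 1 + 2 * Cg + 4 * (S * M1 * sE).
have SMs : 0 <= S * M1 * sE by rewrite !mulr_ge0 ?(ltW S0).
have tdenE : tden = 1 + 2 * Cg + 4 * (S * M1 * sE) by []; clearbody tden.
have tden1 : 1 <= tden by rewrite tdenE; lra.
have tden0 : 0 < tden by lra.
exists E, tden^-1, (maxn N1 k); split; rewrite ?invr_gt0//.
move=> N K m eu ev er; rewrite geq_max => /andP[NN1 Nk] N0 K0 am tau eps n0 tt0 eu0 ev0 er0 step.
have KR : 0 < K%:R :> R by rewrite ltr0n.
have NR : 0 < N%:R :> R by rewrite ltr0n.
have t0 : 0 < tau by rewrite divr_gt0.
have tden_t : tden * tau <= 1.
  by rewrite -(mulfV (x := tden)) ?gt_eqF// ler_pM2l.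
have tSM : 0 <= S * M1 * sE * tau by rewrite mulr_ge0 ?(ltW t0).
have tCg : 0 <= Cg * tau by rewrite mulr_ge0 ?(ltW t0).
have [t1 tC tS] : [/\ tau <= 1, Cg * tau <= 1 / 2 & 4 * (S * M1 * sE * tau) <= 1].
  by move: tden_t; rewrite tdenE => tt; clear - tt tSM tCg t0 SMs Cg0; split; lra.
have e0 : 0 <= eps by rewrite addr_ge0 ?sqr_ge0 ?powR_ge0.
have n0ge x : 0 <= n0 x by exact: vn_ge0.
pose Y n := energy_err (J R N) (lam alpha) kappa (eu n) (ev n) (er n).
have Y_ge0 n : 0 <= Y n.
  by rewrite /Y /energy_err !addr_ge0 ?sqr_ge0// mulr_ge0 ?sqr_ge0// ltW.
have Y0 : Y 0%N = 0.
  have z x om : {in J R N, x =1 fun=> 0} -> vn (J R N) om x = 0.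
    by move=> x0; rewrite /vn /vd big_seq big1 ?sqrtr0// => j /x0 ->; rewrite mul0r mulr0.
  by rewrite /Y /energy_err !z// er0 !expr0n/= !mulr0 !addr0.
have Ystep n : (n < K)%N -> (forall k, (k <= n)%N -> \sum_(j <- J R N) `|eu k j| <= 1) ->
    Y n.+1 - Y n <= tau * (Cg * (Y n.+1 + Y n + Y n.-1 + eps ^+ 2)).
  move=> nK /(step n nK)[rho1 [rho2 [G [res _ _]]]].
  have := energy_step (lam_ge0 alpha) kappa0 g10 g20 B0 t0 e0 res; rewrite -!/(Y _) => h.
  apply: le_trans h _; rewrite ler_pM2l// CgE (mulrC 3) -mulrA ler_wpM2l//.
  have b (i : nat) : n0 (eu i) ^+ 2 <= Y i.
    have h1 := sqr_ge0 (n0 (ev i)); have h3 := sqr_ge0 (er i).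
    have h4 : 0 <= kappa * vn (J R N) (lam alpha) (eu i) ^+ 2 by rewrite mulr_ge0 ?sqr_ge0// ltW.
    by rewrite /Y /energy_err -/n0; lra.
  have := b n; have := b n.-1; have := sqr_ge0 (n0 (eu n) - n0 (eu n.-1)).
  have := Y_ge0 n.+1; have := Y_ge0 n.-1; have := sqr_ge0 eps; rewrite sqrrB sqrrD; lra.
have Ybound n : (n <= K)%N ->
    (forall k, (k < n)%N -> \sum_(j <- J R N) `|eu k j| <= 1) -> Y n <= E * eps ^+ 2.
  move=> nK small.
  apply: le_trans (discrete_gronwall (eps := eps) Cg0 (ltW t0) tC Y0 Y_ge0 nK _) _.
    move=> i ni; apply: Ystep; first exact: leq_trans ni nK.
    by move=> i' ii'; apply: small; exact: leq_ltn_trans ii' ni.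
  rewrite ler_wpM2r ?sqr_ge0// EE ler_expR ler_wpM2l ?mulr_ge0//.
  by rewrite /tau mulrCA ler_piMr// ler_pdivrMr// mul1r ler_nat.
(* The induction carries both the sup bound and, in the regime N^-m <= tau^2, a bound on [lam eu]
   growing linearly with the number of steps. *)
suff main n : (n <= K)%N -> forall i, (i <= n)%N ->
    \sum_(j <- J R N) `|eu i j| <= 1 /\
    (N%:R `^ (- m) <= tau ^+ 2 -> n0 (fun j => lam alpha j * eu i j) <= i%:R * (C5 * tau)).
  move=> n nK; apply: Ybound => // i ni; exact: (main n nK i (ltnW ni)).1.
elim: n => [_ i|n IH nK i].
  rewrite leqn0 => /eqP ->; split.
    by rewrite big_seq big1 ?ler01// => j /eu0 ->; rewrite normr0.
  rewrite mul0r => _; rewrite /n0 /vn /vd big_seq big1 ?sqrtr0// => j /eu0 ->.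
  by rewrite mulr0 mul0r mulr0.
have {}IH := IH (ltnW nK).
rewrite leq_eqVlt => /predU1P[->|]; last by rewrite ltnS; exact: IH.
have sE_le l : (l <= n.+1)%N -> Y l <= (sE * eps) ^+ 2.
  move=> ln; rewrite exprMn sEE; apply: Ybound; first exact: leq_trans ln nK.
  by move=> i' il; apply: (IH i' _).1; rewrite -ltnS; exact: leq_trans il ln.
have see : 0 <= sE * eps by rewrite mulr_ge0.
have [va ua ra] := energy_err_le kappa0 see (sE_le _ (leqnSn n)).
have [va' ua' ra'] := energy_err_le kappa0 see (sE_le _ (leqnn n.+1)).
have [_ up _] := energy_err_le kappa0 see (sE_le _ (leq_trans (leq_pred n) (leqnSn n))).
rewrite -/n0 in va ua va' ua' up.
have reg1 : N%:R `^ (- m) <= tau ^+ 2 ->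
    n0 (fun j => lam alpha j * eu n.+1 j) <= n.+1%:R * (C5 * tau).
  move=> Nt; have e2 : eps <= 2 * (tau * tau) by rewrite /eps -expr2; lra.
  have tt : tau * tau <= tau by rewrite ler_piMl// ltW.
  have [rho1 [rho2 [G [[H1 H2 _ Gn _] r1 r2]]]] :=
    step n nK (fun i' ii' => (IH i' ii').1).
  have /= := lam_step kappa0 g10 g20 t0 H1 H2; rewrite -/n0 => h; apply: le_trans h _.
  have -> : n.+1%:R * (C5 * tau) = n%:R * (C5 * tau) + 2 / kappa * (C4 * tau).
    by rewrite -natr1 mulrDl mul1r C5E; ring.
  apply: lerD; first exact: (IH n (leqnn n)).2.
  rewrite ler_wpM2l//.
  have se2 : sE * eps <= sE * (2 * (tau * tau)) by rewrite ler_wpM2l.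
  have se3 : sE * (2 * (tau * tau)) <= sE * (2 * tau) by rewrite ler_wpM2l// ler_wpM2l.
  have q1 : gamma1 * n0 (fun j => lam alpha j * rho1 j) <= gamma1 * (B * tau) by rewrite ler_wpM2l.
  have q2 : n0 G <= B * ((2 + 8 * sE) * tau).
    apply: le_trans Gn _; rewrite ler_wpM2l//.
    by clear - ra ra' ua up se2 se3 e2 tt; lra.
  have q3 : gamma2 / 2 * (n0 (ev n.+1) + n0 (ev n)) <= gamma2 / 2 * (sE * (4 * tau)).
    by rewrite ler_wpM2l ?divr_ge0//; clear - va va' se2 se3; lra.
  have q4 : (n0 (ev n.+1) + n0 (ev n)) / tau <= 4 * sE * tau.
    by rewrite ler_pdivrMr//; clear - va va' se2; lra.
  by rewrite C4E; clear - r2 q1 q2 q3 q4; lra.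
split => //.
have sub0 (s1 : seq index) x : 0 <= \sum_(j <- s1) `|x j| :> R by apply: sumr_ge0.
have [Nt|Nt] := leP (N%:R `^ (- m)) (tau ^+ 2).
  have e2 : eps <= 2 * tau ^+ 2 by rewrite /eps; clear - Nt; lra.
  have lb := reg1 Nt.
  (* Half of the budget goes to the frequencies of the fixed box [N1], controlled by the energy
     through the inverse inequality with factor [M1], and half to the tail. *)
  rewrite (sum_J_sub _ NN1) (splitr 1); apply: lerD.
    have W'0 : 0 <= M1 * (sE * eps) by rewrite mulr_ge0.
    apply: le_trans (HS N1 (eu n.+1) _ W'0 _) _.
      rewrite [leRHS]exprMn.
      apply: (@le_trans _ _ (M1 ^+ 2 * \sum_(j <- J R N1) eu n.+1 j ^+ 2)).
        rewrite mulr_sumr big_seq [leRHS]big_seq; apply: ler_sum => j.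
        rewrite mem_J => jN; rewrite ler_wpM2r ?sqr_ge0// M1E -powR_mulrn ?powR_ge0// -powRrM mulrC.
        apply: wt_le_box => //; move: jN; rewrite sseqP.
        by case: (N1) => // /andP[/(le_trans (normr_ge0 _))]; clear; lra.
      rewrite ler_wpM2l ?sqr_ge0//; apply: (@le_trans _ _ (n0 (eu n.+1) ^+ 2)).
        rewrite sqr_vn// /vd (sum_J_sub _ NN1).
        apply: ler_wpDr; first by apply: sumr_ge0 => j _; rewrite mul1r -expr2 sqr_ge0.
        by apply: ler_sum => j _; rewrite mul1r expr2.
      by rewrite lerXn2r ?nnegrE.
    by have := ler_wpM2l SMs e2; have := ler_wpM2l tSM t1; rewrite expr2; clear - tS; lra.
  apply: le_trans (tailN1 N (eu n.+1) W NN1 W0 _) _; last first.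
    by rewrite mulrC ler_pdivrMr//; clear - W0; lra.
  rewrite WW; apply: (@le_trans _ _ (2 `^ alpha * (n0 (eu n.+1) ^+ 2 +
      n0 (fun j => lam alpha j * eu n.+1 j) ^+ 2))).
    rewrite !sqr_vn// /vd -big_split mulr_sumr; apply: ler_sum => j _ /=.
    have := wt_le_freq j.1 (ltW (lt_trans ltr01 alpha1)).
    move=> /(ler_wpM2r (sqr_ge0 (eu n.+1 j))) /le_trans; apply.
    by rewrite le_eqVlt; apply/orP; left; apply/eqP; rewrite /lam; ring.
  rewrite ler_wpM2l ?powR_ge0//; apply: lerD.
    rewrite -sEE; have -> : 4 * sE ^+ 2 = (2 * sE) ^+ 2 by ring.
    rewrite lerXn2r ?nnegrE ?mulr_ge0//; apply: le_trans ua' _; rewrite mulrC ler_wpM2r//.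
    by have := ler_wpM2l (ltW t0) t1; rewrite expr2 in e2; clear - e2 t1; lra.
  rewrite lerXn2r ?nnegrE ?mulr_ge0//; apply: le_trans lb _.
  rewrite mulrCA ler_wpM2l// /tau mulrCA ler_piMr// ler_pdivrMr// mul1r ler_nat//.
(* Now tau^2 < N^-m <= N^-alpha, where alpha <= m is used; the loss N^al' of the inverse inequality
   is more than compensated. *)
have e2 : eps <= 2 * N%:R `^ (- alpha).
  have : N%:R `^ (- m) <= N%:R `^ (- alpha) :> R by rewrite ler_powR ?ler1n// lerN2.
  by rewrite /eps; move: Nt; clear; lra.
have W'0 : 0 <= N%:R `^ al' * (sE * eps) by rewrite mulr_ge0 ?powR_ge0.
apply: le_trans (HS N (eu n.+1) _ W'0 _) _.
  rewrite [leRHS]exprMn.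
  apply: (@le_trans _ _ ((N%:R `^ al') ^+ 2 * n0 (eu n.+1) ^+ 2)); last first.
    by rewrite ler_wpM2l ?sqr_ge0// lerXn2r ?nnegrE.
  rewrite sqr_vn// /vd mulr_sumr big_seq [leRHS]big_seq; apply: ler_sum => j.
  rewrite mem_J mul1r -expr2 => jN.
  rewrite ler_wpM2r ?sqr_ge0// -powR_mulrn ?powR_ge0// -powRrM mulrC.
  exact: wt_le_box.
apply: (@le_trans _ _ (2 * S * sE * N%:R `^ (- q))).
  have -> : N%:R `^ (- q) = N%:R `^ al' * N%:R `^ (- alpha) :> R.
    rewrite -powRD; [|by rewrite (gt_eqF NR) implybT]; by congr (_ `^ _); rewrite qE al'E; clear; lra.
  have x0 : 0 <= S * N%:R `^ al' * sE by rewrite !mulr_ge0 ?powR_ge0 ?(ltW S0).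
  by have := ler_wpM2l x0 e2; clear; lra.
rewrite powRN ler_pdivrMr ?powR_gt0// mul1r.
have y0 : 0 <= 4 * S * sE by rewrite !mulr_ge0 ?(ltW S0).
have : 4 * S * sE <= N%:R `^ q.
  have -> : 4 * S * sE = ((4 * S * sE) `^ q^-1) `^ q by rewrite -powRrM mulVf ?gt_eqF// powRr1.
  apply: (ge0_ler_powR (ltW q0)); rewrite ?nnegrE ?powR_ge0//.
  by apply: le_trans hk _; rewrite ler_nat.
by move: y0; clear; lra.
Qed.

(** * Differences in time *)

Section IntervalDerivative.
Context {R : realType}.
Implicit Types (f g : R -> R) (p q t s e B : R).

(** Differentiability relative to a closed interval, one-sided at its ends, written as a first-order
    expansion: the form that derivatives in L^2 transmit to scalar products. *)
Definition dder p q f g : Prop := forall t, p <= t <= q -> forall e, 0 < e ->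
  exists2 eta, 0 < eta & forall s, p <= s <= q -> `|s - t| < eta ->
    `|f s - f t - g t * (s - t)| <= e * `|s - t|.

Lemma dderD p q f g f' g' : dder p q f g -> dder p q f' g' ->
  dder p q (fun t => f t + f' t) (fun t => g t + g' t).
Proof.
move=> d1 d2 t tpq e e0; have e2 : 0 < e / 2 by rewrite divr_gt0.
have [n1 n10 h1] := d1 t tpq _ e2; have [n2 n20 h2] := d2 t tpq _ e2.
exists (Num.min n1 n2); first by rewrite lt_min n10.
move=> s spq; rewrite lt_min => /andP[s1 s2].
have := h1 s spq s1; have := h2 s spq s2.
have := ler_normD (f s - f t - g t * (s - t)) (f' s - f' t - g' t * (s - t)).
have -> : f s - f t - g t * (s - t) + (f' s - f' t - g' t * (s - t)) =
  f s + f' s - (f t + f' t) - (g t + g' t) * (s - t) by ring.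
lra.
Qed.

Lemma dderZ p q r f g : dder p q f g ->
  dder p q (fun t => r * f t) (fun t => r * g t).
Proof.
move=> d1 t tpq e e0; have r1 : 0 < `|r| + 1 by rewrite ltr_wpDl.
have [n1 n10 h1] := d1 t tpq _ (divr_gt0 e0 r1); exists n1 => // s spq st.
have -> : r * f s - r * f t - r * g t * (s - t) = r * (f s - f t - g t * (s - t)) by ring.
rewrite normrM; have := ler_wpM2l (normr_ge0 r) (h1 s spq st); move=> /le_trans; apply.
rewrite mulrA ler_wpM2r// mulrA ler_pdivrMr// mulrC ler_wpM2l ?(ltW e0)//.
by rewrite lerDl.
Qed.

Lemma dder_cst p q c : dder p q (fun=> c) (fun=> 0).
Proof.
move=> t _ e e0; exists 1 => // s _ _.
by rewrite subrr mul0r subrr normr0 mulr_ge0// ltW.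
Qed.

Lemma dder_id p q : dder p q id (fun=> 1).
Proof.
move=> t _ e e0; exists 1 => // s _ _.
by rewrite mul1r subrr normr0 mulr_ge0// ltW.
Qed.

Lemma dder_sum p q (I : Type) (s : seq I) (f g : I -> R -> R) :
  (forall i, dder p q (f i) (g i)) ->
  dder p q (fun t => \sum_(i <- s) f i t) (fun t => \sum_(i <- s) g i t).
Proof.
move=> fg; elim: s => [|i s IH].
  have E (F : I -> R -> R) : (fun t => \sum_(i <- [::]) F i t) = fun=> 0.
    by apply/funext => t; rewrite big_nil.
  by rewrite !E; exact: dder_cst.
have E (F : I -> R -> R) : (fun t => \sum_(i <- i :: s) F i t) =
    fun t => F i t + \sum_(i <- s) F i t.
  by apply/funext => t; rewrite big_cons.
by rewrite !E; exact: dderD.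
Qed.

Lemma dder_shift p q p' q' t f g : p <= t + p' -> t + q' <= q -> dder p q f g ->
  dder p' q' (fun s => f (t + s)) (fun s => g (t + s)).
Proof.
move=> tp tq d1 s spq e e0; have [|n1 n10 h1] := d1 (t + s) _ e e0; first lra.
exists n1 => // s' s'pq ss'; have E : t + s' - (t + s) = s' - s by ring.
by have := h1 (t + s'); rewrite E; apply => //; lra.
Qed.

Lemma dder_reflect p q p' q' t f g : p <= t - q' -> t - p' <= q -> dder p q f g ->
  dder p' q' (fun s => f (t - s)) (fun s => - g (t - s)).
Proof.
move=> tp tq d1 s spq e e0; have [|n1 n10 h1] := d1 (t - s) _ e e0; first lra.
exists n1 => // s' s'pq ss'; have E : t - s' - (t - s) = - (s' - s) by ring.
by have := h1 (t - s'); rewrite E mulrN mulNr normrN opprK; apply => //; lra.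
Qed.

Lemma dder_continuous p q f g : dder p q f g -> {within `[p, q], continuous f}.
Proof.
move=> d1; apply/subspace_continuousP => t /=; rewrite in_itv/= => tpq.
apply/cvgrPdist_lt => e e0.
have [n1 n10 h1] := d1 t tpq 1 ltr01; have g1 : 0 < `|g t| + 2 by rewrite ltr_wpDl.
have dpos : 0 < Num.min n1 (e / (`|g t| + 2)) by rewrite lt_min n10 divr_gt0.
rewrite near_withinE; near=> s => /=; rewrite in_itv/= => spq.
have : `|t - s| < Num.min n1 (e / (`|g t| + 2)) by near: s; exact: cvgr_dist_lt.
rewrite lt_min distrC => /andP[sn1 se].
have := h1 s spq sn1; rewrite mul1r => h2.
rewrite distrC; have -> : f s - f t = (f s - f t - g t * (s - t)) + g t * (s - t) by ring.
apply: le_lt_trans (ler_normD _ _) _; rewrite normrM.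
move: se; rewrite ltr_pdivlMr//; have := normr_ge0 (s - t); have := normr_ge0 (g t); nra.
Unshelve. all: by end_near. Qed.

Lemma dder_is_derive p q f g t : p < t < q -> dder p q f g -> is_derive t 1 f (g t).
Proof.
move=> /andP[pt tq] d1; have tpq : p <= t <= q by rewrite !ltW.
have cv : h^-1 *: (f (h *: (1 : R) + t) - f t) @[h --> 0^'] --> (g t : R).
  apply/cvgrPdist_le => e e0; have [n1 n10 h1] := d1 t tpq e e0.
  have dpos : 0 < Num.min n1 (Num.min (t - p) (q - t)) by rewrite !lt_min n10 !subr_gt0 pt.
  near=> h; have hn0 : h != 0 by near: h; exact: nbhs_dnbhs_neq.
  have : `|h| < Num.min n1 (Num.min (t - p) (q - t)).
    by near: h; exact: dnbhs0_lt.
  rewrite !lt_min !ltr_norml => /andP[hn /andP[hp hq]].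
  rewrite /GRing.scale/= mulr1 distrC.
  have -> : h^-1 * (f (h + t) - f t) - g t = h^-1 * (f (h + t) - f t - g t * (h + t - t)) by field.
  rewrite normrM normfV ler_pdivrMl ?normr_gt0//.
  rewrite [leRHS]mulrC; have := h1 (h + t); have -> : h + t - t = h by ring.
  by apply; rewrite ?ltr_norml//; lra.
have dv : derivable f t 1 by apply/cvg_ex; exists (g t).
by apply: DeriveDef => //; apply: (@cvg_lim) => //.
Unshelve. all: by end_near. Qed.

Lemma dder_mean_value p q f g B : p <= q -> dder p q f g ->
  (forall t, p < t < q -> `|g t| <= B) -> `|f q - f p| <= B * (q - p).
Proof.
rewrite le_eqVlt => /predU1P[->|pq] d1 gB; first by rewrite !subrr normr0 mulr0.
have dI t : t \in `]p, q[ -> is_derive t 1 f (g t).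
  by rewrite in_itv/= => tpq; exact: dder_is_derive tpq d1.
have [t] := MVT pq dI (dder_continuous d1).
rewrite in_itv/= => tpq ->; rewrite normrM [X in _ * X]ger0_norm ?subr_ge0 ?(ltW pq)//.
by rewrite ler_wpM2r ?gB// subr_ge0 ltW.
Qed.

(** Mean value inequality for s |-> f (t + s) - f (t - s) - 2 s g t. Only a second difference of [g]
    is required, and no second derivative of [g]. *)
Lemma dder_midpoint T f g t del M : 0 <= del -> 0 <= t - del -> t + del <= T ->
  dder 0 T f g ->
  (forall s, 0 < s < del -> `|g (t + s) + g (t - s) - 2 * g t| <= M) ->
  `|f (t + del) - f (t - del) - 2 * del * g t| <= M * del.
Proof.
move=> d0 td tT d1 gM.
have da : dder 0 del (fun s => f (t + s)) (fun s => g (t + s)).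
  by apply: (dder_shift _ _ d1); lra.
have db : dder 0 del (fun s => f (t - s)) (fun s => - g (t - s)).
  by apply: (dder_reflect _ _ d1); lra.
have dc := dderD (dderD da (dderZ (-1) db)) (dderZ (- (2 * g t)) (@dder_id 0 del)).
have := dder_mean_value (B := M) d0 dc.
rewrite !subr0 !addr0 /= => h.
have -> : f (t + del) - f (t - del) - 2 * del * g t = (f (t + del) + -1 * f (t - del) +
  - (2 * g t) * del - (f t + -1 * f t + - (2 * g t) * 0)) by ring.
apply: h => s sd; have := gM s sd.
by congr (`|_| <= _); ring.
Qed.

Lemma dder_second_diff T f g t del M : 0 <= del -> 0 <= t - del -> t + del <= T ->
  dder 0 T f g ->
  (forall s, 0 < s < del -> `|g (t + s) - g (t - s)| <= M) ->
  `|f (t + del) + f (t - del) - 2 * f t| <= M * del.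
Proof.
move=> d0 td tT d1 gM.
have da : dder 0 del (fun s => f (t + s)) (fun s => g (t + s)).
  by apply: (dder_shift _ _ d1); lra.
have db : dder 0 del (fun s => f (t - s)) (fun s => - g (t - s)).
  by apply: (dder_reflect _ _ d1); lra.
have := dder_mean_value (B := M) d0 (dderD da db).
rewrite !subr0 !addr0 /= => h.
have -> : f (t + del) + f (t - del) - 2 * f t =
  f (t + del) + f (t - del) - (f t + f t) by ring.
exact: h.
Qed.

Lemma dder_taylor1 T f g t M : 0 <= t <= T -> dder 0 T f g ->
  (forall s, 0 < s < t -> `|g s - g 0| <= M) ->
  `|f t - f 0 - t * g 0| <= M * t.
Proof.
move=> /andP[t0 tT] d1 gM.
have da : dder 0 t (fun s => f (0 + s)) (fun s => g (0 + s)).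
  by apply: (dder_shift _ _ d1); lra.
have := dder_mean_value (B := M) t0 (dderD da (dderZ (- g 0) (@dder_id 0 t))).
rewrite !add0r !subr0 !mulr0 !addr0 /= => h.
have -> : f t - f 0 - t * g 0 = f t + - g 0 * t - f 0 by ring.
by apply: h => s st; rewrite add0r mulr1; exact: gM.
Qed.

End IntervalDerivative.

(** * Mean value estimates for families of coefficients *)

Section VectorTaylor.
Context {R : realType} (I : eqType).
Variables (s : seq I) (om : I -> R) (T : R).
Hypothesis om0 : forall i, 0 <= om i.
Variables (x y : R -> I -> R).
Hypothesis dxy : forall i, dder 0 T (x^~ i) (y^~ i).
Implicit Types (phi : I -> R) (t del M : R).

Lemma dder_vd phi : dder 0 T (fun t => vd s om (x t) phi) (fun t => vd s om (y t) phi).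
Proof.
have d1 i : dder 0 T (fun t => om i * (x t i * phi i)) (fun t => om i * (y t i * phi i)).
  have := dderZ (om i * phi i) (dxy i); congr dder; apply/funext => t; ring.
exact: (dder_sum s d1).
Qed.

(** No mean value theorem holds for vectors; the scalar one is applied to the product with the fixed
    vector [z] that is to be bounded, and [vn_dual] removes one factor. *)
Lemma vn_midpoint t del M : 0 <= del -> 0 <= M -> 0 <= t - del -> t + del <= T ->
  (forall r, 0 < r < del -> vn s om (fun i => y (t + r) i + y (t - r) i - 2 * y t i) <= M) ->
  vn s om (fun i => x (t + del) i - x (t - del) i - 2 * del * y t i) <= M * del.
Proof.
move=> d0 M0 td tT yM; set z := (fun i => _).
apply: (vn_dual om0); first exact: mulr_ge0.
have := dder_midpoint (M := M * vn s om z) d0 td tT (dder_vd z).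
have -> : vd s om z z = vd s om (x (t + del)) z - vd s om (x (t - del)) z -
    2 * del * vd s om (y t) z by rewrite {1}/z !vdBl vdZl.
move=> h; rewrite [leRHS]mulrAC; apply: le_trans (ler_norm _) _; apply: h => r rd.
have := vd_le_vn s om0 (fun i => y (t + r) i + y (t - r) i - 2 * y t i) z.
rewrite vdBl vdDl vdZl => /le_trans; apply.
by rewrite ler_wpM2r ?vn_ge0// yM.
Qed.

Lemma vn_second_diff t del M : 0 <= del -> 0 <= M -> 0 <= t - del -> t + del <= T ->
  (forall r, 0 < r < del -> vn s om (fun i => y (t + r) i - y (t - r) i) <= M) ->
  vn s om (fun i => x (t + del) i + x (t - del) i - 2 * x t i) <= M * del.
Proof.
move=> d0 M0 td tT yM; set z := (fun i => _).
apply: (vn_dual om0); first exact: mulr_ge0.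
have := dder_second_diff (M := M * vn s om z) d0 td tT (dder_vd z).
have -> : vd s om z z = vd s om (x (t + del)) z + vd s om (x (t - del)) z -
    2 * vd s om (x t) z by rewrite {1}/z !vdBl vdDl vdZl.
move=> h; rewrite [leRHS]mulrAC; apply: le_trans (ler_norm _) _; apply: h => r rd.
have := vd_le_vn s om0 (fun i => y (t + r) i - y (t - r) i) z.
rewrite vdBl => /le_trans; apply.
by rewrite ler_wpM2r ?vn_ge0// yM.
Qed.

Lemma vn_lipschitz p q M : 0 <= p -> p <= q -> q <= T -> 0 <= M ->
  (forall t, 0 <= t <= T -> vn s om (y t) <= M) ->
  vn s om (fun i => x q i - x p i) <= M * (q - p).
Proof.
move=> p0 pq qT M0 yM; set z := (fun i => _).
apply: (vn_dual om0); first by rewrite mulr_ge0// subr_ge0.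
have dz : dder p q (fun t => vd s om (x (0 + t)) z) (fun t => vd s om (y (0 + t)) z).
  by apply: (dder_shift _ _ (dder_vd z)); lra.
have := dder_mean_value (B := M * vn s om z) pq dz.
have -> : vd s om z z = vd s om (x q) z - vd s om (x p) z by rewrite {1}/z vdBl.
rewrite !add0r => h; rewrite [leRHS]mulrAC; apply: le_trans (ler_norm _) _; apply: h => t tpq.
rewrite add0r; apply: le_trans (vd_le_vn s om0 _ _) _.
by rewrite ler_wpM2r ?vn_ge0// yM//; lra.
Qed.

Lemma vn_taylor1 t M : 0 <= t <= T -> 0 <= M ->
  (forall r, 0 < r < t -> vn s om (fun i => y r i - y 0 i) <= M) ->
  vn s om (fun i => x t i - x 0 i - t * y 0 i) <= M * t.
Proof.
move=> tT M0 yM; set z := (fun i => _).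
apply: (vn_dual om0); first by rewrite mulr_ge0//; lra.
have := dder_taylor1 (M := M * vn s om z) tT (dder_vd z).
have -> : vd s om z z = vd s om (x t) z - vd s om (x 0) z - t * vd s om (y 0) z.
  by rewrite {1}/z !vdBl vdZl.
move=> h; rewrite [leRHS]mulrAC; apply: le_trans (ler_norm _) _; apply: h => r rt.
have := vd_le_vn s om0 (fun i => y r i - y 0 i) z; rewrite vdBl => /le_trans; apply.
by rewrite ler_wpM2r ?vn_ge0// yM.
Qed.

End VectorTaylor.

(** * The nonlinearity and the modified energy *)

Section RealTaylor.
Context {R : realType}.
Implicit Types (G : R -> R) (x y M K : R).

Lemma mean_value_between G G' x y : (forall t : R, is_derive t 1 G (G' t)) ->
  exists2 c, `|c - x| <= `|y - x| /\ Num.min x y <= c <= Num.max x y &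
    G y - G x = G' c * (y - x).
Proof.
move=> dG; have cG : continuous G.
  by move=> t; apply: differentiable_continuous; apply/derivable1_diffP/ex_derive.
have [xy|yx|->] := ltgtP x y.
- have [c] := MVT xy (fun t _ => dG t) (continuous_subspaceT cG).
  rewrite in_itv/= => /andP[xc cy] E; exists c => //.
  split; last by apply/andP; split; lra.
  by rewrite !ger0_norm ?subr_ge0 ?(ltW xc) ?(ltW xy)//; lra.
- have [c] := MVT yx (fun t _ => dG t) (continuous_subspaceT cG).
  rewrite in_itv/= => /andP[yc cx] E; exists c; last by rewrite -opprB E; ring.
  split; last by apply/andP; split; lra.
  by rewrite !ler0_norm ?subr_le0 ?(ltW cx) ?(ltW yx)//; lra.
- by exists y; rewrite ?subrr ?mulr0// !lexx.
Qed.

Lemma lipschitz_of_derive G G' M K x y : (forall t : R, is_derive t 1 G (G' t)) ->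
  (forall t, `|t| <= M -> `|G' t| <= K) -> `|x| <= M -> `|y| <= M ->
  `|G y - G x| <= K * `|y - x|.
Proof.
move=> dG GK xM yM.
have /andP[x1 x2] : - M <= x <= M by rewrite -ler_norml.
have /andP[y1 y2] : - M <= y <= M by rewrite -ler_norml.
have [c [_ cxy] ->] := mean_value_between x y dG.
rewrite normrM ler_wpM2r// GK// ler_norml.
by move: cxy; have [_|_] := leP x y => /andP[? ?]; apply/andP; split; lra.
Qed.

Lemma taylor2_of_derive G G' G'' M K x y : (forall t : R, is_derive t 1 G (G' t)) ->
  (forall t : R, is_derive t 1 G' (G'' t)) ->
  (forall t, `|t| <= M -> `|G'' t| <= K) -> `|x| <= M -> `|y| <= M ->
  `|G y - G x - G' x * (y - x)| <= K * (y - x) ^+ 2.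
Proof.
move=> dG dG' GK xM yM; have [c [cx cxy] ->] := mean_value_between x y dG.
have cM : `|c| <= M.
  move: xM yM cxy; rewrite !ler_norml => /andP[x1 x2] /andP[y1 y2].
  by have [_|_] := leP x y => /andP[? ?]; apply/andP; split; lra.
rewrite -mulrBl normrM -[_ ^+ 2]real_normK ?num_real// expr2 mulrA ler_wpM2r//.
apply: le_trans (lipschitz_of_derive dG' GK xM cM) _.
by rewrite ler_wpM2l//; exact: le_trans (normr_ge0 _) (GK _ xM).
Qed.

Lemma continuous_bounded_itv G M : continuous G -> 0 <= M ->
  exists2 K, 0 < K & forall t, `|t| <= M -> `|G t| <= K.
Proof.
move=> cG M0; have MM : - M <= M by lra.
have cN : {within `[- M, M], continuous (fun t => `|G t|)}.
  by apply: continuous_subspaceT => t; apply: continuous_comp; [exact: cG|exact: norm_continuous].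
have [c _ cmax] := EVT_max MM cN; exists (`|G c| + 1); first by rewrite ltr_wpDl.
move=> t; rewrite ler_norml => tM; have := cmax t; rewrite in_itv/= => /(_ tM); lra.
Qed.

End RealTaylor.

(** * Local bounds for [F] and its derivative *)

Section Nonlinearity.
Context {R : realType}.
Variables (F : R -> R) (C0 : R).
Hypothesis hF : (forall (k : nat) (s : R), (k < 3)%N -> derivable (derive1n k F) s 1) /\
            continuous (derive1n 3 F).
Implicit Types (x y M K : R).

Local Notation F1 := (derive1 F).
Local Notation F2 := (derive1n 2 F).

Lemma is_derive_derive1n k (t : R) : (k < 3)%N ->
  is_derive t 1 (derive1n k F) (derive1n k.+1 F t).
Proof.
by move=> k3; apply: DeriveDef; [exact: hF.1|rewrite -derive1E].
Qed.

Lemma continuous_derive1n k : (k < 4)%N -> continuous (derive1n k F).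
Proof.
rewrite ltnS leq_eqVlt => /predU1P[->|k3]; first exact: hF.2.
move=> t; apply: differentiable_continuous; apply/derivable1_diffP; exact: hF.1.
Qed.

(** All constants are relative to [-M, M], as no global Lipschitz condition is available. The third
    derivative of [F] is behind the last clause, which gives second order in time for [F'(u)]. *)
Record nonlin_bounds M K : Prop := NonlinBounds {
  nb_K : 0 < K;
  nb_F : forall x, `|x| <= M -> `|F x| <= K;
  nb_F1 : forall x, `|x| <= M -> `|F1 x| <= K;
  nb_Flip : forall x y, `|x| <= M -> `|y| <= M -> `|F y - F x| <= K * `|y - x|;
  nb_F1lip : forall x y, `|x| <= M -> `|y| <= M -> `|F1 y - F1 x| <= K * `|y - x|;
  nb_Ftay : forall x y, `|x| <= M -> `|y| <= M ->
    `|F y - F x - F1 x * (y - x)| <= K * (y - x) ^+ 2;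
  nb_Fdd : forall x y z, `|x| <= M -> `|y| <= M -> `|z| <= M ->
    `|F y + F z - 2 * F x| <= K * (`|y + z - 2 * x| + (y - x) ^+ 2 + (z - x) ^+ 2);
  nb_F1dd : forall x y z, `|x| <= M -> `|y| <= M -> `|z| <= M ->
    `|F1 y + F1 z - 2 * F1 x| <= K * (`|y + z - 2 * x| + (y - x) ^+ 2 + (z - x) ^+ 2) }.

Lemma second_diff_of_taylor (G : R -> R) g K x y z : `|g| <= K ->
  `|G y - G x - g * (y - x)| <= K * (y - x) ^+ 2 ->
  `|G z - G x - g * (z - x)| <= K * (z - x) ^+ 2 ->
  `|G y + G z - 2 * G x| <= K * (`|y + z - 2 * x| + (y - x) ^+ 2 + (z - x) ^+ 2).
Proof.
move=> gK h1 h2.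
have -> : G y + G z - 2 * G x = (G y - G x - g * (y - x)) + (G z - G x - g * (z - x)) +
  g * (y + z - 2 * x) by ring.
apply: le_trans (ler_normD _ _) _.
have := ler_normD (G y - G x - g * (y - x)) (G z - G x - g * (z - x)).
have := ler_wpM2r (normr_ge0 (y + z - 2 * x)) gK; rewrite -normrM; lra.
Qed.

Lemma nonlin_bounds_ex M : 0 <= M -> exists K, nonlin_bounds M K.
Proof.
move=> M0.
have [K0 K00 F0K] := continuous_bounded_itv (@continuous_derive1n 0 isT) M0.
have [K1 K10 F1K] := continuous_bounded_itv (@continuous_derive1n 1 isT) M0.
have [K2 K20 F2K] := continuous_bounded_itv (@continuous_derive1n 2 isT) M0.
have [K3 K30 F3K] := continuous_bounded_itv (@continuous_derive1n 3 isT) M0.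
pose K := K0 + K1 + K2 + K3.
have [k0 k1 k2 k3] : [/\ K0 <= K, K1 <= K, K2 <= K & K3 <= K] by rewrite /K; split; lra.
have B0 x : `|x| <= M -> `|F x| <= K by move=> /F0K h; exact: le_trans h k0.
have B1 x : `|x| <= M -> `|F1 x| <= K by move=> /F1K h; exact: le_trans h k1.
have B2 x : `|x| <= M -> `|F2 x| <= K by move=> /F2K h; exact: le_trans h k2.
have B3 x : `|x| <= M -> `|derive1n 3 F x| <= K by move=> /F3K h; exact: le_trans h k3.
have d0 (t : R) : is_derive t 1 F (F1 t) by exact: (@is_derive_derive1n 0).
have d1 (t : R) : is_derive t 1 F1 (F2 t) by exact: (@is_derive_derive1n 1).
have d2 (t : R) : is_derive t 1 F2 (derive1n 3 F t) by exact: (@is_derive_derive1n 2).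
have T0 x y : `|x| <= M -> `|y| <= M -> `|F y - F x - F1 x * (y - x)| <= K * (y - x) ^+ 2.
  by move=> xM yM; exact: taylor2_of_derive d0 d1 B2 xM yM.
have T1 x y : `|x| <= M -> `|y| <= M -> `|F1 y - F1 x - F2 x * (y - x)| <= K * (y - x) ^+ 2.
  by move=> xM yM; exact: taylor2_of_derive d1 d2 B3 xM yM.
exists K; split => //.
- by rewrite /K; lra.
- by move=> x y xM yM; exact: lipschitz_of_derive d0 B1 xM yM.
- by move=> x y xM yM; exact: lipschitz_of_derive d1 B2 xM yM.
- move=> x y z xM yM zM; apply: second_diff_of_taylor (T0 _ _ xM yM) (T0 _ _ xM zM); exact: B1.
- move=> x y z xM yM zM; apply: second_diff_of_taylor (T1 _ _ xM yM) (T1 _ _ xM zM); exact: B2.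
Qed.

End Nonlinearity.

(** * Composition with the nonlinearity, and the energy functional *)

Section Superposition.
Context {R : realType}.
Variables (a b c d : R).
Hypotheses (hab : b = a + 2 * pi) (hcd : d = c + 2 * pi).
Let Om : set (plane R) := `]a, b[ `*` `]c, d[.
Let mD : measurable Om := measurable_cell a b c d.
Let fD : (leb2 Om < +oo)%E := cell_measure_lty hab hcd.
Variables (F : R -> R) (C0 : R).
Hypothesis hF : (forall (k : nat) (s : R), (k < 3)%N -> derivable (derive1n k F) s 1) /\
            continuous (derive1n 3 F).
Hypothesis hC0 : forall w, bounded_per Om w -> 0 < energy Om F C0 w.
Variables (M K : R).
Hypotheses (M0 : 0 <= M) (nb : nonlin_bounds F M K).
Implicit Types (f g h : plane R -> R).
Local Notation L2 := (L2 leb2 Om).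
Local Notation dot := (L2dot leb2 Om).
Local Notation nrm := (L2nrm leb2 Om).
Local Notation F1 := (derive1 F).
Local Notation E := (energy Om F C0).

(** Boundedness almost everywhere, since the exact solution is only bounded through its
    coefficients. *)
Definition aebdd (B : R) f : Prop :=
  measurable_fun Om f /\ {ae leb2, forall x, Om x -> `|f x| <= B}.

Lemma aebdd_L2 B f : aebdd B f -> L2 f.
Proof. by move=> [mf fB]; exact: (L2_ae_bounded mD fD mf fB). Qed.

Let mcomp (G : R -> R) f : continuous G -> measurable_fun Om f ->
  measurable_fun Om (fun x => G (f x)).
Proof.
by move=> cG mf; apply: (measurableT_comp (f := G)) => //; exact: continuous_measurable_fun.
Qed.

Let cF : continuous F. Proof. exact: (@continuous_derive1n _ _ hF 0 isT). Qed.
Let cF1 : continuous F1. Proof. exact: (@continuous_derive1n _ _ hF 1 isT). Qed.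

Lemma aebdd_F f : aebdd M f -> aebdd K (fun x => F (f x)).
Proof.
move=> [mf fM]; split; first exact: mcomp.
by apply: filterS fM => x fx Dx; apply: (nb_F nb); exact: fx.
Qed.

Lemma aebdd_F1 f : aebdd M f -> aebdd K (fun x => F1 (f x)).
Proof.
move=> [mf fM]; split; first exact: mcomp.
by apply: filterS fM => x fx Dx; apply: (nb_F1 nb); exact: fx.
Qed.

Let pi0 : 0 < 2 * pi :> R. Proof. by rewrite mulr_gt0 ?pi_gt0. Qed.

Lemma nrm_cst r : nrm (fun=> r) = 2 * pi * `|r|.
Proof.
rewrite /L2nrm /L2dot Rintegral_cst// (cell_measure hab hcd)/=.
by rewrite -expr2 -exprMn sqrtr_sqr normrM mulrC ger0_norm// ltW.
Qed.

Lemma nrm_aebdd B f : 0 <= B -> aebdd B f -> nrm f <= 2 * pi * B.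
Proof.
move=> B0 fB; rewrite -[X in _ * X](ger0_norm B0) -nrm_cst.
apply: nrm_ae_le => //; [exact: aebdd_L2 fB|exact: L2_cst|].
by apply: filterS fB.2 => x fx Dx; rewrite (ger0_norm B0); exact: fx.
Qed.

Lemma Rintegral_le_nrm f g : L2 f -> L2 g ->
  {ae leb2, forall x, Om x -> `|f x| <= g x} ->
  `|\int[leb2]_(x in Om) f x| <= 2 * pi * nrm g.
Proof.
move=> f2 g2 fg; have fi := L2_integrable mD fD f2; have gi := L2_integrable mD fD g2.
have h : `|\int[leb2]_(x in Om) f x| <= \int[leb2]_(x in Om) g x.
  rewrite ler_norml; apply/andP; split.
    rewrite lerNl -mulN1r -RintegralZl//; apply: ae_le_Rintegral => //.
      by apply: L2_integrable => //; exact: L2Z.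
    apply: filterS fg => x fx Dx; have := fx Dx; rewrite ler_norml; lra.
  apply: ae_le_Rintegral => //; apply: filterS fg => x fx Dx.
  by apply: le_trans (ler_norm _) (fx Dx).
apply: le_trans h _; rewrite (Rintegral_dot1 leb2 Om).
apply: le_trans (ler_norm _) _.
apply: le_trans (dot_le_nrm mD g2 (L2_cst mD fD 1)) _.
by rewrite nrm_cst normr1 mulr1 mulrC.
Qed.

Lemma energyB f g : aebdd M f -> aebdd M g ->
  E f - E g = \int[leb2]_(x in Om) (F (f x) - F (g x)).
Proof.
move=> fM gM; rewrite /energy RintegralB//; first by ring.
  exact/(L2_integrable mD fD)/(aebdd_L2 (aebdd_F fM)).
exact/(L2_integrable mD fD)/(aebdd_L2 (aebdd_F gM)).
Qed.

Lemma energy_lip f g : aebdd M f -> aebdd M g ->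
  `|E f - E g| <= 2 * pi * K * nrm (fun x => f x - g x).
Proof.
move=> fM gM; rewrite energyB//.
have f2 := aebdd_L2 fM; have g2 := aebdd_L2 gM; have fg2 := L2B mD f2 g2.
have afg : L2 (fun x => K * `|f x - g x|).
  apply: L2Z => //; apply: (L2_ae_dom mD _ fg2); last by apply: aeW => x _; rewrite normr_id.
  by apply: measurableT_comp => //; have [] := fg2.
apply: le_trans (Rintegral_le_nrm (g := fun x => K * `|f x - g x|) _ afg _) _.
- exact: (L2B mD (aebdd_L2 (aebdd_F fM)) (aebdd_L2 (aebdd_F gM))).
- apply: filterS2 fM.2 gM.2 => x fx gx Dx.
  by apply: (nb_Flip nb); [exact: gx|exact: fx].
rewrite -[leRHS]mulrA ler_wpM2l ?(ltW pi0)//.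
have K0 := ltW (nb_K nb); have := nrmZ mD K fg2; rewrite ger0_norm// => <-.
apply: nrm_ae_le => //; first exact: L2Z.
by apply: aeW => x _; rewrite !normrM normr_id.
Qed.

Lemma nrm_F1_lip f g : aebdd M f -> aebdd M g ->
  nrm (fun x => F1 (f x) - F1 (g x)) <= K * nrm (fun x => f x - g x).
Proof.
move=> fM gM; have K0 := ltW (nb_K nb).
have fg2 := L2B mD (aebdd_L2 fM) (aebdd_L2 gM).
rewrite -[X in X * _](ger0_norm K0) -nrmZ//; apply: nrm_ae_le => //.
- exact: (L2B mD (aebdd_L2 (aebdd_F1 fM)) (aebdd_L2 (aebdd_F1 gM))).
- exact: L2Z.
apply: filterS2 fM.2 gM.2 => x fx gx Dx; rewrite normrM (ger0_norm K0).
by apply: (nb_F1lip nb); [exact: gx|exact: fx].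
Qed.

Lemma sqrt_lip (s0 x y : R) : 0 < s0 -> s0 ^+ 2 <= x -> s0 ^+ 2 <= y ->
  `|Num.sqrt x - Num.sqrt y| <= `|x - y| / (2 * s0).
Proof.
move=> s00 sx sy; have s02 : 0 <= s0 ^+ 2 by exact: sqr_ge0.
have sX : s0 <= Num.sqrt x by rewrite -(ger0_norm (ltW s00)) -sqrtr_sqr ler_wsqrtr.
have sY : s0 <= Num.sqrt y by rewrite -(ger0_norm (ltW s00)) -sqrtr_sqr ler_wsqrtr.
have X2 : Num.sqrt x ^+ 2 = x by rewrite sqr_sqrtr//; exact: le_trans sx.
have Y2 : Num.sqrt y ^+ 2 = y by rewrite sqr_sqrtr//; exact: le_trans sy.
have s2 : 0 < 2 * s0 by rewrite mulr_gt0.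
rewrite ler_pdivlMr// -[in leRHS]X2 -[in leRHS]Y2 subr_sqr normrM ler_wpM2l//.
rewrite ger0_norm; lra.
Qed.

(** The quadratic Taylor terms are squares, whose L^2 norm is not controlled by L^2 norms of the
    increments; hence the almost-everywhere bound [rho] on these. *)
Lemma nrm_F1_dd f g h rho : aebdd M f -> aebdd M g -> aebdd M h -> 0 <= rho ->
  {ae leb2, forall x, Om x -> `|g x - f x| <= rho} ->
  {ae leb2, forall x, Om x -> `|h x - f x| <= rho} ->
  nrm (fun x => F1 (g x) + F1 (h x) - 2 * F1 (f x)) <=
    K * (nrm (fun x => g x + h x - 2 * f x) + 2 * pi * (2 * rho ^+ 2)).
Proof.
move=> fM gM hM rho0 gf hf; have K0 := ltW (nb_K nb).
have f2 := aebdd_L2 fM; have g2 := aebdd_L2 gM; have h2 := aebdd_L2 hM.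
have dd2 : L2 (fun x => g x + h x - 2 * f x) by apply: (L2B mD) (L2D mD g2 h2) (L2Z mD _ f2).
have r0 : 0 <= 2 * rho ^+ 2 by rewrite mulr_ge0 ?sqr_ge0.
have add2 : L2 (fun x => `|g x + h x - 2 * f x|).
  apply: (L2_ae_dom mD _ dd2); last by apply: aeW => x _; rewrite normr_id.
  by apply: measurableT_comp => //; have [] := dd2.
have R2 : L2 (fun x => K * (`|g x + h x - 2 * f x| + 2 * rho ^+ 2)).
  by apply: (L2Z mD); apply: (L2D mD) => //; exact: L2_cst.
apply: le_trans (nrm_ae_le mD (g := fun x => K * (`|g x + h x - 2 * f x| + 2 * rho ^+ 2)) _ R2 _) _.
- by apply: (L2B mD) (L2D mD (aebdd_L2 (aebdd_F1 gM)) (aebdd_L2 (aebdd_F1 hM)))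
    (L2Z mD _ (aebdd_L2 (aebdd_F1 fM))).
- have all3 : {ae leb2, forall x, Om x -> [/\ `|f x| <= M, `|g x| <= M & `|h x| <= M]}.
    by apply: filterS3 fM.2 gM.2 hM.2 => x fx gx hx Dx; split; [exact: fx|exact: gx|exact: hx].
  apply: filterS3 all3 gf hf => x fgh gfx hfx Dx; have [fx gx hx] := fgh Dx; rewrite [leRHS]ger0_norm; last by rewrite mulr_ge0// addr_ge0.
  apply: le_trans (nb_F1dd nb fx gx hx) _.
  rewrite ler_wpM2l//; have sq (z : R) : `|z| <= rho -> z ^+ 2 <= rho ^+ 2.
    by move=> zr; rewrite -[leLHS]real_normK ?num_real// lerXn2r ?nnegrE.
  have := sq _ (gfx Dx); have := sq _ (hfx Dx); lra.
rewrite nrmZ//; last by apply: (L2D mD) => //; exact: L2_cst.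
rewrite ger0_norm// ler_wpM2l//; apply: le_trans (nrmD mD add2 (L2_cst mD fD _)) _.
rewrite nrm_cst (ger0_norm r0) lerD2r; apply: nrm_ae_le => //.
by apply: aeW => x _; rewrite normr_id.
Qed.

Lemma energy_dd f g h rho : aebdd M f -> aebdd M g -> aebdd M h -> 0 <= rho ->
  {ae leb2, forall x, Om x -> `|g x - f x| <= rho} ->
  {ae leb2, forall x, Om x -> `|h x - f x| <= rho} ->
  `|E g + E h - 2 * E f| <=
    2 * pi * (K * (nrm (fun x => g x + h x - 2 * f x) + 2 * pi * (2 * rho ^+ 2))).
Proof.
move=> fM gM hM rho0 gf hf; have K0 := ltW (nb_K nb).
have f2 := aebdd_L2 fM; have g2 := aebdd_L2 gM; have h2 := aebdd_L2 hM.
have dd2 : L2 (fun x => g x + h x - 2 * f x) by apply: (L2B mD) (L2D mD g2 h2) (L2Z mD _ f2).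
have r0 : 0 <= 2 * rho ^+ 2 by rewrite mulr_ge0 ?sqr_ge0.
have add2 : L2 (fun x => `|g x + h x - 2 * f x|).
  apply: (L2_ae_dom mD _ dd2); last by apply: aeW => x _; rewrite normr_id.
  by apply: measurableT_comp => //; have [] := dd2.
have S2 : L2 (fun x => `|g x + h x - 2 * f x| + 2 * rho ^+ 2).
  by apply: (L2D mD) => //; exact: L2_cst.
have R2 : L2 (fun x => K * (`|g x + h x - 2 * f x| + 2 * rho ^+ 2)) by exact: (L2Z mD).
have Ff := aebdd_L2 (aebdd_F fM); have Fg := aebdd_L2 (aebdd_F gM).
have Fh := aebdd_L2 (aebdd_F hM).
have FF2 : L2 (fun x => (F (g x) - F (f x)) + (F (h x) - F (f x))).
  exact: (L2D mD (L2B mD Fg Ff) (L2B mD Fh Ff)).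
have -> : E g + E h - 2 * E f = \int[leb2]_(x in Om) ((F (g x) - F (f x)) + (F (h x) - F (f x))).
  rewrite RintegralD//; first by rewrite -!energyB//; ring.
    exact/(L2_integrable mD fD)/(L2B mD Fg Ff).
  exact/(L2_integrable mD fD)/(L2B mD Fh Ff).
apply: le_trans (Rintegral_le_nrm FF2 R2 _) _.
- have all3 : {ae leb2, forall x, Om x -> [/\ `|f x| <= M, `|g x| <= M & `|h x| <= M]}.
    by apply: filterS3 fM.2 gM.2 hM.2 => x fx gx hx Dx; split; [exact: fx|exact: gx|exact: hx].
  apply: filterS3 all3 gf hf => x fgh gfx hfx Dx; have [fx gx hx] := fgh Dx.
  have -> : F (g x) - F (f x) + (F (h x) - F (f x)) = F (g x) + F (h x) - 2 * F (f x) by ring.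
  apply: le_trans (nb_Fdd nb fx gx hx) _.
  rewrite ler_wpM2l//; have sq (z : R) : `|z| <= rho -> z ^+ 2 <= rho ^+ 2.
    by move=> zr; rewrite -[leLHS]real_normK ?num_real// lerXn2r ?nnegrE.
  have := sq _ (gfx Dx); have := sq _ (hfx Dx); lra.
rewrite ler_wpM2l ?(ltW pi0)// nrmZ// ger0_norm// ler_wpM2l//.
apply: le_trans (nrmD mD add2 (L2_cst mD fD _)) _.
rewrite nrm_cst (ger0_norm r0) lerD2r; apply: nrm_ae_le => //.
by apply: aeW => x _; rewrite normr_id.
Qed.

Lemma energy_taylor f g : aebdd M f -> aebdd M g ->
  `|E g - E f - dot (fun x => F1 (f x)) (fun x => g x - f x)| <=
    K * nrm (fun x => g x - f x) ^+ 2.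
Proof.
move=> fM gM; have K0 := ltW (nb_K nb).
have f2 := aebdd_L2 fM; have g2 := aebdd_L2 gM; have gf2 := L2B mD g2 f2.
have Ff := aebdd_L2 (aebdd_F fM); have Fg := aebdd_L2 (aebdd_F gM).
have F1f := aebdd_L2 (aebdd_F1 fM).
have i1 := L2_integrable mD fD (L2B mD Fg Ff).
have i2 := L2_mul_integrable mD F1f gf2.
have i3 := L2_mul_integrable mD gf2 gf2.
have i4 : leb2.-integrable Om (EFin \o (fun x => K * ((g x - f x) * (g x - f x)))).
  exact: (integrableZl mD K i3).
have i5 : leb2.-integrable Om (EFin \o (fun x => F (g x) - F (f x) - F1 (f x) * (g x - f x))).
  exact (integrableB mD i1 i2).
rewrite energyB// sqr_nrm /L2dot -RintegralB// -RintegralZl//.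
have tay : {ae leb2, forall x, Om x -> `|F (g x) - F (f x) - F1 (f x) * (g x - f x)| <=
    K * ((g x - f x) * (g x - f x))}.
  apply: filterS2 fM.2 gM.2 => x fx gx Dx; rewrite -expr2.
  by apply: (nb_Ftay nb); [exact: fx|exact: gx].
rewrite ler_norml; apply/andP; split.
  rewrite lerNl -mulN1r -RintegralZl//; apply: ae_le_Rintegral => //.
    exact: (integrableZl mD (-1) i5).
  by apply: filterS tay => x h Dx; have := h Dx; rewrite ler_norml; lra.
by apply: ae_le_Rintegral => //; apply: filterS tay => x h Dx;
  apply: le_trans (ler_norm _) (h Dx).
Qed.

(** Positivity is given for each bounded function separately. A uniform bound comes from the
    constant function at which [F] attains its minimum on [-M, M]: its energy is a lower bound for
    all others. *)
Lemma energy_lower : exists2 s0 : R, 0 < s0 & forall f, aebdd M f -> s0 ^+ 2 <= E f.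
Proof.
have MM : - M <= M by have := M0; lra.
have [t0 t0M tmin] := EVT_min MM (continuous_subspaceT cF).
have cst_b : bounded_per Om (fun=> t0).
  by split; [move=> x y|exact: measurable_cst|exists `|t0| => x].
have e0 := hC0 cst_b; exists (Num.sqrt (E (fun=> t0))); first by rewrite sqrtr_gt0.
move=> f fM; rewrite sqr_sqrtr ?(ltW e0)// /energy lerD2r.
apply: ae_le_Rintegral => //.
- exact/(L2_integrable mD fD)/L2_cst.
- exact/(L2_integrable mD fD)/(aebdd_L2 (aebdd_F fM)).
apply: filterS fM.2 => x fx Dx; apply: tmin; rewrite in_itv/= -ler_norml; exact: fx.
Qed.

Definition sav (f : plane R -> R) (x : plane R) : R := F1 (f x) / Num.sqrt (E f).

Lemma L2_sav f : aebdd M f -> L2 (sav f).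
Proof.
move=> fM; have := L2Z mD (Num.sqrt (E f))^-1 (aebdd_L2 (aebdd_F1 fM)).
by congr L2; apply/funext => x; rewrite mulrC.
Qed.

Lemma savE f : sav f = fun x => (Num.sqrt (E f))^-1 * F1 (f x).
Proof. by apply/funext => x; rewrite /sav mulrC. Qed.

Lemma nrm_sav (s0 : R) f : 0 < s0 -> s0 ^+ 2 <= E f -> aebdd M f ->
  nrm (sav f) <= s0^-1 * (2 * pi * K).
Proof.
move=> s00 fE fM; have K0 := ltW (nb_K nb).
have sX : s0 <= Num.sqrt (E f) by rewrite -(ger0_norm (ltW s00)) -sqrtr_sqr ler_wsqrtr.
rewrite savE nrmZ//; last exact: aebdd_L2 (aebdd_F1 fM).
rewrite ger0_norm ?invr_ge0 ?sqrtr_ge0//; apply: ler_pM; rewrite ?nrm_ge0 ?invr_ge0 ?sqrtr_ge0//.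
  by rewrite lef_pV2 ?posrE//; exact: lt_le_trans sX.
by apply: nrm_aebdd => //; exact: aebdd_F1.
Qed.

Lemma nrm_sav_lip (s0 : R) f g : 0 < s0 -> s0 ^+ 2 <= E f -> s0 ^+ 2 <= E g ->
  aebdd M f -> aebdd M g ->
  nrm (fun x => sav f x - sav g x) <=
    (s0^-1 * K + (2 * pi * K / (2 * s0)) * (s0^-1 * s0^-1) * (2 * pi * K)) *
      nrm (fun x => f x - g x).
Proof.
move=> s00 fE gE fM gM; have K0 := ltW (nb_K nb).
have sX : s0 <= Num.sqrt (E f) by rewrite -(ger0_norm (ltW s00)) -sqrtr_sqr ler_wsqrtr.
have sY : s0 <= Num.sqrt (E g) by rewrite -(ger0_norm (ltW s00)) -sqrtr_sqr ler_wsqrtr.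
have F1f := aebdd_L2 (aebdd_F1 fM); have F1g := aebdd_L2 (aebdd_F1 gM).
have rf := lt_le_trans s00 sX; have rg := lt_le_trans s00 sY.
set X := Num.sqrt (E f) in sX rf *; set Y := Num.sqrt (E g) in sY rg *.
have -> : (fun x => sav f x - sav g x) = (fun x => X^-1 * (F1 (f x) - F1 (g x)) +
    (X^-1 - Y^-1) * F1 (g x)).
  by apply/funext => x; rewrite /sav -/X -/Y; ring.
have fg2 := L2B mD F1f F1g.
apply: le_trans (nrmD mD (L2Z mD _ fg2) (L2Z mD _ F1g)) _.
rewrite !nrmZ// mulrDl; apply: lerD.
  rewrite -mulrA ger0_norm ?invr_ge0 ?(ltW rf)//; apply: ler_pM; rewrite ?invr_ge0 ?nrm_ge0 ?(ltW rf)//.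
    by rewrite lef_pV2 ?posrE.
  exact: nrm_F1_lip.
have -> : X^-1 - Y^-1 = (X^-1 * Y^-1) * (Y - X).
  by field; rewrite !gt_eqF.
rewrite normrM ger0_norm; last by rewrite mulr_ge0 ?invr_ge0 ?(ltW rf) ?(ltW rg).
have h1 : `|Y - X| <= 2 * pi * K / (2 * s0) * nrm (fun x => f x - g x).
  rewrite distrC; apply: le_trans (sqrt_lip s00 fE gE) _.
  rewrite [leRHS]mulrAC ler_wpM2r ?invr_ge0 ?mulr_ge0 ?(ltW s00)//.
  exact: energy_lip.
have h2 : X^-1 * Y^-1 <= s0^-1 * s0^-1.
  by apply: ler_pM; rewrite ?invr_ge0 ?(ltW rf) ?(ltW rg)// lef_pV2 ?posrE.
have h3 : nrm (fun x => F1 (g x)) <= 2 * pi * K.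
  by apply: nrm_aebdd => //; exact: aebdd_F1.
apply: le_trans (ler_pM _ _ (ler_pM _ _ h2 h1) h3) _ => //.
- by rewrite !mulr_ge0 ?invr_ge0 ?(ltW rf) ?(ltW rg).
- exact: nrm_ge0.
- by rewrite mulr_ge0 ?invr_ge0 ?(ltW rf) ?(ltW rg).
move: (2 * pi * K) (nrm _) (s0^-1) (2 * s0)^-1 => A B C D.
by rewrite le_eqVlt; apply/orP; left; apply/eqP; ring.
Qed.

End Superposition.

(** * The exact solution along the time grid *)

Section Weights.
Context {R : realType}.
Variable alpha : R.
Hypothesis alpha1 : 1 < alpha.
Implicit Types (s : seq index) (x : index -> R).
Local Notation one := (fun=> 1 : R).
Local Notation wi r := (fun j : index => wt r j.1).

Lemma wt_mono r r' k : r <= r' -> wt r k <= wt r' k :> R.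
Proof. by move=> rr; rewrite /wt ler_powR// lerDl freq2_ge0. Qed.

Lemma vn_one_wt r s x : 0 <= r -> vn s one x <= vn s (wi r) x.
Proof.
move=> r0; apply: vn_wle => j _; rewrite ler_wpM2r ?sqr_ge0//.
by have := wt_mono j.1 r0; rewrite /wt powRr0.
Qed.

Lemma vn_lam_wt s x : vn s (lam alpha) x <= vn s (wi (alpha / 2)) x.
Proof.
have a1 := alpha1; apply: vn_wle => j _; rewrite ler_wpM2r ?sqr_ge0// /lam /wt.
have f0 := @freq2_ge0 R j.1.
have a2 : 0 <= alpha / 2 by lra.
by apply: (ge0_ler_powR a2); rewrite ?nnegrE; lra.
Qed.

Lemma vn_lam2_wt s x : vn s one (fun j => lam alpha j * x j) <= vn s (wi alpha) x.
Proof.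
have a1 := alpha1; apply: vn_wle => j _; rewrite mul1r exprMn ler_wpM2r ?sqr_ge0// /lam /wt.
have f0 := @freq2_ge0 R j.1; have a2 : 0 <= alpha by lra.
rewrite -powR_mulrn ?powR_ge0// -powRrM divfK ?pnatr_eq0//.
by apply: (ge0_ler_powR a2); rewrite ?nnegrE; lra.
Qed.

Lemma vn_half_wt s x : vn s (wi (alpha / 2)) x <= vn s (wi alpha) x.
Proof.
have a1 := alpha1; apply: vn_wle => j _; rewrite ler_wpM2r ?sqr_ge0//.
by apply: wt_mono; lra.
Qed.

Lemma wi_ge0 r (j : index) : 0 <= wt r j.1 :> R.
Proof. by rewrite ltW// wt_gt0. Qed.

End Weights.

(** * Time regularity of the coefficients of the exact solution *)

Section Trajectory.
Context {R : realType}.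
Variables (a b c d : R).
Hypotheses (hab : b = a + 2 * pi) (hcd : d = c + 2 * pi).
Let Om : set (plane R) := `]a, b[ `*` `]c, d[.
Let mD : measurable Om := measurable_cell a b c d.
Let fD : (leb2 Om < +oo)%E := cell_measure_lty hab hcd.
Local Notation L2 := (L2 leb2 Om).
Local Notation dot := (L2dot leb2 Om).
Local Notation nrm := (L2nrm leb2 Om).
Local Notation hat := (fhat Om).
Local Notation J := (J R).
Local Notation one := (fun=> 1 : R).
Local Notation wi r := (fun j : index => wt r j.1).
Implicit Types (f g : plane R -> R) (t p q del : R).

Let pi0 : 0 < 2 * pi :> R. Proof. by rewrite mulr_gt0 ?pi_gt0. Qed.
Let one0 : forall i : index, 0 <= one i :> R. Proof. by move=> i; exact: ler01. Qed.

Lemma vn_one_hat N f : L2 f -> vn (J N) one (hat f) <= nrm f.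
Proof.
move=> f2; apply: vn_le; rewrite ?nrm_ge0//.
apply: le_trans (bessel hab hcd N f2); apply: ler_sum => j _.
by rewrite mul1r expr2.
Qed.

Lemma hat_le_nrm f j : L2 f -> `|hat f j| <= nrm f.
Proof.
move=> f2; have [N0 jN] := @sseq_ex R j.1.
have jJ : j \in J N0 by rewrite mem_J; exact: jN.
rewrite -(ler_pXn2r (n := 2)) ?nnegrE ?nrm_ge0// real_normK ?num_real//.
apply: le_trans (bessel hab hcd N0 f2).
by rewrite (bigD1_seq j)//= ?uniq_J// lerDl sumr_ge0// => i _; exact: sqr_ge0.
Qed.

Lemma nrm_le_vn f r : L2 f -> 0 <= r -> (forall N, vn (J N) one (hat f) <= r) -> nrm f <= r.
Proof.
move=> f2 r0 fr; rewrite -(ler_pXn2r (n := 2)) ?nnegrE ?nrm_ge0//.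
apply: (nrm_sqr_le hab hcd f2) => N.
have := fr N; rewrite -(ler_pXn2r (n := 2)) ?nnegrE ?vn_ge0// => h; apply: (le_trans _ h) => {fr}.
by rewrite sqr_vn// le_eqVlt; apply/orP; left; apply/eqP; apply: eq_bigr => j _;
  rewrite mul1r expr2.
Qed.

Definition L2der T (u v : R -> plane R -> R) : Prop := forall t, 0 <= t <= T ->
  forall e, 0 < e -> exists2 eta, 0 < eta & forall s, 0 <= s <= T -> `|s - t| < eta ->
    nrm (fun x => u s x - u t x - (s - t) * v t x) <= e * `|s - t|.

(** By Bessel's inequality each single coefficient is dominated by the L^2 norm. *)
Lemma L2der_hat T u v : (forall t, 0 <= t <= T -> L2 (u t)) ->
  (forall t, 0 <= t <= T -> L2 (v t)) -> L2der T u v ->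
  forall j, dder 0 T (fun t => hat (u t) j) (fun t => hat (v t) j).
Proof.
move=> u2 v2 duv j t tT e e0; have [eta eta0 h] := duv t tT e e0.
exists eta => // s sT st.
have us := u2 _ sT; have ut := u2 _ tT; have vt := v2 _ tT.
have uu := L2B mD us ut; have tv := L2Z mD (s - t) vt.
apply: le_trans (h s sT st); apply: le_trans (hat_le_nrm j (L2B mD uu tv)).
by rewrite !hatB// hatZ// [hat (v t) j * _]mulrC.
Qed.

Variables (alpha T LL S : R).
Hypotheses (alpha1 : 1 < alpha) (LL0 : 0 <= LL) (S0 : 0 < S).
Hypothesis HS : forall N (x : index -> R) W, 0 <= W ->
  \sum_(j <- J N) wt alpha j.1 * x j ^+ 2 <= W ^+ 2 -> \sum_(j <- J N) `|x j| <= S * W.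

Lemma l1_vn N (x : index -> R) B : 0 <= B -> vn (J N) (wi alpha) x <= B ->
  \sum_(j <- J N) `|x j| <= S * B.
Proof.
move=> B0 xB; apply: HS => //.
have := xB; rewrite -(ler_pXn2r (n := 2)) ?nnegrE ?vn_ge0// => h; apply: (le_trans _ h).
rewrite sqr_vn; last exact: wi_ge0.
by rewrite le_eqVlt; apply/orP; left; apply/eqP; apply: eq_bigr => j _; rewrite expr2.
Qed.

Lemma aebdd_vn f B : L2 f -> 0 <= B -> (forall N, vn (J N) (wi alpha) (hat f) <= B) ->
  {ae leb2, forall x, Om x -> `|f x| <= S * B}.
Proof.
move=> f2 B0 fB; apply: (ae_bounded_of_hat hab hcd f2) => N.
by apply: l1_vn => //; exact: fB.
Qed.

(** [z] is u_ttt, the only function with the half weight; this limits the second-order estimates of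
    u_t to the weight alpha / 2. *)
Record smooth_traj (u v w z : R -> plane R -> R) : Prop := SmoothTraj {
  st_u2 : forall t, 0 <= t <= T -> L2 (u t);
  st_v2 : forall t, 0 <= t <= T -> L2 (v t);
  st_w2 : forall t, 0 <= t <= T -> L2 (w t);
  st_z2 : forall t, 0 <= t <= T -> L2 (z t);
  st_u : forall t N, 0 <= t <= T -> vn (J N) (wi alpha) (hat (u t)) <= LL;
  st_v : forall t N, 0 <= t <= T -> vn (J N) (wi alpha) (hat (v t)) <= LL;
  st_w : forall t N, 0 <= t <= T -> vn (J N) (wi alpha) (hat (w t)) <= LL;
  st_z : forall t N, 0 <= t <= T -> vn (J N) (wi (alpha / 2)) (hat (z t)) <= LL;
  st_du : L2der T u v;
  st_dv : L2der T v w;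
  st_dw : L2der T w z }.

Section Estimates.
Variables (u v w z : R -> plane R -> R).
Hypothesis st : smooth_traj u v w z.

Let du := L2der_hat (st_u2 st) (st_v2 st) (st_du st).
Let dv := L2der_hat (st_v2 st) (st_w2 st) (st_dv st).
Let dw := L2der_hat (st_w2 st) (st_z2 st) (st_dw st).
Let wa0 r (j : index) : 0 <= wt r j.1 :> R := wi_ge0 r j.

Lemma traj_u_lip N p q : 0 <= p -> p <= q -> q <= T ->
  vn (J N) (wi alpha) (fun j => hat (u q) j - hat (u p) j) <= LL * (q - p).
Proof.
by move=> p0 pq qT; apply: (vn_lipschitz (wa0 _) du p0 pq qT LL0) => t tT; apply: (st_v st).
Qed.

Lemma traj_v_lip N p q : 0 <= p -> p <= q -> q <= T ->
  vn (J N) (wi alpha) (fun j => hat (v q) j - hat (v p) j) <= LL * (q - p).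
Proof.
by move=> p0 pq qT; apply: (vn_lipschitz (wa0 _) dv p0 pq qT LL0) => t tT; apply: (st_w st).
Qed.

Lemma traj_w_lip N p q : 0 <= p -> p <= q -> q <= T ->
  vn (J N) (wi (alpha / 2)) (fun j => hat (w q) j - hat (w p) j) <= LL * (q - p).
Proof.
by move=> p0 pq qT; apply: (vn_lipschitz (wa0 _) dw p0 pq qT LL0) => t tT; apply: (st_z st).
Qed.

Lemma traj_u_dd N t del : 0 <= del -> 0 <= t - del -> t + del <= T ->
  vn (J N) (wi alpha) (fun j => hat (u (t + del)) j + hat (u (t - del)) j - 2 * hat (u t) j)
    <= 2 * LL * del ^+ 2.
Proof.
have L0 := LL0.
move=> d0 td tT; have M0 : 0 <= 2 * LL * del by rewrite !mulr_ge0.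
rewrite expr2 mulrA; apply: (vn_second_diff (wa0 _) du d0 M0 td tT) => r /andP[r0 rd].
apply: (le_trans (traj_v_lip N _ _ _)); try lra.
by have := ler_wpM2l LL0 (ltW rd); lra.
Qed.

Lemma traj_v_dd N t del : 0 <= del -> 0 <= t - del -> t + del <= T ->
  vn (J N) (wi (alpha / 2))
    (fun j => hat (v (t + del)) j + hat (v (t - del)) j - 2 * hat (v t) j)
    <= 2 * LL * del ^+ 2.
Proof.
have L0 := LL0.
move=> d0 td tT; have M0 : 0 <= 2 * LL * del by rewrite !mulr_ge0.
rewrite expr2 mulrA; apply: (vn_second_diff (wa0 _) dv d0 M0 td tT) => r /andP[r0 rd].
apply: (le_trans (traj_w_lip N _ _ _)); try lra.
by have := ler_wpM2l LL0 (ltW rd); lra.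
Qed.

(** Gives up one power of [del] to reach the full weight alpha: only the Lipschitz bound coming from
    u_tt is used. *)
Lemma traj_v_dd1 N t del : 0 <= del -> 0 <= t - del -> t + del <= T ->
  vn (J N) (wi alpha)
    (fun j => hat (v (t + del)) j + hat (v (t - del)) j - 2 * hat (v t) j)
    <= 2 * LL * del.
Proof.
have L0 := LL0; move=> d0 td tT.
have h1 : vn (J N) (wi alpha) (fun j => hat (v (t + del)) j - hat (v t) j) <= LL * del.
  by apply: (le_trans (traj_v_lip N _ _ _)); try lra.
have h2 : vn (J N) (wi alpha) (fun j => hat (v t) j - hat (v (t - del)) j) <= LL * del.
  by apply: (le_trans (traj_v_lip N _ _ _)); try lra.
have := vnB (J N) (wa0 alpha) (fun j => hat (v (t + del)) j - hat (v t) j)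
  (fun j => hat (v t) j - hat (v (t - del)) j).
have -> : (fun j => hat (v (t + del)) j - hat (v t) j - (hat (v t) j - hat (v (t - del)) j)) =
  (fun j => hat (v (t + del)) j + hat (v (t - del)) j - 2 * hat (v t) j).
  by apply/funext => j; ring.
by lra.
Qed.

Lemma traj_w_dd1 N t del : 0 <= del -> 0 <= t - del -> t + del <= T ->
  vn (J N) (wi (alpha / 2))
    (fun j => hat (w (t + del)) j + hat (w (t - del)) j - 2 * hat (w t) j)
    <= 2 * LL * del.
Proof.
have L0 := LL0; move=> d0 td tT.
have h1 : vn (J N) (wi (alpha / 2)) (fun j => hat (w (t + del)) j - hat (w t) j) <= LL * del.
  by apply: (le_trans (traj_w_lip N _ _ _)); try lra.
have h2 : vn (J N) (wi (alpha / 2)) (fun j => hat (w t) j - hat (w (t - del)) j) <= LL * del.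
  by apply: (le_trans (traj_w_lip N _ _ _)); try lra.
have := vnB (J N) (wa0 (alpha / 2)) (fun j => hat (w (t + del)) j - hat (w t) j)
  (fun j => hat (w t) j - hat (w (t - del)) j).
have -> : (fun j => hat (w (t + del)) j - hat (w t) j - (hat (w t) j - hat (w (t - del)) j)) =
  (fun j => hat (w (t + del)) j + hat (w (t - del)) j - 2 * hat (w t) j).
  by apply/funext => j; ring.
by lra.
Qed.

End Estimates.
End Trajectory.

Section DotSecondDifference.
Context {d : measure_display} {T : measurableType d} {R : realType}.
Variables (mu : {measure set T -> \bar R}) (D : set T).
Hypothesis mD : measurable D.

(** The discrete Leibniz rule for second differences. *)
Lemma dot_second_diff (f fp fm g gp gm : T -> R) :
  L2 mu D f -> L2 mu D fp -> L2 mu D fm -> L2 mu D g -> L2 mu D gp -> L2 mu D gm ->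
  L2dot mu D fp gp + L2dot mu D fm gm - 2 * L2dot mu D f g =
  L2dot mu D (fun x => fp x + fm x - 2 * f x) g + L2dot mu D f (fun x => gp x + gm x - 2 * g x)
  + L2dot mu D (fun x => fp x - f x) (fun x => gp x - g x)
  + L2dot mu D (fun x => fm x - f x) (fun x => gm x - g x).
Proof.
move=> f2 fp2 fm2 g2 gp2 gm2.
have f22 := L2Z mD 2 f2; have g22 := L2Z mD 2 g2.
have fpm := L2D mD fp2 fm2; have gpm := L2D mD gp2 gm2.
have gpg := L2B mD gp2 g2; have gmg := L2B mD gm2 g2.
rewrite !(dotBl mD)// !(dotDl mD)// (dotZl mD)// !(dotBr mD)// !(dotDr mD)// (dotZr mD)//.
by ring.
Qed.

End DotSecondDifference.

(** * Differences in time of the energy and of its square root *)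

Section TimeConsistency.
Context {R : realType}.
Variables (a b c d : R).
Hypotheses (hab : b = a + 2 * pi) (hcd : d = c + 2 * pi).
Let Om : set (plane R) := `]a, b[ `*` `]c, d[.
Let mD : measurable Om := measurable_cell a b c d.
Let fD : (leb2 Om < +oo)%E := cell_measure_lty hab hcd.
Local Notation L2 := (L2 leb2 Om).
Local Notation dot := (L2dot leb2 Om).
Local Notation nrm := (L2nrm leb2 Om).
Local Notation hat := (fhat Om).
Local Notation J := (J R).
Local Notation one := (fun=> 1 : R).
Local Notation wi r := (fun j : index => wt r j.1).
Local Notation aebdd := (aebdd a b c d).
Implicit Types (f g : plane R -> R) (t p q del : R).

Variables (alpha T LL S : R).
Hypotheses (alpha1 : 1 < alpha) (LL0 : 0 <= LL) (S0 : 0 < S).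
Hypothesis HS : forall N (x : index -> R) W, 0 <= W ->
  \sum_(j <- J N) wt alpha j.1 * x j ^+ 2 <= W ^+ 2 -> \sum_(j <- J N) `|x j| <= S * W.
Variables (F : R -> R) (C0 M K s0 : R).
Hypothesis hF : (forall (k : nat) (s : R), (k < 3)%N -> derivable (derive1n k F) s 1) /\
            continuous (derive1n 3 F).
Hypotheses (MS : S * LL <= M) (nb : nonlin_bounds F M K) (s00 : 0 < s0).
Hypothesis hs0 : forall f, aebdd M f -> s0 ^+ 2 <= energy Om F C0 f.
Local Notation F1 := (derive1 F).
Local Notation E := (energy Om F C0).
Local Notation sav := (sav a b c d F C0).

Variables (u v w z : R -> plane R -> R).
Hypothesis st : smooth_traj a b c d alpha T LL u v w z.

Let u2 := st_u2 st.
Let v2 := st_v2 st.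
Let pi0 : 0 < 2 * pi :> R. Proof. by rewrite mulr_gt0 ?pi_gt0. Qed.
Let one0 : forall i : index, 0 <= one i :> R. Proof. by move=> i; exact: ler01. Qed.

Lemma nrm_vn f r B : L2 f -> 0 <= r -> 0 <= B ->
  (forall N, vn (J N) (wi r) (hat f) <= B) -> nrm f <= B.
Proof.
move=> f2 r0 B0 fB; apply: (nrm_le_vn hab hcd f2 B0) => N.
by apply: le_trans (fB N); exact: vn_one_wt.
Qed.

Lemma nrm_u_lip p q : 0 <= p -> p <= q -> q <= T ->
  nrm (fun x => u q x - u p x) <= LL * (q - p).
Proof.
move=> p0 pq qT; have a1 := alpha1; have [uq up] : L2 (u q) /\ L2 (u p) by split; apply: u2; lra.
apply: (nrm_vn (r := alpha)); [exact: L2B|lra|by rewrite mulr_ge0// subr_ge0|move=> N].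
have := traj_u_lip hab hcd LL0 st N p0 pq qT; congr (_ <= _).
by congr vn; apply/funext => j; rewrite hatB.
Qed.

Lemma nrm_v_lip p q : 0 <= p -> p <= q -> q <= T ->
  nrm (fun x => v q x - v p x) <= LL * (q - p).
Proof.
move=> p0 pq qT; have a1 := alpha1; have [vq vp] : L2 (v q) /\ L2 (v p) by split; apply: v2; lra.
apply: (nrm_vn (r := alpha)); [exact: L2B|lra|by rewrite mulr_ge0// subr_ge0|move=> N].
have := traj_v_lip hab hcd LL0 st N p0 pq qT; congr (_ <= _).
by congr vn; apply/funext => j; rewrite hatB.
Qed.

Lemma ae_u_lip p q : 0 <= p -> p <= q -> q <= T ->
  {ae leb2, forall x, Om x -> `|u q x - u p x| <= S * (LL * (q - p))}.
Proof.
move=> p0 pq qT; have a1 := alpha1; have [uq up] : L2 (u q) /\ L2 (u p) by split; apply: u2; lra.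
apply: (aebdd_vn hab hcd HS (L2B mD uq up)); first by rewrite mulr_ge0// subr_ge0.
move=> N; have := traj_u_lip hab hcd LL0 st N p0 pq qT; congr (_ <= _).
by congr vn; apply/funext => j; rewrite hatB.
Qed.

Lemma u_aebdd t : 0 <= t <= T -> aebdd M (u t).
Proof.
move=> tT; split; first by have [] := u2 tT.
have := aebdd_vn hab hcd HS (u2 tT) LL0 (fun N => st_u st N tT).
by apply: filterS => x ux Dx; exact: le_trans (ux Dx) MS.
Qed.

Lemma nrm_v t : 0 <= t <= T -> nrm (v t) <= LL.
Proof.
have a1 := alpha1; move=> tT; apply: (nrm_vn (r := alpha) (v2 tT)) => //; first lra.
by move=> N; exact: (st_v st).
Qed.

Definition power t : R := dot (fun x => F1 (u t x)) (v t).

Let F1u2 t : 0 <= t <= T -> L2 (fun x => F1 (u t x)).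
Proof. by move=> tT; exact (aebdd_L2 hab hcd (aebdd_F1 hF nb (u_aebdd tT))). Qed.

Let nrm_F1u t : 0 <= t <= T -> nrm (fun x => F1 (u t x)) <= 2 * pi * K.
Proof.
move=> tT; apply: (nrm_aebdd hab hcd (ltW (nb_K nb))).
exact (aebdd_F1 hF nb (u_aebdd tT)).
Qed.

(** Chain rule for a map differentiable in L^2 only: the Taylor remainder of the energy is at most K
    times the square of the L^2 increment, hence O((s - t)^2) because [u] is Lipschitz in time. *)
Lemma energy_dder : dder 0 T (fun t => E (u t)) power.
Proof.
move=> t tT e e0; have K0 := nb_K nb; have L0 := LL0.
have A0 : 0 < 2 * pi * K + 1 by rewrite ltr_wpDl// mulr_ge0 ?(ltW pi0) ?(ltW K0).
have B0 : 0 < K * LL ^+ 2 + 1 by rewrite ltr_wpDl// mulr_ge0 ?sqr_ge0 ?(ltW K0).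
have e2 : 0 < e / 2 by rewrite divr_gt0.
have [eta eta0 h] := st_du st tT (divr_gt0 e2 A0).
exists (Num.min eta (e / 2 / (K * LL ^+ 2 + 1))); first by rewrite lt_min eta0 divr_gt0.
move=> s sT; rewrite lt_min => /andP[s1 s2].
have us := u2 sT; have ut := u2 tT; have vt := v2 tT; have ft := F1u2 tT.
have ust := L2B mD us ut; have vst := L2Z mD (s - t) vt.
have lip : nrm (fun x => u s x - u t x) <= LL * `|s - t|.
  have [ts|ts] := leP t s.
    by rewrite ger0_norm ?subr_ge0//; apply: nrm_u_lip; lra.
  rewrite ltr0_norm ?subr_lt0// opprB.
  have -> : nrm (fun x => u s x - u t x) = nrm (fun x => u t x - u s x).
    have := nrmZ mD (-1) (L2B mD ut us); rewrite normrN1 mul1r => <-.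
    by congr L2nrm; apply/funext => x; ring.
  by apply: nrm_u_lip; lra.
have tay := energy_taylor hab hcd C0 hF nb (u_aebdd tT) (u_aebdd sT).
have rem : `|dot (fun x => F1 (u t x)) (fun x => u s x - u t x) - power t * (s - t)| <=
    2 * pi * K * (e / 2 / (2 * pi * K + 1) * `|s - t|).
  have -> : dot (fun x => F1 (u t x)) (fun x => u s x - u t x) - power t * (s - t) =
      dot (fun x => F1 (u t x)) (fun x => u s x - u t x - (s - t) * v t x).
    by rewrite (dotBr mD ust vst ft) dotZr// mulrC.
  apply: le_trans (dot_le_nrm mD ft (L2B mD ust vst)) _.
  by apply: ler_pM; rewrite ?nrm_ge0//; [exact: nrm_F1u|exact: h].
set D := E (u s) - E (u t).
have -> : D - power t * (s - t) =
  (D - dot (fun x => F1 (u t x)) (fun x => u s x - u t x)) +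
  (dot (fun x => F1 (u t x)) (fun x => u s x - u t x) - power t * (s - t)) by ring.
apply: le_trans (ler_normD _ _) _.
have b1 : K * nrm (fun x => u s x - u t x) ^+ 2 <= e / 2 * `|s - t|.
  have : nrm (fun x => u s x - u t x) ^+ 2 <= (LL * `|s - t|) ^+ 2.
    by rewrite lerXn2r ?nnegrE ?nrm_ge0 ?mulr_ge0.
  move=> /(ler_wpM2l (ltW K0)) => h1; apply: le_trans h1 _.
  rewrite exprMn mulrA expr2 mulrA ler_wpM2r//.
  apply: le_trans (_ : (K * LL ^+ 2 + 1) * `|s - t| <= _); first by rewrite ler_wpM2r// lerDl.
  by rewrite mulrC -ler_pdivlMr// ltW.
have b2 : 2 * pi * K * (e / 2 / (2 * pi * K + 1) * `|s - t|) <= e / 2 * `|s - t|.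
  rewrite mulrA ler_wpM2r// [e / 2 / _]mulrC mulrA ler_piMl ?(ltW e2)//.
  by rewrite ler_pdivrMr// mul1r lerDl.
have := lerD (le_trans tay b1) (le_trans rem b2); move=> h2; apply: (le_trans h2).
by rewrite le_eqVlt; apply/orP; left; apply/eqP; field.
Qed.

Section Centered.
Variables (t del : R).
Hypotheses (d0 : 0 <= del) (td : 0 <= t - del) (tdT : t + del <= T).

Let tT : 0 <= t <= T. Proof. have := d0; have := td; have := tdT; lra. Qed.
Let pT : 0 <= t + del <= T. Proof. have := d0; have := td; have := tdT; lra. Qed.
Let mT : 0 <= t - del <= T. Proof. have := d0; have := td; have := tdT; lra. Qed.

Lemma L2_dd (f : R -> plane R -> R) : (forall t, 0 <= t <= T -> L2 (f t)) ->
  L2 (fun x => f (t + del) x + f (t - del) x - 2 * f t x).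
Proof.
by move=> f2; exact: (L2B mD (L2D mD (f2 _ pT) (f2 _ mT)) (L2Z mD _ (f2 _ tT))).
Qed.

Lemma hat_dd (f : R -> plane R -> R) j : (forall t, 0 <= t <= T -> L2 (f t)) ->
  hat (fun x => f (t + del) x + f (t - del) x - 2 * f t x) j =
  hat (f (t + del)) j + hat (f (t - del)) j - 2 * hat (f t) j.
Proof.
move=> f2; have fp := f2 _ pT; have fm := f2 _ mT; have ft := f2 _ tT.
rewrite hatB//; first by rewrite hatD// hatZ.
- exact: L2D.
- exact: L2Z.
Qed.

Lemma nrm_u_dd : nrm (fun x => u (t + del) x + u (t - del) x - 2 * u t x) <= 2 * LL * del ^+ 2.
Proof.
have a1 := alpha1; apply: (nrm_vn (r := alpha)); [exact: L2_dd|lra| |move=> N].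
  by rewrite !mulr_ge0.
have := traj_u_dd hab hcd LL0 st N d0 td tdT; congr (_ <= _).
by congr vn; apply/funext => j; rewrite hat_dd.
Qed.

Lemma nrm_v_dd : nrm (fun x => v (t + del) x + v (t - del) x - 2 * v t x) <= 2 * LL * del ^+ 2.
Proof.
have a1 := alpha1; apply: (nrm_vn (r := alpha / 2)); [exact: L2_dd|lra| |move=> N].
  by rewrite !mulr_ge0.
have := traj_v_dd hab hcd LL0 st N d0 td tdT; congr (_ <= _).
by congr vn; apply/funext => j; rewrite hat_dd.
Qed.

Definition cF : R := K * (2 * LL + 2 * pi * (2 * (S * LL) ^+ 2)).

Let aep : {ae leb2, forall x, Om x -> `|u (t + del) x - u t x| <= S * LL * del}.
Proof.
have := d0; have := td; have := tdT => ? ? ?.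
have [t0 tp pT'] : [/\ 0 <= t, t <= t + del & t + del <= T] by split; lra.
by apply: filterS (ae_u_lip t0 tp pT') => x h Dx; have := h Dx; rewrite [t + del - t]addrAC subrr add0r mulrA.
Qed.

Let aem : {ae leb2, forall x, Om x -> `|u (t - del) x - u t x| <= S * LL * del}.
Proof.
have := d0; have := td; have := tdT => ? ? ?.
have [tT' mt] : t <= T /\ t - del <= t by split; lra.
apply: filterS (ae_u_lip td mt tT') => x h Dx; have := h Dx.
by rewrite distrC [- (t - del)]opprB addrCA subrr addr0 mulrA.
Qed.

Lemma nrm_F1_second_diff :
  nrm (fun x => F1 (u (t + del) x) + F1 (u (t - del) x) - 2 * F1 (u t x)) <= cF * del ^+ 2.
Proof.
have K0 := ltW (nb_K nb).
have r0 : 0 <= S * LL * del by rewrite !mulr_ge0// ltW.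
apply: le_trans (nrm_F1_dd hab hcd hF nb (u_aebdd tT) (u_aebdd pT) (u_aebdd mT) r0 aep aem) _.
rewrite /cF -[leRHS]mulrA ler_wpM2l//; have := nrm_u_dd; move: (2 * pi) (nrm _) => q n; lra.
Qed.

Lemma energy_second_diff :
  `|E (u (t + del)) + E (u (t - del)) - 2 * E (u t)| <= 2 * pi * cF * del ^+ 2.
Proof.
have K0 := ltW (nb_K nb).
have r0 : 0 <= S * LL * del by rewrite !mulr_ge0// ltW.
apply: le_trans (energy_dd hab hcd C0 hF nb (u_aebdd tT) (u_aebdd pT) (u_aebdd mT) r0 aep aem) _.
rewrite -[leRHS]mulrA ler_wpM2l ?(ltW pi0)// /cF -[leRHS]mulrA ler_wpM2l//.
have := nrm_u_dd; move: (2 * pi) (nrm _) => q n; lra.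
Qed.

Definition cP : R := cF * LL + 2 * pi * K * (2 * LL) + 2 * (K * LL * LL).

Lemma power_second_diff :
  `|power (t + del) + power (t - del) - 2 * power t| <= cP * del ^+ 2.
Proof.
have K0 := ltW (nb_K nb); have L0 := LL0.
have fp := F1u2 pT; have fm := F1u2 mT; have ft := F1u2 tT.
have vp := v2 pT; have vm := v2 mT; have vt := v2 tT.
rewrite (dot_second_diff mD ft fp fm vt vp vm).
have [t0 [tp pT'] [tT' mt]] : [/\ 0 <= t, t <= t + del /\ t + del <= T & t <= T /\ t - del <= t].
  by have := d0; have := td; have := tdT; split; [lra|split; lra|split; lra].
have Ep : t + del - t = del by ring.
have Em : t - (t - del) = del by ring.
have sw f g : L2 f -> L2 g -> nrm (fun x => f x - g x) = nrm (fun x => g x - f x).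
  move=> f2 g2; have := nrmZ mD (-1) (L2B mD f2 g2); rewrite normrN1 mul1r => <-.
  by congr L2nrm; apply/funext => x; ring.
have lp : nrm (fun x => F1 (u (t + del) x) - F1 (u t x)) <= K * (LL * del).
  apply: le_trans (nrm_F1_lip hab hcd hF nb (u_aebdd pT) (u_aebdd tT)) _.
  by rewrite ler_wpM2l//; have := nrm_u_lip t0 tp pT'; rewrite Ep.
have lm : nrm (fun x => F1 (u (t - del) x) - F1 (u t x)) <= K * (LL * del).
  apply: le_trans (nrm_F1_lip hab hcd hF nb (u_aebdd mT) (u_aebdd tT)) _.
  rewrite ler_wpM2l// sw; [|exact: u2..].
  by have := nrm_u_lip td mt tT'; rewrite Em.
have kp : nrm (fun x => v (t + del) x - v t x) <= LL * del.
  by have := nrm_v_lip t0 tp pT'; rewrite Ep.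
have km : nrm (fun x => v (t - del) x - v t x) <= LL * del.
  by rewrite sw//; have := nrm_v_lip td mt tT'; rewrite Em.
have h1 := le_trans (dot_le_nrm mD (L2B mD (L2D mD fp fm) (L2Z mD 2 ft)) vt)
  (ler_pM (nrm_ge0 _ _ _) (nrm_ge0 _ _ _) nrm_F1_second_diff (nrm_v tT)).
have h2 := le_trans (dot_le_nrm mD ft (L2_dd v2))
  (ler_pM (nrm_ge0 _ _ _) (nrm_ge0 _ _ _) (nrm_F1u tT) nrm_v_dd).
have h3 := le_trans (dot_le_nrm mD (L2B mD fp ft) (L2B mD vp vt))
  (ler_pM (nrm_ge0 _ _ _) (nrm_ge0 _ _ _) lp kp).
have h4 := le_trans (dot_le_nrm mD (L2B mD fm ft) (L2B mD vm vt))
  (ler_pM (nrm_ge0 _ _ _) (nrm_ge0 _ _ _) lm km).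
apply: le_trans (ler_normD _ _) _; rewrite /cP.
have := lerD (le_trans (ler_normD _ _) (lerD (le_trans (ler_normD _ _) (lerD h1 h2)) h3)) h4.
move=> h5; apply: (le_trans h5); rewrite le_eqVlt; apply/orP; left; apply/eqP.
by move: (2 * pi) cF => q C; ring.
Qed.

End Centered.

Lemma cF_ge0 : 0 <= cF.
Proof.
rewrite /cF mulr_ge0 ?(ltW (nb_K nb))// addr_ge0//; first exact: mulr_ge0.
by rewrite mulr_ge0 ?(ltW pi0)// mulr_ge0// sqr_ge0.
Qed.

Lemma cP_ge0 : 0 <= cP.
Proof.
have C0' := cF_ge0; have K0 := ltW (nb_K nb); have L0 := LL0; have p0 := ltW pi0.
by rewrite /cP; move: (2 * pi) cF p0 C0' => q C q0 C0'; rewrite !addr_ge0// !mulr_ge0.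
Qed.

Lemma energy_midpoint t del : 0 <= del -> 0 <= t - del -> t + del <= T ->
  `|E (u (t + del)) - E (u (t - del)) - 2 * del * power t| <= cP * del ^+ 2 * del.
Proof.
move=> d0 td tdT; apply: (dder_midpoint d0 td tdT energy_dder) => s /andP[s0' sd].
have [s1 s2 s3] : [/\ 0 <= s, 0 <= t - s & t + s <= T] by split; lra.
apply: le_trans (power_second_diff s1 s2 s3) _.
by rewrite ler_wpM2l ?cP_ge0// lerXn2r ?nnegrE// ltW.
Qed.

Let r t : R := Num.sqrt (E (u t)).

Let r_low t : 0 <= t <= T -> s0 <= r t.
Proof.
by move=> tT; rewrite -(ger0_norm (ltW s00)) -sqrtr_sqr ler_wsqrtr// hs0//; exact: u_aebdd.
Qed.

Let r_sqr t : 0 <= t <= T -> r t ^+ 2 = E (u t).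
Proof.
move=> tT; rewrite /r sqr_sqrtr//.
by apply: le_trans (sqr_ge0 s0) _; apply: hs0; exact: u_aebdd.
Qed.

Definition cr : R := 2 * pi * K * LL / (2 * s0).

Lemma r_lip p q : 0 <= p -> p <= q -> q <= T -> `|r q - r p| <= cr * (q - p).
Proof.
move=> p0 pq qT; have [pT qT'] : 0 <= p <= T /\ 0 <= q <= T by split; lra.
apply: le_trans (sqrt_lip s00 (hs0 (u_aebdd qT')) (hs0 (u_aebdd pT))) _.
rewrite /cr [leRHS]mulrAC ler_wpM2r ?invr_ge0 ?mulr_ge0 ?(ltW s00)//.
apply: le_trans (energy_lip hab hcd C0 hF nb (u_aebdd qT') (u_aebdd pT)) _.
rewrite -[leRHS]mulrA ler_wpM2l ?nrm_u_lip//.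
by rewrite mulr_ge0 ?(ltW pi0)// ltW// (nb_K nb).
Qed.

Lemma cr_ge0 : 0 <= cr.
Proof.
have K0 := ltW (nb_K nb); have L0 := LL0; have p0 := ltW pi0; have s0' := ltW s00.
by rewrite /cr; move: (2 * pi) p0 => q q0; rewrite !mulr_ge0// invr_ge0 mulr_ge0.
Qed.

Definition cdd : R := (2 * pi * cF + 2 * cr ^+ 2) / (2 * s0).

(** With a, b the values at t + del and t - del, 2 r (a + b - 2 r) = (a^2 + b^2 - 2 r^2) - (a - r)^2
    - (b - r)^2, and r is bounded below by [s0]. *)
Lemma r_second_diff t del : 0 <= del -> 0 <= t - del -> t + del <= T ->
  `|r (t + del) + r (t - del) - 2 * r t| <= cdd * del ^+ 2.
Proof.
move=> d0 td tdT.
have [[pT mT tT] [t0 tp tT' mt]] : [/\ 0 <= t + del <= T, 0 <= t - del <= T & 0 <= t <= T] /\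
    [/\ 0 <= t, t <= t + del, t <= T & t - del <= t] by split; split; lra.
have rt := r_low tT; have s2 : 0 < 2 * s0 by rewrite mulr_gt0.
rewrite /cdd mulrAC ler_pdivlMr//.
have A := energy_second_diff d0 td tdT.
have cc := cr_ge0.
have Ep : t + del - t = del by ring.
have Em : t - (t - del) = del by ring.
have lp := r_lip t0 tp tdT; rewrite Ep in lp.
have lm := r_lip td mt tT'; rewrite Em distrC in lm.
have sq (x y : R) : 0 <= y -> `|x| <= y -> x ^+ 2 <= y ^+ 2.
  by move=> y0 xy; rewrite -[leLHS]real_normK ?num_real// lerXn2r ?nnegrE.
have cd : 0 <= cr * del by exact: mulr_ge0.
have lp2 := sq _ _ cd lp; have lm2 := sq _ _ cd lm.
rewrite -!r_sqr// in A.
have rpos : 0 <= r t by apply: le_trans rt; exact: ltW.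
apply: le_trans (_ : `|2 * r t * (r (t + del) + r (t - del) - 2 * r t)| <= _).
  rewrite normrM [leRHS]mulrC ler_wpM2l// ger0_norm; lra.
have -> : 2 * r t * (r (t + del) + r (t - del) - 2 * r t) =
  (r (t + del) ^+ 2 + r (t - del) ^+ 2 - 2 * r t ^+ 2) -
  ((r (t + del) - r t) ^+ 2 + (r (t - del) - r t) ^+ 2) by ring.
apply: le_trans (ler_normB _ _) _.
rewrite [X in _ + X <= _]ger0_norm ?addr_ge0 ?sqr_ge0//.
rewrite [leRHS]mulrDl; apply: lerD => //.
rewrite -mulrA -exprMn; lra.
Qed.

Lemma cdd_ge0 : 0 <= cdd.
Proof.
have C0' := cF_ge0; have p0 := ltW pi0; have s0' := ltW s00; have c0 := cr_ge0.
rewrite /cdd; move: (2 * pi) cF cr p0 C0' c0 => q C e q0 C0' e0.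
by rewrite mulr_ge0 ?invr_ge0 ?mulr_ge0// addr_ge0 ?mulr_ge0// sqr_ge0.
Qed.

Definition cR : R := (cP + 2 * (cdd * cr)) / (2 * s0).

Lemma power_sav t : 0 <= t <= T -> dot (sav (u t)) (v t) = power t / r t.
Proof.
by move=> tT; rewrite savE (dotZl mD _ (F1u2 tT) (v2 tT)) mulrC.
Qed.

(** With the same a, b, 2 r (a - b) = (a^2 - b^2) - (a + b - 2 r)(a - b): the first term is the
    midpoint rule for the energy, the second is a second difference times a first one. *)
Lemma r_midpoint t del : 0 <= del -> 0 <= t - del -> t + del <= T ->
  `|r (t + del) - r (t - del) - del * dot (sav (u t)) (v t)| <= cR * del ^+ 3.
Proof.
move=> d0 td tdT.
have [[pT mT tT] mp] : [/\ 0 <= t + del <= T, 0 <= t - del <= T & 0 <= t <= T] /\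
    t - del <= t + del by split; [split; lra|lra].
have rt := r_low tT; have s2 : 0 < 2 * s0 by rewrite mulr_gt0.
have rpos : 0 < r t by exact: lt_le_trans rt.
rewrite /cR mulrAC ler_pdivlMr// power_sav//.
have A := energy_midpoint d0 td tdT; rewrite -!r_sqr// in A.
have B := r_second_diff d0 td tdT.
have l := r_lip td mp tdT; have cc := cr_ge0.
have E2 : t + del - (t - del) = 2 * del by ring.
rewrite E2 in l.
apply: le_trans (_ : `|2 * r t * (r (t + del) - r (t - del) - del * (power t / r t))| <= _).
  rewrite normrM [leRHS]mulrC ler_wpM2l// ger0_norm; lra.
have -> : 2 * r t * (r (t + del) - r (t - del) - del * (power t / r t)) =
  (r (t + del) ^+ 2 - r (t - del) ^+ 2 - 2 * del * power t) -
  (r (t + del) + r (t - del) - 2 * r t) * (r (t + del) - r (t - del)).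
  by field; rewrite gt_eqF.
apply: le_trans (ler_normB _ _) _; rewrite normrM.
have B' := ler_pM (normr_ge0 _) (normr_ge0 _) B l.
have -> : (cP + 2 * (cdd * cr)) * del ^+ 3 = cP * del ^+ 2 * del + cdd * del ^+ 2 * (cr * (2 * del)) by ring.
exact: lerD A B'.
Qed.

End TimeConsistency.

(** * Defects of the exact solution in the difference equations *)

Section Residuals.
Context {R : realType}.
Variables (a b c d : R).
Hypotheses (hab : b = a + 2 * pi) (hcd : d = c + 2 * pi).
Let Om : set (plane R) := `]a, b[ `*` `]c, d[.
Let mD : measurable Om := measurable_cell a b c d.
Let fD : (leb2 Om < +oo)%E := cell_measure_lty hab hcd.
Local Notation L2 := (L2 leb2 Om).
Local Notation dot := (L2dot leb2 Om).
Local Notation nrm := (L2nrm leb2 Om).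
Local Notation hat := (fhat Om).
Local Notation J := (J R).
Local Notation one := (fun=> 1 : R).
Local Notation wi r := (fun j : index => wt r j.1).
Local Notation aebdd := (aebdd a b c d).
Implicit Types (f g : plane R -> R) (t p q del : R).

Variables (kappa gamma1 gamma2 : R).
Hypotheses (kappa0 : 0 < kappa) (g10 : 0 <= gamma1) (g20 : 0 <= gamma2).
Variables (alpha T LL S : R).
Hypotheses (alpha1 : 1 < alpha) (LL0 : 0 <= LL) (S0 : 0 < S).
Hypothesis HS : forall N (x : index -> R) W, 0 <= W ->
  \sum_(j <- J N) wt alpha j.1 * x j ^+ 2 <= W ^+ 2 -> \sum_(j <- J N) `|x j| <= S * W.
Variables (F : R -> R) (M K : R).
Hypothesis hF : (forall (k : nat) (s : R), (k < 3)%N -> derivable (derive1n k F) s 1) /\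
            continuous (derive1n 3 F).
Hypotheses (MS : S * LL <= M) (nb : nonlin_bounds F M K).
Local Notation F1 := (derive1 F).
Local Notation lam := (lam alpha).

Variables (u v w z : R -> plane R -> R).
Hypothesis st : smooth_traj a b c d alpha T LL u v w z.
Hypothesis heq : forall t, 0 < t <= T -> forall j,
  hat (w t) j = - (kappa * (lam j * hat (u t) j) + gamma1 * (lam j * hat (v t) j)
    + gamma2 * hat (v t) j + hat (fun x => F1 (u t x)) j).

Let u2 := st_u2 st.
Let v2 := st_v2 st.
Let w2 := st_w2 st.
Let du := L2der_hat hab hcd (st_u2 st) (st_v2 st) (st_du st).
Let dv := L2der_hat hab hcd (st_v2 st) (st_w2 st) (st_dv st).
Let wa0 r (j : index) : 0 <= wt r j.1 :> R := wi_ge0 r j.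
Let lam0 (j : index) : 0 <= lam j := lam_ge0 alpha j.
Let one0 : forall i : index, 0 <= one i :> R. Proof. by move=> i; exact: ler01. Qed.

(** [res1] and [res2] are what the coefficients of the exact solution leave over in the two
    equations, for a step [2 * del] centred at [t]. *)
Definition res1 t del (j : index) : R :=
  (hat (u (t + del)) j - hat (u (t - del)) j) / (2 * del)
  - (hat (v (t + del)) j + hat (v (t - del)) j) / 2.

Definition res2 t del (j : index) : R :=
  (hat (v (t + del)) j - hat (v (t - del)) j) / (2 * del)
  + kappa * (lam j * ((hat (u (t + del)) j + hat (u (t - del)) j) / 2))
  + gamma1 * (lam j * ((hat (v (t + del)) j + hat (v (t - del)) j) / 2))
  + gamma2 * ((hat (v (t + del)) j + hat (v (t - del)) j) / 2)
  + hat (fun x => F1 (u t x)) j.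

Lemma vd_lin_le s (x y g phi : index -> R) :
  `|vd s one (fun j => kappa * (lam j * x j) + gamma1 * (lam j * y j) + gamma2 * y j + g j) phi|
  <= (kappa * vn s one (fun j => lam j * x j) + gamma2 * vn s one y + vn s one g) * vn s one phi
     + gamma1 * (vn s lam y * vn s lam phi).
Proof.
rewrite !vdDl !vdZl.
have -> : vd s one (fun j => lam j * y j) phi = vd s lam y phi.
  by apply: eq_bigr => j _; ring.
have k1 := ler_wpM2l (ltW kappa0) (vd_le_vn s one0 (fun j => lam j * x j) phi).
have k2 := ler_wpM2l g10 (vd_le_vn s lam0 y phi).
have k3 := ler_wpM2l g20 (vd_le_vn s one0 y phi).
have k4 := vd_le_vn s one0 g phi.
set X := vd s one (fun j => lam j * x j) phi in k1 *.
set Y := vd s lam y phi in k2 *; set Z := vd s one y phi in k3 *.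
set G := vd s one g phi in k4 *.
have := ler_normD (kappa * X + gamma1 * Y + gamma2 * Z) G.
have := ler_normD (kappa * X + gamma1 * Y) (gamma2 * Z).
have := ler_normD (kappa * X) (gamma1 * Y).
rewrite !normrM (ger0_norm (ltW kappa0)) (ger0_norm g10) (ger0_norm g20) !mulrDl.
by rewrite -[kappa * _ * _]mulrA -[gamma2 * _ * _]mulrA; lra.
Qed.

Section Fixed.
Variables (N : nat) (t del : R).
Hypotheses (d0 : 0 < del) (td : 0 <= t - del) (tdT : t + del <= T).

Let ud j := hat (u (t + del)) j - hat (u (t - del)) j - 2 * del * hat (v t) j.
Let udd j := hat (u (t + del)) j + hat (u (t - del)) j - 2 * hat (u t) j.
Let vdd j := hat (v (t + del)) j + hat (v (t - del)) j - 2 * hat (v t) j.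

Let res1E : res1 t del = fun j => (2 * del)^-1 * ud j - 2^-1 * vdd j.
Proof. by apply/funext => j; rewrite /res1 /ud /vdd; field; rewrite gt_eqF. Qed.

Let d2 : 0 < 2 * del. Proof. by rewrite mulr_gt0. Qed.

Lemma res1_le : vn (J N) (wi (alpha / 2)) (res1 t del) <= 2 * LL * del ^+ 2.
Proof.
have L0 := LL0; have d0' := ltW d0.
have M0 : 0 <= 2 * LL * del ^+ 2 by rewrite !mulr_ge0// ltW.
have h1 : vn (J N) (wi (alpha / 2)) ud <= 2 * LL * del ^+ 2 * del.
  apply: (vn_midpoint (wa0 _) du d0' M0 td tdT) => r /andP[r0 rd].
  have [r0' tr trT] : [/\ 0 <= r, 0 <= t - r & t + r <= T].
    by have := td; have := tdT => ? ?; split; lra.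
  apply: le_trans (traj_v_dd hab hcd LL0 st N r0' tr trT) _.
  by rewrite ler_wpM2l ?mulr_ge0// lerXn2r ?nnegrE// ltW.
have h2 := traj_v_dd hab hcd LL0 st N d0' td tdT.
rewrite res1E; apply: le_trans (vnB _ (wa0 _) _ _) _; rewrite !vnZ; try exact: wa0.
rewrite !ger0_norm ?invr_ge0 ?(ltW d2)//.
have h3 : (2 * del)^-1 * vn (J N) (wi (alpha / 2)) ud <= LL * del ^+ 2.
  by rewrite ler_pdivrMl//; apply: le_trans h1 _; rewrite le_eqVlt; apply/orP; left; apply/eqP; ring.
by have := lerD h3 (ler_wpM2l _ h2); lra.
Qed.

(** Meant for [lam_step]: second order is out of reach with the full symbol, but first order is
    enough there. *)
Lemma res1_lam_le : vn (J N) one (fun j => lam j * res1 t del j) <= 2 * LL * del.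
Proof.
have L0 := LL0; have d0' := ltW d0.
apply: le_trans (vn_lam2_wt alpha1 _ _) _.
have M0 : 0 <= 2 * LL * del by rewrite !mulr_ge0// ltW.
have h1 : vn (J N) (wi alpha) ud <= 2 * LL * del * del.
  apply: (vn_midpoint (wa0 _) du d0' M0 td tdT) => r /andP[r0 rd].
  have [r0' tr trT] : [/\ 0 <= r, 0 <= t - r & t + r <= T].
    by have := td; have := tdT => ? ?; split; lra.
  apply: le_trans (traj_v_dd1 hab hcd LL0 st N r0' tr trT) _.
  by rewrite ler_wpM2l ?mulr_ge0// ltW.
have h2 := traj_v_dd1 hab hcd LL0 st N d0' td tdT.
rewrite res1E; apply: le_trans (vnB _ (wa0 _) _ _) _; rewrite !vnZ; try exact: wa0.
rewrite !ger0_norm ?invr_ge0 ?(ltW d2)//.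
have h3 : (2 * del)^-1 * vn (J N) (wi alpha) ud <= LL * del.
  by rewrite ler_pdivrMl//; apply: le_trans h1 _; rewrite le_eqVlt; apply/orP; left; apply/eqP; ring.
by have := lerD h3 (ler_wpM2l _ h2); lra.
Qed.

Definition cW : R := kappa * (2 * LL) + gamma2 * (2 * LL) + 2 * LL + cF LL S K.

Lemma cW_ge0 : 0 <= cW.
Proof.
have cF0 := cF_ge0 S LL0 nb; have L0 := LL0.
by rewrite /cW !addr_ge0// !mulr_ge0// ltW.
Qed.

(* Since no fourth time derivative is available, the second difference of u_tt is
   read off the equation; the damping term costs a factor [lam], moved onto [phi]. *)
Lemma w_dd_le (phi : index -> R) : 0 < t - del ->
  `|vd (J N) one (fun j => hat (w (t + del)) j + hat (w (t - del)) j - 2 * hat (w t) j) phi|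
  <= cW * del ^+ 2 * (vn (J N) one phi + gamma1 * vn (J N) lam phi).
Proof.
move=> td0; have d0' := ltW d0; have L0 := LL0.
have [pT mT tT] : [/\ 0 < t + del <= T, 0 < t - del <= T & 0 < t <= T].
  by have := td; have := tdT; have := d0 => ? ? ?; split; lra.
have wk q : 0 < q <= T -> 0 <= q <= T by lra.
pose g x := F1 (u (t + del) x) + F1 (u (t - del) x) - 2 * F1 (u t x).
have F12 q : 0 < q <= T -> L2 (fun x => F1 (u q x)).
  move=> qT; have uq := u_aebdd hab hcd LL0 HS MS st (wk _ qT).
  exact (aebdd_L2 hab hcd (aebdd_F1 hF nb uq)).
have fp := F12 _ pT; have fm := F12 _ mT; have ft := F12 _ tT.
have g2 : L2 g by exact: (L2B mD (L2D mD fp fm) (L2Z mD 2 ft)).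
have hg j : hat g j = hat (fun x => F1 (u (t + del) x)) j + hat (fun x => F1 (u (t - del) x)) j
    - 2 * hat (fun x => F1 (u t x)) j.
  by rewrite (hatB hab hcd _ (L2D mD fp fm) (L2Z mD 2 ft)) (hatD hab hcd _ fp fm) (hatZ hab hcd _ _ ft).
have -> : (fun j => hat (w (t + del)) j + hat (w (t - del)) j - 2 * hat (w t) j) =
   (fun j => -1 * (kappa * (lam j * udd j) + gamma1 * (lam j * vdd j) + gamma2 * vdd j + hat g j)).
  apply/funext => j; rewrite hg (heq pT) (heq mT) (heq tT) /udd /vdd.
  move: (hat _ j) (hat _ j) (hat _ j) (hat _ j) (hat _ j) (hat _ j) (hat _ j) (hat _ j) (hat _ j).
  by move=> *; ring.
rewrite vdZl normrM normrN1 mul1r; apply: le_trans (vd_lin_le _ _ _ _ _) _.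
have h1 := le_trans (vn_lam2_wt alpha1 (J N) udd) (traj_u_dd hab hcd LL0 st N d0' td tdT).
have h2 := traj_v_dd hab hcd LL0 st N d0' td tdT.
have a2 : 0 <= alpha / 2 by have := alpha1; lra.
have h3 := le_trans (vn_one_wt (J N) vdd a2) h2.
have h4 := le_trans (vn_lam_wt alpha1 (J N) vdd) h2.
have h5 := le_trans (vn_one_hat hab hcd N g2)
  (nrm_F1_second_diff hab hcd alpha1 LL0 S0 HS hF MS nb st d0' td tdT).
have n0 := vn_ge0 (J N) one phi; have n1 := vn_ge0 (J N) lam phi.
have cF0 := cF_ge0 S LL0 nb.
have e2 : 0 <= del ^+ 2 by exact: sqr_ge0.
rewrite mulrDr; apply: lerD.
  rewrite ler_wpM2r// /cW.
  have := lerD (lerD (ler_wpM2l (ltW kappa0) h1) (ler_wpM2l g20 h3)) h5.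
  have := mulr_ge0 (mulr_ge0 (ler0n R 2) L0) e2.
  by move: (cF _ _ _) (vn _ _ _) (vn _ _ _) (vn _ _ _) (del ^+ 2) => ? ? ? ? ?; lra.
rewrite [leRHS]mulrCA ler_wpM2l// ler_wpM2r//; apply: le_trans h4 _; rewrite ler_wpM2r// /cW.
have k1 : 0 <= kappa * (2 * LL) by rewrite !mulr_ge0// ltW.
have k2 : 0 <= gamma2 * (2 * LL) by rewrite !mulr_ge0.
by move: k1 k2; move: (kappa * _) (gamma2 * _) => ? ?; lra.
Qed.

End Fixed.

(** Subtracting the equation at [t] leaves the midpoint error of u_t and half the second differences
    of the linear terms; [F'(u t)] cancels, being frozen at the midpoint. *)
Lemma res2_dual N t del (phi : index -> R) : 0 < del -> 0 <= t - del -> t + del <= T ->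
  `|vd (J N) one (res2 t del) phi| <=
    cW * del ^+ 2 * (vn (J N) one phi + gamma1 * vn (J N) lam phi).
Proof.
move=> d0 td tdT; have d0' := ltW d0; have L0 := LL0.
have tT : 0 < t <= T by lra.
have n0 := vn_ge0 (J N) one phi; have n1 := vn_ge0 (J N) lam phi.
set Q := vn (J N) one phi + gamma1 * vn (J N) lam phi.
have Q0 : 0 <= Q by rewrite addr_ge0// mulr_ge0.
pose udd j := hat (u (t + del)) j + hat (u (t - del)) j - 2 * hat (u t) j.
pose vdd j := hat (v (t + del)) j + hat (v (t - del)) j - 2 * hat (v t) j.
pose vm j := hat (v (t + del)) j - hat (v (t - del)) j - 2 * del * hat (w t) j.
have -> : res2 t del = fun j => (2 * del)^-1 * vm j +
    2^-1 * (kappa * (lam j * udd j) + gamma1 * (lam j * vdd j) + gamma2 * vdd j + 0).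
  apply/funext => j; rewrite /res2 /vm /udd /vdd (heq tT).
  move: (hat _ j) (hat _ j) (hat _ j) (hat _ j) (hat _ j) (hat _ j) (hat _ j).
  by move=> *; field; rewrite gt_eqF.
rewrite vdDl !vdZl; apply: le_trans (ler_normD _ _) _; rewrite !normrM.
have d2 : 0 < 2 * del by rewrite mulr_gt0.
have i2 : (0 : R) <= 2^-1 by rewrite invr_ge0.
have d2V : 0 <= (2 * del)^-1 by rewrite invr_ge0 ltW.
rewrite (ger0_norm i2) (ger0_norm d2V).
have h1 : `|vd (J N) one vm phi| <= cW * del ^+ 2 * Q * del.
  have dvd' := dder_vd (J N) one dv phi.
  have := dder_midpoint (M := cW * del ^+ 2 * Q) d0' td tdT dvd'.
  have -> : vd (J N) one (fun j => hat (v (t + del)) j) phi - vd (J N) one (fun j => hat (v (t - del)) j) phi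
     - 2 * del * vd (J N) one (fun j => hat (w t) j) phi = vd (J N) one vm phi.
    by rewrite /vm !vdBl vdZl.
  apply => r /andP[r0 rd].
  (* [t - r] is positive even when [t - del = 0], so the equation, which holds for positive times,
     is available in the first step too. *)
  have [r1 r2 r3] : [/\ 0 <= t - r, t + r <= T & 0 < t - r] by split; lra.
  have -> : vd (J N) one (fun j => hat (w (t + r)) j) phi + vd (J N) one (fun j => hat (w (t - r)) j) phi
     - 2 * vd (J N) one (fun j => hat (w t) j) phi =
     vd (J N) one (fun j => hat (w (t + r)) j + hat (w (t - r)) j - 2 * hat (w t) j) phi.
    by rewrite vdBl vdDl vdZl.
  apply: le_trans (w_dd_le N r0 r1 r2 phi r3) _.
  by rewrite ler_wpM2r// ler_wpM2l ?cW_ge0// lerXn2r ?nnegrE// ltW.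
have h2 : `|vd (J N) one (fun j => kappa * (lam j * udd j) + gamma1 * (lam j * vdd j)
    + gamma2 * vdd j + 0) phi| <= cW * del ^+ 2 * Q.
  apply: le_trans (vd_lin_le _ _ _ (fun=> 0) _) _.
  have k1 := le_trans (vn_lam2_wt alpha1 (J N) udd) (traj_u_dd hab hcd LL0 st N d0' td tdT).
  have k2 := traj_v_dd hab hcd LL0 st N d0' td tdT.
  have a2 : 0 <= alpha / 2 by have := alpha1; lra.
  have k3 := le_trans (vn_one_wt (J N) vdd a2) k2.
  have k4 := le_trans (vn_lam_wt alpha1 (J N) vdd) k2.
  have k5 : vn (J N) one (fun=> 0) = 0.
    by rewrite /vn /vd big1 ?sqrtr0// => j _; rewrite mul0r mulr0.
  have cF0 := cF_ge0 S LL0 nb.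
  have e2 : 0 <= del ^+ 2 by exact: sqr_ge0.
  rewrite k5 addr0 /Q mulrDr; apply: lerD.
    rewrite ler_wpM2r// /cW.
    have := lerD (ler_wpM2l (ltW kappa0) k1) (ler_wpM2l g20 k3).
    have := mulr_ge0 (mulr_ge0 (ler0n R 2) L0) e2.
    have := mulr_ge0 cF0 e2.
    by move: (cF _ _ _) (vn _ _ _) (vn _ _ _) (del ^+ 2) => ? ? ? ?; lra.
  rewrite [leRHS]mulrCA ler_wpM2l// ler_wpM2r//; apply: le_trans k4 _; rewrite ler_wpM2r// /cW.
  have l1 : 0 <= kappa * (2 * LL) by rewrite !mulr_ge0// ltW.
  have l2 : 0 <= gamma2 * (2 * LL) by rewrite !mulr_ge0.
  by move: l1 l2 cF0; move: (kappa * _) (gamma2 * _) (cF _ _ _) => ? ? ?; lra.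
have h3 : (2 * del)^-1 * `|vd (J N) one vm phi| <= cW * del ^+ 2 * Q / 2.
  rewrite ler_pdivrMl//; apply: le_trans h1 _; rewrite le_eqVlt; apply/orP; left; apply/eqP.
  by field.
apply: le_trans (lerD h3 (ler_wpM2l i2 h2)) _.
by rewrite le_eqVlt; apply/orP; left; apply/eqP; field.
Qed.

Definition cV : R := LL * (1 + kappa * T + gamma1 + gamma2 * T).

(** [lam_step] requires the plain norm instead of a dual one. First order is affordable: it takes
    the Lipschitz bound of u_tt and first differences of u_t in H^alpha. Spare powers of [del] are
    bounded by [T]. *)
Lemma res2_le N t del : 0 < del -> 0 <= t - del -> t + del <= T ->
  vn (J N) one (res2 t del) <= cV * del.
Proof.
move=> d0 td tdT; have d0' := ltW d0; have L0 := LL0.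
have tT : 0 < t <= T by lra.
have dT : del <= T by lra.
pose udd j := hat (u (t + del)) j + hat (u (t - del)) j - 2 * hat (u t) j.
pose vdd j := hat (v (t + del)) j + hat (v (t - del)) j - 2 * hat (v t) j.
pose vm j := hat (v (t + del)) j - hat (v (t - del)) j - 2 * del * hat (w t) j.
have d2 : 0 < 2 * del by rewrite mulr_gt0.
have a2 : 0 <= alpha / 2 by have := alpha1; lra.
have k1 := le_trans (vn_lam2_wt alpha1 (J N) udd) (traj_u_dd hab hcd LL0 st N d0' td tdT).
have k2 := le_trans (vn_lam2_wt alpha1 (J N) vdd) (traj_v_dd1 hab hcd LL0 st N d0' td tdT).
have k3 := le_trans (vn_one_wt (J N) vdd a2) (traj_v_dd hab hcd LL0 st N d0' td tdT).
have M0 : 0 <= 2 * LL * del by rewrite !mulr_ge0// ltW.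
have h1 : vn (J N) one vm <= 2 * LL * del * del.
  apply: (le_trans (vn_one_wt (J N) vm a2)).
  apply: (vn_midpoint (wa0 _) dv d0' M0 td tdT) => r /andP[r0 rd].
  have [r0' tr trT] : [/\ 0 <= r, 0 <= t - r & t + r <= T] by split; lra.
  apply: le_trans (traj_w_dd1 hab hcd LL0 st N r0' tr trT) _.
  by rewrite ler_wpM2l ?mulr_ge0// ltW.
have -> : res2 t del = fun j => (2 * del)^-1 * vm j +
    (kappa / 2 * (lam j * udd j) + (gamma1 / 2 * (lam j * vdd j) + gamma2 / 2 * vdd j)).
  apply/funext => j; rewrite /res2 /vm /udd /vdd (heq tT).
  move: (hat _ j) (hat _ j) (hat _ j) (hat _ j) (hat _ j) (hat _ j) (hat _ j).
  by move=> *; field; rewrite gt_eqF.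
apply: le_trans (vnD _ one0 _ _) _.
have h2 : (2 * del)^-1 * vn (J N) one vm <= LL * del.
  by rewrite ler_pdivrMl//; apply: le_trans h1 _; rewrite le_eqVlt; apply/orP; left; apply/eqP; ring.
rewrite [vn _ _ (fun j => (2 * del)^-1 * vm j)]vnZ.
have d2V : 0 <= (2 * del)^-1 by rewrite invr_ge0 ltW.
rewrite (ger0_norm d2V) /cV.
apply: le_trans (lerD h2 (vnD _ one0 _ _)) _.
apply: le_trans (lerD (lexx _) (lerD (lexx _) (vnD _ one0 _ _))) _.
have [n1 n2 n3] : [/\ 0 <= kappa / 2, 0 <= gamma1 / 2 & 0 <= gamma2 / 2].
  by rewrite !mulr_ge0 ?invr_ge0// ltW.
rewrite !vnZ (ger0_norm n1) (ger0_norm n2) (ger0_norm n3).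
have kk : kappa / 2 * vn (J N) one (fun j => lam j * udd j) <= LL * (kappa * T) * del.
  apply: le_trans (ler_wpM2l _ k1) _; first by rewrite mulr_ge0// ltW.
  have -> : kappa / 2 * (2 * LL * del ^+ 2) = LL * kappa * del * del by field.
  have -> : LL * (kappa * T) * del = LL * kappa * T * del by ring.
  by rewrite ler_wpM2r// ler_wpM2l// mulr_ge0// ltW.
have gg : gamma1 / 2 * vn (J N) one (fun j => lam j * vdd j) <= LL * gamma1 * del.
  apply: le_trans (ler_wpM2l _ k2) _; first by rewrite mulr_ge0.
  by rewrite le_eqVlt; apply/orP; left; apply/eqP; field.
have gg2 : gamma2 / 2 * vn (J N) one vdd <= LL * (gamma2 * T) * del.
  apply: le_trans (ler_wpM2l _ k3) _; first by rewrite mulr_ge0.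
  have -> : gamma2 / 2 * (2 * LL * del ^+ 2) = LL * gamma2 * del * del by field.
  have -> : LL * (gamma2 * T) * del = LL * gamma2 * T * del by ring.
  by rewrite ler_wpM2r// ler_wpM2l// mulr_ge0.
have := lerD (lexx (LL * del)) (lerD kk (lerD gg gg2)); move=> h; apply: (le_trans h).
by rewrite le_eqVlt; apply/orP; left; apply/eqP; ring.
Qed.

End Residuals.

(** * The scheme *)

Section SchemeCoefficients.
Context {R : realType}.
Variables (a b c d : R).
Hypotheses (hab : b = a + 2 * pi) (hcd : d = c + 2 * pi).
Let Om : set (plane R) := `]a, b[ `*` `]c, d[.
Let mD : measurable Om := measurable_cell a b c d.
Let fD : (leb2 Om < +oo)%E := cell_measure_lty hab hcd.
Local Notation L2 := (L2 leb2 Om).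
Local Notation dot := (L2dot leb2 Om).
Local Notation nrm := (L2nrm leb2 Om).
Local Notation hat := (fhat Om).
Local Notation J := (J R).
Local Notation PN := (projN Om).
Local Notation one := (fun=> 1 : R).
Local Notation aebdd := (aebdd a b c d).
Implicit Types (f g q : plane R -> R).

Variables (kappa alpha gamma1 gamma2 : R) (F : R -> R) (C0 : R).
Hypothesis hF : (forall (k : nat) (s : R), (k < 3)%N -> derivable (derive1n k F) s 1) /\
            continuous (derive1n 3 F).
Local Notation F1 := (derive1 F).
Local Notation lam := (lam alpha).
Local Notation E := (energy Om F C0).
Local Notation sav := (sav a b c d F C0).

Let pi0 : 0 < 2 * pi :> R. Proof. by rewrite mulr_gt0 ?pi_gt0. Qed.
Let one0 : forall i : index, 0 <= one i :> R. Proof. by move=> i; exact: ler01. Qed.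

Lemma XN_aebdd N q B : XN N q -> \sum_(j <- J N) `|hat q j| <= B -> aebdd B q.
Proof.
move=> qN qB; split; first exact: XN_measurable qN.
by apply: aeW => x Dx; apply: le_trans (XN_le hab hcd x qN) qB.
Qed.

Lemma L2_sav_XN N q : XN N q -> L2 (sav q).
Proof.
move=> qN; pose B := \sum_(j <- J N) `|hat q j|.
have [|K nb] := nonlin_bounds_ex hF (M := B); first by apply: sumr_ge0.
exact: (L2_sav hab hcd C0 hF nb (XN_aebdd qN (lexx _))).
Qed.

Lemma is_PN_hat N f p : L2 f -> is_PN Om N f p -> {in J N, hat p =1 hat f}.
Proof.
move=> f2 [pN ort] j jN; have := ort _ (XN_tj jN).
have p2 := XN_L2 hab hcd pN; have t2 := L2_tj hab hcd j.
have -> : ip Om (f \- p) (tj j) = dot f (tj j) - dot p (tj j).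
  by rewrite -(dotBl mD f2 p2 t2).
move=> /eqP; rewrite subr_eq0 => /eqP h.
by rewrite /fhat h.
Qed.

Lemma dot_XN_eq N f g g' : L2 f -> XN N g -> XN N g' -> {in J N, hat g =1 hat g'} ->
  dot f g = dot f g'.
Proof.
move=> f2 gN gN' gg; rewrite (dot_XN hab hcd f2 gN) (dot_XN hab hcd f2 gN').
by rewrite big_seq [RHS]big_seq; apply: eq_bigr => j /gg ->.
Qed.

Lemma hat_quot f g s j : L2 f -> L2 g -> hat (fun x => (f x - g x) / s) j = (hat f j - hat g j) / s.
Proof.
move=> f2 g2; have -> : (fun x => (f x - g x) / s) = (fun x => s^-1 * (f x - g x)).
  by apply/funext => x; rewrite mulrC.
by rewrite (hatZ hab hcd _ _ (L2B mD f2 g2)) hatB// mulrC.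
Qed.

Lemma XN_quot N f g s : XN N f -> XN N g -> XN N (fun x => (f x - g x) / s).
Proof.
move=> fN gN; have := XN_Z s^-1 (XN_D fN (XN_Z (-1) gN)).
by congr XN; apply/funext => x; rewrite mulN1r mulrC.
Qed.

(** Testing with the waves of [J N] decouples the linear part. In the scalar equation the quotient
    of the position is replaced by [vm], as both are in X_N with the same coefficients. The
    evaluation points are kept general to cover both the first step and the later ones. *)
Lemma sav_increment N q f f' g g' (rho rho' s : R) um vm rm : 0 < s ->
  XN N q -> XN N f -> XN N f' -> XN N g -> XN N g' -> XN N vm ->
  SAV_equations Om kappa alpha gamma1 gamma2 F C0 N q um vm rm
    (fun x => (f' x - f x) / s) (fun x => (g' x - g x) / s) ((rho' - rho) / s) ->
  [/\ {in J N, forall j, hat f' j - hat f j = s * hat vm j},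
      {in J N, forall j, hat g' j - hat g j + s * (kappa * (lam j * hat um j)
         + gamma1 * (lam j * hat vm j) + gamma2 * hat vm j + rm * hat (sav q) j) = 0} &
      rho' - rho = s / 2 * dot (sav q) vm].
Proof.
move=> s0 qN fN fN' gN gN' vN [h1 [Au [Av [hAu hAv h2]]] h3].
have f2 := XN_L2 hab hcd fN; have f2' := XN_L2 hab hcd fN'.
have g2 := XN_L2 hab hcd gN; have g2' := XN_L2 hab hcd gN'.
have sq2 := L2_sav_XN qN.
have E1 : {in J N, hat (fun x => (f' x - f x) / s) =1 hat vm}.
  by move=> j jN; have := h1 _ (XN_tj jN); rewrite /fhat /L2dot /ip => ->.
split.
- by move=> j jN; rewrite -E1// hat_quot// mulrC divfK// gt_eqF.
- move=> j jN; have := h2 _ (XN_tj jN).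
  have ipE h : ip Om h (tj j) = 2 * pi * hat h j by rewrite -(dot_tjE a b c d).
  rewrite !ipE hat_quot// (fracLap_hat hAu) (fracLap_hat hAv).
  move: (2 * pi) pi0 => p p0; rewrite /lam.
  have -> : hat (fun x => F1 (q x) / Num.sqrt (E q)) j = hat (sav q) j by [].
  move=> h; have : p * ((hat g' j - hat g j) / s + kappa * (freq2 j.1 `^ (alpha / 2) * hat um j)
    + gamma1 * (freq2 j.1 `^ (alpha / 2) * hat vm j) + gamma2 * hat vm j + rm * hat (sav q) j) = 0.
    by rewrite -[RHS]h; ring.
  move=> /eqP; rewrite mulf_eq0 gt_eqF//= => /eqP h'.
  transitivity (s * ((hat g' j - hat g j) / s + kappa * (freq2 j.1 `^ (alpha / 2) * hat um j)
    + gamma1 * (freq2 j.1 `^ (alpha / 2) * hat vm j) + gamma2 * hat vm j + rm * hat (sav q) j)).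
    by field; rewrite gt_eqF.
  by rewrite h' mulr0.
- have F12 : L2 (fun x => F1 (q x)).
    pose B := \sum_(j <- J N) `|hat q j|.
    have [|K nb] := nonlin_bounds_ex hF (M := B); first by apply: sumr_ge0.
    exact: (aebdd_L2 hab hcd (aebdd_F1 hF nb (XN_aebdd qN (lexx _)))).
  have duN := XN_quot s fN' fN; have du2 := XN_L2 hab hcd duN.
  rewrite -(dot_XN_eq sq2 duN vN E1) savE (dotZl mD _ F12 du2).
  have -> : rho' - rho = (rho' - rho) / s * s by rewrite divfK// gt_eqF.
  rewrite h3 invfM /ip /L2dot.
  move: (\int[_]_(x in _) _) (Num.sqrt _)^-1 => y e; ring.
Qed.
End SchemeCoefficients.

(** * A priori bounds for the implicit Euler predictor *)

Section ImplicitEuler.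
Context {R : realType} (I : eqType).
Variables (s : seq I) (l : I -> R).
Hypothesis l0 : forall i, 0 <= l i.
Variables (kappa gamma1 gamma2 sig A H : R).
Hypotheses (kappa0 : 0 < kappa) (g10 : 0 <= gamma1) (g20 : 0 <= gamma2) (sig0 : 0 < sig).
Local Notation one := (fun=> 1 : R).
Local Notation n0 := (vn s one).
Variables (d g h : I -> R).
(** The equation for the velocity increment [d] once position and scalar variable are eliminated;
    the latter leaves the rank-one term in [h]. *)
Hypothesis dE : {in s, forall i, d i + sig * (sig * (kappa * (l i * d i)) + gamma1 * (l i * d i)
  + gamma2 * d i) + sig ^+ 2 / 2 * vd s one h d * h i = - sig * g i}.
Hypotheses (gA : n0 g <= A) (hH : n0 h <= H).

Let one0 : forall i : I, 0 <= one i :> R. Proof. by move=> i; exact: ler01. Qed.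

Lemma euler_test (phi : I -> R) : vd s one d phi + sig * (sig * (kappa * vd s l d phi)
  + gamma1 * vd s l d phi + gamma2 * vd s one d phi) + sig ^+ 2 / 2 * vd s one h d * vd s one h phi
  = - sig * vd s one g phi.
Proof.
have -> : vd s l d phi = vd s one (fun i => l i * d i) phi.
  by apply: eq_bigr => i _; ring.
transitivity (vd s one (fun i => d i + sig * (sig * (kappa * (l i * d i)) + gamma1 * (l i * d i)
  + gamma2 * d i) + sig ^+ 2 / 2 * vd s one h d * h i) phi).
  by rewrite !(vdDl, vdZl).
by rewrite -[RHS]vdZl; exact: (vd_eq one dE).
Qed.

(** Tested with [d] itself, every term on the left is nonnegative; the rank-one term becomes a
    square. *)
Lemma euler_le : n0 d <= sig * A.
Proof.
have A0 : 0 <= A := le_trans (vn_ge0 _ _ _) gA.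
apply: (vn_dual one0); first by rewrite mulr_ge0 ?(ltW sig0).
have := euler_test d.
have := vd_le_vn s one0 g d; rewrite ler_norml => /andP[h1 _].
have h2 := ler_wpM2r (vn_ge0 s one d) gA.
have p1 := vd_ge0 s l0 d; have p2 := vd_ge0 s one0 d.
have q1 : 0 <= sig * (sig * (kappa * vd s l d d) + gamma1 * vd s l d d + gamma2 * vd s one d d).
  by rewrite mulr_ge0 ?(ltW sig0)// !addr_ge0// ?mulr_ge0 ?(ltW sig0) ?(ltW kappa0).
have q2 : 0 <= sig ^+ 2 / 2 * vd s one h d * vd s one h d.
  by rewrite -mulrA -expr2 mulr_ge0 ?sqr_ge0// mulr_ge0 ?sqr_ge0.
have h3 : - sig * vd s one g d <= sig * A * n0 d.
  have := ler_wpM2l (ltW sig0) (le_trans _ h2).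
  rewrite -mulrA mulNr -mulrN; apply; lra.
lra.
Qed.

(* Testing with [l d] bounds the predictor in a norm that controls the sup norm. *)
Lemma euler_lam_le : sig * (kappa * n0 (fun i => l i * d i)) <= A + sig ^+ 2 / 2 * H ^+ 2 * A.
Proof.
have A0 : 0 <= A := le_trans (vn_ge0 _ _ _) gA.
have H0 : 0 <= H := le_trans (vn_ge0 _ _ _) hH.
pose phi i := l i * d i; have P0 := vn_ge0 s one phi.
have sk : 0 < sig * kappa by rewrite mulr_gt0.
rewrite mulrA mulrC -ler_pdivlMr//; apply: (vn_dual one0).
  by rewrite divr_ge0 ?(ltW sk)// addr_ge0// mulr_ge0// mulr_ge0 ?sqr_ge0// mulr_ge0 ?sqr_ge0.
rewrite -/phi mulrAC ler_pdivlMr// -(ler_pM2l sig0).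
have := euler_test phi.
have E1 : vd s l d phi = vd s one phi phi by apply: eq_bigr => i _; rewrite /phi; ring.
have p1 : 0 <= vd s one d phi by apply: sumr_ge0 => i _; rewrite /phi mul1r mulrCA -expr2 mulr_ge0 ?sqr_ge0.
have p2 := vd_ge0 s one0 phi.
rewrite E1; set D := vd s one phi phi in p2 *.
have := vd_le_vn s one0 g phi; rewrite ler_norml => /andP[h1 _].
have h2 := ler_wpM2r P0 gA.
have d1 := euler_le.
(* Against [phi] the rank-one term has no sign, and it is estimated with [euler_le]. *)
have h3 : `|vd s one h d * vd s one h phi| <= (H * (sig * A)) * (H * n0 phi).
  rewrite normrM; apply: ler_pM => //.
    by apply: le_trans (vd_le_vn s one0 _ _) _; apply: ler_pM; rewrite ?vn_ge0.
  by apply: le_trans (vd_le_vn s one0 _ _) _; rewrite ler_wpM2r ?vn_ge0.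
move: h3; rewrite ler_norml => /andP[h3 _].
have s2 : 0 <= sig ^+ 2 / 2 by rewrite mulr_ge0 ?sqr_ge0.
have h4 := ler_wpM2l s2 h3; rewrite [sig ^+ 2 / 2 * (_ * _)]mulrA in h4.
have q1 : 0 <= sig * (gamma1 * D) by rewrite !mulr_ge0// ltW.
have q2 : 0 <= sig * (gamma2 * vd s one d phi) by rewrite !mulr_ge0// ltW.
have h5 : - sig * vd s one g phi <= sig * (A * n0 phi).
  by rewrite mulNr -mulrN ler_wpM2l ?(ltW sig0)//; lra.
move: h4 h5; set X := sig ^+ 2 / 2 * vd s one h d * vd s one h phi => h4 h5 E.
have E' : sig ^+ 2 / 2 * - (H * (sig * A) * (H * n0 phi)) =
  - (sig * ((sig ^+ 2 / 2 * H ^+ 2 * A) * n0 phi)) by ring.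
rewrite E' in h4; lra.
Qed.

End ImplicitEuler.

Section RealArithmetic.
Context {R : realType}.

Lemma sum6_ge (x1 x2 x3 x4 x5 x6 : R) : 0 <= x1 -> 0 <= x2 -> 0 <= x3 -> 0 <= x4 -> 0 <= x5 ->
  0 <= x6 -> [/\ x1 <= x1 + x2 + x3 + x4 + x5 + x6, x2 <= x1 + x2 + x3 + x4 + x5 + x6 &
    x3 <= x1 + x2 + x3 + x4 + x5 + x6].
Proof. by move=> *; split; lra. Qed.

Lemma pos3 (x1 x2 x3 : R) : 0 <= x1 -> 0 <= x2 -> 0 <= x3 -> 0 <= x1 + x2 + x3.
Proof. by move=> *; lra. Qed.

Lemma pos4 (x1 x2 x3 x4 : R) : 0 <= x1 -> 0 <= x2 -> 0 <= x3 -> 0 <= x4 ->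
  0 <= x1 + x2 + x3 + x4.
Proof. by move=> *; lra. Qed.

Lemma half_le (x p : R) : 0 <= x -> 0 <= p -> x / 2 <= x + p. Proof. by move=> *; lra. Qed.

Lemma avg_le (x y w : R) : 0 <= x -> 0 <= y -> w <= x + y -> w * 2^-1 <= y + x.
Proof. by move=> *; lra. Qed.

Lemma half_dd (x L y p : R) : x <= 2 * L * y -> L * y <= p -> 2^-1 * x <= p.
Proof. by rewrite -mulrA; move: (L * y) => *; lra. Qed.

Lemma combine_res (H c p l e x y : R) : 0 <= H -> 0 <= c -> 0 <= p -> 0 <= l -> 0 <= e ->
  0 <= x -> 0 <= y -> c * e * H + (x + y) * H <= H * (c + p + l + 1) * (e + x + y) /\
  H * (p * e + (l * e + (x + y))) <= H * (c + p + l + 1) * (e + x + y).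
Proof.
move=> H0 c0 p0 l0 e0 x0 y0.
have := mulr_ge0 (mulr_ge0 H0 (addr_ge0 p0 l0)) (addr_ge0 x0 y0).
have := mulr_ge0 (mulr_ge0 H0 c0) (addr_ge0 x0 y0).
have := mulr_ge0 (mulr_ge0 H0 (addr_ge0 p0 l0)) e0.
have := mulr_ge0 (mulr_ge0 H0 c0) e0; have := mulr_ge0 H0 e0.
by split; lra.
Qed.

Lemma combine_first (p l g x y q r s : R) : 0 <= p -> 0 <= l + g -> 0 <= x -> 0 <= q ->
  r <= p * x -> y <= (l + g) * s -> s <= q -> r + y <= (p + l + g) * (q + x).
Proof.
move=> p0 lg0 x0 q0 rx ys sq.
have := ler_wpM2l lg0 sq; have := mulr_ge0 p0 q0; have := mulr_ge0 lg0 x0; lra.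
Qed.

End RealArithmetic.

(** * Comparison of the scheme with the exact solution on one step *)

Section SchemeConsistency.
Context {R : realType}.
Variables (a b c d : R).
Hypotheses (hab : b = a + 2 * pi) (hcd : d = c + 2 * pi).
Let Om : set (plane R) := `]a, b[ `*` `]c, d[.
Let mD : measurable Om := measurable_cell a b c d.
Let fD : (leb2 Om < +oo)%E := cell_measure_lty hab hcd.
Local Notation L2 := (L2 leb2 Om).
Local Notation dot := (L2dot leb2 Om).
Local Notation nrm := (L2nrm leb2 Om).
Local Notation hat := (fhat Om).
Local Notation J := (J R).
Local Notation PN := (projN Om).
Local Notation one := (fun=> 1 : R).
Local Notation wi r := (fun j : index => wt r j.1).
Local Notation aebdd := (aebdd a b c d).

Variables (kappa gamma1 gamma2 : R).
Hypotheses (kappa0 : 0 < kappa) (g10 : 0 <= gamma1) (g20 : 0 <= gamma2).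
Variables (alpha T LL S : R).
Hypotheses (alpha1 : 1 < alpha) (LL0 : 0 <= LL) (S0 : 0 < S) (T0 : 0 < T).
Hypothesis HS : forall N (x : index -> R) W, 0 <= W ->
  \sum_(j <- J N) wt alpha j.1 * x j ^+ 2 <= W ^+ 2 -> \sum_(j <- J N) `|x j| <= S * W.
Variables (F : R -> R) (C0 M K s0 : R).
Hypothesis hF : (forall (k : nat) (s : R), (k < 3)%N -> derivable (derive1n k F) s 1) /\
            continuous (derive1n 3 F).
Hypotheses (MS : S * LL <= M) (nb : nonlin_bounds F M K) (s00 : 0 < s0).
Hypothesis hs0 : forall f, aebdd M f -> s0 ^+ 2 <= energy Om F C0 f.
Local Notation F1 := (derive1 F).
Local Notation E := (energy Om F C0).
Local Notation sav := (sav a b c d F C0).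
Local Notation lam := (lam alpha).

Variables (u v w z : R -> plane R -> R).
Hypothesis st : smooth_traj a b c d alpha T LL u v w z.
Hypothesis heq : forall t, 0 < t <= T -> forall j,
  hat (w t) j = - (kappa * (lam j * hat (u t) j) + gamma1 * (lam j * hat (v t) j)
    + gamma2 * hat (v t) j + hat (fun x => F1 (u t x)) j).
Variables (m P : R).
Hypothesis P0 : 0 <= P.
Hypothesis pu : forall N t, (0 < N)%N -> 0 <= t <= T ->
  nrm (fun x => u t x - PN N (u t) x) <= P * N%:R `^ (- m).
Hypothesis pv : forall N t, (0 < N)%N -> 0 <= t <= T ->
  nrm (fun x => v t x - PN N (v t) x) <= P * N%:R `^ (- m).

Let u2 := st_u2 st.
Let v2 := st_v2 st.
Let du := L2der_hat hab hcd (st_u2 st) (st_v2 st) (st_du st).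
Let wa0 r (j : index) : 0 <= wt r j.1 :> R := wi_ge0 r j.
Let one0 : forall i : index, 0 <= one i :> R. Proof. by move=> i; exact: ler01. Qed.
Let pi0 : 0 < 2 * pi :> R. Proof. by rewrite mulr_gt0 ?pi_gt0. Qed.

Lemma nrm_sub_XN N f g : L2 f -> XN N g ->
  nrm (fun x => f x - g x) <= nrm (fun x => f x - PN N f x) +
    vn (J N) one (fun j => hat f j - hat g j).
Proof.
move=> f2 gN; have p2 := L2_PN hab hcd N f; have g2 := XN_L2 hab hcd gN.
have -> : (fun x => f x - g x) = (fun x => (f x - PN N f x) + (PN N f x - g x)).
  by apply/funext => x; ring.
apply: le_trans (nrmD mD (L2B mD f2 p2) (L2B mD p2 g2)) _; rewrite lerD2l.
apply: nrm_le; first exact: vn_ge0.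
have fg2 := L2B mD f2 g2.
have E1 : (fun x => PN N f x - g x) = PN N (fun x => f x - g x).
  rewrite -{1}(XN_projN hab hcd gN); apply/funext => x; rewrite /projN -mulrBr -sumrB.
  by congr (_ * _); apply: eq_bigr => j _; rewrite hatB// mulrBl.
rewrite E1 (dot_PN hab hcd N fg2) sqr_vn// le_eqVlt; apply/orP; left; apply/eqP.
by apply: eq_bigr => j _; rewrite hatB// mul1r expr2.
Qed.

Let alpha_ge0 : 0 <= alpha. Proof. by have := alpha1; lra. Qed.
Let alpha2_ge0 : 0 <= alpha / 2. Proof. by have := alpha1; lra. Qed.

Definition HH : R := s0^-1 * (2 * pi * K).

Let HH0 : 0 <= HH.
Proof. by rewrite /HH mulr_ge0 ?invr_ge0 ?(ltW s00)// mulr_ge0 ?(ltW pi0)// ltW// (nb_K nb). Qed.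

Let nrm_sav_le q : aebdd M q -> nrm (sav q) <= HH.
Proof. by move=> qM; apply: (nrm_sav hab hcd hF nb s00 (hs0 qM) qM). Qed.

Let L2sav q : aebdd M q -> L2 (sav q).
Proof. exact: (L2_sav hab hcd C0 hF nb). Qed.

Variable Rm : R.
Hypothesis Rm0 : forall t, 0 <= t <= T -> Num.sqrt (E (u t)) <= Rm.

(** Constants of the first step: [cG1] for its forcing, [cL1] and [cU1] for the predictor with and
    without the operator, [cM1] for its l^1 norm and [cS1] for its error. *)
Definition cG1 : R := kappa * (LL + T * LL) + gamma1 * LL + gamma2 * LL + (Rm + T * HH * LL) * HH.
Definition cL1 : R := LL + T * LL + (cG1 + T ^+ 2 * HH ^+ 2 * cG1) / kappa.
Definition cU1 : R := LL + T * LL + T ^+ 2 * cG1.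
Definition cM1 : R := S * Num.sqrt (2 `^ alpha * (cU1 ^+ 2 + cL1 ^+ 2)).
Definition cS1 : R := P + LL + cG1.

(** A single half step of implicit Euler has local error O(tau^2), enough for an argument of the
    nonlinearity. Among numerical data only the initial projections are bounded beforehand, so [cM1]
    is known before any induction. *)
Lemma first_step N tau uN0 vN0 uh vh Rh : (0 < N)%N -> 0 < tau -> tau <= T ->
  XN N uN0 -> XN N vN0 -> XN N uh -> XN N vh ->
  {in J N, hat uN0 =1 hat (u 0)} -> {in J N, hat vN0 =1 hat (v 0)} ->
  SAV_equations Om kappa alpha gamma1 gamma2 F C0 N uN0 uh vh Rh
    (fun x => (uh x - uN0 x) / (tau / 2)) (fun x => (vh x - vN0 x) / (tau / 2))
    ((Rh - Num.sqrt (E (u 0))) / (tau / 2)) ->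
  \sum_(j <- J N) `|hat uh j| <= cM1 /\
  nrm (fun x => u (tau / 2) x - uh x) <= cS1 * (tau ^+ 2 + N%:R `^ (- m)).
Proof.
move=> N0 tau0 tauT uN vN uhN vhN hu0 hv0 eqs.
have L0 := LL0; have T0' := T0; have H0 := HH0; have S0' := S0.
have [sig sigE] : exists sig, sig = tau / 2 by exists (tau / 2).
rewrite -!sigE in eqs *; have sig0 : 0 < sig by lra.
have sigT : sig <= T by lra.
have sT : 0 <= sig <= T by lra.
have sigtau : sig <= tau by lra.
have sig2 : sig / 2 <= T by lra.
have sig2' : 0 <= sig / 2 by lra.
have zT : 0 <= (0 : R) <= T by lra.
have [e1 e2 e3] := sav_increment hab hcd hF sig0 uN uN uhN vN vhN vhN eqs.
have l1u0 : \sum_(j <- J N) `|hat uN0 j| <= M.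
  rewrite big_seq; under eq_bigr => j jN do rewrite hu0//; rewrite -big_seq.
  apply: le_trans MS; exact: (l1_vn HS LL0 (st_u st N zT)).
have qM := XN_aebdd hab hcd uN l1u0.
have sq2 := L2sav qM; have sqH := nrm_sav_le qM.
pose h := hat (sav uN0); have hH : vn (J N) one h <= HH.
  exact: le_trans (vn_one_hat hab hcd N sq2) sqH.
have e3' : Rh = Num.sqrt (E (u 0)) + sig / 2 * vd (J N) one h (hat vh).
  have -> : vd (J N) one h (hat vh) = dot (sav uN0) vh.
    by rewrite (dot_XN hab hcd sq2 vhN); apply: eq_bigr => j _; rewrite mul1r.
  by rewrite -e3; ring.
set r0 := Num.sqrt (E (u 0)) in e3'.
have r0m : r0 <= Rm := Rm0 zT.
have r00 : 0 <= r0 by exact: sqrtr_ge0.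
pose dd j := hat vh j - hat (v 0) j.
pose g j := kappa * (lam j * hat (u 0) j + sig * (lam j * hat (v 0) j))
   + gamma1 * (lam j * hat (v 0) j) + gamma2 * hat (v 0) j
   + (r0 + sig / 2 * vd (J N) one h (hat (v 0))) * h j.
have nv0 : vn (J N) one (hat (v 0)) <= LL.
  by apply: le_trans (vn_one_wt _ _ alpha_ge0) (st_v st N zT).
have nu0 : vn (J N) one (hat (u 0)) <= LL.
  by apply: le_trans (vn_one_wt _ _ alpha_ge0) (st_u st N zT).
have nlv0 : vn (J N) one (fun j => lam j * hat (v 0) j) <= LL.
  exact: le_trans (vn_lam2_wt alpha1 _ _) (st_v st N zT).
have nlu0 : vn (J N) one (fun j => lam j * hat (u 0) j) <= LL.
  exact: le_trans (vn_lam2_wt alpha1 _ _) (st_u st N zT).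
(* Substituting [uh] and [Rh] leaves an equation in [dd] alone, of the form treated by
   [euler_le]. *)
have dE : {in J N, forall i, dd i + sig * (sig * (kappa * (lam i * dd i)) + gamma1 * (lam i * dd i)
  + gamma2 * dd i) + sig ^+ 2 / 2 * vd (J N) one h dd * h i = - sig * g i}.
  move=> j jN; have := e2 j jN; have := e1 j jN; rewrite hu0// hv0//.
  move=> /(canRL (subrK _)) ->; rewrite e3' /dd /g vdBr -/h.
  rewrite -/(h j); move: (vd _ _ _ _) (vd _ _ _ _) (hat _ _) (hat _ _) (hat _ _) (h j) (lam j) => x1 x2 x3 x4 x5 x6 x7 e.
  apply/eqP; rewrite -subr_eq0 -e; apply/eqP; ring.
pose rho := r0 + sig / 2 * vd (J N) one h (hat (v 0)).
have rhoB : `|rho| <= Rm + T * HH * LL.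
  have h1 := le_trans (vd_le_vn (J N) one0 h (hat (v 0)))
    (ler_pM (vn_ge0 _ _ _) (vn_ge0 _ _ _) hH nv0).
  apply: le_trans (ler_normD _ _) _; rewrite (ger0_norm r00) lerD// normrM (ger0_norm sig2').
  by rewrite -mulrA; apply: ler_pM.
have cG10 : 0 <= cG1.
  have := le_trans (normr_ge0 rho) rhoB => r1; rewrite /cG1.
  have k0 := ltW kappa0; have t0 := ltW T0.
  apply: addr_ge0; last exact: mulr_ge0.
  by apply: addr_ge0; [apply: addr_ge0; [rewrite mulr_ge0// addr_ge0// mulr_ge0|exact: mulr_ge0]|exact: mulr_ge0].
have gA : vn (J N) one g <= cG1.
  apply: le_trans (vnD _ one0 (fun j => kappa * (lam j * hat (u 0) j + sig * (lam j * hat (v 0) j))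
    + gamma1 * (lam j * hat (v 0) j) + gamma2 * hat (v 0) j) (fun j => rho * h j)) _.
  apply: lerD; last by rewrite vnZ; apply: ler_pM => //; exact: vn_ge0.
  apply: le_trans (vnD _ one0 (fun j => kappa * (lam j * hat (u 0) j + sig * (lam j * hat (v 0) j))
    + gamma1 * (lam j * hat (v 0) j)) (fun j => gamma2 * hat (v 0) j)) _.
  apply: lerD; last by rewrite vnZ (ger0_norm g20) ler_wpM2l.
  apply: le_trans (vnD _ one0 (fun j => kappa * (lam j * hat (u 0) j + sig * (lam j * hat (v 0) j)))
    (fun j => gamma1 * (lam j * hat (v 0) j))) _.
  apply: lerD; last by rewrite vnZ (ger0_norm g10) ler_wpM2l.
  rewrite vnZ (ger0_norm (ltW kappa0)) ler_wpM2l ?(ltW kappa0)//.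
  apply: le_trans (vnD _ one0 _ _) _; apply: lerD => //.
  by rewrite (vnZ _ _ sig) (ger0_norm (ltW sig0)); apply: ler_pM; rewrite ?vn_ge0 ?(ltW sig0).
have d1 := euler_le (@lam_ge0 R alpha) kappa0 g10 g20 sig0 dE gA.
have d2 := euler_lam_le (@lam_ge0 R alpha) kappa0 g10 g20 sig0 dE gA hH.
have sig2T : sig ^+ 2 <= T ^+ 2 by rewrite lerXn2r ?nnegrE ?(ltW sig0) ?(ltW T0).
have xE : {in J N, forall j, hat uh j = (hat (u 0) j + sig * hat (v 0) j) + sig * dd j}.
  move=> j jN; have := e1 j jN; rewrite hu0// => /(canRL (subrK _)) ->.
  by rewrite /dd; ring.
have T00 := ltW T0; have sig00 := ltW sig0.
have nU : vn (J N) one (hat uh) <= cU1.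
  rewrite (vn_eq one xE); apply: le_trans (vnD _ one0 _ _) _; rewrite (vnZ _ _ sig) (ger0_norm sig00) /cU1.
  apply: lerD.
    apply: le_trans (vnD _ one0 _ _) _; rewrite (vnZ _ _ sig) (ger0_norm sig00); apply: lerD => //.
    by apply: ler_pM; rewrite ?vn_ge0.
  apply: le_trans (ler_wpM2l sig00 d1) _.
  by rewrite mulrA -expr2 ler_wpM2r.
have nL : vn (J N) one (fun j => lam j * hat uh j) <= cL1.
  have xE' : {in J N, (fun j => lam j * hat uh j) =1 fun j => (lam j * hat (u 0) j
      + sig * (lam j * hat (v 0) j)) + sig * (lam j * dd j)}.
    by move=> j jN; rewrite xE//; ring.
  rewrite (vn_eq one xE'); apply: le_trans (vnD _ one0 _ _) _; rewrite (vnZ _ _ sig) (ger0_norm sig00) /cL1.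
  apply: lerD.
    apply: le_trans (vnD _ one0 _ _) _; rewrite (vnZ _ _ sig) (ger0_norm sig00); apply: lerD => //.
    by apply: ler_pM; rewrite ?vn_ge0.
  rewrite ler_pdivlMr// -[leLHS]mulrA [_ * kappa]mulrC; apply: le_trans d2 _; rewrite lerD2l.
  rewrite ler_wpM2r// ler_wpM2r ?sqr_ge0//.
  by apply: le_trans sig2T; rewrite ler_pdivrMr// ler_peMr ?sqr_ge0 ?ler1n.
split.
  have W0 : 0 <= 2 `^ alpha * (cU1 ^+ 2 + cL1 ^+ 2).
    by rewrite mulr_ge0 ?powR_ge0// addr_ge0 ?sqr_ge0.
  rewrite /cM1; apply: HS; first exact: sqrtr_ge0.
  rewrite sqr_sqrtr//.
  apply: (@le_trans _ _ (2 `^ alpha * (vn (J N) one (hat uh) ^+ 2 +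
      vn (J N) one (fun j => lam j * hat uh j) ^+ 2))).
    rewrite !sqr_vn// /vd -big_split/= mulr_sumr; apply: ler_sum => j _.
    have := ler_wpM2r (sqr_ge0 (hat uh j)) (wt_le_freq j.1 alpha_ge0).
    move=> hw; apply: (le_trans hw); rewrite le_eqVlt; apply/orP; left; apply/eqP.
    by rewrite /lam; ring.
  rewrite ler_wpM2l ?powR_ge0// lerD//.
    by rewrite lerXn2r ?nnegrE ?vn_ge0//; exact: le_trans (vn_ge0 _ _ _) nU.
  by rewrite lerXn2r ?nnegrE ?vn_ge0//; exact: le_trans (vn_ge0 _ _ _) nL.
apply: le_trans (nrm_sub_XN (u2 sT) uhN) _.
have hp := pu N0 sT.
have tay : vn (J N) one (fun j => hat (u sig) j - hat (u 0) j - sig * hat (v 0) j) <= LL * sig * sig.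
  apply: (vn_taylor1 one0 du sT); first by rewrite mulr_ge0.
  move=> r /andP[r0' rs]; have x1 := ltW r0'; have x2 := ltW (lt_le_trans rs sigT).
  have := le_trans (vn_one_wt (J N) _ _) (traj_v_lip hab hcd LL0 st N (lexx 0) x1 x2).
  rewrite subr0 => hh; apply: (le_trans (hh alpha_ge0)).
  by rewrite ler_wpM2l// ltW.
have key : vn (J N) one (fun j => hat (u sig) j - hat uh j) <= (LL + cG1) * sig ^+ 2.
  have kE : {in J N, (fun j => hat (u sig) j - hat uh j) =1
     fun j => (hat (u sig) j - hat (u 0) j - sig * hat (v 0) j) - sig * dd j}.
    by move=> j jN; rewrite xE//; ring.
  rewrite (vn_eq one kE); apply: le_trans (vnB _ one0 _ _) _; rewrite (vnZ _ _ sig) (ger0_norm sig00).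
  apply: le_trans (lerD tay (ler_wpM2l sig00 d1)) _.
  by rewrite le_eqVlt; apply/orP; left; apply/eqP; ring.
have Nm : 0 <= N%:R `^ (- m) :> R := powR_ge0 _ _.
have e2' : sig ^+ 2 <= tau ^+ 2 by rewrite lerXn2r ?nnegrE// ltW.
have LG : 0 <= LL + cG1 by rewrite addr_ge0.
by rewrite /cS1; exact: (combine_first P0 LG Nm (sqr_ge0 tau) hp key e2').
Qed.

Lemma hat_avg (f g : plane R -> R) j : L2 f -> L2 g -> hat (fun x => (f x + g x) / 2) j = (hat f j + hat g j) / 2.
Proof.
move=> f2 g2; have -> : (fun x => (f x + g x) / 2) = (fun x => 2^-1 * (f x + g x)).
  by apply/funext => x; rewrite mulrC.
by rewrite (hatZ hab hcd _ _ (L2D mD f2 g2)) hatD// mulrC.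
Qed.

Lemma XN_avg N (f g : plane R -> R) : XN N f -> XN N g -> XN N (fun x => (f x + g x) / 2).
Proof.
move=> fN gN; have := XN_Z 2^-1 (XN_D fN gN).
by congr XN; apply/funext => x; rewrite mulrC.
Qed.

Definition cS2 : R := s0^-1 * K + (2 * pi * K / (2 * s0)) * (s0^-1 * s0^-1) * (2 * pi * K).

Let cS20 : 0 <= cS2.
Proof.
have K0 := ltW (nb_K nb); have s0' := ltW s00; have p0 := ltW pi0.
rewrite /cS2; move: (2 * pi) p0 => p p0.
by rewrite addr_ge0 ?mulr_ge0 ?invr_ge0 ?mulr_ge0.
Qed.

Local Notation cWK := (cW kappa gamma2 LL S K).
Local Notation cVK := (cV kappa gamma1 gamma2 T LL).
Local Notation cRK := (cR LL S K s0).
Local Notation cddK := (cdd LL S K s0).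

Definition cB Cq : R := LL + cWK + cVK + cRK + cS2 * Cq * (Rm + LL) + HH * (cddK + P + LL + 1).

Let Rm_ge0 : 0 <= Rm.
Proof.
have T0' := ltW T0; apply: le_trans (sqrtr_ge0 (E (u 0))) (Rm0 _).
by rewrite lexx.
Qed.

Let cWK0 : 0 <= cWK. Proof. exact (cW_ge0 kappa0 g20 S LL0 nb). Qed.

Let cddK0 : 0 <= cddK. Proof. exact (cdd_ge0 S LL0 nb s00). Qed.

Let cRK0 : 0 <= cRK.
Proof.
rewrite /cR mulr_ge0 ?invr_ge0 ?mulr_ge0 ?(ltW s00)// addr_ge0 ?(cP_ge0 S LL0 nb)//.
by rewrite mulr_ge0// mulr_ge0 ?cddK0// (cr_ge0 LL0 nb s00).
Qed.

Let cVK0 : 0 <= cVK.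
Proof.
by rewrite /cV mulr_ge0 ?LL0// !addr_ge0 ?g10// mulr_ge0 ?g20 ?ltW.
Qed.

Lemma cB_ge0 Cq : 0 <= Cq -> 0 <= cB Cq.
Proof.
move=> Cq0; have Q : 0 <= cS2 * Cq * (Rm + LL).
  by apply: mulr_ge0; [exact: mulr_ge0|rewrite addr_ge0].
have H : 0 <= HH * (cddK + P + LL + 1).
  by apply: mulr_ge0 => //; exact: pos4.
have [h _ _] := sum6_ge LL0 cWK0 cVK0 cRK0 Q H.
exact: le_trans LL0 h.
Qed.

Lemma residuals N t del Cq X (q f f' g g' : plane R -> R) rho rho' : (0 < N)%N -> 0 < del -> 0 <= t - del ->
  t + del <= T -> 0 <= Cq -> 0 <= X ->
  XN N f -> XN N f' -> XN N g -> XN N g' -> XN N q -> aebdd M q ->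
  let tau := 2 * del in let eps := tau ^+ 2 + N%:R `^ (- m) in
  let r t := Num.sqrt (E (u t)) in
  let n0 := vn (J N) one in
  nrm (fun x => u t x - q x) <= Cq * (eps + X) ->
  SAV_equations Om kappa alpha gamma1 gamma2 F C0 N q
    (fun x => (f' x + f x) / 2) (fun x => (g' x + g x) / 2) ((rho' + rho) / 2)
    (fun x => (f' x - f x) / tau) (fun x => (g' x - g x) / tau) ((rho' - rho) / tau) ->
  exists rho1 rho2 G : index -> R,
    [/\ scheme_residuals (J N) lam kappa gamma1 gamma2 (cB Cq) tau eps X
          (fun j => hat (u (t - del)) j - hat f j) (fun j => hat (u (t + del)) j - hat f' j)
          (fun j => hat (v (t - del)) j - hat g j) (fun j => hat (v (t + del)) j - hat g' j)
          (r (t - del) - rho) (r (t + del) - rho') rho1 rho2 G,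
        n0 (fun j => lam j * rho1 j) <= cB Cq * tau & n0 rho2 <= cB Cq * tau].
Proof.
move=> N0 d0 td tdT Cq0 X0 fN fN' gN gN' qN qM tau eps r n0 uq eqs.
have L0 := LL0; have T0' := T0; have H0 := HH0; have s20 := cS20; have P0' := P0.
have tau0 : 0 < tau by rewrite mulr_gt0.
have [d0' [tT pT mT]] : 0 <= del /\ [/\ 0 <= t <= T, 0 <= t + del <= T & 0 <= t - del <= T].
  by split; [lra|split; lra].
have uM := u_aebdd hab hcd LL0 HS MS st tT.
have f2 := XN_L2 hab hcd fN; have f2' := XN_L2 hab hcd fN'.
have g2 := XN_L2 hab hcd gN; have g2' := XN_L2 hab hcd gN'.
have vmN := XN_avg gN' gN.
have [e1 e2 e3] := sav_increment hab hcd hF tau0 qN fN fN' gN gN' vmN eqs.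
have su2 := L2sav uM; have sq2 := L2sav qM; have sqH := nrm_sav_le qM.
have Rm00 := Rm_ge0; have cW0 := cWK0; have cdd0 := cddK0; have cR0 := cRK0; have cV0 := cVK0.
have Nm : 0 <= N%:R `^ (- m) :> R := powR_ge0 _ _.
have eps0 : 0 <= eps by rewrite addr_ge0 ?sqr_ge0.
have Nme : N%:R `^ (- m) <= eps by rewrite lerDr sqr_ge0.
have d2e : del ^+ 2 <= eps.
  have -> : del ^+ 2 = tau ^+ 2 / 2 / 2 by rewrite /tau; field.
  apply: le_trans (half_le (sqr_ge0 tau) Nm); rewrite ler_pdivrMr// ler_peMr ?ler1n//.
  by rewrite divr_ge0 ?sqr_ge0.
have cQ0 : 0 <= cS2 * Cq * (Rm + LL) by rewrite !mulr_ge0// addr_ge0.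
have cH0 : 0 <= HH * (cddK + P + LL + 1) by rewrite mulr_ge0// !addr_ge0.
have [bL bW bV] : [/\ LL <= cB Cq, cWK <= cB Cq & cVK <= cB Cq].
  exact: sum6_ge.
have B0 : 0 <= cB Cq := le_trans L0 bL.
have slip : nrm (fun x => sav (u t) x - sav q x) <= cS2 * (Cq * (eps + X)).
  apply: le_trans (nrm_sav_lip hab hcd hF nb s00 (hs0 uM) (hs0 qM) uM qM) _.
  by rewrite -/cS2 ler_wpM2l.
have i2 : (0 : R) <= 2^-1 by rewrite invr_ge0.
pose rm := (rho' + rho) / 2.
pose G j := hat (fun x => F1 (u t x)) j - rm * hat (sav q) j.
exists (res1 a b c d u v t del), (res2 a b c d kappa gamma1 gamma2 alpha F u v t del), G.
have E1 : {in J N, forall j, hat f' j - hat f j = tau * ((hat g' j + hat g j) / 2)}.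
  by move=> j jN; rewrite e1// hat_avg.
split; last 2 first.
- apply: le_trans (res1_lam_le hab hcd alpha1 LL0 st N d0 td tdT) _.
  by rewrite /tau mulrCA mulrA; rewrite ler_wpM2r// ler_wpM2l.
- apply: le_trans (res2_le hab hcd kappa0 g10 g20 alpha1 LL0 st heq N d0 td tdT) _.
  by apply: ler_pM => //; rewrite /tau ler_peMl// ler1n.
split.
- move=> j jN; have := E1 j jN; rewrite /res1 /tau.
  move: (hat f j) (hat f' j) (hat g j) (hat g' j) => x1 x2 x3 x4.
  move: (hat _ j) (hat _ j) (hat _ j) (hat _ j) => x5 x6 x7 x8 h.
  have -> : x2 = x1 + 2 * del * ((x4 + x3) / 2) by rewrite -h; ring.
  by field; rewrite gt_eqF.
- move=> j jN; have := e2 j jN; rewrite !hat_avg// /res2 /G /tau -/rm.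
  move: (hat f j) (hat f' j) (hat g j) (hat g' j) => x1 x2 x3 x4.
  move: (hat _ j) (hat _ j) (hat _ j) (hat _ j) (hat _ j) (hat _ j) (lam j) => x5 x6 x7 x8 x9 x10 l h.
  apply/eqP; rewrite -subr_eq0 -[0]oppr0 -h; apply/eqP; field; rewrite gt_eqF//.
- have h := res1_le hab hcd LL0 st N d0 td tdT.
  have hB : 2 * LL * del ^+ 2 <= cB Cq * eps.
    have -> : 2 * LL * del ^+ 2 = LL * (tau ^+ 2 / 2) by rewrite /tau; field.
    apply: ler_pM => //; first by rewrite mulr_ge0 ?sqr_ge0.
    exact: half_le (sqr_ge0 tau) Nm.
  split.
  + exact: le_trans (le_trans (vn_one_wt _ _ alpha2_ge0) h) hB.
  + exact: le_trans (le_trans (vn_lam_wt alpha1 _ _) h) hB.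
  + move=> phi.
    apply: le_trans (res2_dual hab hcd kappa0 g10 g20 alpha1 LL0 S0 HS hF MS nb st heq N phi d0 td tdT) _.
    rewrite ler_wpM2r//; first by rewrite addr_ge0 ?mulr_ge0 ?vn_ge0.
    by apply: ler_pM => //; exact: sqr_ge0.
- have r2E : r t != 0.
    rewrite gt_eqF// sqrtr_gt0; apply: lt_le_trans (hs0 uM).
    by rewrite exprn_gt0.
  have GE : forall j, G j = r t * (hat (sav (u t)) j - hat (sav q) j)
     + (r t - (r (t + del) + r (t - del)) / 2) * hat (sav q) j
     + ((r (t + del) - rho') + (r (t - del) - rho)) / 2 * hat (sav q) j.
    move=> j; have -> : hat (sav (u t)) j = (r t)^-1 * hat (fun x => F1 (u t x)) j.
      by rewrite savE hatZ//; exact: (aebdd_L2 hab hcd (aebdd_F1 hF nb uM)).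
    by rewrite /G /rm; field.
  have -> : G = (fun j => r t * (hat (sav (u t)) j - hat (sav q) j)
     + (r t - (r (t + del) + r (t - del)) / 2) * hat (sav q) j
     + ((r (t + del) - rho') + (r (t - del) - rho)) / 2 * hat (sav q) j).
    exact/funext.
  apply: le_trans (vnD _ one0 (fun j => r t * (hat (sav (u t)) j - hat (sav q) j)
     + (r t - (r (t + del) + r (t - del)) / 2) * hat (sav q) j) (fun j =>
     ((r (t + del) - rho') + (r (t - del) - rho)) / 2 * hat (sav q) j)) _.
  apply: le_trans (lerD (vnD _ one0 (fun j => r t * (hat (sav (u t)) j - hat (sav q) j))
     (fun j => (r t - (r (t + del) + r (t - del)) / 2) * hat (sav q) j)) (lexx _)) _.
  rewrite !(vnZ _ _ (r t)) (vnZ _ _ (r t - _)) (vnZ _ _ (_ / 2)).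
  have nq : vn (J N) one (hat (sav q)) <= HH := le_trans (vn_one_hat hab hcd N sq2) sqH.
  have nd : vn (J N) one (fun j => hat (sav (u t)) j - hat (sav q) j) <= cS2 * (Cq * (eps + X)).
    apply: le_trans slip; apply: le_trans (vn_one_hat hab hcd N (L2B mD su2 sq2)).
    by rewrite le_eqVlt; apply/orP; left; apply/eqP; congr vn; apply/funext => j; rewrite hatB.
  have b1 : `|r t| * vn (J N) one (fun j => hat (sav (u t)) j - hat (sav q) j) <=
      Rm * (cS2 * (Cq * (eps + X))).
    by apply: ler_pM; rewrite ?vn_ge0// ger0_norm ?sqrtr_ge0//; exact: Rm0.
  have b2 : `|r t - (r (t + del) + r (t - del)) / 2| * vn (J N) one (hat (sav q)) <= cddK * eps * HH.
    apply: ler_pM; rewrite ?vn_ge0//.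
    have h : `|r (t + del) + r (t - del) - 2 * r t| <= cddK * del ^+ 2.
      exact: (r_second_diff hab hcd alpha1 LL0 S0 HS hF MS nb s00 hs0 st d0' td tdT).
    have -> : r t - (r (t + del) + r (t - del)) / 2 = - 2^-1 * (r (t + del) + r (t - del) - 2 * r t).
      by field.
    rewrite normrM normrN (ger0_norm i2).
    apply: le_trans (ler_piMl (normr_ge0 _) _) (le_trans h (ler_wpM2l cdd0 d2e)).
    by rewrite invf_le1// ler1n.
  have b3 : `|(r (t + del) - rho' + (r (t - del) - rho)) / 2| * vn (J N) one (hat (sav q)) <=
     (`|r (t - del) - rho| + `|r (t + del) - rho'|) * HH.
    apply: ler_pM; rewrite ?vn_ge0//.
    rewrite normrM (ger0_norm i2).
    by apply: avg_le => //; rewrite addrC addrC; exact: ler_normD.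
  apply: le_trans (lerD (lerD b1 b2) b3) _.
  have p1 : 0 <= cS2 * Cq by exact: mulr_ge0.
  have eX : 0 <= eps + X by rewrite addr_ge0.
  set e' := `|r (t - del) - rho|; set e'' := `|r (t + del) - rho'|.
  have [e'0 e''0] : 0 <= e' /\ 0 <= e'' by split; exact: normr_ge0.
  have k1 : Rm * (cS2 * (Cq * (eps + X))) <= cS2 * Cq * (Rm + LL) * (eps + X).
    have -> : Rm * (cS2 * (Cq * (eps + X))) = cS2 * Cq * Rm * (eps + X) by ring.
    by rewrite ler_wpM2r// ler_wpM2l// lerDl.
  have k2 : cddK * eps * HH + (e' + e'') * HH <= HH * (cddK + P + LL + 1) * (eps + e' + e'').
    exact: (combine_res H0 cdd0 P0' L0 eps0 e'0 e''0).1.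
  have s1 : 0 <= (HH * (cddK + P + LL + 1)) * X by exact: mulr_ge0.
  have s2 : 0 <= cS2 * Cq * (Rm + LL) * (e' + e'') by rewrite mulr_ge0// addr_ge0.
  have s3 : 0 <= (LL + cWK + cVK + cRK) * (eps + e' + e'' + X).
    by apply: mulr_ge0; exact: pos4.
  have -> : cB Cq * (eps + e' + e'' + X) = (cS2 * Cq * (Rm + LL) * (eps + X)
    + HH * (cddK + P + LL + 1) * (eps + e' + e'')) + ((HH * (cddK + P + LL + 1)) * X
    + cS2 * Cq * (Rm + LL) * (e' + e'') + (LL + cWK + cVK + cRK) * (eps + e' + e'' + X)).
    by rewrite /cB; ring.
  rewrite -[leLHS]addrA; apply: le_trans (lerD k1 k2) _.
  by rewrite lerDl; exact: pos3.
- have [vt vp vm] : [/\ L2 (v t), L2 (v (t + del)) & L2 (v (t - del))] by split; apply: v2.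
  have vm2 := XN_L2 hab hcd vmN.
  set vN := (fun x => (g' x + g x) / 2) in e3 vmN vm2.
  have suv := L2B mD su2 sq2; have vv := L2B mD vt vm2.
  have ident : (r (t + del) - rho') - (r (t - del) - rho) =
    (r (t + del) - r (t - del) - del * dot (sav (u t)) (v t)) +
    del * (dot (fun x => sav (u t) x - sav q x) (v t) + dot (sav q) (fun x => v t x - vN x)).
    rewrite (dotBl mD su2 sq2 vt) (dotBr mD vt vm2 sq2).
    have e3' : rho' = rho + del * dot (sav q) vN.
      by rewrite -[rho'](subrK rho) e3 /tau addrC; congr (_ + _); field.
    rewrite e3'; move: (r _) (r _) (dot _ _) (dot _ _) (dot _ _) => r1 r2 w1 w2 w3.
    by ring.
  have b1 : `|r (t + del) - r (t - del) - del * dot (sav (u t)) (v t)| <= cRK * del ^+ 3.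
    exact: (r_midpoint hab hcd alpha1 LL0 S0 HS hF MS nb s00 hs0 st d0' td tdT).
  have b2 := le_trans (dot_le_nrm mD suv vt) (ler_pM (nrm_ge0 _ _ _) (nrm_ge0 _ _ _) slip
    (nrm_v hab hcd alpha1 LL0 st tT)).
  pose ev j := hat (v (t - del)) j - hat g j; pose ev' j := hat (v (t + del)) j - hat g' j.
  have nvN : nrm (fun x => v t x - vN x) <= P * eps + (LL * eps + (n0 ev + n0 ev')).
    apply: le_trans (nrm_sub_XN vt vmN) _; apply: lerD.
      by apply: le_trans (pv N0 tT) _; rewrite ler_wpM2l.
    have -> : (fun j => hat (v t) j - hat vN j) = (fun j => (2^-1 * ev j + 2^-1 * ev' j)
       - 2^-1 * (hat (v (t + del)) j + hat (v (t - del)) j - 2 * hat (v t) j)).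
      apply/funext => j; rewrite hat_avg// /ev /ev'.
      by move: (hat _ j) (hat _ j) (hat _ j) (hat _ j) (hat _ j) => *; field.
    apply: le_trans (vnB _ one0 _ _) _; rewrite addrC; apply: lerD.
      rewrite (vnZ _ _ 2^-1) (ger0_norm i2).
      apply: half_dd (ler_wpM2l L0 d2e).
      exact: le_trans (vn_one_wt (J N) _ alpha2_ge0) (traj_v_dd hab hcd LL0 st N d0' td tdT).
    apply: le_trans (vnD _ one0 _ _) _; rewrite !(vnZ _ _ 2^-1) (ger0_norm i2).
    rewrite -mulrDr mulrC addrC; apply: avg_le; rewrite ?vn_ge0//.
    by rewrite addrC.
  have b3 := le_trans (dot_le_nrm mD sq2 vv) (ler_pM (nrm_ge0 _ _ _) (nrm_ge0 _ _ _) sqH nvN).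
  rewrite ident; apply: le_trans (ler_normD _ _) _; rewrite normrM (ger0_norm d0').
  have b4 := le_trans (ler_normD _ _) (lerD b2 b3).
  apply: le_trans (lerD b1 (ler_wpM2l d0' b4)) _.
  have nv0 : 0 <= n0 ev := vn_ge0 _ _ _; have nv0' : 0 <= n0 ev' := vn_ge0 _ _ _.
  rewrite -/(n0 ev) -/(n0 ev').
  set y := n0 ev in nv0 *; set y' := n0 ev' in nv0' *.
  have k0 : cRK * del ^+ 3 <= del * (cRK * eps).
    have -> : cRK * del ^+ 3 = del * (cRK * del ^+ 2) by ring.
    exact: (ler_wpM2l d0' (ler_wpM2l cR0 d2e)).
  have k1 : cS2 * (Cq * (eps + X)) * LL <= cS2 * Cq * (Rm + LL) * (eps + X).
    have -> : cS2 * (Cq * (eps + X)) * LL = cS2 * Cq * LL * (eps + X) by ring.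
    apply: ler_wpM2r; first exact: addr_ge0.
    by apply: ler_wpM2l; [exact: mulr_ge0|rewrite lerDr].
  have k2 : HH * (P * eps + (LL * eps + (y + y'))) <= HH * (cddK + P + LL + 1) * (eps + y + y').
    exact: (combine_res H0 cdd0 P0' L0 eps0 nv0 nv0').2.
  have yy : 0 <= eps + y + y' + X by exact: pos4.
  have s1 : 0 <= (HH * (cddK + P + LL + 1)) * X by exact: mulr_ge0.
  have s2 : 0 <= cS2 * Cq * (Rm + LL) * (y + y') by rewrite mulr_ge0// addr_ge0.
  have s3 : 0 <= (LL + cWK + cVK) * (eps + y + y' + X) by apply: mulr_ge0 => //; exact: pos3.
  have s4 : 0 <= cRK * (y + y' + X) by apply: mulr_ge0 => //; exact: pos3.
  have BE : cB Cq * (eps + y + y' + X) = cRK * eps + (cS2 * Cq * (Rm + LL) * (eps + X)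
    + HH * (cddK + P + LL + 1) * (eps + y + y')) + ((HH * (cddK + P + LL + 1)) * X
    + cS2 * Cq * (Rm + LL) * (y + y') + (LL + cWK + cVK) * (eps + y + y' + X)
    + cRK * (y + y' + X)).
    by rewrite /cB; ring.
  apply: (@le_trans _ _ (del * (cB Cq * (eps + y + y' + X)))); last first.
    by rewrite ler_wpM2r ?mulr_ge0// /tau ler_peMl// ler1n.
  apply: le_trans (lerD k0 (ler_wpM2l d0' (lerD k1 k2))) _; rewrite -mulrDr ler_wpM2l// BE.
  by rewrite lerDl; exact: pos4.
Qed.

End SchemeConsistency.

(** * Convergence and stability *)

Section Convergence.
Context {R : realType}.
Variables (a b c d : R).
Hypotheses (hab : b = a + 2 * pi) (hcd : d = c + 2 * pi).
Let Om : set (plane R) := `]a, b[ `*` `]c, d[.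
Let mD : measurable Om := measurable_cell a b c d.
Let fD : (leb2 Om < +oo)%E := cell_measure_lty hab hcd.
Local Notation L2 := (L2 leb2 Om).
Local Notation nrm := (L2nrm leb2 Om).
Local Notation hat := (fhat Om).
Local Notation J := (J R).
Local Notation PN := (projN Om).
Local Notation one := (fun=> 1 : R).
Local Notation aebdd := (aebdd a b c d).

Variables (kappa gamma1 gamma2 : R).
Hypotheses (kappa0 : 0 < kappa) (g10 : 0 <= gamma1) (g20 : 0 <= gamma2).
Variables (alpha T LL : R).
Hypotheses (alpha1 : 1 < alpha) (LL0 : 0 <= LL) (T0 : 0 < T).
Variables (F : R -> R) (C0 : R).
Hypothesis hF : (forall (k : nat) (s : R), (k < 3)%N -> derivable (derive1n k F) s 1) /\
            continuous (derive1n 3 F).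
Hypothesis hC0 : forall w, bounded_per Om w -> 0 < energy Om F C0 w.
Local Notation F1 := (derive1 F).
Local Notation E := (energy Om F C0).
Local Notation lam := (lam alpha).

Variables (u v w z : R -> plane R -> R).
Hypothesis st : smooth_traj a b c d alpha T LL u v w z.
Hypothesis heq : forall t, 0 < t <= T -> forall j,
  hat (w t) j = - (kappa * (lam j * hat (u t) j) + gamma1 * (lam j * hat (v t) j)
    + gamma2 * hat (v t) j + hat (fun x => F1 (u t x)) j).
Variables (m P : R).
Hypotheses (P0 : 0 <= P) (malpha : alpha <= m).
Hypothesis pu : forall N t, (0 < N)%N -> 0 <= t <= T ->
  nrm (fun x => u t x - PN N (u t) x) <= P * N%:R `^ (- m).
Hypothesis pv : forall N t, (0 < N)%N -> 0 <= t <= T ->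
  nrm (fun x => v t x - PN N (v t) x) <= P * N%:R `^ (- m).
Variables phi0 phi1 : plane R -> R.
Hypotheses (phi02 : L2 phi0) (phi12 : L2 phi1).
Hypotheses (uphi : {ae leb2, forall x, Om x -> u 0 x = phi0 x})
           (vphi : {ae leb2, forall x, Om x -> v 0 x = phi1 x}).

Let u2 := st_u2 st.
Let v2 := st_v2 st.
Let one0 : forall i : index, 0 <= one i :> R. Proof. by move=> i; exact: ler01. Qed.
Let alpha_ge0 : 0 <= alpha. Proof. by have := alpha1; lra. Qed.

(** The initial condition holds almost everywhere only; the Lipschitz bound of the energy gives
    equality. *)
Lemma energy_initial M K : nonlin_bounds F M K -> aebdd M (u 0) -> E phi0 = E (u 0).
Proof.
move=> nb uM; have T0' := ltW T0; have zT : 0 <= (0 : R) <= T by rewrite lexx.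
have pM : aebdd M phi0.
  split; first by have [] := phi02.
  by apply: filterS2 uphi uM.2 => x up ux Dx; rewrite -(up Dx); exact: ux.
have := energy_lip hab hcd C0 hF nb pM uM.
have -> : nrm (fun x => phi0 x - u 0 x) = nrm (fun=> 0).
  apply: (nrm_ae_eq mD); [exact (L2B mD phi02 (u2 zT))|exact: (L2_cst mD fD)|].
  by apply: filterS uphi => x up Dx; rewrite (up Dx) subrr.
by rewrite nrm_cst// normr0 !mulr0 normr_le0 subr_eq0 => /eqP.
Qed.

Lemma extrapolate_XN N uh uN n : XN N uh -> (forall k, (k <= n)%N -> XN N (uN k)) ->
  @XN R N (extrapolate uh uN n).
Proof.
case: n => [|n] uhN uNN //=.
have := XN_Z 2^-1 (XN_D (XN_Z 3 (uNN n.+1 (leqnn _))) (XN_Z (-1) (uNN n (leqnSn _)))).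
by congr XN; apply/funext => x; rewrite mulN1r mulrC.
Qed.

Section Extrapolation.
Variables (S : R).
Hypotheses (S0 : 0 < S).
Hypothesis HS : forall N (x : index -> R) W, 0 <= W ->
  \sum_(j <- J N) wt alpha j.1 * x j ^+ 2 <= W ^+ 2 -> \sum_(j <- J N) `|x j| <= S * W.

Lemma l1_error N t f : 0 <= t <= T -> \sum_(j <- J N) `|hat (u t) j - hat f j| <= 1 ->
  \sum_(j <- J N) `|hat f j| <= S * LL + 1.
Proof.
move=> tT h; apply: le_trans (lerD (l1_vn HS LL0 (st_u st N tT)) h).
rewrite -big_split/=; apply: ler_sum => j _.
have := ler_normB (hat (u t) j) (hat (u t) j - hat f j).
by rewrite opprB addrCA subrr addr0.
Qed.

(** The weights 3/2 and -1/2 have total size 2; adding [Mh] covers the predictor as well. *)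
Lemma extrapolate_l1 N uh uN n Mh : XN N uh -> (forall k, (k <= n)%N -> XN N (uN k)) ->
  0 <= Mh -> \sum_(j <- J N) `|hat uh j| <= Mh ->
  (forall k, (k <= n)%N -> \sum_(j <- J N) `|hat (uN k) j| <= S * LL + 1) ->
  XN N (extrapolate uh uN n) /\
  \sum_(j <- J N) `|hat (extrapolate uh uN n) j| <= 2 * (S * LL + 1) + Mh.
Proof.
move=> uhN uNN Mh0 hMh l1; have L0 := LL0; have S0' := S0.
have SL : 0 <= S * LL by rewrite mulr_ge0// ltW.
case: n uNN l1 => [|n] uNN l1 /=; first by split=> //; lra.
have k1N := uNN n.+1 (leqnn _); have kN := uNN n (leqnSn _).
split; first exact: (@extrapolate_XN N uh uN n.+1).
have E1 j : hat (fun x => (3 * uN n.+1 x - uN n x) / 2) j =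
    (3 * hat (uN n.+1) j - hat (uN n) j) / 2.
  have k1L := XN_L2 hab hcd k1N; have kL := XN_L2 hab hcd kN.
  by rewrite (hat_quot hab hcd _ _ (L2Z mD 3 k1L) kL) (hatZ hab hcd _ _ k1L).
apply: (@le_trans _ _ (\sum_(j <- J N) (3 / 2 * `|hat (uN n.+1) j| + 2^-1 * `|hat (uN n) j|))).
  apply: ler_sum => j _; rewrite E1 normrM.
  have i2 : (0 : R) <= 2^-1 by rewrite invr_ge0.
  rewrite (ger0_norm i2); have := ler_normB (3 * hat (uN n.+1) j) (hat (uN n) j).
  rewrite normrM (ger0_norm (ler0n R 3)); lra.
rewrite big_split/= -!mulr_sumr; have := l1 n.+1 (leqnn _); have := l1 n (leqnSn _); lra.
Qed.

Lemma extrapolate_close N n uh uN t del cS X : (0 < N)%N -> 0 < del ->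
  t = n%:R * (2 * del) + del -> t + del <= T -> 0 <= cS ->
  XN N uh -> (forall k, (k <= n)%N -> XN N (uN k)) ->
  let tau := 2 * del in let eps := tau ^+ 2 + N%:R `^ (- m) in
  let eu k j := hat (u (k%:R * tau)) j - hat (uN k) j in
  X = vn (J N) one (eu n) + vn (J N) one (eu n.-1) ->
  nrm (fun x => u del x - uh x) <= cS * eps ->
  nrm (fun x => u t x - extrapolate uh uN n x) <= (cS + P + LL + 2) * (eps + X).
Proof.
move=> N0 d0 tE tT cS0 uhN uNN tau eps eu XE huh.
have L0 := LL0; have P0' := P0; have d0' := ltW d0.
have Nm : 0 <= N%:R `^ (- m) :> R := powR_ge0 _ _.
have t2 : 0 <= tau ^+ 2 by exact: sqr_ge0.
have eps0 : 0 <= eps by rewrite addr_ge0.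
have X0 : 0 <= X by rewrite XE addr_ge0 ?vn_ge0.
have big (x : R) : 0 <= x -> x <= cS + P + LL + 2 ->
    forall y, y <= x * (eps + X) -> y <= (cS + P + LL + 2) * (eps + X).
  by move=> x0 xc y yx; apply: le_trans yx _; rewrite ler_wpM2r// addr_ge0.
case: n tE uNN XE => [|n] tE uNN XE /=.
  have -> : t = del by rewrite tE mul0r add0r.
  apply: (big cS) => //; first lra.
  by apply: le_trans huh _; rewrite ler_wpM2l// lerDl.
have k1N := uNN n.+1 (leqnn _); have kN := uNN n (leqnSn _).
have [t1 t1m t1mm] : [/\ n.+1%:R * tau = t - del, n%:R * tau = t - del - del - del & 0 <= n%:R * tau].
  split; [by rewrite tE -natr1 /tau; ring|by rewrite tE -natr1 /tau; ring|].
  by rewrite mulr_ge0// /tau mulr_ge0.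
have tb : 0 <= t - del - del - del by rewrite -t1m.
have [tT1 tT2 tT3 tT4] : [/\ 0 <= t <= T, 0 <= t - del <= T, 0 <= t - del - del <= T &
    0 <= t - del - del - del <= T] by split; apply/andP; split; lra.
have qN : XN N (fun x => (3 * uN n.+1 x - uN n x) / 2).
  exact: (@extrapolate_XN N uh uN n.+1).
apply: le_trans (nrm_sub_XN hab hcd (u2 tT1) qN) _.
have hp := pu N0 tT1.
pose D1 j := hat (u (t - del + del)) j + hat (u (t - del - del)) j - 2 * hat (u (t - del)) j.
pose D2 j := hat (u (t - del - del + del)) j + hat (u (t - del - del - del)) j
  - 2 * hat (u (t - del - del)) j.
have tt1 : t - del + del = t by ring.
have tt2 : t - del - del + del = t - del by ring.
(* With nodes [t - del] and [t - 3 * del], the extrapolation error of [u] is the second difference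
   at [t - del] plus half the one at [t - 2 * del]. *)
have key : (fun j => hat (u t) j - hat (fun x => (3 * uN n.+1 x - uN n x) / 2) j) =
  (fun j => (D1 j + 2^-1 * D2 j) + (3 / 2 * eu n.+1 j - 2^-1 * eu n j)).
  have k1L := XN_L2 hab hcd k1N; have kL := XN_L2 hab hcd kN.
  apply/funext => j; rewrite (hat_quot hab hcd _ _ (L2Z mD 3 k1L) kL) (hatZ hab hcd _ _ k1L).
  rewrite /D1 /D2 /eu t1 t1m tt1 tt2.
  by move: (hat (u t) j) (hat (u (t - del)) j) (hat (u (t - del - del)) j)
    (hat (u (t - del - del - del)) j) (hat (uN n.+1) j) (hat (uN n) j) => *; field.
rewrite key; have dd1 : vn (J N) one D1 <= 2 * LL * del ^+ 2.
  apply: le_trans (vn_one_wt _ _ alpha_ge0) _.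
  by apply: (traj_u_dd hab hcd LL0 st N d0'); rewrite ?tt1//; have := tT3; lra.
have dd2 : vn (J N) one D2 <= 2 * LL * del ^+ 2.
  apply: le_trans (vn_one_wt _ _ alpha_ge0) _.
  by apply: (traj_u_dd hab hcd LL0 st N d0'); rewrite ?tt2//; have := tT2; lra.
have i2 : (0 : R) <= 2^-1 by rewrite invr_ge0.
have i3 : (0 : R) <= 3 / 2 by rewrite divr_ge0.
have n1 : vn (J N) one (fun j => D1 j + 2^-1 * D2 j) <= 3 * (LL * del ^+ 2).
  apply: le_trans (vnD _ one0 _ _) _; rewrite (vnZ _ _ 2^-1) (ger0_norm i2).
  by move: dd1 dd2; rewrite -mulrA; move: (LL * _) => y; lra.
have n2 : vn (J N) one (fun j => 3 / 2 * eu n.+1 j - 2^-1 * eu n j) <= 2 * X.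
  apply: le_trans (vnB _ one0 _ _) _; rewrite (vnZ _ _ 2^-1) (ger0_norm i2).
  rewrite (vnZ _ _ (3 / 2)) (ger0_norm i3) XE/=.
  by have := vn_ge0 (J N) one (eu n.+1); have := vn_ge0 (J N) one (eu n); lra.
have n3 := le_trans (vnD _ one0 _ _) (lerD n1 n2).
apply: le_trans (lerD hp n3) _.
have d2 : 3 * (LL * del ^+ 2) <= LL * tau ^+ 2.
  have -> : LL * tau ^+ 2 = 4 * (LL * del ^+ 2) by rewrite /tau; ring.
  by rewrite ler_wpM2r ?mulr_ge0 ?sqr_ge0// ler_nat.
have q1 := mulr_ge0 cS0 (addr_ge0 eps0 X0); have q2 := mulr_ge0 P0' (addr_ge0 t2 X0).
have q3 := mulr_ge0 L0 (addr_ge0 Nm X0).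
rewrite /eps in q1 *.
move: d2 q1 q2 q3 t2 Nm; move: (N%:R `^ _) (tau ^+ 2) (_ * (_ * del ^+ 2)) => p q y; lra.
Qed.

End Extrapolation.
Lemma hat_initial : (forall j, hat phi0 j = hat (u 0) j) /\ (forall j, hat phi1 j = hat (v 0) j).
Proof.
have T0' := ltW T0; have zT : 0 <= (0 : R) <= T by rewrite lexx.
split=> j; apply: (hat_ae_eq hab hcd); [exact phi02|exact: u2| |exact phi12|exact: v2|].
  by apply: filterS uphi => x up Dx; rewrite up.
by apply: filterS vphi => x up Dx; rewrite up.
Qed.

Lemma convergence : exists C tau0 : R, exists N0 : nat, [/\ 0 < C, 0 < tau0 &
  forall (N K : nat) uh vh Rh uN vN RN, (0 < N)%N -> (0 < K)%N -> (N0 <= N)%N ->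
  let tau := T / K%:R in tau <= tau0 ->
  SAV_scheme Om kappa alpha gamma1 gamma2 F C0 phi0 phi1 T N K uh vh Rh uN vN RN ->
  forall n, (n <= K)%N ->
  energy_err (J N) lam kappa (fun j => hat (u (n%:R * tau)) j - hat (uN n) j)
    (fun j => hat (v (n%:R * tau)) j - hat (vN n) j)
    (Num.sqrt (E (u (n%:R * tau))) - RN n) <= C * (tau ^+ 2 + N%:R `^ (- m)) ^+ 2].
Proof.
have [S S0 HS] := l1_wt alpha1; have L0 := LL0; have T0' := ltW T0.
have SL : 0 <= S * LL by rewrite mulr_ge0// ltW.
(* Constants on the range of the exact solution; they suffice for the predictor and hence for
   [Mh]. *)
have [K1 nb1] := nonlin_bounds_ex hF SL.
have [s1 s10 hs1] := energy_lower hab hcd hF hC0 SL nb1.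
pose r t := Num.sqrt (E (u t)); pose Rm := r 0 + cr LL K1 s1 * T.
have Rm0 t : 0 <= t <= T -> Num.sqrt (E (u t)) <= Rm.
  move=> /andP[t0 tT].
  have h := r_lip hab hcd alpha1 LL0 HS hF (lexx _) nb1 s10 hs1 st (lexx 0) t0 tT.
  rewrite /Rm -/(r t) -lerBlDl; apply: le_trans (ler_norm _) _; apply: le_trans h _.
  by rewrite subr0 ler_wpM2l// (cr_ge0 LL0 nb1 s10).
pose Mh := cM1 kappa gamma1 gamma2 alpha T LL S K1 s1 Rm.
have Mh0 : 0 <= Mh by rewrite /Mh /cM1 mulr_ge0 ?sqrtr_ge0// ltW.
(* The final range: an l^1 error of at most 1 puts every extrapolated argument in it, and the
   constants [K], [s0] are chosen for it. *)
pose M := 2 * (S * LL + 1) + Mh.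
have M0 : 0 <= M by rewrite /M addr_ge0// mulr_ge0// addr_ge0.
have MS : S * LL <= M by rewrite /M ler_wpDr//; lra.
have [K nb] := nonlin_bounds_ex hF M0.
have [s0 s00 hs0] := energy_lower hab hcd hF hC0 M0 nb.
(* The absolute value only serves to have a nonnegative constant at once. *)
pose cS := `|cS1 kappa gamma1 gamma2 T LL K1 s1 P Rm|.
have cS0 : 0 <= cS := normr_ge0 _.
pose Cq := cS + P + LL + 2.
have Cq0 : 0 <= Cq by rewrite /Cq !addr_ge0.
have B0 := cB_ge0 kappa0 g10 g20 S LL0 T0 nb s00 P0 Rm0 Cq0.
have [C [tau0 [N0 [C00 tau00 boot]]]] := bootstrap kappa0 g10 g20 T0 B0 alpha1.
exists C, tau0, N0; split => // N K' uh vh Rh uN vN RN N1 K0 NN tau tt0.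
move=> [[pu0 pv0 R0E] XNk [uhN vhN eq0] eqn].
pose eu k j := hat (u (k%:R * tau)) j - hat (uN k) j.
pose ev k j := hat (v (k%:R * tau)) j - hat (vN k) j.
pose er k := r (k%:R * tau) - RN k.
have [hi1 hi2] := hat_initial.
have hu0 : {in J N, hat (uN 0%N) =1 hat (u 0)}.
  by move=> j jN; rewrite (is_PN_hat hab hcd phi02 pu0 jN) hi1.
have hv0 : {in J N, hat (vN 0%N) =1 hat (v 0)}.
  by move=> j jN; rewrite (is_PN_hat hab hcd phi12 pv0 jN) hi2.
have K0R : 0 < K'%:R :> R by rewrite ltr0n.
have ta0 : 0 < tau by rewrite divr_gt0.
have taT : tau <= T by rewrite ler_pdivrMr// ler_peMr// ler1n.
have zT : 0 <= (0 : R) <= T by rewrite lexx.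
have E0 : E phi0 = E (u 0).
  exact: (energy_initial nb1 (u_aebdd hab hcd LL0 HS (lexx _) st zT)).
have R0E' : RN 0%N = Num.sqrt (E (u 0)) by rewrite R0E E0.
rewrite -/tau R0E' in eq0.
have [u0N v0N] := XNk 0%N (leq0n _).
have [l1h close] := first_step hab hcd kappa0 g10 g20 alpha1 LL0 S0 T0 HS hF (lexx _) nb1 s10
  hs1 st P0 pu Rm0 N1 ta0 taT u0N v0N uhN vhN hu0 hv0 eq0.
apply: (boot N K' m eu ev er NN N1 K0 malpha tt0).
- by move=> j jN; rewrite /eu mul0r hu0// subrr.
- by move=> j jN; rewrite /ev mul0r hv0// subrr.
- by rewrite /er mul0r R0E' subrr.
move=> n nK l1e; pose del := tau / 2.
have taE : 2 * del = tau by rewrite /del mulrC divfK.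
have d0 : 0 < del by rewrite divr_gt0.
pose t := n%:R * tau + del.
have tm : t - del = n%:R * tau by rewrite /t addrK.
have tp : t + del = n.+1%:R * tau by rewrite /t -addrA -natr1 mulrDl mul1r -taE; ring.
have n0 : 0 <= n%:R * tau by rewrite mulr_ge0 ?ler0n// ltW.
have nT (k : nat) : (k <= K')%N -> 0 <= k%:R * tau <= T.
  move=> kK; rewrite mulr_ge0 ?ler0n ?(ltW ta0)//= /tau mulrCA ler_piMr//.
  by rewrite ler_pdivrMr// mul1r ler_nat.
have td : 0 <= t - del by rewrite tm.
have tdT : t + del <= T by rewrite tp; have /andP[] := nT _ nK.
have uNn k : (k <= n)%N -> XN N (uN k) by move=> kn; have [] := XNk k (leq_trans kn (ltnW nK)).
have l1u k : (k <= n)%N -> \sum_(j <- J N) `|hat (uN k) j| <= S * LL + 1.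
  move=> kn; apply: (l1_error HS (t := k%:R * tau)); last exact: l1e.
  by apply: nT; exact: leq_trans kn (ltnW nK).
have [qN l1q] := extrapolate_l1 S0 uhN uNn Mh0 l1h l1u.
have qM := XN_aebdd hab hcd qN l1q.
have [unN vnN] := XNk n (ltnW nK); have [unN' vnN'] := XNk n.+1 nK.
have Xge : 0 <= vn (J N) one (eu n) + vn (J N) one (eu n.-1) by rewrite addr_ge0 ?vn_ge0.
have hq : nrm (fun x => u t x - extrapolate uh uN n x) <=
    Cq * ((2 * del) ^+ 2 + N%:R `^ (- m) + (vn (J N) one (eu n) + vn (J N) one (eu n.-1))).
  apply: (extrapolate_close N1 d0 _ _ cS0 uhN uNn); rewrite ?taE//.
  apply: le_trans close _; rewrite ler_wpM2r ?ler_norm// addr_ge0 ?sqr_ge0 ?powR_ge0//.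
have := eqn n nK; rewrite -/tau -taE => eqs.
have := residuals hab hcd kappa0 g10 g20 alpha1 LL0 S0 T0 HS hF MS nb s00 hs0 st heq P0 pv Rm0
  N1 d0 td tdT Cq0 Xge unN unN' vnN vnN' qN qM hq eqs.
by rewrite /= taE tm tp.
Qed.

Lemma energy_decay N q (uu uu' vv vv' : plane R -> R) rho rho' tau : 0 < tau ->
  XN N q -> XN N uu -> XN N uu' -> XN N vv -> XN N vv' ->
  SAV_equations Om kappa alpha gamma1 gamma2 F C0 N q
    (fun x => (uu' x + uu x) / 2) (fun x => (vv' x + vv x) / 2) ((rho' + rho) / 2)
    (fun x => (uu' x - uu x) / tau) (fun x => (vv' x - vv x) / tau) ((rho' - rho) / tau) ->
  vn (J N) one (hat vv') ^+ 2 + kappa * vn (J N) lam (hat uu') ^+ 2 + 2 * rho' ^+ 2 <=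
  vn (J N) one (hat vv) ^+ 2 + kappa * vn (J N) lam (hat uu) ^+ 2 + 2 * rho ^+ 2 /\
  vn (J N) one (hat uu') <=
    vn (J N) one (hat uu) + tau / 2 * (vn (J N) one (hat vv') + vn (J N) one (hat vv)).
Proof.
move=> t0 qN uN uN' vN vN' eqs.
have vmN := XN_avg vN' vN.
have [e1 e2 e3] := sav_increment hab hcd hF t0 qN uN uN' vN vN' vmN eqs.
have uL := XN_L2 hab hcd uN; have uL' := XN_L2 hab hcd uN'.
have vL := XN_L2 hab hcd vN; have vL' := XN_L2 hab hcd vN'.
have sq2 := L2_sav_XN hab hcd C0 hF qN.
have hm j : hat (fun x => (vv' x + vv x) / 2) j = (hat vv' j + hat vv j) / 2.
  by rewrite (hat_avg hab hcd).
have um j : hat (fun x => (uu' x + uu x) / 2) j = (hat uu' j + hat uu j) / 2.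
  by rewrite (hat_avg hab hcd).
have l0 := @lam_ge0 R alpha.
split; last first.
  have -> : vn (J N) one (hat uu') = vn (J N) one (fun j => hat uu j + tau / 2 * (hat vv' j + hat vv j)).
    apply: vn_eq => j jN; have := e1 j jN; rewrite hm => /(canRL (subrK _)) ->.
    by move: (hat _ _) (hat _ _) (hat _ _) => x y x'; field.
  apply: le_trans (vnD _ one0 _ _) _; rewrite lerD2l (vnZ _ _ (tau / 2)).
  have t2 : 0 <= tau / 2 by rewrite divr_ge0// ltW.
  by rewrite (ger0_norm t2) ler_wpM2l//; exact: vnD.
pose h := hat (sav a b c d F C0 q).
pose D := vd (J N) one h (fun j => hat vv' j + hat vv j).
have e3' : rho' - rho = tau / 4 * D.
  rewrite e3 (dot_XN hab hcd sq2 vmN).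
  have -> : \sum_(j <- J N) h j * hat (fun x => (vv' x + vv x) / 2) j = 2^-1 * D.
    by rewrite /D mulr_sumr; apply: eq_bigr => j _; rewrite hm; ring.
  by field.
pose S1 := vd (J N) lam (fun j => hat vv' j + hat vv j) (fun j => hat vv' j + hat vv j).
pose S2 := vd (J N) one (fun j => hat vv' j + hat vv j) (fun j => hat vv' j + hat vv j).
have S10 : 0 <= S1 by exact: vd_ge0.
have S20 : 0 <= S2 by exact: vd_ge0.
have id1 : vn (J N) one (hat vv') ^+ 2 - vn (J N) one (hat vv) ^+ 2
   + kappa * (vn (J N) lam (hat uu') ^+ 2 - vn (J N) lam (hat uu) ^+ 2)
   + tau * (gamma1 / 2 * S1 + gamma2 / 2 * S2 + (rho' + rho) / 2 * D) = 0.
  rewrite !sqr_vn// /S1 /S2 /D /vd.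
  have sD (f g : index -> R) : \sum_(i <- J N) f i + \sum_(i <- J N) g i = \sum_(i <- J N) (f i + g i).
    by rewrite big_split.
  rewrite !(sD, mulr_sumr, =^~ sumrB) big_seq big1// => j jN.
  have h1 := e1 j jN; have := e2 j jN; rewrite um hm => h2; rewrite hm in h1.
  rewrite -/(h j) in h2; move: h1 h2.
  move: (hat uu' j) (hat uu j) (hat vv' j) (hat vv j) (h j) (lam j) => x x' y y' g l h1 h2.
  have f1 : (x - x' - tau * ((y + y') / 2)) * (kappa * l * (x + x')) = 0.
    by rewrite h1 subrr mul0r.
  have f2 : (y - y' + tau * (kappa * (l * ((x + x') / 2)) + gamma1 * (l * ((y + y') / 2))
    + gamma2 * ((y + y') / 2) + (rho' + rho) / 2 * g)) * (y + y') = 0.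
    by rewrite h2 mul0r.
  by rewrite -[RHS](addr0 0) -{1}f1 -f2; field.
have id2 : tau * ((rho' + rho) / 2 * D) = 2 * (rho' ^+ 2 - rho ^+ 2).
  have -> : rho' ^+ 2 - rho ^+ 2 = (rho' - rho) * (rho' + rho) by ring.
  by rewrite e3'; field.
have p1 : 0 <= tau * (gamma1 / 2 * S1 + gamma2 / 2 * S2).
  by rewrite mulr_ge0 ?(ltW t0)// addr_ge0// mulr_ge0// divr_ge0.
move: id1 id2 p1; rewrite !mulrDr.
move: (vn _ _ _ ^+ 2) (vn _ _ _ ^+ 2) (vn _ _ _ ^+ 2) (vn _ _ _ ^+ 2) => x1 x2 x3 x4.
move: (tau * (_ * S1)) (tau * (_ * S2)) (tau * (_ * D)) => y1 y2 y3; lra.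
Qed.

(** The decaying energy bounds velocity, seminorm and [RN], and the position grows at most linearly
    in time; no relation between [tau] and [N] and no sup bound on the numerical solution is
    involved. *)
Lemma stability : exists2 A : R, 0 < A &
  forall (N K : nat) uh vh Rh uN vN RN, (0 < N)%N -> (0 < K)%N ->
  let tau := T / K%:R in
  SAV_scheme Om kappa alpha gamma1 gamma2 F C0 phi0 phi1 T N K uh vh Rh uN vN RN ->
  forall n, (n <= K)%N ->
  energy_err (J N) lam kappa (fun j => hat (u (n%:R * tau)) j - hat (uN n) j)
    (fun j => hat (v (n%:R * tau)) j - hat (vN n) j)
    (Num.sqrt (E (u (n%:R * tau))) - RN n) <= A.
Proof.
have [S S0 HS] := l1_wt alpha1; have L0 := LL0; have T0' := ltW T0.
have SL : 0 <= S * LL by rewrite mulr_ge0// ltW.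
have [K1 nb1] := nonlin_bounds_ex hF SL.
have [s1 s10 hs1] := energy_lower hab hcd hF hC0 SL nb1.
have zT : 0 <= (0 : R) <= T by rewrite lexx.
pose Rm := Num.sqrt (E (u 0)) + cr LL K1 s1 * T.
have Rm0 t : 0 <= t <= T -> Num.sqrt (E (u t)) <= Rm.
  move=> /andP[t0 tT].
  have h := r_lip hab hcd alpha1 LL0 HS hF (lexx _) nb1 s10 hs1 st (lexx 0) t0 tT.
  rewrite /Rm -lerBlDl; apply: le_trans (ler_norm _) _; apply: le_trans h _.
  by rewrite subr0 ler_wpM2l// (cr_ge0 LL0 nb1 s10).
have Rm00 : 0 <= Rm := le_trans (sqrtr_ge0 _) (Rm0 _ zT).
have [hi1 hi2] := hat_initial.
pose A0 := LL ^+ 2 + kappa * LL ^+ 2 + 2 * Rm ^+ 2.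
have L2' : 0 <= LL ^+ 2 := sqr_ge0 _.
have kL2 : 0 <= kappa * LL ^+ 2 by rewrite mulr_ge0// ltW.
have A00 : 0 <= A0 by rewrite /A0 !addr_ge0// mulr_ge0 ?sqr_ge0.
pose sA := Num.sqrt A0; have sA0 : 0 <= sA := sqrtr_ge0 _.
have sAE : sA ^+ 2 = A0 by rewrite sqr_sqrtr.
pose U := LL + T * sA; have U0 : 0 <= U by rewrite /U addr_ge0// mulr_ge0.
pose A := (LL + sA) ^+ 2 + kappa * (2 * LL ^+ 2 + 2 * (A0 / kappa)) + (LL + U) ^+ 2 + (Rm + sA) ^+ 2 + 1.
exists A.
  have Ak : 0 <= A0 / kappa by rewrite divr_ge0// ltW.
  have Am : 0 <= kappa * (2 * LL ^+ 2 + 2 * (A0 / kappa)).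
    by rewrite mulr_ge0 ?(ltW kappa0)// addr_ge0// mulr_ge0.
  exact: ltr_wpDl (pos4 (sqr_ge0 _) Am (sqr_ge0 _) (sqr_ge0 _)) ltr01.
move=> N K uh vh Rh uN vN RN N1 K0 tau [[pu0 pv0 R0E] XNk [uhN vhN eq0] eqn].
have K0R : 0 < K%:R :> R by rewrite ltr0n.
have ta0 : 0 < tau by rewrite divr_gt0.
have nT (k : nat) : (k <= K)%N -> 0 <= k%:R * tau <= T.
  move=> kK; rewrite mulr_ge0 ?ler0n ?(ltW ta0)//= /tau mulrCA ler_piMr//.
  by rewrite ler_pdivrMr// mul1r ler_nat.
have hu0 : {in J N, hat (uN 0%N) =1 hat (u 0)}.
  by move=> j jN; rewrite (is_PN_hat hab hcd phi02 pu0 jN) hi1.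
have hv0 : {in J N, hat (vN 0%N) =1 hat (v 0)}.
  by move=> j jN; rewrite (is_PN_hat hab hcd phi12 pv0 jN) hi2.
have E0 : E phi0 = E (u 0).
  exact: (energy_initial nb1 (u_aebdd hab hcd LL0 HS (lexx _) st zT)).
have nu t : 0 <= t <= T -> vn (J N) one (hat (u t)) <= LL.
  by move=> tT; exact: le_trans (vn_one_wt _ _ alpha_ge0) (st_u st N tT).
have nv t : 0 <= t <= T -> vn (J N) one (hat (v t)) <= LL.
  by move=> tT; exact: le_trans (vn_one_wt _ _ alpha_ge0) (st_v st N tT).
have nlu t : 0 <= t <= T -> vn (J N) lam (hat (u t)) <= LL.
  move=> tT; apply: le_trans (vn_lam_wt alpha1 _ _) _.
  by apply: le_trans (vn_half_wt alpha1 _ _) (st_u st N tT).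
have sq (x y : R) : 0 <= x -> x <= y -> x ^+ 2 <= y ^+ 2.
  by move=> x0 xy; rewrite lerXn2r ?nnegrE//; exact: le_trans xy.
have inv n : (n <= K)%N ->
    vn (J N) one (hat (vN n)) ^+ 2 + kappa * vn (J N) lam (hat (uN n)) ^+ 2 + 2 * RN n ^+ 2 <= A0
    /\ vn (J N) one (hat (uN n)) <= LL + n%:R * tau * sA.
  elim: n => [|n IH] nK.
    rewrite mul0r mul0r addr0 R0E E0 (vn_eq one hv0) (vn_eq lam hu0) (vn_eq one hu0).
    split; last exact: nu.
    rewrite /A0; apply: lerD; first apply: lerD.
    - by apply: sq; rewrite ?vn_ge0 ?nv.
    - by rewrite ler_wpM2l ?(ltW kappa0)//; apply: sq; rewrite ?vn_ge0 ?nlu.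
    - by rewrite ler_wpM2l//; apply: sq; rewrite ?sqrtr_ge0 ?Rm0.
  have [h1 h2] := IH (ltnW nK).
  have [x1 x2] := XNk n (ltnW nK); have [x3 x4] := XNk n.+1 nK.
  have qN : XN N (extrapolate uh uN n).
    by apply: extrapolate_XN => // k kn; have [] := XNk k (leq_trans kn (ltnW nK)).
  have [d1 d2] := energy_decay ta0 qN x1 x3 x2 x4 (eqn n nK).
  have d1' := le_trans d1 h1; split => //.
  have vb rho y x : y ^+ 2 + kappa * x ^+ 2 + 2 * rho ^+ 2 <= A0 -> 0 <= y -> y <= sA.
    move=> h y0; rewrite -(ler_pXn2r (n := 2)) ?nnegrE// sAE.
    have := sqr_ge0 rho; have := mulr_ge0 (ltW kappa0) (sqr_ge0 x); lra.
  have v1 := vb _ _ _ h1 (vn_ge0 _ _ _); have v2' := vb _ _ _ d1' (vn_ge0 _ _ _).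
  apply: le_trans d2 _.
  have -> : LL + n.+1%:R * tau * sA = (LL + n%:R * tau * sA) + tau / 2 * (sA + sA).
    by rewrite -natr1; field.
  by apply: lerD => //; rewrite ler_wpM2l ?lerD// divr_ge0// ltW.
move=> n nK; have tT := nT n nK; have [i1 i2] := inv n nK.
set t := n%:R * tau in tT i2 *.
have p1 := sqr_ge0 (vn (J N) one (hat (vN n))); have p2 := sqr_ge0 (RN n).
have p3 : 0 <= kappa * vn (J N) lam (hat (uN n)) ^+ 2 by rewrite mulr_ge0 ?sqr_ge0// ltW.
have q1 : vn (J N) one (hat (vN n)) <= sA.
  by rewrite -(ler_pXn2r (n := 2)) ?nnegrE ?vn_ge0// sAE; lra.
have q2 : `|RN n| <= sA.
  by rewrite -(ler_pXn2r (n := 2)) ?nnegrE// sAE real_normK ?num_real//; lra.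
have q3 : vn (J N) lam (hat (uN n)) ^+ 2 <= A0 / kappa.
  by rewrite ler_pdivlMr// mulrC; lra.
have q4 : vn (J N) one (hat (uN n)) <= U.
  by apply: le_trans i2 _; rewrite /U lerD2l ler_wpM2r//; have /andP[] := tT.
have l0 := @lam_ge0 R alpha.
rewrite /energy_err /A ler_wpDr//.
apply: lerD; [apply: lerD; [apply: lerD|]|].
- by apply: sq; rewrite ?vn_ge0//; apply: le_trans (vnB _ one0 _ _) _; rewrite lerD// nv.
- rewrite ler_wpM2l ?(ltW kappa0)//.
  apply: (@le_trans _ _ ((vn (J N) lam (hat (u t)) + vn (J N) lam (hat (uN n))) ^+ 2)).
    by apply: sq; rewrite ?vn_ge0// vnB.
  have w1 := sq _ _ (vn_ge0 _ _ _) (nlu _ tT).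
  have := sqr_ge0 (vn (J N) lam (hat (u t)) - vn (J N) lam (hat (uN n))).
  by move: w1 q3; move: (vn _ _ _) (vn _ _ _) (A0 / kappa) (LL ^+ 2) => x y e f; lra.
- by apply: sq; rewrite ?vn_ge0//; apply: le_trans (vnB _ one0 _ _) _; rewrite lerD// nu.
- rewrite -[leLHS]real_normK ?num_real//; apply: sq => //; apply: le_trans (ler_normB _ _) _.
  by rewrite lerD// ger0_norm ?sqrtr_ge0// Rm0.
Qed.

End Convergence.

(** * From errors of coefficients to the norms of the theorem *)

Section ErrorEstimate.
Context {R : realType}.
Variables (a b c d : R).
Hypotheses (hab : b = a + 2 * pi) (hcd : d = c + 2 * pi).
Let Om : set (plane R) := `]a, b[ `*` `]c, d[.
Let mD : measurable Om := measurable_cell a b c d.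
Let fD : (leb2 Om < +oo)%E := cell_measure_lty hab hcd.
Local Notation L2 := (L2 leb2 Om).
Local Notation nrm := (L2nrm leb2 Om).
Local Notation hat := (fhat Om).
Local Notation J := (J R).
Local Notation PN := (projN Om).
Local Notation one := (fun=> 1 : R).
Local Notation aebdd := (aebdd a b c d).

Variables (kappa gamma1 gamma2 : R).
Hypotheses (kappa0 : 0 < kappa) (g10 : 0 <= gamma1) (g20 : 0 <= gamma2).
Variables (alpha T LL : R).
Hypotheses (alpha1 : 1 < alpha) (LL0 : 0 <= LL) (T0 : 0 < T).
Variables (F : R -> R) (C0 : R).
Hypothesis hF : (forall (k : nat) (s : R), (k < 3)%N -> derivable (derive1n k F) s 1) /\
            continuous (derive1n 3 F).
Hypothesis hC0 : forall w, bounded_per Om w -> 0 < energy Om F C0 w.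
Local Notation F1 := (derive1 F).
Local Notation E := (energy Om F C0).
Local Notation lam := (lam alpha).

Variables (u v w z : R -> plane R -> R).
Hypothesis st : smooth_traj a b c d alpha T LL u v w z.
Hypothesis heq : forall t, 0 < t <= T -> forall j,
  hat (w t) j = - (kappa * (lam j * hat (u t) j) + gamma1 * (lam j * hat (v t) j)
    + gamma2 * hat (v t) j + hat (fun x => F1 (u t x)) j).
Variables (m P : R).
Hypotheses (P0 : 0 <= P) (malpha : alpha <= m).
Hypothesis pu : forall N t, (0 < N)%N -> 0 <= t <= T ->
  nrm (fun x => u t x - PN N (u t) x) <= P * N%:R `^ (- m).
Hypothesis pv : forall N t, (0 < N)%N -> 0 <= t <= T ->
  nrm (fun x => v t x - PN N (v t) x) <= P * N%:R `^ (- m).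
Hypothesis hbu : forall t, 0 <= t <= T -> hb a b c d m (u t) LL.
Variable m0 : R.
Hypothesis m0m : m0 <= m.
Variables phi0 phi1 : plane R -> R.
Hypotheses (phi02 : L2 phi0) (phi12 : L2 phi1).
Hypotheses (uphi : {ae leb2, forall x, Om x -> u 0 x = phi0 x})
           (vphi : {ae leb2, forall x, Om x -> v 0 x = phi1 x}).

Let u2 := st_u2 st.
Let v2 := st_v2 st.
Let one0 : forall i : index, 0 <= one i :> R. Proof. by move=> i; exact: ler01. Qed.
Let alpha_ge0 : 0 <= alpha. Proof. by have := alpha1; lra. Qed.

(** Off the box, freq2^rho <= wt m * (1 + freq2)^(-(m - rho)), and the last factor is at most (N^2 /
    8)^(-(m - rho)). *)
Lemma hb_tail rho f B N N2 : rho <= m -> 0 <= m - rho -> 0 <= rho -> (0 < N)%N -> (N <= N2)%N ->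
  hb a b c d m f B ->
  \sum_(j <- J N2 | j \notin J N) freq2 j.1 `^ rho * hat f j ^+ 2 <=
    8 `^ (m - rho) * N%:R `^ (2 * rho - 2 * m) * B ^+ 2.
Proof.
move=> rm mr rho0 N0 NN fB.
have N1 : 0 < N%:R :> R by rewrite ltr0n.
have N8 : 0 < N%:R ^+ 2 / 8 :> R by rewrite divr_gt0// exprn_gt0.
have E : 8 `^ (m - rho) * N%:R `^ (2 * rho - 2 * m) = (N%:R ^+ 2 / 8) `^ (- (m - rho)) :> R.
  have E8 : (8^-1 : R) `^ (- (m - rho)) = 8 `^ (m - rho).
    by rewrite -[8^-1]powR_inv1// -powRrM; congr (_ `^ _); ring.
  rewrite powRM ?sqr_ge0 ?invr_ge0// E8 mulrC -[N%:R ^+ 2]powR_mulrn// -powRrM.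
  by congr (_ `^ _ * _); ring.
rewrite E; apply: (@le_trans _ _ ((N%:R ^+ 2 / 8) `^ (- (m - rho)) *
    \sum_(j <- J N2 | j \notin J N) wt m j.1 * hat f j ^+ 2)).
  rewrite mulr_sumr; apply: ler_sum => j; rewrite mem_J => jN.
  have f0 := @freq2_ge0 R j.1.
  rewrite mulrA ler_wpM2r ?sqr_ge0// powRN mulrC ler_pdivlMr ?powR_gt0//.
  apply: (@le_trans _ _ ((1 + freq2 j.1) `^ rho * (1 + freq2 j.1) `^ (m - rho))).
    apply: ler_pM; rewrite ?powR_ge0//.
      by apply: (ge0_ler_powR rho0); rewrite ?nnegrE ?lerDr// addr_ge0.
    apply: (ge0_ler_powR mr); rewrite ?nnegrE ?(ltW N8) ?addr_ge0//.
    exact: modes_off_box.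
  rewrite /wt -powRD; first by rewrite addrCA subrr addr0.
  by apply/implyP => _; rewrite gt_eqF// ltr_wpDr.
rewrite ler_wpM2l ?powR_ge0//; apply: le_trans (fB N2).
rewrite (sum_J_sub _ NN) lerDr sumr_ge0// => j _.
by rewrite mulr_ge0 ?sqr_ge0// ltW ?wt_gt0.
Qed.

(* For large [tau] or small [N] the right-hand side is bounded below, and the
   unconditional stability of the scheme is enough. *)
Lemma error_squared : exists2 C : R, 0 < C &
  forall (N K : nat) uh vh Rh uN vN RN, (0 < N)%N -> (0 < K)%N ->
  let tau := T / K%:R in
  SAV_scheme Om kappa alpha gamma1 gamma2 F C0 phi0 phi1 T N K uh vh Rh uN vN RN ->
  forall n, (n <= K)%N ->
  energy_err (J N) lam kappa (fun j => hat (u (n%:R * tau)) j - hat (uN n) j)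
    (fun j => hat (v (n%:R * tau)) j - hat (vN n) j)
    (Num.sqrt (E (u (n%:R * tau))) - RN n) <= C * (tau ^+ 2 + N%:R `^ (- m)) ^+ 2.
Proof.
have [C1 [tau0 [N0 [C10 tau00 conv]]]] := convergence hab hcd kappa0 g10 g20 alpha1 LL0 T0 hF hC0
  st heq P0 malpha pu pv phi02 phi12 uphi vphi.
have [A A0 stab] := stability hab hcd kappa0 g10 g20 alpha1 LL0 T0 hF hC0 st phi02 phi12 uphi vphi.
have m00 : 0 <= m by have := alpha1; have := malpha; lra.
have q1 : 0 < tau0 ^+ 2 by rewrite exprn_gt0.
have q2 : 0 < N0.+1%:R `^ (- m) :> R by rewrite powR_gt0// ltr0n.
(* Off the asymptotic regime eps is at least tau0^2 or (N0 + 1)^-m, and the stability bound [A] is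
   at most the corresponding multiple of eps^2. *)
pose C := C1 + A / (tau0 ^+ 2) ^+ 2 + A / (N0.+1%:R `^ (- m)) ^+ 2.
have c1 : 0 < A / (tau0 ^+ 2) ^+ 2 by rewrite divr_gt0// exprn_gt0.
have c2 : 0 < A / (N0.+1%:R `^ (- m)) ^+ 2 by rewrite divr_gt0// exprn_gt0.
exists C; first by rewrite /C !addr_gt0.
move=> N K uh vh Rh uN vN RN N1 K0 tau sch n nK.
have Nm : 0 <= N%:R `^ (- m) :> R := powR_ge0 _ _.
have t20 : 0 <= tau ^+ 2 := sqr_ge0 _.
set eps := tau ^+ 2 + N%:R `^ (- m).
have eps0 : 0 <= eps ^+ 2 := sqr_ge0 _.
have triv y : 0 < y -> y <= eps -> A <= A / y ^+ 2 * eps ^+ 2.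
  move=> y0 ye; rewrite mulrAC ler_pdivlMr ?exprn_gt0// ler_wpM2l ?(ltW A0)//.
  by rewrite lerXn2r ?nnegrE ?(ltW y0)//; exact: le_trans (ltW y0) ye.
have up x : x <= C1 * eps ^+ 2 \/ x <= A / (tau0 ^+ 2) ^+ 2 * eps ^+ 2 \/
   x <= A / (N0.+1%:R `^ (- m)) ^+ 2 * eps ^+ 2 -> x <= C * eps ^+ 2.
  have := mulr_ge0 (ltW C10) eps0; have := mulr_ge0 (ltW c1) eps0.
  have := mulr_ge0 (ltW c2) eps0; rewrite /C !mulrDl.
  by move: (C1 * _) (_ / _ * _) (_ / _ * _) => p q r p0 q0 r0 [|[|]]; lra.
apply: up; have [tt|tt] := leP tau tau0; last first.
  right; left; apply: le_trans (stab _ _ _ _ _ _ _ _ N1 K0 sch n nK) _; apply: triv => //.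
  have tt' : tau0 <= tau := ltW tt; have ta := le_trans (ltW tau00) tt'.
  by rewrite /eps ler_wpDr// lerXn2r ?nnegrE ?(ltW tau00).
have [NN|NN] := leqP N0 N; first by left; exact (conv _ _ _ _ _ _ _ _ N1 K0 NN tt sch n nK).
right; right; apply: le_trans (stab _ _ _ _ _ _ _ _ N1 K0 sch n nK) _; apply: triv => //.
rewrite /eps ler_wpDl// !powRN lef_pV2 ?posrE ?powR_gt0 ?ltr0n//.
by apply: (ge0_ler_powR m00); rewrite ?nnegrE// ler_nat; exact: leq_trans (ltnW NN) _.
Qed.

(** The energy measures the error inside the box; the projection error is added for the L^2 norms.
    [m] is the enlarged regularity index and [m0] the one of the conclusion. *)
Lemma error_estimate : exists2 C : R, 0 < C &
  forall (N K : nat) uh vh Rh uN vN RN, (0 < N)%N -> (0 < K)%N ->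
  SAV_scheme Om kappa alpha gamma1 gamma2 F C0 phi0 phi1 T N K uh vh Rh uN vN RN ->
  let tau := T / K%:R in
  forall n, (n <= K)%N -> let t := n%:R * tau in
  L2norm2 Om (u t \- uN n) + L2norm2 Om (v t \- vN n) + `|Num.sqrt (E (u t)) - RN n| ^+ 2
    <= C * (tau ^+ 4 + N%:R `^ (- (2 * m0))) /\
  (kappa%:E * hseminorm2 Om (alpha / 2) (u t \- uN n)%R
    <= (C * (tau ^+ 4 + N%:R `^ (alpha - 2 * m0)))%:E)%E.
Proof.
have [C C0' err] := error_squared.
have a2 : 0 <= alpha / 2 by have := alpha1; lra.
have am : alpha / 2 <= m by have := malpha; have := alpha1; lra.
have am0 : 0 <= m - alpha / 2 by rewrite subr_ge0.
pose C2 := 8 `^ (m - alpha / 2) * LL ^+ 2.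
have C20 : 0 <= C2 by rewrite mulr_ge0 ?powR_ge0 ?sqr_ge0.
have P20 : 0 <= P ^+ 2 := sqr_ge0 _.
have kC2 : 0 <= kappa * C2 by rewrite mulr_ge0// ltW.
exists (4 * P ^+ 2 + 4 * C + kappa * C2).
  by rewrite ltr_wpDr// ltr_wpDl ?mulr_ge0// mulr_gt0.
move=> N K uh vh Rh uN vN RN N1 K0 sch tau n nK t.
have e := err _ _ _ _ _ _ _ _ N1 K0 sch n nK.
rewrite -/tau -/t in e.
have K0R : 0 < K%:R :> R by rewrite ltr0n.
have ta0 : 0 < tau by rewrite divr_gt0.
have tT : 0 <= t <= T.
  rewrite mulr_ge0 ?ler0n ?(ltW ta0)//= /t /tau mulrCA ler_piMr ?(ltW T0)//.
  by rewrite ler_pdivrMr// mul1r ler_nat.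
have [_ XNk _ _] := sch; have [unN vnN] := XNk n nK.
have ut := u2 tT; have vt := v2 tT.
have unL := XN_L2 hab hcd unN; have vnL := XN_L2 hab hcd vnN.
set eu := (fun j => hat (u t) j - hat (uN n) j) in e.
set ev := (fun j => hat (v t) j - hat (vN n) j) in e.
set er := Num.sqrt (E (u t)) - RN n in e *.
have N1R : 1 <= N%:R :> R by rewrite ler1n.
pose y := N%:R `^ (- (2 * m)) : R.
have y0 : 0 <= y := powR_ge0 _ _.
have yE : (N%:R `^ (- m)) ^+ 2 = y.
  by rewrite -powR_mulrn ?powR_ge0// -powRrM /y; congr (_ `^ _); ring.
have ym : y <= N%:R `^ (- (2 * m0)) by rewrite /y ler_powR//; have := m0m; lra.
have y0a : y <= N%:R `^ (alpha - 2 * m0) by rewrite /y ler_powR//; have := m0m; have := alpha1; lra.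
have eps2 : (tau ^+ 2 + N%:R `^ (- m)) ^+ 2 <= 2 * (tau ^+ 4 + y).
  have -> : tau ^+ 4 = (tau ^+ 2) ^+ 2 by rewrite -exprM.
  rewrite -yE; move: (tau ^+ 2) (N%:R `^ (- m)) => p q.
  by have := sqr_ge0 (p - q); lra.
have t4 : 0 <= tau ^+ 4 by rewrite exprn_ge0// ltW.
have e2 : energy_err (J N) lam kappa eu ev er <= 2 * C * (tau ^+ 4 + y).
  apply: le_trans e _; rewrite -[2 * C]mulrC -mulrA ler_wpM2l//; exact: ltW.
have [x1 [x2 [x3 x4]]] : 0 <= vn (J N) one ev ^+ 2 /\ 0 <= kappa * vn (J N) lam eu ^+ 2 /\
   0 <= vn (J N) one eu ^+ 2 /\ 0 <= er ^+ 2.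
  by rewrite !sqr_ge0; repeat split => //; rewrite mulr_ge0 ?sqr_ge0// ltW.
have half f g : L2 f -> XN N g -> nrm (fun x => f x - PN N f x) <= P * N%:R `^ (- m) ->
   L2norm2 Om (f \- g) <= 2 * (P ^+ 2 * y) + 2 * vn (J N) one (fun j => hat f j - hat g j) ^+ 2.
  move=> f2 gN hp; have := nrm_sub_XN hab hcd f2 gN.
  set n1 := nrm (fun x => f x - PN N f x) in hp *; set n2 := vn _ _ _ => h.
  have n20 : 0 <= n2 := vn_ge0 _ _ _.
  have -> : L2norm2 Om (f \- g) = nrm (fun x => f x - g x) ^+ 2 by rewrite sqr_nrm.
  have h' : nrm (fun x => f x - g x) ^+ 2 <= (P * N%:R `^ (- m) + n2) ^+ 2.
    rewrite lerXn2r ?nnegrE ?nrm_ge0 ?addr_ge0 ?mulr_ge0 ?powR_ge0//.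
    by apply: le_trans h _; rewrite lerD2r.
  apply: le_trans h' _; rewrite -yE -exprMn; move: (P * _) => p.
  by have := sqr_ge0 (p - n2); lra.
split.
  have hu := half _ _ ut unN (pu N1 tT); have hv := half _ _ vt vnN (pv N1 tT).
  rewrite real_normK ?num_real//.
  apply: le_trans (lerD (lerD hu hv) (lexx _)) _; rewrite -/eu -/ev.
  apply: (@le_trans _ _ (4 * P ^+ 2 * y + 2 * energy_err (J N) lam kappa eu ev er)).
    by rewrite /energy_err -[4 * _ * _]mulrA; move: x1 x2 x3 x4; move: (vn _ _ eu ^+ 2) (kappa * _)
      (vn _ _ ev ^+ 2) (er ^+ 2) (P ^+ 2 * y) => *; lra.
  apply: (@le_trans _ _ (4 * P ^+ 2 * (tau ^+ 4 + y) + 4 * C * (tau ^+ 4 + y))).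
    apply: lerD; first by rewrite ler_wpM2l ?mulr_ge0// lerDr.
    have := ler_wpM2l (ler0n R 2) e2; move=> h; apply: (le_trans h).
    by rewrite le_eqVlt; apply/orP; left; apply/eqP; ring.
  rewrite -mulrDl; apply: (@le_trans _ _ ((4 * P ^+ 2 + 4 * C) * (tau ^+ 4 + N%:R `^ (- (2 * m0))))).
    by rewrite ler_wpM2l ?lerD2l// addr_ge0 ?mulr_ge0// ltW.
  by rewrite ler_wpM2r ?lerDl// addr_ge0 ?powR_ge0.
pose W := N%:R `^ (alpha - 2 * m0) : R.
have W0 : 0 <= W := powR_ge0 _ _.
have uuL : L2 (u t \- uN n) by exact: (L2B mD ut unL).
have hatE j : hat (u t \- uN n) j = hat (u t) j - hat (uN n) j by exact: hatB.
pose B := 2 * C / kappa * (tau ^+ 4 + W) + C2 * W.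
have hB : (hseminorm2 Om (alpha / 2) (u t \- uN n)%R <= B%:E)%E.
  apply: hseminorm2_le => N'.
  pose N2 := maxn N N'; have NN2 : (N <= N2)%N by exact: leq_maxl.
  have N'N2 : (N' <= N2)%N by exact: leq_maxr.
  apply: (@le_trans _ _ (\sum_(j <- J N2) freq2 j.1 `^ (alpha / 2) * hat (u t \- uN n) j ^+ 2)).
    rewrite (sum_J_sub _ N'N2) lerDl sumr_ge0// => j _.
    by rewrite mulr_ge0 ?powR_ge0 ?sqr_ge0.
  rewrite (sum_J_sub _ NN2) /B; apply: lerD.
    have -> : \sum_(j <- J N) freq2 j.1 `^ (alpha / 2) * hat (u t \- uN n) j ^+ 2 = vn (J N) lam eu ^+ 2.
      rewrite sqr_vn; last exact: lam_ge0.
      by apply: eq_bigr => j _; rewrite hatE -/(eu j) expr2.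
    rewrite mulrAC ler_pdivlMr// mulrC.
    apply: (@le_trans _ _ (2 * C * (tau ^+ 4 + y))); last first.
      by rewrite ler_wpM2l ?lerD2l// mulr_ge0// ltW.
    apply: le_trans e2; rewrite /energy_err; move: x1 x2 x3 x4.
    by move: (vn _ _ ev ^+ 2) (kappa * _) (vn _ one eu ^+ 2) (er ^+ 2) => *; lra.
  (* Outside the box the numerical solution has no coefficients, and the tail of [u] produces the
     rate N^(alpha - 2m). *)
  have -> : \sum_(j <- J N2 | j \notin J N) freq2 j.1 `^ (alpha / 2) * hat (u t \- uN n) j ^+ 2 =
      \sum_(j <- J N2 | j \notin J N) freq2 j.1 `^ (alpha / 2) * hat (u t) j ^+ 2.
    by apply: eq_bigr => j jN; rewrite hatE (hat_XN_out hab hcd unN jN) subr0.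
  apply: le_trans (hb_tail am am0 a2 N1 NN2 (hbu tT)) _.
  rewrite /C2 [leRHS]mulrAC ler_wpM2r ?sqr_ge0// ler_wpM2l ?powR_ge0//.
  by rewrite /W ler_powR//; have := m0m; lra.
apply: le_trans (lee_wpmul2l _ hB) _; first by rewrite lee_fin ltW.
rewrite -EFinM lee_fin /B.
have -> : kappa * (2 * C / kappa * (tau ^+ 4 + W) + C2 * W) = 2 * C * (tau ^+ 4 + W) + kappa * C2 * W.
  by field; rewrite gt_eqF.
rewrite -/W.
have z1 : 0 <= 4 * P ^+ 2 * (tau ^+ 4 + W) by rewrite mulr_ge0 ?mulr_ge0 ?addr_ge0.
have z2 : 0 <= 2 * C * (tau ^+ 4 + W) by rewrite mulr_ge0 ?addr_ge0// mulr_ge0// ltW.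
have z3 : 0 <= kappa * C2 * tau ^+ 4 by rewrite mulr_ge0.
have -> : (4 * P ^+ 2 + 4 * C + kappa * C2) * (tau ^+ 4 + W) = (2 * C * (tau ^+ 4 + W) + kappa * C2 * W)
  + (4 * P ^+ 2 * (tau ^+ 4 + W) + 2 * C * (tau ^+ 4 + W) + kappa * C2 * tau ^+ 4) by ring.
by rewrite lerDl; exact: pos3.
Qed.

End ErrorEstimate.

Section Hypotheses.
Context {R : realType}.
Variables (a b c d : R).
Hypotheses (hab : b = a + 2 * pi) (hcd : d = c + 2 * pi).
Let Om : set (plane R) := `]a, b[ `*` `]c, d[.
Let mD : measurable Om := measurable_cell a b c d.
Let fD : (leb2 Om < +oo)%E := cell_measure_lty hab hcd.
Local Notation L2 := (L2 leb2 Om).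
Local Notation nrm := (L2nrm leb2 Om).
Local Notation hat := (fhat Om).
Local Notation J := (J R).
Local Notation one := (fun=> 1 : R).
Implicit Types (f g : plane R -> R) (u v w : R -> plane R -> R).

Lemma L2per_L2 f : L2per Om f -> L2 f. Proof. by case. Qed.

Lemma L2_derivative_L2der T u v : (forall t, 0 <= t <= T -> L2 (u t)) ->
  (forall t, 0 <= t <= T -> L2 (v t)) -> L2_derivative Om T u v -> L2der a b c d T u v.
Proof.
move=> u2 v2 duv t tT e e0.
have e20 : 0 < e ^+ 2 by rewrite exprn_gt0.
have /cvgrPdist_lt /(_ _ e20) := duv t tT.
rewrite near_withinE => /nbhs_ballP[eta eta0 H]; exists eta => // s sT st.
(* The limit runs over a punctured neighbourhood, so [s = t] is treated apart. *)
have [->|sne] := eqVneq s t.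
  rewrite subrr normr0 mulr0 le_eqVlt; apply/orP; left; apply/eqP.
  have -> : (fun x => u t x - u t x - 0 * v t x) = fun=> 0.
    by apply/funext => x; rewrite mul0r !subrr.
  by rewrite nrm_cst// normr0 mulr0.
have us := u2 _ sT; have ut := u2 _ tT; have vt := v2 _ tT.
have st0 : s - t != 0 by rewrite subr_eq0.
pose q x := (u s x - u t x) / (s - t) - v t x.
have q2 : L2 q.
  have -> : q = fun x => (s - t)^-1 * (u s x - u t x) - v t x.
    by apply/funext => x; rewrite /q mulrC.
  exact: (L2B mD (L2Z mD _ (L2B mD us ut)) vt).
have -> : (fun x => u s x - u t x - (s - t) * v t x) = (fun x => (s - t) * q x).
  by apply/funext => x; rewrite /q; field.
rewrite nrmZ// mulrC ler_wpM2r// -(ler_pXn2r (n := 2)) ?nnegrE ?nrm_ge0 ?(ltW e0)//.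
rewrite sqr_nrm; have := H s; rewrite /ball/= distrC => /(_ st sne).
rewrite in_itv/= => /(_ sT); rewrite sub0r normrN => h.
by apply: le_trans (ltW h); exact: ler_norm.
Qed.

Lemma hnorm_ge0 rho f : (0 <= hnorm Om rho f)%E.
Proof. exact: poweR_ge0. Qed.

Lemma sup_time_le T rho u t : 0 <= t <= T -> (hnorm Om rho (u t) <= sup_time T (hnorm Om rho) u)%E.
Proof. by move=> tT; apply: ereal_sup_ubound; exists t => //=; rewrite in_itv. Qed.

Lemma sup_time_ge0 T rho u : 0 <= T -> (0 <= sup_time T (hnorm Om rho) u)%E.
Proof.
by move=> T0; apply: le_trans (hnorm_ge0 _ _) (sup_time_le (t := 0) _ _ _); rewrite lexx.
Qed.

Lemma Linfty_norm_ge0 T (h : R -> R) : (0 <= Linfty_norm T h)%E.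
Proof. exact: Lnorm_ge0. Qed.

Lemma hb_vn N rho f B : 0 <= B -> hb a b c d rho f B ->
  vn (J N) (fun j => wt rho j.1) (hat f) <= B.
Proof.
move=> B0 fB; apply: vn_le => //; apply: le_trans (fB N).
by apply: ler_sum => j _; rewrite expr2.
Qed.

Lemma equation_hat kappa alpha gamma1 gamma2 (F : R -> R) (f g h Af Ag : plane R -> R) j :
  L2 f -> L2 g -> L2 h -> L2 (fun x => derive1 F (f x)) ->
  is_fracLap Om (alpha / 2) f Af -> is_fracLap Om (alpha / 2) g Ag ->
  {ae leb2, forall x, Om x -> h x + kappa * Af x + gamma1 * Ag x + gamma2 * g x
    + derive1 F (f x) = 0} ->
  hat h j = - (kappa * (lam alpha j * hat f j) + gamma1 * (lam alpha j * hat g j)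
    + gamma2 * hat g j + hat (fun x => derive1 F (f x)) j).
Proof.
move=> f2 g2 h2 F2 fA gA eqn.
have A2 := L2per_L2 fA.1; have B2 := L2per_L2 gA.1.
rewrite /lam -(fracLap_hat fA) -(fracLap_hat gA).
have kA := L2Z mD kappa A2; have kB := L2Z mD gamma1 B2; have kg := L2Z mD gamma2 g2.
have s1 := L2D mD kA kB; have s2 := L2D mD s1 kg; have s3 := L2D mD s2 F2.
have -> : hat h j = hat (fun x => -1 * (kappa * Af x + gamma1 * Ag x + gamma2 * g x
    + derive1 F (f x))) j.
  apply: (hat_ae_eq hab hcd) => //; first exact: L2Z.
  by apply: filterS eqn => x e Dx; have := e Dx; lra.
rewrite (hatZ hab hcd _ _ s3) mulN1r (hatD hab hcd _ s2 F2) (hatD hab hcd _ s1 kg).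
by rewrite (hatD hab hcd _ kA kB) !(hatZ hab hcd).
Qed.

End Hypotheses.

Lemma adde_le_split (R : realType) (x y : \bar R) (L : R) : (0 <= x)%E -> (0 <= y)%E ->
  (x + y <= L%:E)%E -> (x <= L%:E)%E /\ (y <= L%:E)%E.
Proof.
move=> x0 y0 xy; split; apply: le_trans xy; [exact: leeDl|exact: leeDr].
Qed.

Theorem theorem3p3 (R : realType) (a b c d : R) (Om : set (plane R))
    (hab : b = a + 2 * pi) (hcd : d = c + 2 * pi)
    (hOm : Om = `]a, b[ `*` `]c, d[)
    (kappa alpha gamma1 gamma2 m T L : R)
    (hkappa : 0 < kappa) (halpha : 1 < alpha <= 2)
    (hgamma1 : 0 <= gamma1) (hgamma2 : 0 <= gamma2)
    (hm : 0 <= m) (hT : 0 < T) (hL : 0 < L)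
    (F : R -> R) (C0 : R)
    (hF0 : forall s, 0 <= F s)
    (hFC3 : (forall (k : nat) (s : R), (k < 3)%N -> derivable (derive1n k F) s 1) /\
            continuous (derive1n 3 F))
    (hFlip : [locally [lipschitz derive1 F s | s in [set: R]]])
    (hC0 : forall w, bounded_per Om w -> 0 < energy Om F C0 w)
    (phi0 phi1 : plane R -> R)
    (hphi0 : L2per Om phi0) (hphi1 : L2per Om phi1)
    (u v w z : R -> plane R -> R)
    (hsol : is_solution Om kappa alpha gamma1 gamma2 F phi0 phi1 T u v w)
    (hreg : regularity Om alpha F C0 phi0 T m L u v w z) :
  let r := fun t => Num.sqrt (energy Om F C0 (u t)) in
  exists2 C : R, 0 < C &
    forall (N K : nat) (uh vh : plane R -> R) (Rh : R)
      (uN vN : nat -> plane R -> R) (RN : nat -> R),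
    (0 < N)%N -> (0 < K)%N ->
    SAV_scheme Om kappa alpha gamma1 gamma2 F C0 phi0 phi1 T N K
      uh vh Rh uN vN RN ->
    let tau := T / K%:R in
    forall n, (n <= K)%N ->
      let t := n%:R * tau in
      L2norm2 Om (u t \- uN n) + L2norm2 Om (v t \- vN n) + `|r t - RN n| ^+ 2
        <= C * (tau ^+ 4 + N%:R `^ (- (2 * m))) /\
      (kappa%:E * hseminorm2 Om (alpha / 2) (u t \- uN n)%R
        <= (C * (tau ^+ 4 + N%:R `^ (alpha - 2 * m)))%:E)%E.
Proof.
have [k0 [a1 a2]] : 0 < kappa /\ 1 < alpha /\ alpha <= 2 by case/andP: halpha.
subst Om; have T0 := ltW hT.
have [hz dwz _ hreg'] := hreg; have [hL2 [duv dvw] [uphi vphi] heqn] := hsol.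
(* The enlarged index makes N^-m' at most N^-alpha, as the bootstrap requires; [2 * pi] is the ratio
   between the coefficients [fhat] and [fcoef]. *)
pose m' := Num.max m alpha; pose LL := 2 * pi * L.
have pi2 : 0 < 2 * pi :> R by rewrite mulr_gt0 ?pi_gt0.
have LL0 : 0 <= LL by rewrite mulr_ge0 ?(ltW pi2)// ltW.
have L0 := ltW hL.
have st0 rho g := sup_time_ge0 a b c d rho g T0.
have li0 h := Linfty_norm_ge0 T h.
have p1 : (0 <= hnorm (`]a, b[ `*` `]c, d[) m phi0)%E by exact: poweR_ge0.
have p2 := adde_ge0 p1 (st0 m u); have p3 := adde_ge0 p2 (st0 m v).
pose r t := Num.sqrt (energy (`]a, b[ `*` `]c, d[) F C0 (u t)).
have p4 := adde_ge0 p3 (li0 r); have p5 := adde_ge0 p4 (li0 (derive1n 1 r)).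
have p6 := adde_ge0 p5 (li0 (derive1n 2 r)); have p7 := adde_ge0 p6 (li0 (derive1n 3 r)).
have p8 := adde_ge0 p7 (st0 alpha u); have p9 := adde_ge0 p8 (st0 alpha v).
have p10 := adde_ge0 p9 (st0 alpha w).
have [h10 zB] := adde_le_split p10 (st0 _ _) hreg'.
have [h9 wB] := adde_le_split p9 (st0 _ _) h10.
have [h8 vB] := adde_le_split p8 (st0 _ _) h9.
have [h7 uB] := adde_le_split p7 (st0 _ _) h8.
have [h6 _] := adde_le_split p6 (li0 _) h7.
have [h5 _] := adde_le_split p5 (li0 _) h6.
have [h4 _] := adde_le_split p4 (li0 _) h5.
have [h3 _] := adde_le_split p3 (li0 _) h4.
have [h2 vmB] := adde_le_split p2 (st0 _ _) h3.
have [_ umB] := adde_le_split p1 (st0 _ _) h2.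
have hbt rho g t : 0 <= t <= T -> (sup_time T (hnorm (`]a, b[ `*` `]c, d[) rho) g <= L%:E)%E ->
    hb a b c d rho (g t) LL.
  move=> tT gL; apply: (hnorm_hb L0); apply: le_trans gL; exact: sup_time_le.
have u2 t : 0 <= t <= T -> L2 leb2 (`]a, b[ `*` `]c, d[) (u t).
  by move=> tT; have [h _ _] := hL2 t tT; exact: L2per_L2 h.
have v2 t : 0 <= t <= T -> L2 leb2 (`]a, b[ `*` `]c, d[) (v t).
  by move=> tT; have [_ h _] := hL2 t tT; exact: L2per_L2 h.
have w2 t : 0 <= t <= T -> L2 leb2 (`]a, b[ `*` `]c, d[) (w t).
  by move=> tT; have [_ _ h] := hL2 t tT; exact: L2per_L2 h.
have z2 t : 0 <= t <= T -> L2 leb2 (`]a, b[ `*` `]c, d[) (z t).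
  by move=> tT; exact: L2per_L2 (hz t tT).
have st : smooth_traj a b c d alpha T LL u v w z.
  split => //.
  - by move=> t N tT; exact: hb_vn LL0 (hbt _ _ _ tT uB).
  - by move=> t N tT; exact: hb_vn LL0 (hbt _ _ _ tT vB).
  - by move=> t N tT; exact: hb_vn LL0 (hbt _ _ _ tT wB).
  - by move=> t N tT; exact: hb_vn LL0 (hbt _ _ _ tT zB).
  - exact: (L2_derivative_L2der hab hcd).
  - exact: (L2_derivative_L2der hab hcd).
  - exact: (L2_derivative_L2der hab hcd).
have hbu t : 0 <= t <= T -> hb a b c d m' (u t) LL.
  by move=> tT; apply: hb_max; apply: hbt.
have hbv t : 0 <= t <= T -> hb a b c d m' (v t) LL.
  by move=> tT; apply: hb_max; apply: hbt.
have m'0 : 0 <= m' by rewrite /m' le_max hm.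
have malpha : alpha <= m' by rewrite /m' le_max lexx orbT.
have mm' : m <= m' by rewrite /m' le_max lexx.
(* Bounds of [F'] on the range of [u], by which [F'(u)] is square integrable and the coefficients of
   the equation can be taken. *)
have [S S0 HS] := l1_wt a1.
have SL : 0 <= S * LL by rewrite mulr_ge0// ltW.
have [K1 nb1] := nonlin_bounds_ex hFC3 SL.
have heq t (tT : 0 < t <= T) j : fhat (`]a, b[ `*` `]c, d[) (w t) j =
   - (kappa * (lam alpha j * fhat (`]a, b[ `*` `]c, d[) (u t) j)
      + gamma1 * (lam alpha j * fhat (`]a, b[ `*` `]c, d[) (v t) j)
      + gamma2 * fhat (`]a, b[ `*` `]c, d[) (v t) j
      + fhat (`]a, b[ `*` `]c, d[) (fun x => derive1 F (u t x)) j).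
  have tT' : 0 <= t <= T by case/andP: tT => /ltW -> ->.
  have [Au [Av [hu hv hw]]] := heqn t tT.
  have uM := u_aebdd hab hcd LL0 HS (lexx _) st tT'.
  have F2 := aebdd_L2 hab hcd (aebdd_F1 hFC3 nb1 uM).
  exact (equation_hat hab hcd j (u2 _ tT') (v2 _ tT') (w2 _ tT') F2 hu hv hw).
have [P P0 hP] := hb_proj hab hcd m'0.
have PL0 : 0 <= P * LL by rewrite mulr_ge0// ltW.
have pu N t : (0 < N)%N -> 0 <= t <= T -> L2nrm leb2 (`]a, b[ `*` `]c, d[)
    (fun x => u t x - projN (`]a, b[ `*` `]c, d[) N (u t) x) <= P * LL * N%:R `^ (- m').
  by move=> N0 tT; rewrite mulrAC; apply: hP => //; [exact: u2|exact: hbu].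
have pv N t : (0 < N)%N -> 0 <= t <= T -> L2nrm leb2 (`]a, b[ `*` `]c, d[)
    (fun x => v t x - projN (`]a, b[ `*` `]c, d[) N (v t) x) <= P * LL * N%:R `^ (- m').
  by move=> N0 tT; rewrite mulrAC; apply: hP => //; [exact: v2|exact: hbv].
have [C C0' HC] := error_estimate hab hcd k0 hgamma1 hgamma2 a1 LL0 hT hFC3 hC0 st heq PL0
  malpha pu pv hbu mm' (L2per_L2 hphi0) (L2per_L2 hphi1) uphi vphi.
by exists C.
Qed.
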